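(* Let $L>0$ and let $g_{\mathbb{S}^2}$ be the standard round metric on the unit sphere $\mathbb{S}^2$. For every smooth function $h:[0,L]\to\mathbb{R}$ that is positive on $[0,L)$ and satisfies $h(L)=0$ and $h'(L)=-1$, consider the metric $g_h=dt^2+h(t)^2g_{\mathbb{S}^2}$ on $[0,L]\times\mathbb{S}^2$, and let $\sigma_{(j)}(h)$ be its $j$-th distinct Steklov eigenvalue. Then for each $j\ge 0$, \[\sigma_{(j+1)}(h)-\sigma_{(j)}(h)<\frac{L(\lambda_{(j+1)}-\lambda_{(j)})}{h(0)^2},\] where $\lambda_{(j)}$ is the $j$-th distinct eigenvalue of the Laplacian on $(\mathbb{S}^2,g_{\mathbb{S}^2})$. Moreover, if the value of $h$ at $t=0$ is fixed, the upper bound is optimal: for every $h_0>0$ and every $j\ge 0$, \[\sup\left\{\sigma_{(j+1)}(h)-\sigma_{(j)}(h)\;:\;h(0)=h_0\right\}=\frac{L(\lambda_{(j+1)}-\lambda_{(j)})}{h_0^2},\] where the supremum is over all smooth $h:[0,L]\to\mathbb{R}$ positive on $[0,L)$ with $h(L)=0$, $h'(L)=-1$ and $h(0)=h_0$.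
   Context: The metric $g_h$ is a metric of revolution on the $3$-dimensional ball: $\{L\}\times\mathbb{S}^2$ is collapsed to a single point, the center of the ball, and the boundary of the ball is $\{0\}\times\mathbb{S}^2$. The Steklov problem is $\Delta u=0$ in the ball (in the weak sense at the center), $\partial_\nu u=\sigma u$ on the boundary $\{0\}\times\mathbb{S}^2$, where $\Delta$ is the Laplacian of $g_h$ and $\nu$ the outward unit normal. The distinct Steklov eigenvalues (multiplicity not counted) are denoted $0=\sigma_{(0)}(h)<\sigma_{(1)}(h)<\sigma_{(2)}(h)<\cdots\nearrow\infty$. The distinct eigenvalues of the (nonnegative) Laplacian on $\mathbb{S}^2$ are denoted $0=\lambda_{(0)}<\lambda_{(1)}<\lambda_{(2)}<\cdots$. *)

(* Defs.v *)
From HB Require Import structures.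
From mathcomp Require Import all_boot all_order all_algebra.
From mathcomp Require Import all_classical all_reals all_analysis.

Set Implicit Arguments.
Unset Strict Implicit.
Unset Printing Implicit Defensive.

Import Order.TTheory GRing.Theory Num.Theory numFieldNormedType.Exports.

Local Open Scope classical_set_scope.
Local Open Scope ring_scope.

(* The closed ball with the metric [g_h] is realised as the Euclidean closed
   ball of radius [L] in R^3, the point [(t, w)] of [0, L] x S^2 being sent to
   [(L - t) w]: the origin is the center ([t = L]) and the sphere of radius [L]
   is the boundary ([t = 0]).  Away from the center this is a global chart. *)

Section Smoothness.
Variable R : realType.

(* [`|x|] on ['rV[R]_3] is the sup norm, hence: *)
Definition enorm (x : 'rV[R]_3) : R := Num.sqrt (\sum_i x 0 i ^+ 2).

Definition partial (i : 'I_3) (u : 'rV[R]_3 -> R) : 'rV[R]_3 -> R :=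
  fun x => 'D_(delta_mx 0 i) u x.

Definition smooth_at (u : 'rV[R]_3 -> R) (x : 'rV[R]_3) : Prop :=
  forall s : seq 'I_3, differentiable (foldr partial u s) x.

(* Smoothness on a set that need not be open (smoothness up to the boundary)
   means that the function is smooth on some open set containing it. *)
Definition smooth_on (A : set 'rV[R]_3) (u : 'rV[R]_3 -> R) : Prop :=
  exists U : set 'rV[R]_3,
    [/\ open U, A `<=` U & forall x, U x -> smooth_at u x].

Definition smooth_on1 (A : set R) (h : R -> R) : Prop :=
  exists U : set R,
    [/\ open U, A `<=` U & forall n x, U x -> derivable (derive1n n h) x 1].

End Smoothness.

Section Riemannian.
Variable R : realType.
Implicit Types (G : 'rV[R]_3 -> 'M[R]_3) (u v : 'rV[R]_3 -> R).

Definition vol_density G (x : 'rV[R]_3) : R := Num.sqrt (\det (G x)).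

(* The [i]-th component of the gradient of [u], i.e. [g^{ij} d_j u]. *)
Definition grad G u (i : 'I_3) (x : 'rV[R]_3) : R :=
  \sum_j invmx (G x) i j * partial j u x.

(* [g(grad u, grad v) = g^{ij} d_i u d_j v] *)
Definition grad_dot G u v (x : 'rV[R]_3) : R :=
  \sum_i grad G u i x * partial i v x.

Definition laplace_beltrami G u (x : 'rV[R]_3) : R :=
  (vol_density G x)^-1 *
  \sum_i partial i (fun y => vol_density G y * grad G u i y) x.

End Riemannian.

Section Sphere.
Variable R : realType.

(* A function [f] on the unit sphere (its values elsewhere are irrelevant) is
   handled through its extension to [R^3 \ {0}] constant along rays: [f] is
   smooth on S^2 iff the extension is smooth, and the Laplacian of S^2 is the
   restriction of the Euclidean Laplacian of the extension. *)
Definition ray_ext (f : 'rV[R]_3 -> R) (x : 'rV[R]_3) : R :=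
  f ((enorm x)^-1 *: x).

Definition sphere_laplacian (f : 'rV[R]_3 -> R) (x : 'rV[R]_3) : R :=
  \sum_i partial i (partial i (ray_ext f)) x.

Definition sphere_spectrum : set R :=
  [set lam | exists f : 'rV[R]_3 -> R,
    [/\ smooth_on [set x | x != 0] (ray_ext f),
        exists2 x, enorm x = 1 & f x != 0
      & forall x, enorm x = 1 -> - sphere_laplacian f x = lam * f x]].

End Sphere.

Section Steklov.
Variable R : realType.
Variables (L : R) (h : R -> R).

(* [dt^2 + h(t)^2 g_{S^2}] at [x = r w], where [r = |x| = L - t]: [dt^2] is the
   square of [w . dx], and [g_{S^2}] pulls back to [r^-2 (I - w (x) w)]. *)
Definition revolution_metric (x : 'rV[R]_3) : 'M[R]_3 :=
  let r := enorm x in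
  let w := r^-1 *: x in
  w^T *m w + (h (L - r) / r) ^+ 2 *: (1%:M - w^T *m w).

Definition lebesgue3 := (@lebesgue_measure R \x
  (@lebesgue_measure R \x @lebesgue_measure R))%E.

Definition vec3 (p : R * (R * R)) : 'rV[R]_3 :=
  \row_i [:: p.1; p.2.1; p.2.2]`_i.

Definition punctured_ball : set (R * (R * R)) :=
  [set p | 0 < enorm (vec3 p) < L].

Definition integrand (f : 'rV[R]_3 -> R) (p : R * (R * R)) : \bar R :=
  (f (vec3 p) * vol_density revolution_metric (vec3 p))%:E.

(* [u] and its gradient are square integrable for [g_h]; as points have zero
   capacity in dimension 3, for [u] smooth off the center this means
   [u \in H^1] of the ball. *)
Definition finite_energy (u : 'rV[R]_3 -> R) : Prop :=
  lebesgue3.-integrable punctured_ball (integrand (fun x => u x ^+ 2)) /\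
  lebesgue3.-integrable punctured_ball
    (integrand (grad_dot revolution_metric u u)).

Definition test_function (phi : 'rV[R]_3 -> R) : Prop :=
  smooth_on setT phi /\
  exists2 r, r < L & forall x, r <= enorm x -> phi x = 0.

Definition weakly_harmonic (u : 'rV[R]_3 -> R) : Prop :=
  finite_energy u /\
  forall phi, test_function phi ->
    (\int[lebesgue3]_(p in punctured_ball)
       integrand (grad_dot revolution_metric u phi) p = 0)%E.

(* [g_h] is singular at the center, where the equation only makes sense weakly;
   elsewhere eigenfunctions are smooth, up to the boundary.  The value of [u]
   at the origin is irrelevant.  The outward unit normal [- d/dt] at a boundary
   point [x] is [x / L]. *)
Definition steklov_eigenfunction (sigma : R) (u : 'rV[R]_3 -> R) : Prop :=
  [/\ smooth_on [set x | 0 < enorm x <= L] u,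
      exists2 x, 0 < enorm x <= L & u x != 0,
      forall x, 0 < enorm x < L -> laplace_beltrami revolution_metric u x = 0,
      weakly_harmonic u
    & forall x, enorm x = L -> 'D_(L^-1 *: x) u x = sigma * u x].

Definition steklov_spectrum : set R :=
  [set sigma | exists u, steklov_eigenfunction sigma u].

End Steklov.

Section Eigenvalues.
Variable R : realType.

(* The [j]-th element, from [j = 0], of a set of reals listed increasingly
   without repetition.  The spectra it is applied to are discrete and bounded
   below, so that every infimum is a minimum. *)
Fixpoint nth_least (S : set R) (j : nat) : R :=
  if j is j'.+1 then inf [set x | S x /\ nth_least S j' < x] else inf S.

Definition steklov (L : R) (h : R -> R) (j : nat) : R :=
  nth_least (steklov_spectrum L h) j.

Definition sphere_eigenvalue (j : nat) : R :=
  nth_least (@sphere_spectrum R) j.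

Definition admissible (L : R) (h : R -> R) : Prop :=
  [/\ smooth_on1 `[0, L] h,
      forall t, 0 <= t < L -> 0 < h t,
      h L = 0
    & derive1 h L = -1].

End Eigenvalues.

(* Main.v *)
Require Import Defs.
From HB Require Import structures.
From mathcomp Require Import all_boot all_order all_algebra.
From mathcomp Require Import all_classical all_reals all_analysis.
From mathcomp Require Import measurable_realfun ring lra.

(* Write [r = |x|] and [H r = h (L - r)].  Separating variables, the function
   [a(r) Y], with [Y] a spherical harmonic of degree [k], is harmonic when
   [(H^2 a')' = k(k+1) a]; the solution regular at [r = 0] gives the eigenvalue
   [a'(L) / a(L) = w(L) / H(L)^2], where [w = H^2 a' / a] solves the Riccati
   equation [w' = k(k+1) - w^2 / H^2].  The difference [D] of the [w] of two
   consecutive degrees is positive, so [D'] is less than the difference of the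
   sphere eigenvalues, which is the upper bound; and it is larger than that
   difference minus [w^2 / H^2 <= (k+1)^2 (k+2)^2 r^2 / H^2], which has a small
   integral when [h] has a high bump in the interior.

   That nothing else is in the spectra is proved by moments: [w_e^n], with
   [w_e(x) = (1 + cos(x, e)) / 2], satisfies
   [Lap w_e^n = n^2 w_e^(n-1) - n(n+1) w_e^n] on the sphere, so the averages of an
   eigenfunction against [w_e^n] over the spheres [|x| = r] satisfy the radial
   equation up to the previous moment.  By finite energy they are multiples of the
   regular solution, hence vanish by induction if the eigenvalue is not of the
   above form, and [w_e^n] concentrates at [e].  Spherical averages are integrals
   over the shell [1 < |x| < 2] of functions of the direction, and integration by
   parts on the sphere is that of the rotation fields [x_j d_k - x_k d_j]. *)

Set Implicit Arguments.
Unset Strict Implicit.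
Unset Printing Implicit Defensive.

Import Order.TTheory GRing.Theory Num.Theory numFieldNormedType.Exports.

Local Open Scope classical_set_scope.
Local Open Scope ring_scope.

(** * Gradients and smoothness *)

(** Of the profile at the center only [h(L) = 0] and [h'(L) = -1] are prescribed, and [h] need not
    be analytic: the metric may be singular there, and the radial equation has a regular singular
    point without a power series to expand in. Since [r^2 / H^2 = 1 + r eta] with [eta] continuous,
    Picard iteration still produces the regular solution. The profile is continued a little below
    [t = 0], so that [r = L] becomes an interior point of the radial equation.

    A moment is compared with the regular solution by subtracting the multiple with the same value
    at [L]. For the difference [m], the product [P m] with [P = H^2 m'] is nondecreasing; finite
    energy excludes negative values, and it tends to 0 at [L], so it vanishes.

    The weights [w_e^n] form a triangular system for the spherical Laplacian, with diagonal
    [- n (n + 1)], and separate functions by concentration. They stand in for the completeness of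
    spherical harmonics, so one explicit harmonic of each degree settles the reverse inclusion.

    The difference [D] is positive because the Wronskian [P2 a1 - P1 a2] starts at 0 and has
    derivative [(la2 - la1) a1 a2]. *)

Section Gradient.
Variable R : realType.
Notation V := 'rV[R]_3.
Implicit Types (u v : V -> R) (x : V).

(** [partial] is a total function, so its value is meaningful only together with differentiability;
    the calculus rules below carry both. *)
Definition has_grad u x (g : 'I_3 -> R) : Prop :=
  differentiable u x /\ forall i, partial i u x = g i.

Lemma has_grad_partial u x : differentiable u x -> has_grad u x (fun i => partial i u x).
Proof. by split. Qed.

Lemma has_grad_eq u x g g' : has_grad u x g -> (forall i, g i = g' i) -> has_grad u x g'.
Proof. by move=> [du e] e'; split=> // i; rewrite e. Qed.

Lemma has_grad_derive u x g w : has_grad u x g -> 'D_w u x = \sum_i w 0 i * g i.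
Proof.
move=> [du e]; rewrite deriveE// [in LHS](row_sum_delta w) linear_sum.
by apply: eq_bigr => i _; rewrite linearZ /= -e /partial deriveE.
Qed.

Lemma has_grad_cst (c : R) x : has_grad (fun=> c) x (fun=> 0).
Proof.
split; first exact: differentiable_cst.
by move=> i; rewrite /partial derive_cst.
Qed.

Lemma has_grad_coord j x : has_grad (fun y => y 0 j) x (fun i => (i == j)%:R).
Proof.
have d : differentiable (fun y : V => y 0 j) x by exact: differentiable_coord.
split=> // i; rewrite /partial.
rewrite /derive; apply: cvg_lim => //.
 apply: cvg_near_cst.
 near=> t.
 have t0 : t != 0 by near: t; exact: nbhs_dnbhs_neq.
 by rewrite /= !mxE eqxx /= addrK /GRing.scale /= mulrA mulVf // mul1r eq_sym.
Unshelve. all: by end_near.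
Qed.

Lemma has_gradD u v x g1 g2 : has_grad u x g1 -> has_grad v x g2 ->
  has_grad (fun y => u y + v y) x (fun i => g1 i + g2 i).
Proof.
move=> [d1 e1] [d2 e2]; split; first exact: differentiableD.
move=> i; rewrite -e1 -e2 /partial.
by apply: (@deriveD _ _ _ u v); exact: diff_derivable.
Qed.

Lemma has_gradN u x g1 : has_grad u x g1 ->
  has_grad (fun y => - u y) x (fun i => - g1 i).
Proof.
move=> [d1 e1]; split; first exact: differentiableN.
move=> i; rewrite -e1 /partial.
by apply: (@deriveN _ _ _ u); exact: diff_derivable.
Qed.

Lemma has_gradM u v x g1 g2 : has_grad u x g1 -> has_grad v x g2 ->
  has_grad (fun y => u y * v y) x (fun i => g1 i * v x + u x * g2 i).
Proof.
move=> [d1 e1] [d2 e2]; split; first exact: differentiableM.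
move=> i; rewrite -e1 -e2 /partial.
rewrite (@deriveM _ _ u v); [|exact: diff_derivable..].
by rewrite /GRing.scale /=; ring.
Qed.

Lemma has_grad_comp u (phi : R -> R) x g d : has_grad u x g ->
  is_derive (u x) 1 phi d -> has_grad (fun y => phi (u y)) x (fun i => d * g i).
Proof.
move=> [du e] [dphi ed].
have dp : differentiable phi (u x) by exact/derivable1_diffP.
split; first exact: (differentiable_comp du dp).
move=> i; rewrite -e -ed /partial deriveE; last exact: (differentiable_comp du dp).
rewrite (@diff_comp _ _ _ _ u phi) //= -derive1E (@deriveE _ _ _ u) // (diff1E dp).
by rewrite /GRing.scale /= mulrC.
Qed.

(** The difference [g - f] vanishes near [x], so the zero linear map is a differential for it;
    adding it to [f] transfers differentiability. *)
Lemma near_eq_differentiable (f g : V -> R) x :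
  (\near x, f x = g x) -> differentiable f x -> differentiable g x.
Proof.
move=> fg df.
have fgx : f x = g x by exact: nbhs_singleton fg.
pose w : V -> R := fun y => g y - f y.
have -> : g = f + w by apply/funext => y; rewrite !fctE /w addrC subrK.
apply: differentiableD => //.
have wo : w \o shift x = cst (w x) + (\0 : {linear V -> R}) +o_ (0 : V) id.
  apply/eqaddoP => _/posnumP[e]; near=> y.
  rewrite /w /= !fctE fgx subrr addr0.
  have -> : f (y + x) = g (y + x).
    near: y; have := fg; rewrite (near_shift 0) => fg'.
    by apply: filterS fg' => z /=; rewrite subr0.
  by rewrite !subrr normr0 mulr_ge0.
have c0 : continuous (\0 : {linear V -> R}) by apply: (@cst_continuous _ _ (0 : R)).
have dw := diff_unique c0 wo.
by apply/diff_locallyP; rewrite dw; split.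
Unshelve. all: by end_near. Qed.

Lemma near_eq_has_grad u v x g :
  (\near x, u x = v x) -> has_grad u x g -> has_grad v x g.
Proof.
move=> uv [du e]; split; first exact: near_eq_differentiable uv du.
by move=> i; rewrite -e /partial; symmetry; exact: near_eq_derive.
Qed.

Lemma has_grad_comp_row u (w : 'I_3 -> V -> R) x g G :
  has_grad u (\row_j w j x) G -> (forall j, has_grad (w j) x (g j)) ->
  has_grad (fun y => u (\row_j w j y)) x (fun i => \sum_j G j * g j i).
Proof.
move=> [du e] dw; pose W y : V := \row_j w j y.
have WE : W = \sum_j (fun y => w j y *: ('e_j : V)).
  apply/funext => y; rewrite fct_sumE /W [LHS]row_sum_delta.
  by apply: eq_bigr => j _; rewrite mxE.
have dWj j : differentiable (fun y => w j y *: ('e_j : V)) x.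
  by apply: differentiableZl; case: (dw j).
have dW : differentiable W x by rewrite WE; exact: differentiable_sum.
split; first exact: (differentiable_comp dW du).
move=> i; rewrite /partial deriveE; last exact: (differentiable_comp dW du).
rewrite (@diff_comp _ _ _ _ W u)//= -!deriveE//.
rewrite (has_grad_derive _ (conj du e)); apply: eq_bigr => j _.
rewrite mulrC; congr (_ * _).
have -> : 'D_('e_i) W x = \sum_j g j i *: ('e_j : V).
  rewrite WE derive_sum; last by move=> k; exact: diff_derivable.
  apply: eq_bigr => k _; have [dk ek] := dw k.
  by rewrite deriveE// diffZl//= -deriveE// -ek.
rewrite summxE (bigD1 j)//= !mxE !eqxx/= mulr1 big1 ?addr0// => k kj.
by rewrite !mxE eqxx/= eq_sym (negbTE kj) mulr0.
Qed.

Lemma is_derive_ray u (r : R) y g : has_grad u (r *: y) g ->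
  is_derive r 1 (fun s => u (s *: y)) (\sum_i y 0 i * g i).
Proof.
move=> ug.
have dl : differentiable (fun s : R => s *: y) r by [].
have du := proj1 ug.
have dc : differentiable (fun s : R => u (s *: y)) r by exact: (differentiable_comp dl du).
apply: DeriveDef; first exact: diff_derivable.
rewrite deriveE// (@diff_comp _ _ _ _ (fun s : R => s *: y : V) u)//=.
by rewrite diff_val /= scale1r -deriveE// (has_grad_derive _ ug).
Qed.

End Gradient.

(** * Smoothness through classes closed under differentiation *)

Section Smooth.
Variable R : realType.
Notation V := 'rV[R]_3.
Implicit Types (u v : V -> R) (U : set V).

Definition smooth_in U u := forall x, U x -> smooth_at u x.

Lemma smooth_in_sub U U' u : U' `<=` U -> smooth_in U u -> smooth_in U' u.
Proof. by move=> sub su x /sub; exact: su. Qed.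

Lemma smooth_in_partial U u i : smooth_in U u -> smooth_in U (partial i u).
Proof. by move=> su x Ux s; have := su x Ux (rcons s i); rewrite foldr_rcons. Qed.

Lemma smooth_in_grad U u x : smooth_in U u -> U x ->
  has_grad u x (fun i => partial i u x).
Proof. by move=> su Ux; apply: has_grad_partial; exact: (su x Ux [::]). Qed.

(* A class of functions that are differentiable on [U], with partial derivatives
   again in the class, consists of smooth functions. *)
Lemma smooth_coind U (P : (V -> R) -> Prop) : open U ->
  (forall u, P u -> forall i, exists2 v, P v &
    forall x, U x -> differentiable u x /\ partial i u x = v x) ->
  forall u, P u -> smooth_in U u.
Proof.
move=> oU step u Pu x Ux s.
have dif v : P v -> forall y, U y -> differentiable v y.
  by move=> /step /(_ 0) [w _ H] y /H [].
suff [v Pv e] : exists2 v, P v & forall x, U x -> foldr (@partial R) u s x = v x.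
  apply: (@near_eq_differentiable _ v); last exact: dif.
  by near do rewrite e //; exact: open_nbhs_nbhs.
elim: s => [|i s [v Pv e]]; first by exists u.
have [w Pw ew] := step v Pv i; exists w => // y Uy /=.
have [_ <-] := ew y Uy; apply: near_eq_derive.
by near do rewrite e //; exact: open_nbhs_nbhs.
Unshelve. all: by end_near. Qed.

Definition smooth1_in (D : set R) (f : R -> R) :=
  forall n x, D x -> derivable (derive1n n f) x 1.

Lemma smooth1_in_derive1 (D : set R) f : smooth1_in D f -> smooth1_in D (derive1 f).
Proof. by move=> sf n x Dx; rewrite -derive1Sn; exact: sf. Qed.

Lemma smooth1_in_is_derive (D : set R) f x : smooth1_in D f -> D x ->
  is_derive x 1 f (derive1 f x).
Proof.
move=> sf Dx; rewrite derive1E; apply: derivableP; exact: (sf 0%N).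
Qed.

Lemma smooth1_coind (D : set R) (P : (R -> R) -> Prop) : open D ->
  (forall f, P f -> exists2 g, P g & forall x, D x -> is_derive x 1 f (g x)) ->
  forall f, P f -> smooth1_in D f.
Proof.
move=> oD step f Pf n x Dx.
suff [g Pg e] : exists2 g, P g & forall x, D x -> derive1n n f x = g x.
  apply: (@near_eq_derivable _ _ _ g).
    by near do rewrite e //; exact: open_nbhs_nbhs.
  by have [k _ /(_ x Dx) []] := step g Pg.
elim: n => [|n [g Pg e]]; first by exists f.
have [k Pk ek] := step g Pg; exists k => // y Dy.
have [_ <-] := ek y Dy; rewrite derive1nS derive1E; apply: near_eq_derive.
by near do rewrite e //; exact: open_nbhs_nbhs.
Unshelve. all: by end_near. Qed.

(** A syntax of functions generated by a set [B]. It suffices to differentiate each base function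
    once inside the class, where its derivative may involve base functions again; solutions of a
    differential equation are shown to be smooth in this way. *)
Inductive alg1 (B : (R -> R) -> Prop) (D : set R) : (R -> R) -> Prop :=
| alg1_base f : B f -> alg1 B D f
| alg1_smooth f : smooth1_in D f -> alg1 B D f
| alg1_cst c : alg1 B D (fun=> c)
| alg1_add f g : alg1 B D f -> alg1 B D g -> alg1 B D (fun x => f x + g x)
| alg1_mul f g : alg1 B D f -> alg1 B D g -> alg1 B D (fun x => f x * g x)
| alg1_inv f : (forall x, D x -> f x != 0) -> alg1 B D f -> alg1 B D (fun x => (f x)^-1).

Lemma alg1_smooth_in (B : (R -> R) -> Prop) (D : set R) : open D ->
  (forall f, B f -> exists2 g, alg1 B D g & forall x, D x -> is_derive x 1 f (g x)) ->
  forall f, alg1 B D f -> smooth1_in D f.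
Proof.
move=> oD base; apply: smooth1_coind => // f.
elim=> [{}f Bf|{}f sf|c|{}f g af [f' af' ef] ag [g' ag' eg]
  |{}f g af [f' af' ef] ag [g' ag' eg]|{}f f0 af [f' af' ef]].
- exact: base.
- exists (derive1 f); first exact/alg1_smooth/smooth1_in_derive1.
  by move=> x Dx; exact: smooth1_in_is_derive sf Dx.
- exists (fun=> 0); first exact: alg1_cst.
  by move=> x _; exact: is_derive_cst.
- exists (fun x => f' x + g' x); first exact: alg1_add.
  by move=> x Dx; apply: is_deriveD; [exact: ef|exact: eg].
- exists (fun x => f' x * g x + f x * g' x).
    by apply: alg1_add; apply: alg1_mul.
  move=> x Dx; have := ef x Dx; have := eg x Dx => dg df.
  by apply: is_derive_eq; rewrite /GRing.scale /=; ring.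
- exists (fun x => (- 1) * ((f x)^-1 * (f x)^-1) * f' x).
    apply: alg1_mul => //; apply: alg1_mul; first exact: alg1_cst.
    by apply: alg1_mul; apply: alg1_inv.
  move=> x Dx; have [df e] := ef x Dx; have fx := f0 x Dx.
  apply: DeriveDef; first exact: derivableV.
  by rewrite deriveV // e /GRing.scale /=; field.
Qed.

(** The analogue for functions on space. [alg3_comp] covers radial functions, and [alg3_row]
    composition with a map from [U] to [W], such as the projection onto a sphere. *)
Inductive alg3 (U : set V) : (V -> R) -> Prop :=
| alg3_smooth u : smooth_in U u -> alg3 U u
| alg3_cst c : alg3 U (fun=> c)
| alg3_coord i : alg3 U (fun x => x 0 i)
| alg3_add u v : alg3 U u -> alg3 U v -> alg3 U (fun x => u x + v x)
| alg3_mul u v : alg3 U u -> alg3 U v -> alg3 U (fun x => u x * v x)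
| alg3_comp (D : set R) f u : smooth1_in D f -> (forall x, U x -> D (u x)) ->
    alg3 U u -> alg3 U (fun x => f (u x))
| alg3_row (W : set V) u (w : 'I_3 -> V -> R) : smooth_in W u ->
    (forall x, U x -> W (\row_j w j x)) -> (forall j, alg3 U (w j)) ->
    alg3 U (fun x => u (\row_j w j x)).

Lemma alg3_sum U n (u : 'I_n -> V -> R) : (forall i, alg3 U (u i)) ->
  alg3 U (fun x => \sum_i u i x).
Proof.
move=> au; rewrite (_ : (fun _ => _) = fun x => \sum_(i <- index_enum 'I_n) u i x) //.
elim: (index_enum _) => [|i s IH].
  by rewrite (_ : (fun _ => _) = fun=> 0); [exact: alg3_cst|apply/funext => x; rewrite big_nil].
rewrite (_ : (fun _ => _) = fun x => u i x + \sum_(j <- s) u j x).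
  exact: alg3_add.
by apply/funext => x; rewrite big_cons.
Qed.

Lemma alg3_smooth_in U u : open U -> alg3 U u -> smooth_in U u.
Proof.
move=> oU; apply: smooth_coind => // {}u au i.
suff [v av ev] : exists2 v : 'I_3 -> V -> R, (forall i, alg3 U (v i)) &
    forall x, U x -> has_grad u x (v ^~ x).
  by exists (v i) => // x /ev [].
elim: au => [{}u su|c|j|{}u v au [u' au' eu] av [v' av' ev]
  |{}u v au [u' au' eu] av [v' av' ev]|D f {}u sf Df au [u' au' eu]
  |W {}u w su Ww aw].
- exists (fun i => partial i u); last by move=> x Ux; exact: smooth_in_grad su Ux.
  by move=> j; exact/alg3_smooth/smooth_in_partial.
- exists (fun _ _ => 0); first by move=> _; exact: alg3_cst.
  by move=> x _; exact: has_grad_cst.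
- exists (fun i _ => (i == j)%:R); first by move=> k; exact: alg3_cst.
  by move=> x _; exact: has_grad_coord.
- exists (fun i x => u' i x + v' i x); first by move=> k; exact: alg3_add.
  by move=> x Ux; apply: has_gradD; [exact: eu|exact: ev].
- exists (fun i x => u' i x * v x + u x * v' i x).
    by move=> k; apply: alg3_add; apply: alg3_mul.
  by move=> x Ux; apply: has_gradM; [exact: eu|exact: ev].
- exists (fun i x => derive1 f (u x) * u' i x).
    move=> k; apply: alg3_mul => //.
    by apply: (@alg3_comp _ D) => //; exact: smooth1_in_derive1.
  move=> x Ux; apply: has_grad_comp; first exact: eu.
  by apply: smooth1_in_is_derive sf _; exact: Df.
- move=> IH; have {IH} /choice [w' IH] : forall j, exists v : 'I_3 -> V -> R,
      (forall i, alg3 U (v i)) /\ forall x, U x -> has_grad (w j) x (v ^~ x).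
    by move=> j; have [v av ev] := IH j; exists v.
  exists (fun i x => \sum_j partial j u (\row_k w k x) * w' j i x).
    move=> k; apply: alg3_sum => j; apply: alg3_mul; last by case: (IH j).
    by apply: (@alg3_row _ W) => //; exact: smooth_in_partial.
  move=> x Ux; apply: (has_grad_comp_row (g := fun j i => w' j i x)).
    by apply: smooth_in_grad su _; exact: Ww.
  by move=> j; have [_] := IH j; exact.
Qed.

End Smooth.

(** * Lebesgue measure on three-space *)

Section ProductSigmaFinite.
Context d1 d2 (T1 : measurableType d1) (T2 : measurableType d2) (R : realType).
Variables (m1 : {sigma_finite_measure set T1 -> \bar R}).
Variables (m2 : {sigma_finite_measure set T2 -> \bar R}).

Lemma sigma_finite_product_measure1 : sigma_finite setT (m1 \x m2)%E.
Proof.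
have [F TF Foo] := sigma_finiteT m1; have [G TG Goo] := sigma_finiteT m2.
pose H n := if unpickle n is Some (i, j) then F i `*` G j else set0.
exists H => [|n].
  apply/seteqP; split => // -[x y] _.
  have [i _ Fx] : (\bigcup_i F i) x by rewrite -TF.
  have [j _ Gy] : (\bigcup_j G j) y by rewrite -TG.
  by exists (pickle (i, j)) => //; rewrite /H pickleK.
rewrite /H; case: unpickle => [[i j]|]; last by rewrite measure0 ltry.
have [mF Fi] := Foo i; have [mG Gj] := Goo j; split; first exact: measurableX.
by rewrite product_measure1E // lte_mul_pinfty // ge0_fin_numE.
Qed.

(* The library only declares [m1 \x m2] as a sigma-finite measure for
   subprobabilities, although it proves sigma-finiteness in general. *)
Definition sigma_finite_product : {sigma_finite_measure set (T1 * T2)%type -> \bar R} :=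
  HB.pack (m1 \x m2)%E (Measure.on (m1 \x m2)%E)
    (Measure_isSigmaFinite.Build _ _ _ (m1 \x m2)%E sigma_finite_product_measure1).

End ProductSigmaFinite.

Section Lebesgue3.
Variable R : realType.
Notation V := 'rV[R]_3.
Notation T3 := (R * (R * R))%type.
Notation mu := (@lebesgue_measure R).
Notation mu3 := (@lebesgue3 R).

Definition leb2 := sigma_finite_product mu mu.
Definition leb3 := sigma_finite_product mu leb2.

Lemma vec3_0 (p : T3) : vec3 p 0 0 = p.1. Proof. by rewrite mxE. Qed.
Lemma vec3_1 (p : T3) : vec3 p 0 1 = p.2.1. Proof. by rewrite mxE. Qed.
Lemma vec3_2 (p : T3) : vec3 p 0 2%:R = p.2.2. Proof. by rewrite mxE. Qed.

Lemma ord3E (i : 'I_3) : [\/ i = 0, i = 1 | i = 2%:R].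
Proof.
case: i => [[|[|[|//]]] Hi]; [constructor 1|constructor 2|constructor 3]; exact/val_inj.
Qed.

Lemma sum3 (F : 'I_3 -> R) : \sum_i F i = F 0 + F 1 + F 2%:R.
Proof.
rewrite !big_ord_recl big_ord0 addr0 !addrA.
by congr (F _ + F _ + F _); exact/val_inj.
Qed.

Definition box (c : V) (e : R) : set T3 :=
  (`]c 0 0 - e, c 0 0 + e[ `*` (`]c 0 1 - e, c 0 1 + e[ `*` `]c 0 2%:R - e, c 0 2%:R + e[))%classic.

Lemma in_box c e p : box c e p <-> forall i, `|vec3 p 0 i - c 0 i| < e.
Proof.
rewrite /box /= !in_itv /=; split.
  move=> [/andP[a b] [/andP[a1 b1] /andP[a2 b2]]] i.
  case: (ord3E i) => ->; rewrite ?vec3_0 ?vec3_1 ?vec3_2 ltr_distl.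
  - by rewrite a b.
  - by rewrite a1 b1.
  - by rewrite a2 b2.
move=> H; have := H 0; have := H 1; have := H 2%:R.
by rewrite vec3_0 vec3_1 vec3_2 !ltr_distl.
Qed.

Lemma in_box0 e p : box 0 e p <-> forall i, `|vec3 p 0 i| < e.
Proof.
rewrite in_box; split=> H i; have := H i; have -> : (0 : V) 0 i = 0 by rewrite mxE.
  by rewrite subr0.
by rewrite subr0.
Qed.

Lemma measurable_box c e : measurable (box c e).
Proof.
apply: measurableX; first exact: measurable_itv.
by apply: measurableX; exact: measurable_itv.
Qed.

Lemma ball_rV3 (x y : V) (e : R) : 0 < e -> ball x e y <-> forall i, `|x 0 i - y 0 i| < e.
Proof.
move=> e0; rewrite /ball /= /mx_ball; split => [[_ H] i|H]; first exact: (H 0 i).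
by split => // i j; rewrite ord1; exact: H.
Qed.

(** [R * (R * R)] carries the product sigma-algebra, while the topology of row vectors comes from
    the sup norm. Boxes with rational center and radius [1 / (n + 1)] link the two: an open set is
    the union of those it contains, which are countably many and measurable. *)
Lemma measurable_vec3_open (O : set V) : open O -> measurable (@vec3 R @^-1` O).
Proof.
move=> oO.
pose Q (q : (rat * rat * rat * nat)%type) : V :=
  \row_i [:: ratr q.1.1.1; ratr q.1.1.2; ratr q.1.2]`_i.
have QE q i : Q q 0 i = [:: ratr q.1.1.1; ratr q.1.1.2; ratr q.1.2]`_i by rewrite mxE.
pose e (q : (rat * rat * rat * nat)%type) : R := (q.2.+1%:R)^-1.
pose F q : set T3 := if `[< box (Q q) (e q) `<=` @vec3 R @^-1` O >] then box (Q q) (e q) else set0.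
have -> : @vec3 R @^-1` O = \bigcup_q F q.
  apply/seteqP; split => [p Op|p [q _]]; last first.
    by rewrite /F; case: asboolP => // sub; exact: sub.
  have /nbhs_ballP [d /= d0 sub] : nbhs (vec3 p) O by exact: open_nbhs_nbhs.
  have [n nd] : exists n, n.+1%:R^-1 < d / 2.
    have [n _ /(_ n (leqnn n)) nd] := near_infty_natSinv_lt (PosNum (divr_gt0 d0 (@ltr0n R 2))).
    by exists n.
  have H (t : R) : exists q : rat, `|t - ratr q| < n.+1%:R^-1.
    have : 0 < n.+1%:R^-1 :> R by rewrite invr_gt0.
    move: (_^-1) => d1 d10.
    have /rat_in_itvoo [q] : t - d1 < t + d1 by lra.
    by rewrite in_itv /= -ltr_distlC => ?; exists q.
  have [q0 H0] := H (vec3 p 0 0); have [q1 H1] := H (vec3 p 0 1).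
  have [q2 H2] := H (vec3 p 0 2%:R).
  exists (q0, q1, q2, n) => //; rewrite /F asboolT.
    apply/in_box => i; rewrite QE /e /=.
    by case: (ord3E i) => ->.
  move=> z /in_box Hz /=; apply: sub; apply/ball_rV3 => // i.
  have := Hz i; rewrite QE /e /= => zi.
  have pi : `|vec3 p 0 i - [:: ratr q0; ratr q1; ratr q2]`_i| < n.+1%:R^-1.
    by case: (ord3E i) => ->.
  move: (_^-1) nd zi pi => d1 nd; rewrite !ltr_distl => /andP[a1 a2] /andP[b1 b2].
  by apply/andP; split; lra.
apply: countable_bigcupT_measurable; first exact: countableP.
by move=> q; rewrite /F; case: asboolP => // _; exact: measurable_box.
Qed.

Lemma measurable_fun_vec3 (O : set V) (f : V -> R) : open O ->
  (forall x, O x -> {for x, continuous f}) ->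
  measurable_fun (@vec3 R @^-1` O) (f \o @vec3 R).
Proof.
move=> oO cf; apply: (measurability _ (RGenOpens.measurableE R)).
move=> _ [_ [a [b ->]] <-].
rewrite [X in measurable X](_ : _ = @vec3 R @^-1` (O `&` f @^-1` `]a, b[)).
  apply: measurable_vec3_open.
  rewrite openE => x [Ox fx]; apply: filterI; first exact: open_nbhs_nbhs.
  apply: cf => //; apply: open_nbhs_nbhs; split => //; exact: interval_open.
by apply/seteqP; split => p [].
Qed.

Lemma integrable_finite_support d (T : measurableType d) (m : {measure set T -> \bar R})
    (g : T -> R) (A : set T) (M : R) : measurable A -> (m A < +oo)%E ->
  measurable_fun setT g -> (forall p, `|g p| <= M) -> (forall p, ~ A p -> g p = 0) ->
  m.-integrable setT (EFin \o g).
Proof.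
move=> mA mAoo mg gM gA.
have -> : EFin \o g = (EFin \o g) \_ A.
  apply/funext => p; rewrite patchE; case: ifPn => //= /negP pA.
  by rewrite gA // => Ap; apply: pA; rewrite inE.
apply/(integrable_mkcond _ mA); apply: measurable_bounded_integrable => //.
  exact: measurable_funTS.
by exists M; split; [exact: num_real|move=> y My p _; exact: le_trans (gM p) (ltW My)].
Qed.

Lemma mu3_box c (e : R) : 0 < e -> mu3 (box c e) = ((2 * e) ^+ 3)%:E.
Proof.
move=> e0.
have m i : measurable (`]c 0 i - e, c 0 i + e[%classic : set (measurableTypeR R)).
  exact: measurable_itv.
have H i : mu `]c 0 i - e, c 0 i + e[%classic = (2 * e)%:E.
  rewrite lebesgue_measure_itv /= lte_fin; case: ifPn => [_|].
    by rewrite -EFinB; congr EFin; ring.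
  by move/negP; case; lra.
rewrite /box; have := product_measure1E mu leb2 (m 0) (measurableX (m 1) (m 2%:R)).
rewrite (_ : leb2 _ = (2 * e * (2 * e))%:E); last first.
  by rewrite EFinM -{1}(H 1) -(H 2%:R); exact: product_measure1E.
move=> e3; apply: (etrans e3); rewrite [X in (X * _)%E](_ : _ = (2 * e)%:E); last exact: H.
by rewrite -EFinM; congr EFin; ring.
Qed.

Lemma integrable_box (g : T3 -> R) (B M : R) : 0 < B -> measurable_fun setT g ->
  (forall p, `|g p| <= M) -> (forall p, ~ box 0 B p -> g p = 0) ->
  mu3.-integrable setT (EFin \o g).
Proof.
move=> B0 mg gM gB; apply: (@integrable_finite_support _ _ leb3 g (box 0 B) M) gM gB => //.
  exact: measurable_box.
by apply: (@le_lt_trans _ _ ((2 * B) ^+ 3)%:E); [rewrite -(mu3_box 0 B0)|rewrite ltry].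
Qed.

Lemma integral_derive_compact_support (F f : R -> R) (B : R) :
  (forall t : R, is_derive t 1 F (f t)) -> continuous f ->
  (forall t, B <= `|t| -> F t = 0) -> (\int[mu]_t (f t)%:E = 0)%E.
Proof.
move=> dF cf F0; pose b : R := `|B| + 1.
have bB (t : R) : b < `|t| + 1 -> B <= `|t|.
  by move=> h; have := ler_norm B; rewrite /b in h; lra.
have b0 : 0 < b by rewrite /b; have := normr_ge0 B; lra.
have f0 (t : R) : b < `|t| -> f t = 0.
  move=> bt; have [_ <-] := dF t.
  rewrite (@near_eq_derive _ _ _ _ (cst 0)) ?derive_cst //.
  near=> s; apply: F0; apply: bB.
  have : b < `|s| by near: s; apply: (cvgr_gt `|t|) => //; exact: norm_continuous.
  by move: (`|s|) => z; lra.
transitivity (\int[mu]_(t in `[(- b)%R, b%R]) (f t)%:E)%E.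
  rewrite [RHS]integral_mkcond; apply: eq_integral => t _.
  rewrite patchE; case: ifPn => // /negP; rewrite inE /= in_itv /= -ler_norml => /negP.
  by rewrite -ltNge => /f0 ->.
rewrite (@continuous_FTC2 _ _ F).
- rewrite !F0 ?subee //; apply: bB; rewrite ?normrN ger0_norm; lra.
- lra.
- exact: continuous_subspaceT.
- have dFx t : derivable F t 1 by have [] := dF t.
  have cF t : {for t, continuous F} by apply/differentiable_continuous/derivable1_diffP.
  split => //; [exact/cvg_at_right_filter/cF|exact/cvg_at_left_filter/cF].
- by move=> t _; rewrite derive1E; have [] := dF t.
Unshelve. all: by end_near. Qed.

Lemma compact_rV_box (B : R) : compact [set x : V | forall j, `[- B, B]%classic (x 0 j)].
Proof. by apply: (@rV_compact _ _ (fun=> `[- B, B]%classic)) => j; exact: segment_compact. Qed.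

Lemma bounded_compact_support (f : V -> R) (B : R) : 0 < B -> continuous f ->
  (forall x : V, (exists j, B < `|x 0 j|) -> f x = 0) -> exists M, forall x : V, `|f x| <= M.
Proof.
move=> B0 cf f0; pose K := [set x : V | forall j, `[- B, B]%classic (x 0 j)].
have K0 : K !=set0.
  by exists 0 => j; rewrite /= mxE in_itv /= oppr_le0 ltW.
have cfn : {within K, continuous (fun x => `|f x|)}.
  by apply: continuous_subspaceT => x; apply: continuous_comp; [exact: cf|exact: norm_continuous].
have [c _ Hc] := EVT_max_rV K0 (@compact_rV_box B) cfn.
exists `|f c| => x; have [Kx|Kx] := pselect (K x); first by apply: Hc; rewrite inE.
rewrite f0 ?normr0 //; apply: contrapT => H; apply: Kx => j.
by rewrite /= in_itv /= -ler_norml leNgt; apply/negP => Bj; apply: H; exists j.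
Qed.

Lemma is_derive_line (u : V -> R) (r : R) (y w : V) g : has_grad u (r *: y + w) g ->
  is_derive r 1 (fun s : R => u (s *: y + w)) (\sum_i y 0 i * g i).
Proof.
move=> ug.
have ug' : has_grad (fun z : V => u (\row_j (z 0 j + w 0 j) : V)) (r *: y) g.
  have E (x : V) : \row_j (x 0 j + w 0 j) = x + w by apply/rowP => j; rewrite !mxE.
  have ug2 : has_grad u (\row_j ((r *: y) 0 j + w 0 j)) g by rewrite E.
  apply: has_grad_eq (has_grad_comp_row (w := fun j (z : V) => z 0 j + w 0 j) ug2 _) _ => [j|i].
    by apply: has_gradD; [exact: has_grad_coord|exact: has_grad_cst].
  rewrite /= (bigD1 i) //= eqxx addr0 mulr1 big1 ?addr0 // => j ji.
  by rewrite eq_sym (negbTE ji) addr0 mulr0.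
rewrite (_ : (fun s : R => _) = fun s : R => u (\row_j ((s *: y) 0 j + w 0 j))).
  exact: is_derive_ray ug'.
by apply/funext => s; congr u; apply/rowP => j; rewrite !mxE.
Qed.

Lemma partial_support (G : V -> R) i (B : R) :
  (forall x : V, (exists j, B <= `|x 0 j|) -> G x = 0) ->
  forall x : V, (exists j, B < `|x 0 j|) -> partial i G x = 0.
Proof.
move=> G0 x [j Bj]; rewrite /partial (@near_eq_derive _ _ _ _ (cst 0)) ?derive_cst //.
near=> y; apply: G0; exists j; apply: ltW.
near: y; apply: (cvgr_gt `|x 0 j|) => //.
apply: (@continuous_comp _ _ _ (fun y : V => y 0 j) (fun z : R => `|z|)).
  exact: coord_continuous.
exact: norm_continuous.
Unshelve. all: by end_near. Qed.

(** Fubini with the [i]-th axis innermost, where the fundamental theorem of calculus gives 0 on each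
    line. The nesting of [R * (R * R)] makes each coordinate a separate case: the order is exchanged
    in the outer product for [i = 0] and in the inner one for [i = 1]. *)
Lemma integral_partial (G : V -> R) i (B : R) : 0 < B ->
  (forall x, differentiable G x) -> continuous (partial i G) ->
  (forall x : V, (exists j, B <= `|x 0 j|) -> G x = 0) ->
  (\int[mu3]_p (partial i G (vec3 p))%:E = 0)%E.
Proof.
move=> B0 dG cG G0; have dG0 := partial_support i G0.
have [M HM] := bounded_compact_support B0 cG dG0.
pose f := fun p : T3 => partial i G (vec3 p).
have mf : measurable_fun setT f.
  have := @measurable_fun_vec3 setT (partial i G) openT (fun x _ => cG x).
  by rewrite preimage_setT.
have intf : leb3.-integrable setT (EFin \o f).
  apply: (@integrable_box f (2 * B) M) => //; first by rewrite mulr_gt0.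
    by move=> p; exact: HM.
  move=> p Hp; apply: dG0; apply: contrapT => H; apply: Hp; apply/in_box0 => j.
  rewrite ltNge; apply/negP => h; apply: H; exists j; lra.
have line (w : V) : (\int[mu]_t (partial i G (t *: 'e_i + w))%:E = 0)%E.
  pose b := B + `|w 0 i|.
  apply: (@integral_derive_compact_support (fun t => G (t *: 'e_i + w)) _ b).
  - move=> t; have := is_derive_line (has_grad_partial (dG (t *: 'e_i + w))).
    rewrite (bigD1 i) //= mxE !eqxx mul1r big1 ?addr0 // => j ji.
    by rewrite mxE eqxx (negbTE ji) mul0r.
  - move=> t; apply: (@continuous_comp _ _ _ (fun t : R => t *: 'e_i + w) (partial i G)).
      apply: cvgD; last exact: cvg_cst.
      by apply: cvgZr_tmp; exact: cvg_id.
    exact: cG.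
  - move=> t bt; apply: G0; exists i; rewrite !mxE !eqxx mulr1.
    have := lerB_normD t (w 0 i); rewrite /b in bt; lra.
rewrite -[LHS]/(\int[leb3]_p (EFin \o f) p)%E.
have e0E (t : R) (w : V) : (t *: ('e_i : V) + w) = \row_j (if j == i then t + w 0 i else w 0 j).
  apply/rowP => j; rewrite !mxE eqxx /=; case: eqVneq => [->|_]; first by rewrite mulr1.
  by rewrite mulr0 add0r.
have vE (p : T3) (w : V) (t : R) : (forall j, j != i -> vec3 p 0 j = w 0 j) -> w 0 i = 0 ->
    vec3 p 0 i = t -> vec3 p = t *: ('e_i : V) + w.
  move=> h1 h2 h3; rewrite e0E; apply/rowP => j; rewrite [RHS]mxE; case: eqVneq => [->|/h1 //].
  by rewrite h2 addr0.
have inner (g : R -> T3) (w : V) : (forall j, j != i -> forall t, vec3 (g t) 0 j = w 0 j) ->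
    w 0 i = 0 -> (forall t, vec3 (g t) 0 i = t) -> (\int[mu]_t (EFin \o f) (g t) = 0)%E.
  move=> h1 h2 h3; rewrite -[RHS](line w); apply: eq_integral => t _ /=; congr EFin.
  by rewrite /f (vE (g t) w t) // => j ji; exact: h1.
have [i0|i0] := eqVneq i 0.
  rewrite -integral21_prod_meas1 //=; apply: integral0_eq => -[y z] _.
  apply: (inner (fun t => (t, (y, z))) (vec3 (0, (y, z)))); rewrite ?i0.
  - by move=> j; case: (ord3E j) => -> // _ t; rewrite !mxE.
  - by rewrite mxE.
  - by move=> t; rewrite mxE.
rewrite -integral12_prod_meas1 //=; apply: integral0_eq => x _.
have intfx : leb2.-integrable setT (EFin \o (fun q => f (x, q))).
  apply: (@integrable_finite_support _ _ leb2 (fun q => f (x, q))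
    (`](- (2 * B))%R, (2 * B)%R[%classic `*` `](- (2 * B))%R, (2 * B)%R[%classic) M).
  - by apply: measurableX; exact: measurable_itv.
  - apply: (@le_lt_trans _ _ ((4 * B) * (4 * B))%:E); last by rewrite ltry.
    have h : mu `](- (2 * B))%R, (2 * B)%R[%classic = (4 * B)%:E.
      rewrite lebesgue_measure_itv /= lte_fin; case: ifPn => [_|].
        by rewrite -EFinB; congr EFin; ring.
      by move/negP; case; lra.
    by rewrite EFinM -h le_eqVlt; apply/orP; left; apply/eqP; exact: product_measure1E.
  - by apply: measurableT_comp => //; exact: measurable_pair1.
  - by move=> q; exact: HM.
  - move=> q Hq; apply: dG0; apply: contrapT => H; apply: Hq.
    have h j : `|vec3 (x, q) 0 j| < 2 * B.
      by rewrite ltNge; apply/negP => h; apply: H; exists j; lra.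
    have := h 1; have := h 2%:R; rewrite !mxE /= !ltr_norml => /andP[a1 a2] /andP[b1 b2].
    by split; rewrite /= in_itv /= ?a1 ?a2 ?b1 ?b2.
have [i1|i1] := eqVneq i 1.
  rewrite -[LHS]/(\int[leb2]_q (EFin \o (fun q => f (x, q))) q)%E.
  rewrite -integral21_prod_meas1 //=; apply: integral0_eq => z _.
  apply: (inner (fun t => (x, (t, z))) (vec3 (x, (0, z)))); rewrite ?i1.
  - by move=> j; case: (ord3E j) => -> // _ t; rewrite !mxE.
  - by rewrite mxE.
  - by move=> t; rewrite mxE.
rewrite -[LHS]/(\int[leb2]_q (EFin \o (fun q => f (x, q))) q)%E.
rewrite -integral12_prod_meas1 //=; apply: integral0_eq => y _.
have i2 : i = 2%:R by case: (ord3E i) i0 i1 => -> //; rewrite ?eqxx.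
apply: (inner (fun t => (x, (y, t))) (vec3 (x, (y, 0)))); rewrite ?i2.
- by move=> j; case: (ord3E j) => -> // _ t; rewrite !mxE.
- by rewrite mxE.
- by move=> t; rewrite mxE.
Qed.

End Lebesgue3.

(** * Dilations and Lebesgue measure *)

Section ProductMap.
Context d1 d2 (T1 : measurableType d1) (T2 : measurableType d2) (R : realType).
Variables (m1 : {sigma_finite_measure set T1 -> \bar R}).
Variables (m2 : {sigma_finite_measure set T2 -> \bar R}).

(** The hypotheses on the factors have the same form as the conclusion, so dilations of three-space
    follow by applying this twice. *)
Lemma ge0_integral_product_map (s1 : T1 -> T1) (s2 : T2 -> T2) (k1 k2 : R) :
  0 <= k1 -> 0 <= k2 -> measurable_fun setT s1 -> measurable_fun setT s2 ->
  (forall f : T1 -> \bar R, measurable_fun setT f -> (forall x, 0 <= f x)%E ->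
     (\int[m1]_x f (s1 x) = k1%:E * \int[m1]_x f x)%E) ->
  (forall f : T2 -> \bar R, measurable_fun setT f -> (forall x, 0 <= f x)%E ->
     (\int[m2]_x f (s2 x) = k2%:E * \int[m2]_x f x)%E) ->
  forall f : (T1 * T2)%type -> \bar R, measurable_fun setT f -> (forall x, 0 <= f x)%E ->
    (\int[m1 \x m2]_p f (s1 p.1, s2 p.2) = (k1 * k2)%:E * \int[m1 \x m2]_p f p)%E.
Proof.
move=> k10 k20 ms1 ms2 H1 H2 f mf f0.
have mfs : measurable_fun setT (fun p => f (s1 p.1, s2 p.2)).
  apply: (measurableT_comp mf); apply/measurable_fun_pairP; split.
    exact: (measurableT_comp ms1).
  exact: (measurableT_comp ms2).
rewrite fubini_tonelli1 // [in RHS]fubini_tonelli1 // /fubini_F /=.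
under eq_integral => x _.
  rewrite (H2 (fun y => f (s1 x, y))) //; last exact: (measurableT_comp mf (measurable_pair1 _)).
  over.
have mF : measurable_fun setT (fubini_F m2 f) by exact: measurable_fun_fubini_tonelli_F.
have F0 x : (0 <= fubini_F m2 f x)%E by exact: integral_ge0.
have -> : (\int[m1]_x (k2%:E * \int[m2]_y f (s1 x, y)) =
           k2%:E * \int[m1]_x (fubini_F m2 f (s1 x)))%E.
  have mFs : measurable_fun setT (fun x => fubini_F m2 f (s1 x)).
    exact: (measurableT_comp mF ms1).
  exact: (@ge0_integralZl_EFin _ _ _ m1 setT measurableT _ (fun x _ => F0 (s1 x)) mFs _ k20).
by rewrite H1 // muleA -EFinM mulrC.
Qed.

End ProductMap.

Section Scaling.
Variable R : realType.
Notation V := 'rV[R]_3.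
Notation T3 := (R * (R * R))%type.
Notation mu := (@lebesgue_measure R).
Notation mu3 := (@lebesgue3 R).

(** [c] times the image of Lebesgue measure under multiplication by [c] agrees with Lebesgue measure
    on half-open intervals, and these characterise it. *)
Lemma ge0_integral_scale (c : R) (f : R -> \bar R) : 0 < c ->
  measurable_fun [set: R] f -> (forall x, 0 <= f x)%E ->
  (\int[mu]_x f (c * x)%R = (c^-1)%:E * \int[mu]_x f x)%E.
Proof.
move=> c0 mf f0.
have mc : measurable_fun setT (fun x : measurableTypeR R => c * x : measurableTypeR R).
  exact: measurable_funM.
pose nu' : {measure set (measurableTypeR R) -> \bar R} :=
  mscale (NngNum (ltW c0)) (pushforward mu (fun x : measurableTypeR R => c * x : measurableTypeR R)).
pose nu := nu' mc.
have munu A : measurable A -> mu A = nu A.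
  apply: lebesgue_measure_unique => _ [[a b] _ <-].
  transitivity (c%:E * mu `](a / c)%R, (b / c)%R]%classic)%E; last first.
    rewrite /nu /nu' /mscale /=; congr (_ * _)%E; rewrite /pushforward; congr (mu _).
    by apply/seteqP; split => x /=; rewrite !in_itv /= ltr_pdivrMr // ler_pdivlMr // mulrC.
  rewrite !lebesgue_measure_itv /= !lte_fin ltr_pM2r ?invr_gt0 //.
  case: ifPn => _; last by rewrite mule0.
  by rewrite -!EFinB -EFinM; congr EFin; field; rewrite gt_eqF.
have -> : (\int[mu]_x f x = \int[nu]_x f x)%E.
  by apply: eq_measure_integral => A mA _; exact: munu.
rewrite ge0_integral_mscale //= ge0_integral_pushforward //= preimage_setT.
by rewrite muleA -EFinM mulVf ?gt_eqF // mul1e.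
Qed.

Definition scale3 (c : R) (p : T3) : T3 := (c * p.1, (c * p.2.1, c * p.2.2)).

Lemma vec3_scale c p : vec3 (scale3 c p) = c *: vec3 p.
Proof. by apply/rowP => i; case: (ord3E i) => ->; rewrite !mxE. Qed.

Lemma ge0_integral_scale3 (c : R) (f : T3 -> \bar R) : 0 < c ->
  measurable_fun [set: T3] f -> (forall x, 0 <= f x)%E ->
  (\int[mu3]_p f (scale3 c p) = (c^-1 ^+ 3)%:E * \int[mu3]_p f p)%E.
Proof.
move=> c0 mf f0.
have ci0 : 0 <= c^-1 by rewrite invr_ge0 ltW.
have mc : measurable_fun setT (fun x : measurableTypeR R => c * x : measurableTypeR R).
  exact: measurable_funM.
have H1 (g : measurableTypeR R -> \bar R) : measurable_fun setT g -> (forall x, 0 <= g x)%E ->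
  (\int[mu]_x g (c * x)%R = (c^-1)%:E * \int[mu]_x g x)%E by exact: ge0_integral_scale.
pose s2 (q : (measurableTypeR R * measurableTypeR R)%type) :
  (measurableTypeR R * measurableTypeR R)%type := (c * q.1, c * q.2).
have ms2 : measurable_fun setT s2.
  by apply/measurable_fun_pairP; split; apply: (measurableT_comp mc).
have H2 := ge0_integral_product_map ci0 ci0 mc mc H1 H1.
have := @ge0_integral_product_map _ _ _ _ R mu (leb2 R) (fun x => c * x) s2 _ _ ci0
  (mulr_ge0 ci0 ci0) mc ms2 H1 H2 f mf f0.
by move=> h; exact: h.
Qed.

End Scaling.

(** * The Euclidean norm and its smoothness off the origin *)

Section EuclideanNorm.
Variable R : realType.
Notation V := 'rV[R]_3.
Implicit Types x y : V.

Definition sqn (x : V) : R := \sum_i x 0 i ^+ 2.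

Lemma sqn_ge0 x : 0 <= sqn x.
Proof. by apply: sumr_ge0 => i _; rewrite sqr_ge0. Qed.

Lemma sqr_enorm x : enorm x ^+ 2 = sqn x.
Proof. by rewrite /enorm sqr_sqrtr // sqn_ge0. Qed.

Lemma enorm_ge0 x : 0 <= enorm x. Proof. exact: sqrtr_ge0. Qed.

Lemma sqn_eq0 x : (sqn x == 0) = (x == 0).
Proof.
apply/eqP/eqP => [h|->]; last by rewrite /sqn big1 // => i _; rewrite mxE expr0n.
apply/rowP => i; rewrite mxE; apply/eqP; rewrite -sqrf_eq0.
by have /psumr_eq0P -> := h => // j _; rewrite sqr_ge0.
Qed.

Lemma enorm_eq0 x : (enorm x == 0) = (x == 0).
Proof. by rewrite -sqn_eq0 -sqr_enorm sqrf_eq0. Qed.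

Lemma enorm_gt0 x : (0 < enorm x) = (x != 0).
Proof. by rewrite lt_neqAle enorm_ge0 andbT eq_sym enorm_eq0. Qed.

Lemma enormZ (c : R) x : enorm (c *: x) = `|c| * enorm x.
Proof.
apply/eqP; rewrite -(eqrXn2 (n := 2)) ?enorm_ge0 ?mulr_ge0 ?enorm_ge0 //; apply/eqP.
rewrite exprMn !sqr_enorm real_normK ?num_real // /sqn big_distrr /=.
by apply: eq_bigr => i _; rewrite mxE exprMn.
Qed.

Lemma coord_le_enorm x i : `|x 0 i| <= enorm x.
Proof.
rewrite -(ler_pXn2r (n := 2)) ?nnegrE ?enorm_ge0 // sqr_enorm real_normK ?num_real //.
by rewrite /sqn (bigD1 i) //= lerDl sumr_ge0 // => j _; rewrite sqr_ge0.
Qed.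

Lemma has_grad_sqn x : has_grad sqn x (fun i => 2 * x 0 i).
Proof.
have h i : has_grad (fun y : V => y 0 i ^+ 2) x (fun j => (j == i)%:R * x 0 i + x 0 i * (j == i)%:R).
  by rewrite /GRing.exp /=; apply: has_gradM; exact: has_grad_coord.
rewrite (_ : sqn = fun y : V => y 0 0 ^+ 2 + y 0 1 ^+ 2 + y 0 2%:R ^+ 2); last first.
  by apply/funext => y; rewrite /sqn sum3.
apply: has_grad_eq (has_gradD (has_gradD (h 0) (h 1)) (h 2%:R)) _ => i.
by case: (ord3E i) => -> /=; ring.
Qed.

Lemma sqn_continuous : continuous sqn.
Proof. by move=> x; apply: differentiable_continuous; case: (has_grad_sqn x). Qed.

Lemma enorm_continuous : continuous (@enorm R).
Proof.
move=> x; apply: (@continuous_comp _ _ _ sqn (@Num.sqrt R)); first exact: sqn_continuous.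
exact: sqrt_continuous.
Qed.

Lemma is_derive_sqrt (t : R) : 0 < t -> is_derive t 1 (@Num.sqrt R) (2^-1 * (Num.sqrt t)^-1).
Proof.
move=> t0; have h := is_derive1_sqrt t0.
by apply: is_derive_eq; rewrite invfM.
Qed.

Lemma smooth1_sqrt : smooth1_in [set t : R | 0 < t] (@Num.sqrt R).
Proof.
apply: (@alg1_smooth_in _ (fun f => f = @Num.sqrt R)); last exact: alg1_base.
  by rewrite (_ : [set t | 0 < t] = `]0, +oo[%classic); [exact: interval_open|rewrite set_itvE].
move=> _ ->; exists (fun t => 2^-1 * (Num.sqrt t)^-1); last by move=> t; exact: is_derive_sqrt.
apply: alg1_mul; first exact: alg1_cst.
apply: alg1_inv; last exact: alg1_base.
by move=> t t0; rewrite gt_eqF // sqrtr_gt0.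
Qed.

Lemma smooth1_id (D : set R) : open D -> smooth1_in D id.
Proof.
move=> oD; apply: (@alg1_smooth_in _ (fun f => f = id)) => //; last exact: alg1_base.
by move=> _ ->; exists (fun=> 1); [exact: alg1_cst|move=> x _; exact: is_derive_id].
Qed.

Lemma smooth1_inv : smooth1_in [set t : R | 0 < t] (fun t => t^-1).
Proof.
have oD : open [set t : R | 0 < t].
  by rewrite (_ : [set t | 0 < t] = `]0, +oo[%classic); [exact: interval_open|rewrite set_itvE].
apply: (@alg1_smooth_in _ (fun f => f = id)) => //.
  by move=> _ ->; exists (fun=> 1); [exact: alg1_cst|move=> x _; exact: is_derive_id].
apply: alg1_inv; last exact: alg1_base.
by move=> t t0; rewrite gt_eqF.
Qed.

Definition nonzero : set V := [set x | x != 0].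

Lemma open_nonzero : open nonzero.
Proof.
rewrite (_ : nonzero = @enorm R @^-1` `]0, +oo[).
  by apply: open_comp; [move=> x _; exact: enorm_continuous|exact: interval_open].
by apply/seteqP; split => x; rewrite /= in_itv /= andbT enorm_gt0.
Qed.

Lemma open_annulus (a b : R) : open [set x : V | a < enorm x < b].
Proof.
rewrite (_ : [set x | _] = @enorm R @^-1` `]a, b[).
  by apply: open_comp; [move=> x _; exact: enorm_continuous|exact: interval_open].
by apply/seteqP; split => x; rewrite /= in_itv.
Qed.

Lemma alg3_sqn U : alg3 U sqn.
Proof.
apply: (@alg3_sum _ _ _ (fun i (x : V) => x 0 i ^+ 2)) => i; rewrite /GRing.exp /=.
by apply: alg3_mul; exact: alg3_coord.
Qed.

Lemma alg3_enorm U : U `<=` nonzero -> alg3 U (@enorm R).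
Proof.
move=> U0; apply: (@alg3_comp _ _ _ (@Num.sqrt R) sqn); first exact: smooth1_sqrt.
  by move=> x Ux /=; rewrite lt_neqAle sqn_ge0 eq_sym sqn_eq0 andbT; exact: U0.
exact: alg3_sqn.
Qed.

Lemma alg3_invenorm U : U `<=` nonzero -> alg3 U (fun x => (enorm x)^-1).
Proof.
move=> U0; apply: (@alg3_comp _ _ _ (fun t => t^-1) (@enorm R)); first exact: smooth1_inv.
  by move=> x Ux /=; rewrite enorm_gt0; exact: U0.
exact: alg3_enorm.
Qed.

Lemma has_grad_radial (f : R -> R) x d : x != 0 -> is_derive (enorm x) 1 f d ->
  has_grad (fun y => f (enorm y)) x (fun i => d * (x 0 i / enorm x)).
Proof.
move=> x0 df; apply: has_grad_comp => //.
have s0 : 0 < sqn x by rewrite lt_neqAle sqn_ge0 eq_sym sqn_eq0 x0.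
apply: has_grad_eq (has_grad_comp (has_grad_sqn x) (is_derive_sqrt s0)) _ => i.
have -> : Num.sqrt (sqn x) = enorm x by [].
by field; rewrite gt_eqF // enorm_gt0.
Qed.

End EuclideanNorm.

(** * Cutoffs, averages and rotations *)

Section Continuity.
Variables (R : realType) (T : topologicalType).
Implicit Types (f g : T -> R) (x : T).

Lemma ctP f : (forall x, {for x, continuous f}) -> continuous f.
Proof. by []. Qed.

Lemma ct_mul f g x : {for x, continuous f} -> {for x, continuous g} ->
  {for x, continuous (fun y => f y * g y)}.
Proof. exact: continuousM. Qed.

Lemma ct_add f g x : {for x, continuous f} -> {for x, continuous g} ->
  {for x, continuous (fun y => f y + g y)}.
Proof. by move=> cf cg; apply: (@continuousD _ R^o). Qed.

Lemma ct_opp f x : {for x, continuous f} -> {for x, continuous (fun y => - f y)}.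
Proof. by move=> cf; apply: (@continuousN _ R^o). Qed.

Lemma ct_cst (c : R) x : {for x, continuous (fun=> c : R)}.
Proof. exact: cst_continuous. Qed.

Lemma ct_inv f x : f x != 0 -> {for x, continuous f} -> {for x, continuous (fun y => (f y)^-1)}.
Proof. by move=> f0 cf; apply: continuousV. Qed.

Lemma ct_exp f n x : {for x, continuous f} -> {for x, continuous (fun y => f y ^+ n)}.
Proof.
move=> cf; elim: n => [|n IH]; first exact: ct_cst.
by rewrite (_ : (fun y => _) = fun y => f y * f y ^+ n); [exact: ct_mul|apply/funext => y; rewrite exprS].
Qed.

Lemma ct_comp (g : R -> R) f x : {for x, continuous f} -> {for f x, continuous g} ->
  {for x, continuous (fun y => g (f y))}.
Proof. by move=> cf cg; apply: (@continuous_comp _ _ _ f g). Qed.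

Lemma ct_near_cst (c : R) f x : (\forall y \near x, f y = c) -> {for x, continuous f}.
Proof.
move=> H; have H0 := nbhs_singleton H; apply: cvg_near_cst.
by apply: filterS H => y ->; rewrite H0.
Qed.

Lemma ct_sum n (f : 'I_n -> T -> R) x : (forall i, {for x, continuous (f i)}) ->
  {for x, continuous (fun y => \sum_i f i y)}.
Proof.
move=> cf; rewrite (_ : (fun _ => _) = fun y => \sum_(i <- index_enum 'I_n) f i y) //.
elim: (index_enum _) => [|i s IH].
  by rewrite (_ : (fun _ => _) = fun=> 0); [exact: ct_cst|apply/funext => y; rewrite big_nil].
rewrite (_ : (fun _ => _) = fun y => f i y + \sum_(j <- s) f j y); first exact: ct_add.
by apply/funext => y; rewrite big_cons.
Qed.

End Continuity.

(** * The square of the positive part as a cutoff of class C^1 *)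

Section PositivePartSquare.
Variable R : realType.

(** One integration by parts asks only for a C^1 cutoff, and this is the simplest building block:
    its derivative [2 max(0, y)] is continuous. *)
Definition ppsq (y : R) : R := Num.max 0 y ^+ 2.

Lemma is_derive_ppsq (y : R) : is_derive y 1 ppsq (2 * Num.max 0 y).
Proof.
have [y0|y0|->] := ltgtP y 0.
- apply: (@near_eq_is_derive _ _ _ (cst 0)).
    near=> z; rewrite /ppsq max_l ?expr0n //.
    by apply: ltW; near: z; exact: lt_nbhsl.
  by rewrite mulr0; exact: is_derive_cst.
- apply: (@near_eq_is_derive _ _ _ (fun z : R => z ^+ 2)).
    near=> z; rewrite /ppsq max_r //.
    by apply: ltW; near: z; exact: lt_nbhsr.
  have := @exprn_derivable R 2 y 1; move=> h.
  by apply: DeriveDef => //; rewrite exp_derive /= expr1 /GRing.scale /= mulr1 mulr_natl.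
- rewrite mulr0.
  have lim0 : h^-1 *: (ppsq (h *: 1 + 0) - ppsq 0) @[h --> 0^'] --> (0 : R).
    apply/cvgrPdist_le => e e0; near=> h.
    have h0 : h != 0 by near: h; exact: nbhs_dnbhs_neq.
    rewrite sub0r normrN /ppsq /GRing.scale /= mulr1 addr0 maxxx expr0n subr0.
    rewrite normrM normfV.
    have he : `|h| <= e by near: h; apply: dnbhs0_le.
    rewrite mulrC ler_pdivrMr ?normr_gt0 // ger0_norm ?sqr_ge0 //.
    have m0 : 0 <= Num.max 0 h by rewrite le_max lexx.
    have mh : Num.max 0 h <= `|h| by rewrite ge_max normr_ge0 ler_norm.
    by rewrite expr2; apply: ler_pM => //; exact: le_trans mh he.
  apply: DeriveDef; first by apply/cvg_ex; exists 0.
  exact: cvg_lim lim0.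
Unshelve. all: by end_near. Qed.

Lemma ppsq_ge0 y : 0 <= ppsq y. Proof. exact: sqr_ge0. Qed.

Lemma ppsq_le0 y : y <= 0 -> ppsq y = 0.
Proof. by move=> y0; rewrite /ppsq max_l // expr0n. Qed.

Lemma max0_continuous : continuous (fun y : R => Num.max 0 y).
Proof. by move=> y; apply: continuous_max; [exact: cst_continuous|exact: cvg_id]. Qed.

End PositivePartSquare.

(** * Averages over the shell and integration by parts along rotations *)

Section Cutoff.
Variable R : realType.
Notation V := 'rV[R]_3.
Implicit Types x : V.

Definition shell (x : V) : R := (sqn x - 1) * (4 - sqn x).
(** A radial function, hence annihilated by the rotation fields, with support in [1 <= |x| <= 2].
    Being 0 near the origin, it also hides what functions of the direction do there. *)
Definition zeta (x : V) : R := ppsq (shell x).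
Definition zeta1 (x : V) : R := 4 * Num.max 0 (shell x) * (5 - 2 * sqn x).

Lemma shell_gt0 x : 0 < shell x -> 1 < sqn x < 4.
Proof.
rewrite /shell => h; apply/andP; split; nra.
Qed.

Lemma zeta_ge0 x : 0 <= zeta x. Proof. exact: ppsq_ge0. Qed.

Lemma zeta_eq0 x : ~~ (1 < sqn x < 4) -> zeta x = 0.
Proof. by move=> h; apply: ppsq_le0; rewrite leNgt; apply: contra h => /shell_gt0. Qed.

Lemma zeta0 : zeta 0 = 0.
Proof. by apply: zeta_eq0; rewrite /sqn big1 ?ltr10 // => i _; rewrite mxE expr0n. Qed.

Lemma zeta1_eq0 x : ~~ (1 < sqn x < 4) -> zeta1 x = 0.
Proof.
move=> h; rewrite /zeta1 max_l ?mulr0 ?mul0r //.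
by rewrite leNgt; apply: contra h => /shell_gt0.
Qed.

Lemma zeta_le x : zeta x <= 6.
Proof.
rewrite /zeta /ppsq; have m0 : 0 <= Num.max 0 (shell x) by rewrite le_max lexx.
(* [(t - 1) (4 - t)] has its maximum [9 / 4] at [t = 5 / 2], and [81 / 16 < 6]. *)
have : Num.max 0 (shell x) <= 9 / 4.
  rewrite ge_max /shell; apply/andP; split; first by lra.
  by have := sqr_ge0 (sqn x - 5 / 2); move: (sqn x) => t; nra.
by move: (Num.max _ _) m0 => m; nra.
Qed.

Lemma has_grad_shell x : has_grad shell x (fun i => 2 * (5 - 2 * sqn x) * x 0 i).
Proof.
have h1 := has_gradD (has_grad_sqn x) (has_grad_cst (- 1) x).
have h2 := has_gradD (has_grad_cst 4 x) (has_gradN (has_grad_sqn x)).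
by apply: has_grad_eq (has_gradM h1 h2) _ => i /=; ring.
Qed.

Lemma has_grad_zeta x : has_grad zeta x (fun i => zeta1 x * x 0 i).
Proof.
apply: has_grad_eq (has_grad_comp (has_grad_shell x) (is_derive_ppsq (shell x))) _ => i.
by rewrite /zeta1; ring.
Qed.

Lemma shell_continuous : continuous shell.
Proof. by move=> x; apply: differentiable_continuous; case: (has_grad_shell x). Qed.

Lemma zeta_continuous : continuous zeta.
Proof. by move=> x; apply: differentiable_continuous; case: (has_grad_zeta x). Qed.

Lemma zeta1_continuous : continuous zeta1.
Proof.
apply: ctP => x; apply: ct_mul; last first.
  apply: ct_add; first exact: ct_cst.
  by apply: ct_opp; apply: ct_mul; [exact: ct_cst|exact: sqn_continuous].
apply: ct_mul; first exact: ct_cst.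
by apply: (ct_comp (g := fun y : R => Num.max 0 y)); [exact: shell_continuous|exact: max0_continuous].
Qed.

(* [z] is supported away from the origin, so that the (arbitrary) behaviour of
   [f] there does not matter. *)
Lemma cut_near0 (f z : V -> R) : (forall x, ~~ (1 < sqn x < 4) -> z x = 0) ->
  \forall x \near (0 : V), f x * z x = 0.
Proof.
move=> z0; near=> x; rewrite z0 ?mulr0 // negb_and -leNgt; apply/orP; left; apply: ltW.
near: x; apply: (cvgr_lt (sqn 0)); first exact: sqn_continuous.
by rewrite (eqP (_ : sqn 0 == 0)) ?sqn_eq0 //; exact: ltr01.
Unshelve. all: by end_near. Qed.

Lemma cut_continuous (f z : V -> R) : (forall x, x != 0 -> {for x, continuous f}) ->
  continuous z -> (forall x, ~~ (1 < sqn x < 4) -> z x = 0) ->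
  continuous (fun x => f x * z x).
Proof.
move=> cf cz z0; apply: ctP => x; have [->|x0] := eqVneq x 0; last by apply: ct_mul; [exact: cf|exact: cz].
have H := cut_near0 f z0.
exact: ct_near_cst H.
Qed.

Lemma cut_differentiable (f : V -> R) x : (x != 0 -> differentiable f x) ->
  differentiable (fun y => f y * zeta y) x.
Proof.
have [-> _|x0 /(_ isT) df] := eqVneq x 0; last first.
  by apply: differentiableM => //; case: (has_grad_zeta x).
apply: (@near_eq_differentiable _ (cst 0)); last exact: differentiable_cst.
by apply: filterS (cut_near0 f (@zeta_eq0)) => y ->.
Qed.

Lemma cut_support (f z : V -> R) : (forall x, ~~ (1 < sqn x < 4) -> z x = 0) ->
  forall x, (exists j, 2 <= `|x 0 j|) -> f x * z x = 0.
Proof.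
move=> z0 x [j xj]; rewrite z0 ?mulr0 // negb_and -!leNgt.
rewrite -sqr_enorm; have := le_trans xj (coord_le_enorm x j).
by have := enorm_ge0 x; move: (enorm x) => t t0 t2; apply/orP; right; nra.
Qed.


(* The average of [f] over spheres, without surface measure: when [f] is
   homogeneous of degree 0, [avg f] is a multiple of its integral over S^2. *)
Definition avg (f : V -> R) : R := \int[leb3 R]_p (f (vec3 p) * zeta (vec3 p)).

Lemma measurable_vec3_continuous (f : V -> R) : continuous f ->
  measurable_fun setT (fun p : (R * (R * R))%type => f (vec3 p)).
Proof.
move=> cf; have := @measurable_fun_vec3 R setT f openT (fun x _ => cf x).
by rewrite preimage_setT.
Qed.

Lemma not_in_box2 p : ~ box 0 2 p -> exists j, 2 <= `|(vec3 p : V) 0 j|.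
Proof.
move=> Hp; apply: contrapT => H; apply: Hp; apply/in_box0 => j.
by rewrite ltNge; apply/negP => h; apply: H; exists j.
Qed.

Lemma integrable_continuous_support (f : V -> R) : continuous f ->
  (forall x, (exists j, 2 <= `|x 0 j|) -> f x = 0) ->
  (leb3 R).-integrable setT (EFin \o (fun p => f (vec3 p))).
Proof.
move=> cf f0.
have [M HM] : exists M : R, forall x : V, `|f x| <= M.
  by apply: (bounded_compact_support (B := 2)) cf _ => // x [j xj]; apply: f0; exists j; exact: ltW.
apply: (integrable_box (B := 2) (M := M)) => //; first exact: measurable_vec3_continuous.
by move=> p /not_in_box2; exact: f0.
Qed.

Lemma integrable_avg (f : V -> R) : (forall x, x != 0 -> {for x, continuous f}) ->
  (leb3 R).-integrable setT (EFin \o (fun p => f (vec3 p) * zeta (vec3 p))).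
Proof.
move=> cf; apply: (@integrable_continuous_support (fun x => f x * zeta x)).
  exact: cut_continuous cf zeta_continuous (@zeta_eq0).
by move=> x; apply: cut_support; exact: zeta_eq0.
Qed.

Definition rot (j k : 'I_3) (f : V -> R) (x : V) : R :=
  x 0 j * partial k f x - x 0 k * partial j f x.

Lemma integral_coord_partial (f : V -> R) (j k : 'I_3) : smooth_in (@nonzero R) f ->
  let E x := ((j == k)%:R * f x + x 0 j * partial k f x) * zeta x
    + x 0 j * x 0 k * f x * zeta1 x in
  (leb3 R).-integrable setT (EFin \o (fun p => E (vec3 p))) /\
  \int[leb3 R]_p E (vec3 p) = 0.
Proof.
move=> sf E; pose G x := x 0 j * f x * zeta x.
have G2 x : (exists i, 2 <= `|x 0 i|) -> G x = 0.
  exact: (cut_support (fun x => x 0 j * f x) (@zeta_eq0)).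
have cfx x : x != 0 -> {for x, continuous f}.
  by move=> x0; apply: differentiable_continuous; exact: (sf x x0 [::]).
have cpx x : x != 0 -> {for x, continuous (partial k f)}.
  by move=> x0; apply: differentiable_continuous; exact: (sf x x0 [:: k]).
have cx i x : {for x, continuous (fun y : V => y 0 i)} by exact: coord_continuous.
have cE : continuous E.
  apply: ctP => x; apply: ct_add.
    apply: (@cut_continuous (fun x => (j == k)%:R * f x + x 0 j * partial k f x)) => //.
    + move=> y y0; apply: ct_add; apply: ct_mul => //; [exact: ct_cst|exact: cfx|exact: cpx].
    + exact: zeta_continuous.
    + exact: zeta_eq0.
  apply: (@cut_continuous (fun x => x 0 j * x 0 k * f x)) => //.
  + by move=> y y0; apply: ct_mul; [exact: ct_mul|exact: cfx].
  + exact: zeta1_continuous.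
  + exact: zeta1_eq0.
have dG x : differentiable G x.
  apply: (@cut_differentiable (fun x => x 0 j * f x)) => x0.
  by apply: differentiableM; [exact: differentiable_coord|exact: (sf x x0 [::])].
have GE : partial k G = E.
  apply/funext => x; have [->|x0] := eqVneq x 0.
    rewrite /partial (@near_eq_derive _ _ _ _ (cst 0)) ?derive_cst; last first.
      exact: (cut_near0 (fun x => x 0 j * f x) (@zeta_eq0)).
    by rewrite /E zeta_eq0 ?zeta1_eq0 ?mulr0 ?addr0 // (eqP (_ : sqn 0 == 0)) ?sqn_eq0 // ltr10.
  have [_ ->] := has_gradM (has_gradM (has_grad_coord j x) (smooth_in_grad sf x0)) (has_grad_zeta x).
  by rewrite /E eq_sym; ring.
split.
  apply: (@integrable_continuous_support E) => // x xj.
  have h1 := cut_support (fun x => (j == k)%:R * f x + x 0 j * partial k f x) (@zeta_eq0) xj.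
  have h2 := cut_support (fun x => x 0 j * x 0 k * f x) (@zeta1_eq0) xj.
  by rewrite /E h1 h2 addr0.
have := integral_partial (i := k) (ltr0Sn R 1) dG.
rewrite GE => /(_ cE G2) h.
by rewrite /Rintegral (_ : (\int[_]_(p in _) _)%E = 0%:E).
Qed.

Lemma avg_rot (f : V -> R) (j k : 'I_3) : smooth_in (@nonzero R) f -> avg (rot j k f) = 0.
Proof.
move=> sf; have [i1 e1] := integral_coord_partial j k sf.
have [i2 e2] := integral_coord_partial k j sf.
rewrite -[RHS](subrr (0 : R)) -{1}e1 -e2 -RintegralB //.
by apply: eq_Rintegral => p _; rewrite /rot eq_sym; ring.
Qed.

Lemma smooth_rot (U : set V) f j k : open U -> smooth_in U f -> smooth_in U (rot j k f).
Proof.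
move=> oU sf; apply: alg3_smooth_in => //.
have a i l : alg3 U (fun x => x 0 i * partial l f x).
  by apply: alg3_mul; [exact: alg3_coord|exact/alg3_smooth/smooth_in_partial].
apply: alg3_add; first exact: a.
rewrite (_ : (fun x => _) = fun x => (-1) * (x 0 k * partial j f x)).
  by apply: alg3_mul; [exact: alg3_cst|exact: a].
by apply/funext => x; rewrite mulN1r.
Qed.

Lemma rotM (f g : V -> R) j k x : differentiable f x -> differentiable g x ->
  rot j k (fun y => f y * g y) x = rot j k f x * g x + f x * rot j k g x.
Proof.
move=> df dg; rewrite /rot.
have [_ e] := has_gradM (has_grad_partial df) (has_grad_partial dg).
by rewrite !e; ring.
Qed.

Lemma smooth_continuous (U : set V) (f : V -> R) x : smooth_in U f -> U x -> {for x, continuous f}.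
Proof. by move=> sf Ux; apply: differentiable_continuous; exact: (sf x Ux [::]). Qed.

Lemma smooth_mul (U : set V) (f g : V -> R) : open U -> smooth_in U f -> smooth_in U g ->
  smooth_in U (fun x => f x * g x).
Proof.
by move=> oU sf sg; apply: alg3_smooth_in => //; apply: alg3_mul; exact: alg3_smooth.
Qed.

Lemma eq_avg (f g : V -> R) : (forall x, x != 0 -> f x = g x) -> avg f = avg g.
Proof.
move=> fg; apply: eq_Rintegral => p _; have [v0|v0] := eqVneq (vec3 p : V) 0; last by rewrite fg.
by rewrite v0 zeta_eq0 ?mulr0 // (eqP (_ : sqn 0 == 0)) ?sqn_eq0 // ltr10.
Qed.

Lemma avgD (f g : V -> R) : (forall x, x != 0 -> {for x, continuous f}) ->
  (forall x, x != 0 -> {for x, continuous g}) -> avg (fun x => f x + g x) = avg f + avg g.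
Proof.
move=> cf cg; rewrite /avg -RintegralD //; [|exact: integrable_avg|exact: integrable_avg].
by apply: eq_Rintegral => p _; rewrite mulrDl.
Qed.

Lemma avgZ (c : R) (f : V -> R) : (forall x, x != 0 -> {for x, continuous f}) ->
  avg (fun x => c * f x) = c * avg f.
Proof.
move=> cf; rewrite /avg -RintegralZl //; last exact: integrable_avg.
by apply: eq_Rintegral => p _; rewrite mulrA.
Qed.

Lemma avg_rotM (f g : V -> R) j k : smooth_in (@nonzero R) f -> smooth_in (@nonzero R) g ->
  avg (fun x => rot j k f x * g x) = - avg (fun x => f x * rot j k g x).
Proof.
move=> sf sg; have oN := @open_nonzero R.
apply/eqP; rewrite -addr_eq0 -avgD; last first.
- by move=> x x0; apply: (@smooth_continuous (@nonzero R)) => //; apply: smooth_mul => //; exact: smooth_rot.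
- by move=> x x0; apply: (@smooth_continuous (@nonzero R)) => //; apply: smooth_mul => //; exact: smooth_rot.
rewrite -(avg_rot j k (smooth_mul oN sf sg)); apply/eqP/eq_avg => x x0.
by rewrite rotM //; [exact: (sf x x0 [::])|exact: (sg x x0 [::])].
Qed.

(* On functions of the direction alone this is the Laplacian of S^2. *)
Definition rlap (f : V -> R) (x : V) : R :=
  rot 0 1 (rot 0 1 f) x + rot 0 2%:R (rot 0 2%:R f) x + rot 1 2%:R (rot 1 2%:R f) x.

(** A sum of squares of operators that are antisymmetric for the average is symmetric. *)
Lemma avg_rlapM (f g : V -> R) : smooth_in (@nonzero R) f -> smooth_in (@nonzero R) g ->
  avg (fun x => rlap f x * g x) = avg (fun x => f x * rlap g x).
Proof.
move=> sf sg; have oN := @open_nonzero R.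
have c f1 g1 : smooth_in (@nonzero R) f1 -> smooth_in (@nonzero R) g1 ->
    forall x, x != 0 -> {for x, continuous (fun x => f1 x * g1 x)}.
  by move=> s1 s2 x x0; apply: (@smooth_continuous (@nonzero R)) => //; exact: smooth_mul.
have s2 f1 j k : smooth_in (@nonzero R) f1 -> smooth_in (@nonzero R) (rot j k (rot j k f1)).
  by move=> s1; do 2 apply: smooth_rot => //.
have h j k : avg (fun x => rot j k (rot j k f) x * g x) = avg (fun x => f x * rot j k (rot j k g) x).
  by rewrite avg_rotM //; [rewrite avg_rotM ?opprK //|]; exact: smooth_rot.
have distl (a b c1 d : R) : (a + b + c1) * d = a * d + b * d + c1 * d by ring.
have -> : avg (fun x => rlap f x * g x) =
    avg (fun x => rot 0 1 (rot 0 1 f) x * g x + rot 0 2%:R (rot 0 2%:R f) x * g x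
      + rot 1 2%:R (rot 1 2%:R f) x * g x).
  by apply: eq_avg => x _; exact: distl.
have -> : avg (fun x => f x * rlap g x) =
    avg (fun x => f x * rot 0 1 (rot 0 1 g) x + f x * rot 0 2%:R (rot 0 2%:R g) x
      + f x * rot 1 2%:R (rot 1 2%:R g) x).
  by apply: eq_avg => x _; rewrite mulrC distl; congr (_ + _ + _); exact: mulrC.
have A3 (a b c1 : V -> R) : (forall x, x != 0 -> {for x, continuous a}) ->
    (forall x, x != 0 -> {for x, continuous b}) -> (forall x, x != 0 -> {for x, continuous c1}) ->
    avg (fun x => a x + b x + c1 x) = avg a + avg b + avg c1.
  move=> ca cb cc; rewrite (@avgD (fun x => a x + b x) c1) // ?(@avgD a b) // => x x0.
  by apply: ct_add; [exact: ca|exact: cb].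
pose F j k x := rot j k (rot j k f) x * g x; pose G j k x := f x * rot j k (rot j k g) x.
have cF j k x : x != 0 -> {for x, continuous (F j k)} by apply: c => //; exact: s2.
have cG j k x : x != 0 -> {for x, continuous (G j k)} by apply: c => //; exact: s2.
apply: (etrans (A3 _ _ _ (cF 0 1) (cF 0 2%:R) (cF 1 2%:R))); apply: esym.
apply: (etrans (A3 _ _ _ (cG 0 1) (cG 0 2%:R) (cG 1 2%:R))).
by congr (_ + _ + _); exact: (esym (h _ _)).
Qed.

End Cutoff.

(** * A singular linear differential equation *)

Section DerivativeComparison.
Variable R : realType.
Implicit Types (f g F G : R -> R) (a b r : R).

Lemma is_derive_continuous f (x d : R) : is_derive x 1 f d -> {for x, continuous f}.
Proof. by move=> [df _]; apply/differentiable_continuous/derivable1_diffP. Qed.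

Lemma le_of_derive F f a b : a <= b ->
  (forall x, a < x < b -> is_derive x 1 F (f x)) -> (forall x, a < x < b -> 0 <= f x) ->
  {within `[a, b], continuous F} -> F a <= F b.
Proof.
rewrite le_eqVlt => /orP[/eqP -> //|ab] dF f0 cF.
have [c] := MVT ab (fun x h => dF x h) cF.
rewrite in_itv /= => /f0 fc /eqP; rewrite subr_eq => /eqP ->.
by rewrite lerDr mulr_ge0 // subr_ge0 ltW.
Qed.

Lemma lt_of_derive F f a b : a < b ->
  (forall x, a < x < b -> is_derive x 1 F (f x)) -> (forall x, a < x < b -> 0 < f x) ->
  {within `[a, b], continuous F} -> F a < F b.
Proof.
move=> ab dF f0 cF.
have [c] := MVT ab (fun x h => dF x h) cF.
rewrite in_itv /= => /f0 fc /eqP; rewrite subr_eq => /eqP ->.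
by rewrite ltrDr mulr_gt0 // subr_gt0.
Qed.

Lemma within_of_derive F f a b : (forall x, a <= x <= b -> is_derive x 1 F (f x)) ->
  {within `[a, b], continuous F}.
Proof.
move=> dF; apply: derivable_within_continuous => x xab; by have [] := dF x xab.
Qed.

Lemma le_of_derive_cc F f a b : a <= b ->
  (forall x, a <= x <= b -> is_derive x 1 F (f x)) -> (forall x, a <= x <= b -> 0 <= f x) ->
  F a <= F b.
Proof.
move=> ab dF f0; apply: (le_of_derive (f := f)) => //.
- by move=> x /andP[h1 h2]; apply: dF; rewrite !ltW.
- by move=> x /andP[h1 h2]; apply: f0; rewrite !ltW.
- exact: within_of_derive dF.
Qed.

Lemma lt_of_derive_cc F f a b : a < b ->
  (forall x, a <= x <= b -> is_derive x 1 F (f x)) -> (forall x, a <= x <= b -> 0 < f x) ->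
  F a < F b.
Proof.
move=> ab dF f0; apply: (lt_of_derive (f := f)) => //.
- by move=> x /andP[h1 h2]; apply: dF; rewrite !ltW.
- by move=> x /andP[h1 h2]; apply: f0; rewrite !ltW.
- exact: within_of_derive dF.
Qed.

Lemma is_derive_add f g (x df dg : R) : is_derive x 1 f df -> is_derive x 1 g dg ->
  is_derive x 1 (fun y => f y + g y) (df + dg).
Proof. by move=> *; exact: is_deriveD. Qed.

Lemma is_derive_opp f (x df : R) : is_derive x 1 f df -> is_derive x 1 (fun y => - f y) (- df).
Proof. by move=> *; exact: is_deriveN. Qed.

Lemma is_derive_mul f g (x df dg : R) : is_derive x 1 f df -> is_derive x 1 g dg ->
  is_derive x 1 (fun y => f y * g y) (df * g x + f x * dg).
Proof.
move=> h1 h2; apply: is_derive_eq; rewrite /GRing.scale /=; ring.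
Qed.

Lemma is_derive_inv f (x df : R) : f x != 0 -> is_derive x 1 f df ->
  is_derive x 1 (fun y => (f y)^-1) (- df / f x ^+ 2).
Proof.
move=> f0 [h1 h2]; apply: DeriveDef; first exact: derivableV.
by rewrite deriveV // h2 /GRing.scale /=; field.
Qed.

Lemma is_derive_pow (n : nat) (x : R) : is_derive x 1 (fun y : R => y ^+ n) (n%:R * x ^+ n.-1).
Proof.
have := @exprn_derivable R n x 1 => h.
by apply: DeriveDef => //; rewrite exp_derive /GRing.scale /= mulr1 mulr_natl.
Qed.

Lemma is_derive_ext f g (x d : R) : (\forall y \near x, f y = g y) ->
  is_derive x 1 f d -> is_derive x 1 g d.
Proof. exact: near_eq_is_derive. Qed.

Lemma is_derive_change f (x d d' : R) : is_derive x 1 f d -> d = d' -> is_derive x 1 f d'.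
Proof. by move=> ? <-. Qed.

(** With [e n = 2 M / 2^n], the tail of the geometric series, [u n - e n] is nondecreasing and
    [u n + e n] nonincreasing; the supremum of the former is the limit. *)
Lemma geometric_limit (u : nat -> R) (M : R) :
  (forall n, `|u n.+1 - u n| <= M / 2 ^+ n) ->
  exists l, forall n, `|l - u n| <= 2 * M / 2 ^+ n.
Proof.
move=> H.
have M0 : 0 <= M by have := H 0%N; rewrite expr0 divr1; exact: le_trans.
pose e n := 2 * M / 2 ^+ n.
have e0 n : 0 <= e n by rewrite /e divr_ge0 ?mulr_ge0 // exprn_ge0.
have eS n : e n.+1 = M / 2 ^+ n by rewrite /e exprS; field; rewrite expf_neq0.
have eE n : e n = 2 * (M / 2 ^+ n) by rewrite /e mulrA.
have aS n : u n - e n <= u n.+1 - e n.+1.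
  by rewrite eS eE; have := H n; rewrite ler_norml => /andP[]; move: (M / _) => z; lra.
have bS n : u n.+1 + e n.+1 <= u n + e n.
  by rewrite eS eE; have := H n; rewrite ler_norml => /andP[]; move: (M / _) => z; lra.
have a_mono n m : (n <= m)%N -> u n - e n <= u m - e m.
  move=> /subnK <-; elim: (m - n)%N => [|j IH] //; exact: le_trans IH (aS _).
have b_mono n m : (n <= m)%N -> u m + e m <= u n + e n.
  move=> /subnK <-; elim: (m - n)%N => [|j IH] //; exact: le_trans (bS _) IH.
have ab n m : u n - e n <= u m + e m.
  have [nm|/ltnW nm] := leqP n m.
    by apply: le_trans (a_mono _ _ nm) _; have := e0 m; lra.
  by apply: le_trans (b_mono _ _ nm); have := e0 n; lra.
pose S := [set u n - e n | n in setT].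
have hs : has_sup S.
  split; first by exists (u 0%N - e 0%N), 0%N.
  by exists (u 0%N + e 0%N) => _ [n _ <-]; exact: ab.
exists (sup S) => n; rewrite ler_norml.
have h1 : u n - e n <= sup S by apply: ub_le_sup; [case: hs|exists n].
have h2 : sup S <= u n + e n.
  by apply: ge_sup; [case: hs|move=> _ [m _ <-]; exact: ab].
by rewrite -/(e n); apply/andP; split; lra.
Qed.

Lemma uniform_limit_continuous_R (f : R -> R) (fn : nat -> R -> R) (M : R) :
  (forall n, continuous (fn n)) -> (forall n x, `|f x - fn n x| <= M / 2 ^+ n) ->
  continuous f.
Proof.
move=> cf H x; apply/cvgrPdist_le => /= e e0.
have [n Hn] : exists n, M / 2 ^+ n <= e / 3.
  have M1 : 0 < `|M| + 1 by apply: ltr_pwDr.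
  have [n _ /(_ n (leqnn n))] := near_infty_natSinv_lt (PosNum (divr_gt0 e0 (mulr_gt0 (ltr0Sn R 2) M1))).
  rewrite /= => Hn; exists n.
  have h2 : (n.+1%:R : R) <= 2 ^+ n by rewrite -natrX ler_nat ltn_expl.
  have n0 : 0 < n.+1%:R :> R by [].
  apply: (@le_trans _ _ ((`|M| + 1) / n.+1%:R)).
    apply: (@le_trans _ _ ((`|M| + 1) / 2 ^+ n)).
      by rewrite ler_pM2r ?invr_gt0 ?exprn_gt0 //; have := ler_norm M; lra.
    by rewrite ler_pM2l // lef_pV2 // posrE exprn_gt0.
  by rewrite -ler_pdivlMl //; apply/ltW; apply: (lt_le_trans Hn); rewrite le_eqVlt; apply/orP; left; apply/eqP; field; rewrite gt_eqF.
near=> y.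
have h1 := H n x; have h2 := H n y.
have h3 : `|fn n x - fn n y| <= e / 3.
  by near: y; have := cf n x => /cvgrPdist_le /(_ (e / 3)); apply; lra.
have -> : f x - f y = (f x - fn n x) + (fn n x - fn n y) - (f y - fn n y) by ring.
apply: (le_trans (ler_normB _ _)); apply: (@le_trans _ _ (e / 3 + e / 3 + e / 3)); last by lra.
apply: lerD; last exact: le_trans h2 Hn.
by apply: (le_trans (ler_normD _ _)); apply: lerD => //; exact: le_trans h1 Hn.
Unshelve. all: by end_near. Qed.

End DerivativeComparison.

(** * Primitives of continuous functions *)

Section Primitive.
Variable R : realType.
Notation mu := (@lebesgue_measure R).

Implicit Types (g : R -> R) (x t r : R).

(** Normalised at 0 but integrated from [-1], so that 0 is an interior point and the derivative
    there is two-sided. *)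
Definition prim (g : R -> R) (x : R) : R :=
  \int[mu]_(t in `[-1, x]) g t - \int[mu]_(t in `[-1, 0]) g t.

Lemma prim0 g : prim g 0 = 0. Proof. exact: subrr. Qed.

Lemma is_derive_prim g (x : R) : continuous g -> -1 < x -> is_derive x 1 (prim g) (g x).
Proof.
move=> cg x1.
have ig : mu.-integrable `[-1, (x + 1)] (EFin \o g).
  apply: continuous_compact_integrable; first exact: segment_compact.
  exact: continuous_subspaceT.
have xx1 : x < x + 1 by lra.
have [d1 d2] := continuous_FTC1_closed xx1 ig x1 (cg x).
have h : is_derive x 1 (fun x => \int[mu]_(t in `[-1, x]) g t) (g x).
  by apply: DeriveDef; [exact: d1|rewrite -derive1E; exact: d2].
by rewrite -[g x]subr0; apply: is_derive_add.
Qed.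

Lemma prim_continuous g (x : R) : continuous g -> -1 < x -> {for x, continuous (prim g)}.
Proof. by move=> cg x1; apply: is_derive_continuous; exact: is_derive_prim. Qed.

Lemma primD g1 g2 (x : R) : continuous g1 -> continuous g2 -> 0 <= x ->
  prim (fun t => g1 t - g2 t) x = prim g1 x - prim g2 x.
Proof.
move=> c1 c2 x0; apply/eqP; rewrite -subr_eq0; apply/eqP.
pose D t := prim (fun t => g1 t - g2 t) t - (prim g1 t - prim g2 t).
have c12 : continuous (fun t => g1 t - g2 t).
  by apply: ctP => t; apply: ct_add; [exact: c1|apply: ct_opp; exact: c2].
have dD t : -1 < t -> is_derive t 1 D 0.
  move=> t1; apply: is_derive_change (is_derive_add (is_derive_prim c12 t1)
    (is_derive_opp (is_derive_add (is_derive_prim c1 t1) (is_derive_opp (is_derive_prim c2 t1))))) _.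
  by rewrite subrr.
have h t : 0 <= t <= x -> is_derive t 1 D 0 by move=> /andP[t0 _]; apply: dD; lra.
have h2 t : 0 <= t <= x -> is_derive t 1 (fun t : R => - D t) 0.
  by move=> tx; rewrite -oppr0; apply: is_derive_opp; exact: h.
have D0 : D 0 = 0 by rewrite /D !prim0 !subrr.
have := le_of_derive_cc x0 h (fun _ _ => lexx _).
have := le_of_derive_cc x0 h2 (fun _ _ => lexx _).
by rewrite D0 -/(D x); lra.
Qed.

Lemma prim_bound g F (f : R -> R) (x : R) : continuous g -> 0 <= x ->
  (forall t, 0 <= t <= x -> is_derive t 1 F (f t)) ->
  (forall t, 0 <= t <= x -> `|g t| <= f t) -> `|prim g x| <= F x - F 0.
Proof.
move=> cg x0 dF H; rewrite ler_norml.
have dp t : 0 <= t <= x -> is_derive t 1 (prim g) (g t).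
  by move=> /andP[t0 _]; apply: is_derive_prim => //; lra.
have := le_of_derive_cc x0 (fun t tx => is_derive_add (dF t tx) (dp t tx)).
have := le_of_derive_cc x0 (fun t tx => is_derive_add (dF t tx) (is_derive_opp (dp t tx))).
rewrite prim0 => h1 h2.
have {}h1 : F 0 - 0 <= F x - prim g x.
  by apply: h1 => t tx; have := H t tx; rewrite ler_norml => /andP[]; lra.
have {}h2 : F 0 + 0 <= F x + prim g x.
  by apply: h2 => t tx; have := H t tx; rewrite ler_norml => /andP[]; lra.
by apply/andP; split; lra.
Qed.

End Primitive.

(** * A Volterra equation solved by Picard iteration *)

Section Volterra.
Variables (R : realType) (eta : R -> R) (E : R) (N : nat) (kap B : R) (c0 : R).
Hypotheses (ceta : continuous eta) (etaE : forall t, `|eta t| <= E) (B0 : 0 < B) (kap0 : 0 <= kap).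

Implicit Types (f g : R -> R) (t r x : R).

Let G1 (f : R -> R) := prim (fun t => eta t * f t).
Let G2 (f : R -> R) := prim (fun t => t ^+ N * (eta t * f t)).

(** The integral operator with kernel [(1 - (t / r)^N) eta(t)]. For degree [k] it is applied with
    [N = 2 k + 1], the difference of the indicial exponents. The value 0 at [r <= 0] extends it
    continuously. *)
Definition volterra_op (f : R -> R) (r : R) : R := if 0 < r then G1 f r - G2 f r / r ^+ N else 0.

(** Freezing the argument outside [[0, B]] makes the iterates continuous on the whole line, with
    estimates taken on [[0, B]] only. *)
Let clamp (r : R) : R := Num.min B (Num.max 0 r).

Let clamp_ge0 r : 0 <= clamp r.
Proof. by rewrite /clamp le_min (ltW B0) le_max lexx. Qed.

Let clamp_leB r : clamp r <= B. Proof. by rewrite /clamp ge_min lexx. Qed.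

Let clamp_id r : 0 <= r -> r <= B -> clamp r = r.
Proof. by move=> r0 rB; rewrite /clamp max_r // min_r. Qed.

Let clamp_continuous : continuous clamp.
Proof.
move=> r; apply: continuous_min; first exact: cst_continuous.
by apply: continuous_max; [exact: cst_continuous|exact: cvg_id].
Qed.

Let E0 : 0 <= E. Proof. exact: le_trans (normr_ge0 _) (etaE 0). Qed.

Let cg1 f : continuous f -> continuous (fun t => eta t * f t).
Proof. by move=> cf; apply: ctP => t; apply: ct_mul; [exact: ceta|exact: cf]. Qed.

Let cg2 f : continuous f -> continuous (fun t => t ^+ N * (eta t * f t)).
Proof.
by move=> cf; apply: ctP => t; apply: ct_mul; [apply: ct_exp; exact: cvg_id|exact: cg1].
Qed.

Lemma volterra_op_sub f g r : continuous f -> continuous g ->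
  volterra_op (fun t => f t - g t) r = volterra_op f r - volterra_op g r.
Proof.
move=> cf cg; rewrite /volterra_op; case: ifP => [r0|_]; last by rewrite subr0.
have r0' := ltW r0.
have -> : G1 (fun t => f t - g t) r = G1 f r - G1 g r.
  rewrite /G1 -primD //; [|exact: cg1..].
  by congr (prim _ _); apply/funext => t; rewrite mulrBr.
have -> : G2 (fun t => f t - g t) r = G2 f r - G2 g r.
  rewrite /G2 -primD //; [|exact: cg2..].
  by congr (prim _ _); apply/funext => t; rewrite !mulrBr.
ring.
Qed.

(** Since [0 <= (t / r)^N <= 1], each of the two integrals is at most [E] times the increment of
    [F], a primitive of a majorant of [|f|]. *)
Lemma volterra_op_bound f F (df : R -> R) r : continuous f -> 0 < r ->
  (forall t, 0 <= t <= r -> is_derive t 1 F (df t)) ->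
  (forall t, 0 <= t <= r -> `|f t| <= df t) ->
  `|volterra_op f r| <= 2 * E * (F r - F 0).
Proof.
move=> cf r0 dF H; rewrite /volterra_op r0; have r0' := ltW r0.
have rN : 0 < r ^+ N by exact: exprn_gt0.
have h1 : `|G1 f r| <= E * F r - E * F 0.
  apply: (@prim_bound _ _ (fun t => E * F t) (fun t => E * df t)) => //; first exact: cg1.
    move=> t tr; apply: is_derive_change (is_derive_mul (is_derive_cst E t 1) (dF t tr)) _.
    by rewrite mul0r add0r.
  by move=> t tr; rewrite normrM ler_pM // H.
have h2 : `|G2 f r| <= (r ^+ N * E) * F r - (r ^+ N * E) * F 0.
  apply: (@prim_bound _ _ (fun t => (r ^+ N * E) * F t) (fun t => (r ^+ N * E) * df t)) => //.
  - exact: cg2.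
  - move=> t tr; apply: is_derive_change (is_derive_mul (is_derive_cst (r ^+ N * E) t 1) (dF t tr)) _.
    by rewrite mul0r add0r.
  - move=> t /andP[t0 tr]; rewrite normrM -mulrA normrX (ger0_norm t0).
    apply: ler_pM => //; first exact: exprn_ge0.
      by rewrite lerXn2r.
    by rewrite normrM ler_pM // H // t0 tr.
apply: (le_trans (ler_normB _ _)).
have : `|G2 f r / r ^+ N| <= E * F r - E * F 0.
  rewrite normrM normfV (gtr0_norm rN) ler_pdivrMr //.
  by apply: (le_trans h2); rewrite le_eqVlt; apply/orP; left; apply/eqP; ring.
lra.
Qed.

Let bounded_on (f : R -> R) : continuous f -> exists M : R, 0 <= M /\ forall t, 0 <= t <= B -> `|f t| <= M.
Proof.
move=> cf; have cn : {within `[0, B], continuous (fun t => `|f t|)}.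
  by apply: continuous_subspaceT => t; apply: continuous_comp; [exact: cf|exact: norm_continuous].
have [c _ Hc] := EVT_max (ltW B0) cn.
by exists `|f c|; split => // t tB; apply: Hc; rewrite in_itv.
Qed.

Lemma volterra_op_linear_bound f (M : R) r : continuous f ->
  (forall t, 0 <= t <= B -> `|f t| <= M) -> `|volterra_op f (clamp r)| <= 2 * E * M * clamp r.
Proof.
move=> cf HM; have := clamp_ge0 r; rewrite le_eqVlt => /orP[/eqP <-|r0].
  by rewrite /volterra_op ltxx normr0 mulr0.
have -> : 2 * E * M * clamp r = 2 * E * (M * clamp r - M * 0) by ring.
apply: (@volterra_op_bound _ (fun t => M * t) (fun=> M)) => //.
  move=> t _; apply: is_derive_change (is_derive_mul (is_derive_cst M t 1) (is_derive_id t 1)) _.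
  by rewrite mul0r add0r mulr1.
by move=> t /andP[t0 tr]; apply: HM; rewrite t0 (le_trans tr).
Qed.

Lemma volterra_op_continuous f : continuous f -> continuous (fun r => volterra_op f (clamp r)).
Proof.
move=> cf; apply: ctP => r; have := clamp_ge0 r; rewrite le_eqVlt => /orP[/eqP r0|r0].
  have [M [M0 HM]] := bounded_on cf.
  have h : 0 < 2 * E * M + 1 by rewrite ltr_wpDl // !mulr_ge0.
  apply/cvgrPdist_le => /= e e0; near=> y.
  rewrite -r0 {1}/volterra_op ltxx sub0r normrN.
  apply: (le_trans (volterra_op_linear_bound y cf HM)).
  have hy : clamp y <= e / (2 * E * M + 1).
    near: y; have /cvgrPdist_le /(_ _ (divr_gt0 e0 h)) := @clamp_continuous r.
    by apply: filterS => y; rewrite -r0 sub0r normrN ger0_norm.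
  rewrite ler_pdivlMr // in hy; apply: le_trans hy; rewrite mulrC.
  by rewrite ler_wpM2l // lerDl.
have h1 : {for r, continuous (fun y => G1 f (clamp y) - G2 f (clamp y) / clamp y ^+ N)}.
  have cr := @clamp_continuous r.
  have p1 : -1 < clamp r by apply: lt_le_trans (clamp_ge0 r); lra.
  apply: ct_add.
    by apply: (ct_comp (g := G1 f)) => //; apply: prim_continuous => //; exact: cg1.
  apply: ct_opp; apply: ct_mul.
    by apply: (ct_comp (g := G2 f)) => //; apply: prim_continuous => //; exact: cg2.
  by apply: ct_inv; [rewrite expf_neq0 // gt_eqF|exact: ct_exp].
have rpos : 0 < r.
  rewrite ltNge; apply/negP => rle; move: r0.
  by rewrite /clamp max_l // min_r ?ltxx // ltW.
have near_pos : \forall y \near (r : R), 0 < clamp y.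
  near=> y; rewrite /clamp lt_min B0 lt_max.
  by have -> : 0 < y; [near: y; exact: lt_nbhsr|rewrite orbT].
move: h1; rewrite /prop_for /continuous_at => h1.
have -> : volterra_op f (clamp r) = G1 f (clamp r) - G2 f (clamp r) / clamp r ^+ N.
  by rewrite /volterra_op r0.
apply: cvg_trans h1; apply: near_eq_cvg; near=> y.
by rewrite /volterra_op (near near_pos y) //.
Unshelve. all: by end_near. Qed.

Let pow2_eq0 (x C : R) : (forall n, `|x| <= C / 2 ^+ n) -> x = 0.
Proof.
move=> H; apply/eqP; rewrite -normr_eq0; apply/eqP/le_anti; rewrite normr_ge0 andbT.
have [l Hl] := @geometric_limit R (fun=> 0) 0 (fun n => ltac:(by rewrite subrr normr0 mul0r)).
rewrite leNgt; apply/negP => x0.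
have C0 : 0 < C by have := H 0%N; rewrite expr0 divr1; exact: lt_le_trans.
have [n _ /(_ n (leqnn n))] := near_infty_natSinv_lt (PosNum (divr_gt0 x0 C0)).
rewrite /= => Hn; have := H n; rewrite leNgt => /negP; apply.
have h2 : (n.+1%:R : R) <= 2 ^+ n by rewrite -natrX ler_nat ltn_expl.
apply: (@le_lt_trans _ _ (C / n.+1%:R)).
  by rewrite ler_pM2l // lef_pV2 // posrE ?exprn_gt0.
by rewrite mulrC -ltr_pdivlMr.
Qed.

(** In the norm with weight [exp(- K r)] the iteration contracts by [1 / 2], whatever the length
    [B]; the iterates converge geometrically and uniformly. *)
Lemma volterra_solution : exists f : R -> R, continuous f /\
  forall r, 0 <= r <= B -> f r = c0 + kap * volterra_op f r.
Proof.
pose fn := fix fn n : R -> R := if n is m.+1 then fun r => c0 + kap * volterra_op (fn m) (clamp r)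
  else fun=> c0.
have cfn n : continuous (fn n).
  elim: n => [|n IH]; first exact: (@cst_continuous _ _ c0).
  apply: ctP => r; apply: ct_add; first exact: ct_cst.
  by apply: ct_mul; [exact: ct_cst|exact: volterra_op_continuous].
(* One step multiplies the weighted bound by [2 kap E / K], which is at most [1 / 2]; the 1 keeps
   [K] positive. *)
pose K : R := 4 * kap * E + 1.
have K0 : 0 < K by rewrite ltr_wpDl // !mulr_ge0.
pose M0 := kap * (2 * E * `|c0| * B).
have M00 : 0 <= M0 by rewrite !mulr_ge0 // ltW.
have dexp t : is_derive t 1 (fun t : R => expR (K * t)) (K * expR (K * t)).
  have h := is_derive1_comp (is_derive_expR (K * t))
    (is_derive_mul (is_derive_cst K t 1) (is_derive_id t 1)).
  by apply: is_derive_change h _; rewrite mul0r add0r mulr1 mulrC.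
have step n r : `|fn n.+1 r - fn n r| <= M0 / 2 ^+ n * expR (K * clamp r).
  elim: n r => [|n IH] r.
    rewrite expr0 divr1 /= addrAC subrr add0r normrM (ger0_norm kap0) -[leLHS]mulr1.
    have e1 : 1 <= expR (K * clamp r) by rewrite -expR0 ler_expR mulr_ge0 // ltW.
    apply: ler_pM => //; first by rewrite mulr_ge0.
    rewrite /M0; apply: ler_wpM2l => //.
    apply: (le_trans (@volterra_op_linear_bound (fun=> c0) `|c0| r (@cst_continuous _ _ c0) (fun _ _ => lexx _))).
    by apply: ler_wpM2l => //; rewrite !mulr_ge0.
  have -> : fn n.+2 r - fn n.+1 r = kap * volterra_op (fun t => fn n.+1 t - fn n t) (clamp r).
    by rewrite (volterra_op_sub _ (cfn n.+1) (cfn n)) /=; ring.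
  have cd : continuous (fun t => fn n.+1 t - fn n t).
    by apply: ctP => t; apply: ct_add; [exact: cfn|apply: ct_opp; exact: cfn].
  have M2 : 0 <= M0 / 2 ^+ n by rewrite divr_ge0 // exprn_ge0.
  rewrite normrM (ger0_norm kap0).
  have -> : M0 / 2 ^+ n.+1 = M0 / 2 ^+ n / 2.
    by rewrite exprSr; field; rewrite expf_neq0.
  move: (M0 / 2 ^+ n) M2 IH => m M2 IH.
  have := clamp_ge0 r; rewrite le_eqVlt => /orP[/eqP <-|r0].
    by rewrite /volterra_op ltxx normr0 mulr0 mulr_ge0 ?divr_ge0 ?expR_ge0.
  have h := @volterra_op_bound _ (fun t => m / K * expR (K * t)) (fun t => m * expR (K * t)) (clamp r) cd r0.
  have {}h : `|volterra_op (fun t => fn n.+1 t - fn n t) (clamp r)| <=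
      2 * E * (m / K * expR (K * clamp r) - m / K * expR (K * 0)).
    apply: h => t tr.
      apply: is_derive_change (is_derive_mul (is_derive_cst (m / K) t 1) (dexp t)) _.
      by rewrite /cst; field; rewrite gt_eqF.
    have /andP[t0 t1] := tr; have := IH t; rewrite clamp_id // (le_trans t1) //.
  apply: (le_trans (ler_wpM2l kap0 h)); rewrite mulr0 expR0 mulr1.
  have X0 := expR_ge0 (K * clamp r); move: (expR _) X0 => X X0.
  have mK : 0 <= m / K by rewrite divr_ge0 // ltW.
  have -> : m / 2 * X = K / 2 * (m / K * X) by field; rewrite gt_eqF.
  have mKX : 0 <= m / K * X by rewrite mulr_ge0.
  have kE : 0 <= kap * E by rewrite mulr_ge0.
  rewrite /K in mK mKX *; move: (m / _) mK mKX => z z0; nra.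
pose X := M0 * expR (K * B).
have X0 : 0 <= X by rewrite mulr_ge0 // expR_ge0.
have step' n r : `|fn n.+1 r - fn n r| <= X / 2 ^+ n.
  apply: (le_trans (step n r)); rewrite /X mulrAC ler_wpM2r ?invr_ge0 ?exprn_ge0 //.
  by rewrite ler_wpM2l // ler_expR ler_pM2l.
have /choice [f Hf] : forall r, exists l, forall n, `|l - fn n r| <= 2 * X / 2 ^+ n.
  by move=> r; apply: geometric_limit => n; exact: step'.
have cf : continuous f by apply: uniform_limit_continuous_R cfn _ => n x; exact: Hf.
exists f; split => // r /andP[r0 rB].
apply/eqP; rewrite -subr_eq0; apply/eqP.
apply: (@pow2_eq0 _ (2 * X + kap * (2 * E * (2 * X) * B))) => n.
have h1 := Hf r n.+1.
have cd : continuous (fun t => fn n t - f t).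
  by apply: ctP => t; apply: ct_add; [exact: cfn|apply: ct_opp; exact: cf].
have h2 := @volterra_op_linear_bound _ (2 * X / 2 ^+ n) r cd.
have {}h2 : `|volterra_op (fun t => fn n t - f t) (clamp r)| <= 2 * E * (2 * X / 2 ^+ n) * clamp r.
  by apply: h2 => t _; rewrite distrC; exact: Hf.
have -> : f r - (c0 + kap * volterra_op f r) = f r - fn n.+1 r + kap * volterra_op (fun t => fn n t - f t) (clamp r).
  by rewrite (volterra_op_sub _ (cfn n) cf) /= clamp_id //; ring.
apply: (le_trans (ler_normD _ _)); rewrite mulrDl; apply: lerD.
  apply: (le_trans h1); rewrite exprSr invfM mulrA.
  rewrite ler_pdivrMr // ler_peMr ?ler1n //.
  by apply: divr_ge0; [rewrite mulr_ge0|rewrite exprn_ge0].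
rewrite normrM (ger0_norm kap0) -mulrA; apply: ler_wpM2l => //.
apply: (le_trans h2).
have -> : 2 * E * (2 * X) * B / 2 ^+ n = 2 * E * (2 * X / 2 ^+ n) * B by ring.
apply: ler_wpM2l => //; apply: mulr_ge0; first by rewrite mulr_ge0.
by apply: divr_ge0; [rewrite mulr_ge0|rewrite exprn_ge0].
Qed.

End Volterra.

Section DerivativeHelpers.
Variable R : realType.

Lemma is_derive_const (c x : R) : is_derive x 1 (fun=> c) 0.
Proof. exact: is_derive_cst. Qed.

Lemma is_derive_scale (c x d : R) (f : R -> R) : is_derive x 1 f d ->
  is_derive x 1 (fun y => c * f y) (c * d).
Proof.
move=> df; apply: is_derive_change (is_derive_mul (is_derive_const c x) df) _.
by rewrite mul0r add0r.
Qed.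

Lemma is_derive_ident (x : R) : is_derive x 1 (fun y : R => y) 1.
Proof. exact: is_derive_id. Qed.

End DerivativeHelpers.

Section SphereEigenvalue.
Variable R : realType.

Definition lam (n : nat) : R := n%:R * (n%:R + 1).

Lemma lam_ge0 n : 0 <= lam n.
Proof. by rewrite /lam mulr_ge0 // addr_ge0. Qed.

Lemma lam_lt n m : (n < m)%N -> lam n < lam m.
Proof.
move=> nm; rewrite /lam.
have h : n%:R + 1 <= m%:R :> R by rewrite natr1 ler_nat.
by have n0 : 0 <= n%:R :> R by []; nra.
Qed.

End SphereEigenvalue.

(** * The radial solution regular at the center *)

Section RegularSolution.
Variables (R : realType) (B E : R) (H eta : R -> R) (k : nat).
Implicit Types (r t : R).
Hypotheses (B0 : 0 < B) (ceta : continuous eta) (etaE : forall t, `|eta t| <= E).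
Hypothesis Hpos : forall r, 0 < r < B -> 0 < H r.
Hypothesis Heta : forall r, 0 < r < B -> r ^+ 2 / H r ^+ 2 = 1 + r * eta r.

(* The indicial exponents at [r = 0] are [k] and [- k - 1].  Writing [a = r^k al]
   and [H^2 a' = r^(k+1) be] turns the equation into a Volterra equation for [be]. *)
Lemma regular_solution : exists (a P al dal : R -> R) (C : R), 0 <= C /\
  forall r : R, 0 < r < B ->
    [/\ is_derive r 1 a (P r / H r ^+ 2), is_derive r 1 P (lam R k * a r),
        a r = r ^+ k * al r, is_derive r 1 al (dal r)
      & [/\ `|r * dal r| <= C, `|al r - 1| <= C * r & `|P r| <= C * r ^+ k.+1]].
Proof.
pose N := k.*2.+1; have NE : N%:R = 2 * k%:R + 1 :> R by rewrite /N -natr1 -muln2 natrM mulrC.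
have N0 : 0 < N%:R :> R by [].
pose kap : R := k%:R * (k%:R + 1) / N%:R.
have kap0 : 0 <= kap by rewrite divr_ge0 ?lam_ge0.
have [f [cf Hf]] := volterra_solution N (k%:R) ceta etaE B0 kap0.
pose g t := eta t * f t; pose gN t := t ^+ N * (eta t * f t).
have cg : continuous g by apply: ctP => t; apply: ct_mul; [exact: ceta|exact: cf].
have cgN : continuous gN by apply: ctP => t; apply: ct_mul; [apply: ct_exp; exact: cvg_id|exact: cg].
pose Q r := prim gN r / r ^+ N.
have fE r : 0 < r < B -> f r = k%:R + kap * (prim g r - Q r).
  by move=> /andP[r0 rB]; rewrite Hf ?ltW // /volterra_op r0.
have dG1 r : 0 < r -> is_derive r 1 (prim g) (g r) by move=> r0; apply: is_derive_prim => //; lra.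
have dQ r : 0 < r -> is_derive r 1 Q (g r - N%:R * Q r / r).
  move=> r0; have rN : r ^+ N != 0 by rewrite expf_neq0 // gt_eqF.
  have d1 : is_derive r 1 (prim gN) (gN r) by apply: is_derive_prim => //; lra.
  apply: is_derive_change (is_derive_mul d1 (@is_derive_inv R (fun y : R => y ^+ N) r _ rN (is_derive_pow N r))) _.
  have -> : N.-1 = k.*2 by [].
  have e : r ^+ N = r * r ^+ k.*2 by rewrite exprS.
  rewrite /gN -/(g r) /Q e; field.
  by rewrite expf_neq0 ?gt_eqF.
(* The pair [y = (al, f)], with [f] in the role of [be], solves [r y' = A y + (r g, 0)], where [A]
   has the eigenvector [(1, k)] for 0 and [(1, - (k + 1))] for [- N]. The free part is [(1, k)]. The
   vector [(1, 0)] splits along the eigenvectors with weights [(k + 1) / N] and [k / N], which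
   multiply [prim g] and [Q]; the second component explains [kap]. *)
pose al r := 1 + (k%:R + 1) / N%:R * prim g r + k%:R / N%:R * Q r.
pose dal r := g r - k%:R * Q r / r.
have dal_al r : 0 < r -> is_derive r 1 al (dal r).
  move=> r0; apply: is_derive_change (is_derive_add (is_derive_add (is_derive_const 1 r)
    (is_derive_scale ((k%:R + 1) / N%:R) (dG1 r r0)))
    (is_derive_scale (k%:R / N%:R) (dQ r r0))) _.
  rewrite /dal NE; field; rewrite gt_eqF //= gt_eqF //.
have df r : 0 < r < B -> is_derive r 1 f (k%:R * (k%:R + 1) * Q r / r).
  move=> /andP[r0 rB].
  apply: (@is_derive_ext _ (fun r => k%:R + kap * (prim g r - Q r))).
    near=> y; rewrite fE //; apply/andP; split; near: y; [exact: lt_nbhsr|exact: lt_nbhsl].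
  apply: is_derive_change (is_derive_add (is_derive_const k%:R r)
    (is_derive_scale kap (is_derive_add (dG1 r r0) (is_derive_opp (dQ r r0))))) _.
  by rewrite /kap; field; rewrite !gt_eqF.
have kal r : 0 < r < B -> k%:R * al r = f r + k%:R * Q r.
  move=> rB; rewrite fE // /al /kap NE; field.
  by rewrite -NE gt_eqF.
(* At [k = 0] the exponent [k.-1] is 0 instead of [-1]; the factor [k] makes the formula right all
   the same. *)
have powpred r : 0 < r -> k%:R * r ^+ k.-1 = k%:R * r ^+ k / r.
  move=> r0; case: (k) => [|n]; first by rewrite !mul0r.
  by rewrite exprS; field; rewrite gt_eqF.
pose a r := r ^+ k * al r; pose P r := r ^+ k.+1 * f r.
have [M [M0 HM]] : exists M : R, 0 <= M /\ forall t, 0 <= t <= B -> `|f t| <= M.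
  have cn : {within `[0, B], continuous (fun t => `|f t|)}.
    by apply: continuous_subspaceT => t; apply: continuous_comp; [exact: cf|exact: norm_continuous].
  have [c _ Hc] := EVT_max (ltW B0) cn.
  by exists `|f c|; split => // t tB; apply: Hc; rewrite in_itv.
have E0 : 0 <= E by exact: le_trans (normr_ge0 _) (etaE 0).
have EM0 : 0 <= E * M by rewrite mulr_ge0.
have gb t : 0 <= t <= B -> `|g t| <= E * M by move=> tB; rewrite normrM ler_pM // HM.
have G1b r : 0 < r < B -> `|prim g r| <= E * M * r.
  move=> /andP[r0 rB]; have -> : E * M * r = E * M * r - E * M * 0 by ring.
  apply: (@prim_bound _ _ (fun t => E * M * t) (fun=> E * M)) => //; first exact: ltW.
    move=> t _; apply: is_derive_change (is_derive_scale (E * M) (is_derive_ident t)) _.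
    exact: mulr1.
  by move=> t /andP[t0 tr]; apply: gb; rewrite t0 (le_trans tr) // ltW.
have Qb r : 0 < r < B -> `|Q r| <= E * M * r.
  move=> /andP[r0 rB]; have rN : 0 < r ^+ N by rewrite exprn_gt0.
  rewrite /Q normrM normfV (gtr0_norm rN) ler_pdivrMr //.
  have -> : E * M * r * r ^+ N = (r ^+ N * (E * M)) * r - (r ^+ N * (E * M)) * 0 by ring.
  apply: (@prim_bound _ _ (fun t => (r ^+ N * (E * M)) * t) (fun=> r ^+ N * (E * M))) => //; first exact: ltW.
    move=> t _; apply: is_derive_change (is_derive_scale (r ^+ N * (E * M)) (is_derive_ident t)) _.
    exact: mulr1.
  move=> t /andP[t0 tr]; rewrite /gN normrM normrX (ger0_norm t0).
  apply: ler_pM; rewrite ?exprn_ge0 //; first by rewrite lerXn2r // nnegrE // ltW.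
  by apply: gb; rewrite t0 (le_trans tr) // ltW.
pose C := M + E * M + (1 + k%:R) * (E * M) * B.
have k0 : 0 <= k%:R :> R by [].
have C1 : E * M <= C.
  by rewrite /C addrAC lerDr addr_ge0 // !mulr_ge0 ?addr_ge0 // ltW.
have C2 : (1 + k%:R) * (E * M) * B <= C by rewrite /C lerDr addr_ge0.
have C3 : M <= C by rewrite /C -addrA lerDl addr_ge0 // !mulr_ge0 ?addr_ge0 // ltW.
exists a, P, al, dal, C; split; first exact: le_trans M0 C3.
move=> r rB; have /andP[r0 rltB] := rB; have rn0 : r != 0 by rewrite gt_eqF.
split.
- apply: is_derive_change (is_derive_mul (is_derive_pow k r) (dal_al r r0)) _.
  have -> : P r / H r ^+ 2 = r ^+ k / r * f r * (r ^+ 2 / H r ^+ 2).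
    by rewrite /P exprSr; field; rewrite rn0 gt_eqF // Hpos.
  rewrite Heta // powpred //.
  have -> : k%:R * r ^+ k / r * al r = r ^+ k / r * (k%:R * al r) by ring.
  by rewrite kal // /dal /g; field.
- apply: is_derive_change (is_derive_mul (is_derive_pow k.+1 r) (df r rB)) _.
  rewrite /lam /a /= -natr1 exprSr.
  have -> : k%:R * (k%:R + 1) * (r ^+ k * al r) = (k%:R + 1) * r ^+ k * (k%:R * al r) by ring.
  by rewrite kal //; field.
- by [].
- exact: dal_al.
split.
- have -> : r * dal r = r * g r - k%:R * Q r by rewrite /dal; field.
  apply: (le_trans (ler_normB _ _)).
  rewrite (normrM r) (normrM k%:R) (gtr0_norm r0) (ger0_norm k0).
  apply: le_trans C2; have h1 := gb r; have h2 := Qb r rB.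
  have {}h1 : `|g r| <= E * M by apply: h1; rewrite !ltW.
  have h3 : r * `|g r| <= r * (E * M) by rewrite ler_wpM2l // ltW.
  have h4 : k%:R * `|Q r| <= k%:R * (E * M * r) by rewrite ler_wpM2l.
  have h5 : (1 + k%:R) * (E * M) * r <= (1 + k%:R) * (E * M) * B.
    by rewrite ler_wpM2l ?mulr_ge0 ?addr_ge0 // ltW.
  apply: le_trans h5; have -> : (1 + k%:R) * (E * M) * r = r * (E * M) + k%:R * (E * M * r) by ring.
  exact: lerD.
- have -> : al r - 1 = (k%:R + 1) / N%:R * prim g r + k%:R / N%:R * Q r by rewrite /al; ring.
  apply: (le_trans (ler_normD _ _)); rewrite (normrM (_ / _)) (normrM (k%:R / _)).
  rewrite (@ger0_norm _ ((k%:R + 1) / _)) ?divr_ge0 ?addr_ge0 //.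
  rewrite (@ger0_norm _ (k%:R / _)) ?divr_ge0 //.
  have w1 : 0 <= (k%:R + 1) / N%:R :> R by rewrite divr_ge0 ?addr_ge0.
  have w2 : 0 <= k%:R / N%:R :> R by rewrite divr_ge0.
  have := ler_wpM2l w1 (G1b r rB); have := ler_wpM2l w2 (Qb r rB) => h1 h2.
  apply: (le_trans (lerD h2 h1)).
  have -> : (k%:R + 1) / N%:R * (E * M * r) + k%:R / N%:R * (E * M * r) = E * M * r.
    by rewrite NE; field; rewrite -NE gt_eqF.
  by rewrite ler_wpM2r // ltW.
- rewrite /P normrM normrX (gtr0_norm r0) mulrC; apply: ler_wpM2r; first by rewrite exprn_ge0 // ltW.
  by apply: le_trans C3; apply: HM; rewrite !ltW.
Unshelve. all: by end_near. Qed.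

End RegularSolution.

(** * The radial equation *)

Section RadialEquation.
Variables (R : realType) (H : R -> R).
Implicit Types (a P m f df : R -> R) (r s B L la : R).

(* [P] stands for [H^2 a'], so that this is [(H^2 a')' = la a]. *)
Definition radial_solution B la a P : Prop := forall r, 0 < r < B ->
  is_derive r 1 a (P r / H r ^+ 2) /\ is_derive r 1 P (la * a r).

(** What is retained of the regular solution near 0. The last bound makes the Riccati variable
    [P / a] small even when [a] itself tends to 0. *)
Definition regular_at0 a P : Prop := exists d C : R, [/\ 0 < d, 0 <= C &
  forall r, 0 < r < d -> [/\ 0 < a r, a r <= 2, `|P r| <= C * r & `|P r| <= C * r * a r]].

Definition small_at0 f : Prop := exists d C : R, [/\ 0 < d, 0 <= C &
  forall r, 0 < r < d -> `|f r| <= C * r].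

Lemma small_at0_lower f r e : small_at0 f -> 0 < r -> 0 < e -> exists s, [/\ 0 < s, s < r & `|f s| <= e].
Proof.
move=> [d [C [d0 C0 Hf]]] r0 e0.
have C1 : 0 < C + 1 by rewrite ltr_wpDl.
pose s := Num.min (Num.min (r / 2) (d / 2)) (e / (C + 1)).
have s0 : 0 < s by rewrite !lt_min !divr_gt0.
have sr : s <= r / 2 by rewrite /s !ge_min lexx.
have sd : s <= d / 2 by rewrite /s !ge_min lexx orbT.
have se : s <= e / (C + 1) by rewrite /s ge_min lexx orbT.
exists s; split => //; first by lra.
have sd' : 0 < s < d by rewrite s0; lra.
apply: (le_trans (Hf s sd')); move: se; rewrite ler_pdivlMr // => se.
by apply: le_trans se; rewrite mulrC ler_wpM2l ?(ltW s0) // lerDl.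
Qed.

(** The smallness of [f] at arbitrarily small radii takes the place of an initial value at 0, where
    the equation is singular. *)
Lemma grow_from0 B f df : small_at0 f ->
  (forall r, 0 < r < B -> is_derive r 1 f (df r)) -> (forall r, 0 < r < B -> 0 <= df r) ->
  forall r, 0 < r < B -> 0 <= f r.
Proof.
move=> sf dF df0 r /andP[r0 rB]; rewrite leNgt; apply/negP => fr.
have fr2 : 0 < - f r / 2 by lra.
have [s [s0 sr Hs]] := small_at0_lower sf r0 fr2.
have := @le_of_derive_cc R f df s r (ltW sr).
have h t : s <= t <= r -> 0 < t < B.
  by move=> /andP[t1 t2]; rewrite (lt_le_trans s0 t1) (le_lt_trans t2 rB).
move=> /(_ (fun t ht => dF t (h t ht)) (fun t ht => df0 t (h t ht))).
by move: Hs; rewrite ler_norml => /andP[]; lra.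
Qed.

Lemma grow_from0_strict B f df : small_at0 f ->
  (forall r, 0 < r < B -> is_derive r 1 f (df r)) -> (forall r, 0 < r < B -> 0 < df r) ->
  forall r, 0 < r < B -> 0 < f r.
Proof.
move=> sf dF df0 r /andP[r0 rB].
have h t : r / 2 <= t <= r -> 0 < t < B.
  by move=> /andP[t1 t2]; rewrite (le_lt_trans t2 rB) andbT; lra.
have h2 : 0 < r / 2 < B by apply: h; lra.
apply: (@le_lt_trans _ _ (f (r / 2))).
  by apply: (grow_from0 sf dF) h2 => t tB; exact/ltW/df0.
apply: (@lt_of_derive_cc R f df (r / 2) r); first by lra.
- by move=> t /h; exact: dF.
- by move=> t /h; exact: df0.
Qed.

Lemma small_at0D f g : small_at0 f -> small_at0 g -> small_at0 (fun r => f r + g r).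
Proof.
move=> [d [C [d0 C0 Hf]]] [d' [C' [d'0 C'0 Hg]]]; exists (Num.min d d'), (C + C'); split.
- by rewrite lt_min d0.
- exact: addr_ge0.
- move=> r; rewrite lt_min => /andP[r0 /andP[rd rd']]; apply: (le_trans (ler_normD _ _)).
  by rewrite mulrDl; apply: lerD; [apply: Hf|apply: Hg]; rewrite r0.
Qed.

Lemma small_at0Z f c : small_at0 f -> small_at0 (fun r => c * f r).
Proof.
move=> [d [C [d0 C0 Hf]]]; exists d, (`|c| * C); split => //; first by rewrite mulr_ge0.
by move=> r rd; rewrite normrM -mulrA ler_wpM2l // Hf.
Qed.

Lemma small_at0N f : small_at0 f -> small_at0 (fun r => - f r).
Proof. by move=> [d [C [d0 C0 Hf]]]; exists d, C; split => // r rd; rewrite normrN Hf. Qed.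

Lemma small_at0_id : small_at0 (fun r => r).
Proof. by exists 1, 1; split => // r /andP[r0 _]; rewrite mul1r gtr0_norm. Qed.

Lemma small_at0_prod a P a' P' : regular_at0 a P -> regular_at0 a' P' ->
  small_at0 (fun r => P r * a' r).
Proof.
move=> [d [C [d0 C0 Hf]]] [d' [C' [d'0 C'0 Hg]]]; exists (Num.min d d'), (C * 2); split.
- by rewrite lt_min d0.
- exact: mulr_ge0.
- move=> r; rewrite lt_min => /andP[r0 /andP[rd rd']].
  have [_ _ h _] := Hf r (introT andP (conj r0 rd)).
  have [h1 h2 _ _] := Hg r (introT andP (conj r0 rd')).
  by rewrite normrM (gtr0_norm h1) mulrAC; apply: ler_pM => //; exact: ltW.
Qed.

Lemma small_at0_quot a P : regular_at0 a P -> small_at0 (fun r => P r / a r).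
Proof.
move=> [d [C [d0 C0 Hf]]]; exists d, C; split => // r rd; have [h1 _ _ h] := Hf r rd.
by rewrite normrM normfV (gtr0_norm h1) ler_pdivrMr.
Qed.

Section Positivity.
Variables (B la : R) (a P : R -> R).
Hypotheses (la0 : 0 <= la) (sol : radial_solution B la a P) (reg : regular_at0 a P).
Hypothesis Hpos : forall r, 0 < r < B -> 0 < H r.

(** [P a] grows from 0, so [(a^2)' = 2 P a / H^2] is nonnegative and [a^2] stays above a positive
    value taken near 0; a change of sign of [a] would need a zero. *)
Lemma regular_solution_gt0 r : 0 < r < B -> 0 < a r.
Proof.
move=> rB; have F0 : forall s, 0 < s < B -> 0 <= P s * a s.
  apply: (@grow_from0 B (fun s => P s * a s) (fun s => la * a s * a s + P s * (P s / H s ^+ 2))).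
  - exact: (small_at0_prod reg reg).
  - by move=> t tB; have [d1 d2] := sol tB; exact: is_derive_mul.
  - move=> t tB; apply: addr_ge0; first by rewrite -mulrA mulr_ge0 // -expr2 sqr_ge0.
    by rewrite mulrA divr_ge0 ?sqr_ge0 // -expr2 sqr_ge0.
have [d [C [d0 _ Hd]]] := reg; have /andP[r0 rltB] := rB.
pose s := Num.min (d / 2) (r / 2).
have s0 : 0 < s by rewrite lt_min !divr_gt0.
have sr : s < r by apply: (@le_lt_trans _ _ (r / 2)); [rewrite ge_min lexx orbT|lra].
have sd : s < d by apply: (@le_lt_trans _ _ (d / 2)); [rewrite ge_min lexx|lra].
have [as0 _ _ _] : [/\ 0 < a s, a s <= 2, `|P s| <= C * s & `|P s| <= C * s * a s].
  by apply: Hd; rewrite s0.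
have sub t : s <= t <= r -> 0 < t < B.
  by move=> /andP[t1 t2]; rewrite (lt_le_trans s0 t1) (le_lt_trans t2 rltB).
have sq t : s <= t <= r -> a s * a s <= a t * a t.
  move=> /andP[st tr].
  apply: (@le_of_derive_cc R (fun u => a u * a u)
    (fun u => P u / H u ^+ 2 * a u + a u * (P u / H u ^+ 2))) => //.
  - move=> u /andP[u1 u2]; have [d1 _] := sol (sub u ltac:(by rewrite u1 (le_trans u2))).
    exact: is_derive_mul.
  - move=> u /andP[u1 u2]; have uB := sub u ltac:(by rewrite u1 (le_trans u2)).
    have -> : P u / H u ^+ 2 * a u + a u * (P u / H u ^+ 2) = 2 * (P u * a u) / H u ^+ 2 by ring.
    by rewrite divr_ge0 ?sqr_ge0 // mulr_ge0 // F0.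
rewrite ltNge; apply/negP => ar.
have ca : {within `[s, r], continuous a}.
  by apply: (@within_of_derive R a (fun u => P u / H u ^+ 2)) => t /sub tB; case: (sol tB).
have [|c] := IVT (v := 0) (ltW sr) ca.
  by rewrite ge_min le_max ar (ltW as0) orbT.
rewrite in_itv /= => csr ac; have := sq c csr; rewrite ac mulr0.
by rewrite leNgt mulr_gt0.
Qed.

Lemma regular_momentum_ge0 r : 0 < r < B -> 0 <= P r.
Proof.
apply: (@grow_from0 B P (fun r => la * a r)).
- by have [d [C [d0 C0 Hd]]] := reg; exists d, C; split => // s sd; case: (Hd s sd).
- by move=> s sB; case: (sol sB).
- by move=> s sB; rewrite mulr_ge0 // ltW // regular_solution_gt0.
Qed.

Lemma is_derive_riccati r : 0 < r < B ->
  is_derive r 1 (fun r => P r / a r) (la - (P r / a r) ^+ 2 / H r ^+ 2).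
Proof.
move=> rB; have [d1 d2] := sol rB; have ar := regular_solution_gt0 rB.
have a0 : a r != 0 by rewrite gt_eqF.
apply: is_derive_change (is_derive_mul d2 (is_derive_inv a0 d1)) _.
by field; rewrite a0 gt_eqF // Hpos.
Qed.

Lemma riccati_le r : 0 < r < B -> P r / a r <= la * r.
Proof.
move=> rB; rewrite -subr_ge0; move: r rB.
apply: (@grow_from0 B (fun r => la * r - P r / a r) (fun r => (P r / a r) ^+ 2 / H r ^+ 2)).
- apply: small_at0D; first by apply: small_at0Z; exact: small_at0_id.
  exact/small_at0N/small_at0_quot.
- move=> r rB; apply: is_derive_change (is_derive_add (is_derive_scale la (is_derive_ident r))
    (is_derive_opp (is_derive_riccati rB))) _.
  by rewrite mulr1 opprB addrC subrK.
- by move=> r _; rewrite divr_ge0 ?sqr_ge0.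
Qed.

End Positivity.

(** * Comparison of the Riccati variables of two eigenvalues *)

Section Gap.
Variables (B la1 la2 : R) (a1 P1 a2 P2 : R -> R).
Hypotheses (la10 : 0 <= la1) (la12 : la1 < la2).
Hypotheses (sol1 : radial_solution B la1 a1 P1) (reg1 : regular_at0 a1 P1).
Hypotheses (sol2 : radial_solution B la2 a2 P2) (reg2 : regular_at0 a2 P2).
Hypothesis Hpos : forall r, 0 < r < B -> 0 < H r.

Let la20 : 0 <= la2. Proof. exact: le_trans la10 (ltW la12). Qed.
Let pos1 r (rB : 0 < r < B) : 0 < a1 r := regular_solution_gt0 la10 sol1 reg1 rB.
Let pos2 r (rB : 0 < r < B) : 0 < a2 r := regular_solution_gt0 la20 sol2 reg2 rB.

Let D r := P2 r / a2 r - P1 r / a1 r.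

Let dD r : 0 < r < B -> is_derive r 1 D
  (la2 - (P2 r / a2 r) ^+ 2 / H r ^+ 2 - (la1 - (P1 r / a1 r) ^+ 2 / H r ^+ 2)).
Proof.
by move=> rB; apply: is_derive_add; [|apply: is_derive_opp]; exact: is_derive_riccati rB.
Qed.

Let smallD : small_at0 D.
Proof. by apply: small_at0D; [|apply: small_at0N]; exact: small_at0_quot. Qed.

(** The numerator [P2 a1 - P1 a2] is a Wronskian: the terms in [1 / H^2] cancel in its derivative,
    which is [(la2 - la1) a1 a2]. *)
Lemma gap_gt0 r : 0 < r < B -> 0 < P2 r / a2 r - P1 r / a1 r.
Proof.
move=> rB; have a1r := pos1 rB; have a2r := pos2 rB.
have -> : P2 r / a2 r - P1 r / a1 r = (P2 r * a1 r - P1 r * a2 r) / (a1 r * a2 r).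
  by field; rewrite !gt_eqF.
apply: divr_gt0; last exact: mulr_gt0.
move: r rB {a1r a2r}.
apply: (@grow_from0_strict B (fun r => P2 r * a1 r - P1 r * a2 r) (fun r => (la2 - la1) * (a1 r * a2 r))).
- apply: small_at0D; first exact: (small_at0_prod reg2 reg1).
  by apply: small_at0N; exact: (small_at0_prod reg1 reg2).
- move=> r rB; have [d1 e1] := sol1 rB; have [d2 e2] := sol2 rB.
  apply: is_derive_change (is_derive_add (is_derive_mul e2 d1) (is_derive_opp (is_derive_mul e1 d2))) _.
  by ring.
- by move=> r rB; rewrite !mulr_gt0 ?subr_gt0 ?pos1 ?pos2.
Qed.

Lemma gap_lt r : 0 < r < B -> P2 r / a2 r - P1 r / a1 r < (la2 - la1) * r.
Proof.
move=> rB; rewrite -subr_gt0; move: r rB.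
apply: (@grow_from0_strict B (fun r => (la2 - la1) * r - D r) (fun r => ((P2 r / a2 r) ^+ 2 - (P1 r / a1 r) ^+ 2) / H r ^+ 2)).
- apply: small_at0D; first by apply: small_at0Z; exact: small_at0_id.
  exact: small_at0N.
- move=> r rB; apply: is_derive_change (is_derive_add
    (is_derive_scale (la2 - la1) (is_derive_ident r)) (is_derive_opp (dD rB))) _.
  by ring.
- move=> r rB; have := gap_gt0 rB; have Hr := Hpos rB.
  have w1 : 0 <= P1 r / a1 r.
    by rewrite divr_ge0 ?(ltW (pos1 rB)) // (regular_momentum_ge0 la10 sol1 reg1).
  move: (P2 r / _) (P1 r / _) w1 => w2 w1 w10 w12.
  by apply: divr_gt0; [nra|rewrite exprn_gt0].
Qed.

(** [G] is a primitive of a majorant of [la2^2 s^2 / H^2], which dominates the loss [w2^2 / H^2]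
    because [w2 <= la2 s]. Leaving [G] free lets an explicit rational function be inserted later. *)
Lemma gap_lower G dG r : small_at0 G ->
  (forall s, 0 < s < B -> is_derive s 1 G (dG s)) ->
  (forall s, 0 < s < B -> la2 ^+ 2 * (s ^+ 2 / H s ^+ 2) <= dG s) ->
  0 < r < B -> (la2 - la1) * r - G r <= P2 r / a2 r - P1 r / a1 r.
Proof.
move=> sG dGG HG rB; rewrite -subr_ge0; move: r rB.
apply: (@grow_from0 B (fun r => D r - ((la2 - la1) * r - G r)) (fun r => dG r - ((P2 r / a2 r) ^+ 2 - (P1 r / a1 r) ^+ 2) / H r ^+ 2)).
- apply: small_at0D => //; apply: small_at0N; apply: small_at0D; last exact: small_at0N.
  by apply: small_at0Z; exact: small_at0_id.
- move=> r rB; apply: is_derive_change (is_derive_add (dD rB) (is_derive_opp (is_derive_add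
    (is_derive_scale (la2 - la1) (is_derive_ident r)) (is_derive_opp (dGG r rB))))) _.
  by ring.
- move=> r rB; rewrite subr_ge0; apply: le_trans (HG r rB).
  have Hr : 0 < H r ^+ 2 by rewrite exprn_gt0 // Hpos.
  rewrite mulrA; apply: ler_wpM2r; first by rewrite invr_ge0 ltW.
  have w2 := riccati_le la20 sol2 reg2 Hpos rB.
  have w20 : 0 <= P2 r / a2 r.
    by rewrite divr_ge0 ?(ltW (pos2 rB)) // (regular_momentum_ge0 la20 sol2 reg2).
  apply: (@le_trans _ _ ((P2 r / a2 r) ^+ 2)); first by rewrite lerBlDr lerDl sqr_ge0.
  by rewrite -exprMn lerXn2r // nnegrE (le_trans w20).
Qed.

End Gap.

(** * Radial solutions of finite energy *)

Section FiniteEnergy.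
Variables (L la kap kap0 D : R) (m P : R -> R).
Hypotheses (L0 : 0 < L) (la0 : 0 <= la) (kap00 : 0 < kap0).
Hypothesis sol : radial_solution L la m P.
Hypothesis Hpos : forall r, 0 < r < L -> 0 < H r.
Hypothesis Hkap : forall r, 0 < r < L -> kap0 <= r ^+ 2 / H r ^+ 2 <= kap.
(* States [\int_0^L P^2 / H^2 <= D] without mentioning integrals. *)
Hypothesis energy : forall (r s : R) (phi dphi : R -> R), 0 < r -> r < s -> s < L ->
  (forall t, r <= t <= s -> is_derive t 1 phi (dphi t)) ->
  (forall t, r <= t <= s -> dphi t <= P t ^+ 2 / H t ^+ 2) -> phi s - phi r <= D.

Let F r := P r * m r.
Let dF r := la * m r * m r + P r * (P r / H r ^+ 2).

Let dFE r : 0 < r < L -> is_derive r 1 F (dF r).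
Proof. by move=> rL; have [d1 d2] := sol rL; exact: is_derive_mul. Qed.

Let dF0 r : 0 <= dF r.
Proof.
apply: addr_ge0; first by rewrite -mulrA mulr_ge0 // -expr2 sqr_ge0.
by rewrite mulrA divr_ge0 ?sqr_ge0 // -expr2 sqr_ge0.
Qed.

Let sub_itv r s t : 0 < r -> s < L -> r <= t <= s -> 0 < t < L.
Proof. by move=> r0 sL /andP[rt ts]; rewrite (lt_le_trans r0 rt) (le_lt_trans ts sL). Qed.

Let F_le r s : 0 < r -> r <= s -> s < L -> F r <= F s.
Proof.
move=> r0 rs sL; apply: (@le_of_derive_cc R F dF) => //.
by move=> t /(sub_itv r0 sL); exact: dFE.
Qed.

(* If [P m <= - c < 0] near 0 then [m^2] is at least of order [c / r], which is
   the behaviour of the solution of infinite energy. *)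
Lemma finite_energy_ge0 r : 0 < r < L -> 0 <= P r * m r.
Proof.
move=> /andP[r0 rL]; rewrite -/(F r) leNgt; apply/negP => Fr.
pose c := - F r; have c0 : 0 < c by rewrite oppr_gt0.
have kap_gt0 : 0 < kap.
  have h : 0 < r < L by rewrite r0.
  by have /andP[k1 k2] := Hkap h; exact: lt_le_trans kap00 (le_trans k1 k2).
(* This choice gives [th^2 kap = th / 2]. Expanding [(P + th t m)^2 / H^2 >= 0] then bounds
   [P^2 / H^2] below by the derivative of [q ln t - th / 2 t m^2]. The logarithm is unbounded at 0,
   and [T = ln (r / s)] is large enough for the increment of this function to exceed [D]. *)
pose th := (2 * kap)^-1; have th0 : 0 < th by rewrite invr_gt0 mulr_gt0.
pose q := th * c * kap0; have q0 : 0 < q by rewrite !mulr_gt0.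
pose T := (`|D| + th / 2 * r * (m r * m r) + 1) / q.
have sq0 t : 0 <= m t * m t by rewrite -expr2 sqr_ge0.
have th20 : 0 < th / 2 by exact: divr_gt0.
have X0 : 0 <= th / 2 * r * (m r * m r) by rewrite mulr_ge0 // mulr_ge0 // ltW.
have T0 : 0 < T by rewrite divr_gt0 // ltr_wpDl // addr_ge0.
pose s := r * expR (- T).
have s0 : 0 < s by rewrite mulr_gt0 // expR_gt0.
have sr : s < r by rewrite /s gtr_pMr // -[ltRHS]expR0 ltr_expR oppr_lt0.
pose phi t := q * ln t - th / 2 * (t * (m t * m t)).
pose dm t := P t / H t ^+ 2.
pose dphi t := q / t - th / 2 * (m t * m t + t * (dm t * m t + m t * dm t)).
have := energy (phi := phi) (dphi := dphi) s0 sr rL.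
have h1 t : s <= t <= r -> is_derive t 1 phi (dphi t).
  move=> tsr; have tL := sub_itv s0 rL tsr; have /andP[t0 _] := tL.
  have [d1 _] := sol tL; have dl := is_derive1_ln t0.
  apply: is_derive_change (is_derive_add (is_derive_scale q dl) (is_derive_opp
    (is_derive_scale (th / 2) (is_derive_mul (is_derive_ident t) (is_derive_mul d1 d1))))) _.
  by rewrite mul1r.
have h2 t : s <= t <= r -> dphi t <= P t ^+ 2 / H t ^+ 2.
  move=> tsr; have tL := sub_itv s0 rL tsr; have /andP[t0 _] := tL.
  have Ht := Hpos tL; have /andP[k1 k2] := Hkap tL.
  have Ftc : P t * m t <= - c.
    by rewrite /c opprK; case/andP: tsr => st tr; apply: F_le => //; exact: lt_le_trans s0 st.
  pose h := (H t ^+ 2)^-1; have h0 : 0 < h by rewrite invr_gt0 exprn_gt0.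
  have k1' : kap0 / t <= t * h.
    by rewrite ler_pdivrMr // mulrAC -expr2.
  have k2' : t * t * h <= kap by rewrite -expr2.
  have sq : 0 <= (P t + th * t * m t) ^+ 2 * h by rewrite mulr_ge0 ?sqr_ge0 // ltW.
  have a1 : th * t * h * (P t * m t) <= - (th * c) * (kap0 / t).
    apply: (@le_trans _ _ (th * t * h * - c)); first by rewrite ler_wpM2l // !mulr_ge0 // ltW.
    have -> : th * t * h * - c = - (th * c) * (t * h) by ring.
    by rewrite ler_wnM2l // oppr_le0 mulr_ge0 // ltW.
  have a2 : th ^+ 2 * (t * t * h) * (m t * m t) <= th / 2 * (m t * m t).
    apply: ler_wpM2r => //.
    have -> : th / 2 = th ^+ 2 * kap by rewrite /th; field; rewrite gt_eqF.
    by rewrite ler_wpM2l // sqr_ge0.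
  have -> : dphi t = th * c * (kap0 / t) - th / 2 * (m t * m t) - th * t * h * (P t * m t).
    by rewrite /dphi /dm /q -/h; field; rewrite gt_eqF.
  rewrite -/h; move: sq a1 a2; rewrite !expr2; move: (kap0 / t) => z; nra.
move=> /(_ h1 h2); rewrite /phi.
have -> : ln s = ln r - T by rewrite /s lnM ?posrE ?expR_gt0 // expRK.
have e1 : q * T = `|D| + th / 2 * r * (m r * m r) + 1 by rewrite /T; field; rewrite gt_eqF.
have e2 : 0 <= th / 2 * (s * (m s * m s)).
  by apply: mulr_ge0; [exact: ltW|apply: mulr_ge0; [exact: ltW|]].
have := ler_norm D.
have e3 : th / 2 * (r * (m r * m r)) = th / 2 * r * (m r * m r) by ring.
rewrite e3; have -> : q * (ln r - T) = q * ln r - q * T by rewrite mulrBr.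
rewrite e1; move: e2; move: (th / 2 * (s * _)) (th / 2 * r * (m r * m r)) (q * ln r) (`|D|).
by move=> u v w z; lra.
Qed.

(** [F = P m] is nonnegative, nondecreasing and arbitrarily small near [L], hence 0. Then
    [F' = la m^2 + P^2 / H^2] forces [P = 0], so [m] is constant, and being small near [L] it
    vanishes. *)
Lemma finite_energy_eq0 : 
  (forall r e, 0 < r < L -> 0 < e -> exists s, [/\ r < s, s < L, `|P s * m s| <= e & `|m s| <= e]) ->
  forall r, 0 < r < L -> m r = 0.
Proof.
move=> lim r rL.
have Fz t : 0 < t < L -> F t = 0.
  move=> tL; apply/le_anti; rewrite finite_energy_ge0 // andbT.
  rewrite leNgt; apply/negP => Ft.
  have Ft2 : 0 < F t / 2 by lra.
  have [s [ts sL h _]] := lim t _ tL Ft2.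
  have /andP[t0 _] := tL; have := F_le t0 (ltW ts) sL; have := ler_norm (P s * m s).
  by rewrite -/(F s) in h *; lra.
have Pz t : 0 < t < L -> P t = 0.
  move=> tL; have [_ e1] := dFE tL.
  have : dF t = 0.
    rewrite -e1 (@near_eq_derive _ _ _ _ (cst 0)) ?derive_cst //.
    have /andP[t0 tltL] := tL.
    near=> y; rewrite Fz //; apply/andP; split; near: y; [exact: lt_nbhsr|exact: lt_nbhsl].
  have Ht := Hpos tL; have h0 : 0 < (H t ^+ 2)^-1 by rewrite invr_gt0 exprn_gt0.
  rewrite /dF; have : 0 <= la * m t * m t by rewrite -mulrA mulr_ge0 // -expr2 sqr_ge0.
  have e2 : P t * (P t / H t ^+ 2) = P t ^+ 2 / H t ^+ 2 by rewrite mulrA.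
  rewrite e2 => g0 /eqP; rewrite paddr_eq0 ?divr_ge0 ?sqr_ge0 // => /andP[_].
  by rewrite mulf_eq0 sqrf_eq0 (gt_eqF h0) orbF => /eqP.
have mc s t : 0 < s -> s < t -> t < L -> m s = m t.
  move=> s0 st tL.
  have dm u : s <= u <= t -> is_derive u 1 m 0.
    by move=> /(sub_itv s0 tL) uL; have [+ _] := sol uL; rewrite Pz // mul0r.
  have h1 := le_of_derive_cc (ltW st) dm (fun _ _ => lexx _).
  have dmN u : s <= u <= t -> is_derive u 1 (fun x => - m x) 0.
    by move=> /dm h; rewrite -oppr0; exact: is_derive_opp.
  have h2 := le_of_derive_cc (ltW st) dmN (fun _ _ => lexx _).
  by apply/le_anti; rewrite h1 -lerN2.
apply/eqP; rewrite -normr_eq0; apply/eqP/le_anti; rewrite normr_ge0 andbT leNgt; apply/negP => mr.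
have mr2 : 0 < `|m r| / 2 by lra.
have [s [rs sL _ h]] := lim r _ rL mr2.
by have /andP[r0 _] := rL; rewrite -(mc r s) // in h; lra.
Unshelve. all: by end_near. Qed.

End FiniteEnergy.

End RadialEquation.

(** * The metric of revolution *)

Section Metric.
Variable R : realType.
Notation V := 'rV[R]_3.

Lemma det_mx33_nat (f : nat -> nat -> R) :
  \det (\matrix_(i < 3, j < 3) f i j) =
  f 0%N 0%N * (f 1%N 1%N * f 2%N 2%N - f 1%N 2%N * f 2%N 1%N)
  - f 0%N 1%N * (f 1%N 0%N * f 2%N 2%N - f 1%N 2%N * f 2%N 0%N)
  + f 0%N 2%N * (f 1%N 0%N * f 2%N 1%N - f 1%N 1%N * f 2%N 0%N).
Proof.
rewrite (expand_det_row _ ord0) !big_ord_recl big_ord0 /cofactor.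
rewrite !(expand_det_row _ ord0) !big_ord_recl !big_ord0 /cofactor !det_mx11 !mxE /=.
by rewrite /bump /= !addn0 !add0n; ring.
Qed.

Lemma det_mx33 (A : 'M[R]_3) : \det A =
  A 0 0 * (A 1 1 * A 2%:R 2%:R - A 1 2%:R * A 2%:R 1)
  - A 0 1 * (A 1 0 * A 2%:R 2%:R - A 1 2%:R * A 2%:R 0)
  + A 0 2%:R * (A 1 0 * A 2%:R 1 - A 1 1 * A 2%:R 0).
Proof.
have := det_mx33_nat (fun i j => A (inord i) (inord j)).
have -> : \matrix_(i < 3, j < 3) A (inord i) (inord j) = A.
  by apply/matrixP => i j; rewrite mxE !inord_val.
have -> : inord 0 = 0 :> 'I_3 by apply/val_inj; rewrite /= inordK.
have -> : inord 1 = 1 :> 'I_3 by apply/val_inj; rewrite /= inordK.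
by have -> : inord 2 = 2%:R :> 'I_3 by apply/val_inj; rewrite /= inordK.
Qed.

(* [a W + c (1 - W)], where [W] is the orthogonal projection onto the line of [w]. *)
Definition radial_mx (w : V) (a c : R) : 'M[R]_3 := a *: (w^T *m w) + c *: (1%:M - w^T *m w).

Lemma radial_mxE w a c i j : radial_mx w a c i j = a * (w 0 i * w 0 j) + c * ((i == j)%:R - w 0 i * w 0 j).
Proof. by rewrite !mxE big_ord1 !mxE. Qed.

(** [w^T *m w] is idempotent for a unit vector, so these matrices multiply like pairs of scalars. *)
Lemma mul_radial_mx w a c a' c' : sqn w = 1 ->
  radial_mx w a c *m radial_mx w a' c' = radial_mx w (a * a') (c * c').
Proof.
move=> w1; have WW : (w^T *m w) *m (w^T *m w) = w^T *m w.
  rewrite mulmxA -[w^T *m w *m w^T]mulmxA.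
  have -> : w *m w^T = 1%:M.
    apply/matrixP => i j; rewrite !ord1 !mxE eqxx /= -[RHS]w1 /sqn.
    by apply: eq_bigr => l _; rewrite mxE expr2.
  by rewrite mulmx1.
rewrite /radial_mx; move: (w^T *m w) WW => W WW.
rewrite mulmxDl !mulmxDr -!scalemxAl -!scalemxAr !mulmxBl !mulmxBr !mul1mx !mulmx1 WW.
have -> : W - W = 0 by apply/matrixP => i j; rewrite !mxE subrr.
by rewrite !scaler0 addr0 add0r subr0 !scalerA.
Qed.

Lemma radial_mx1 w : radial_mx w 1 1 = 1%:M.
Proof. by rewrite /radial_mx !scale1r addrC subrK. Qed.

Lemma invmx_radial_mx w c : sqn w = 1 -> c != 0 -> invmx (radial_mx w 1 c) = radial_mx w 1 c^-1.
Proof.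
move=> w1 c0; have h : radial_mx w 1 c^-1 *m radial_mx w 1 c = 1%:M.
  by rewrite mul_radial_mx // mulr1 mulVf // radial_mx1.
have [_ u] := mulmx1_unit h.
by rewrite -[RHS]mulmx1 -(mulmxV u) mulmxA h mul1mx.
Qed.

Lemma det_radial_mx w c : sqn w = 1 -> \det (radial_mx w 1 c) = c ^+ 2.
Proof.
rewrite /sqn sum3 det_mx33 !radial_mxE !eqxx /= => w1.
have e2 : w 0 2%:R ^+ 2 = 1 - w 0 0 ^+ 2 - w 0 1 ^+ 2 by rewrite -w1; ring.
move: (w 0 0) (w 0 1) (w 0 2%:R) w1 e2 => a b d w1 e2.
by ring: e2.
Qed.

Variables (L : R) (h : R -> R).

Let c (x : V) := (h (L - enorm x) / enorm x) ^+ 2.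

Lemma revolution_metricE x : revolution_metric L h x = radial_mx ((enorm x)^-1 *: x) 1 (c x).
Proof. by rewrite /revolution_metric /radial_mx scale1r. Qed.

Lemma sqn_unit (x : V) : x != 0 -> sqn ((enorm x)^-1 *: x) = 1.
Proof.
move=> x0; rewrite -sqr_enorm enormZ normfV ger0_norm ?enorm_ge0 //.
by rewrite mulVf ?expr1n // enorm_eq0.
Qed.

Definition euler (u : V -> R) (x : V) : R := \sum_i x 0 i * partial i u x.

(* [vol_density * grad] for the metric of revolution. *)
Definition flux (u : V -> R) (i : 'I_3) (x : V) : R :=
  partial i u x - x 0 i * euler u x / sqn x + x 0 i * (c x * (euler u x / sqn x)).

Lemma vol_density_revolution x : x != 0 -> vol_density (revolution_metric L h) x = c x.
Proof.
by move=> x0; rewrite /vol_density revolution_metricE det_radial_mx ?sqn_unit // sqrtr_sqr ger0_norm // sqr_ge0.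
Qed.

Lemma flux_revolution u i x : x != 0 -> h (L - enorm x) != 0 ->
  vol_density (revolution_metric L h) x * grad (revolution_metric L h) u i x = flux u i x.
Proof.
move=> x0 hx; have c0 : c x != 0 by rewrite expf_neq0 // mulf_neq0 // invr_neq0 // enorm_eq0.
rewrite vol_density_revolution // /grad revolution_metricE invmx_radial_mx ?sqn_unit //.
have s0 : sqn x != 0 by rewrite sqn_eq0.
have w2 j : ((enorm x)^-1 *: x) 0 i * ((enorm x)^-1 *: x) 0 j = x 0 i * x 0 j / sqn x.
  by rewrite !mxE -sqr_enorm; field; rewrite enorm_eq0.
have -> : \sum_j radial_mx ((enorm x)^-1 *: x) 1 (c x)^-1 i j * partial j u x =
    \sum_j ((c x)^-1 * ((i == j)%:R * partial j u x) +
            (1 - (c x)^-1) * (x 0 i / sqn x) * (x 0 j * partial j u x)).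
  by apply: eq_bigr => j _; rewrite radial_mxE w2; field; rewrite ?c0 ?s0.
rewrite big_split /= -!big_distrr /= (bigD1 i) //= eqxx mul1r big1 ?addr0; last first.
  by move=> j ji; rewrite eq_sym (negbTE ji) mul0r.
by rewrite /flux /euler; field; rewrite ?c0 ?s0.
Qed.

Lemma grad_dot_revolution u v x : x != 0 -> h (L - enorm x) != 0 ->
  grad_dot (revolution_metric L h) u v x * vol_density (revolution_metric L h) x =
  \sum_i flux u i x * partial i v x.
Proof.
move=> x0 hx; rewrite /grad_dot mulrC big_distrr /=.
by apply: eq_bigr => i _; rewrite mulrA flux_revolution.
Qed.

End Metric.

(** * Tangential and radial parts of the divergence *)

Section Divergence.
Variable R : realType.
Notation V := 'rV[R]_3.
Implicit Types (u f : V -> R) (x : V) (U : set V).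

Definition hess u (i j : 'I_3) x : R := partial i (partial j u) x.

Lemma has_grad_euler U u x : smooth_in U u -> U x ->
  has_grad (euler u) x (fun i => \sum_j ((i == j)%:R * partial j u x + x 0 j * hess u i j x)).
Proof.
move=> su Ux; rewrite /euler.
have h j : has_grad (fun y : V => y 0 j * partial j u y) x
    (fun i => (i == j)%:R * partial j u x + x 0 j * hess u i j x).
  apply: has_gradM; first exact: has_grad_coord.
  by apply: (smooth_in_grad (U := U)) => //; exact: smooth_in_partial.
have -> : (fun y : V => \sum_i y 0 i * partial i u y) =
    (fun y => y 0 0 * partial 0 u y + y 0 1 * partial 1 u y + y 0 2%:R * partial 2%:R u y).
  by apply/funext => y; rewrite sum3.
apply: (has_grad_eq (g := fun i => ((i == 0)%:R * partial 0 u x + x 0 0 * hess u i 0 x) +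
  ((i == 1)%:R * partial 1 u x + x 0 1 * hess u i 1 x) +
  ((i == 2%:R)%:R * partial 2%:R u x + x 0 2%:R * hess u i 2%:R x))).
  exact: (has_gradD (has_gradD (h 0) (h 1)) (h 2%:R)).
by move=> i; rewrite sum3.
Qed.

(** The component of the Euclidean gradient orthogonal to [x]. *)
Definition tang u (i : 'I_3) x : R := partial i u x - x 0 i * euler u x / sqn x.

Lemma has_grad_invsqn x : x != 0 ->
  has_grad (fun y : V => (sqn y)^-1) x (fun i => - (2 * x 0 i) / sqn x ^+ 2).
Proof.
move=> x0; have s0 : sqn x != 0 by rewrite sqn_eq0.
apply: has_grad_eq; first apply: (has_grad_comp (phi := fun t : R => t^-1) (has_grad_sqn x)).
  by apply: (is_derive_inv s0); exact: is_derive_ident.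
by move=> i /=; field.
Qed.

Lemma has_grad_tang U u x i : smooth_in U u -> U x -> x != 0 ->
  has_grad (tang u i) x (fun j => hess u j i x -
    (((j == i)%:R * euler u x + x 0 i * \sum_k ((j == k)%:R * partial k u x + x 0 k * hess u j k x)) / sqn x
     - x 0 i * euler u x * (2 * x 0 j / sqn x ^+ 2))).
Proof.
move=> su Ux x0; apply: has_grad_eq.
  rewrite /tang; apply: has_gradD.
    by apply: (smooth_in_grad (U := U)); [exact: smooth_in_partial|].
  apply: has_gradN; apply: has_gradM; last exact: has_grad_invsqn.
  by apply: has_gradM; [exact: has_grad_coord|exact: has_grad_euler su Ux].
move=> j /=; rewrite /hess; field; by rewrite sqn_eq0.
Qed.

Lemma partial_rot U u x (i j k : 'I_3) : smooth_in U u -> U x ->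
  partial i (rot j k u) x = (i == j)%:R * partial k u x + x 0 j * hess u i k x
    - ((i == k)%:R * partial j u x + x 0 k * hess u i j x).
Proof.
move=> su Ux.
have h l m : has_grad (fun y : V => y 0 l * partial m u y) x
    (fun i => (i == l)%:R * partial m u x + x 0 l * hess u i m x).
  apply: has_gradM; first exact: has_grad_coord.
  by apply: (smooth_in_grad (U := U)) => //; exact: smooth_in_partial.
have [_ g] := has_gradD (h j k) (has_gradN (h k j)).
exact: g.
Qed.

Lemma rlapE U u x : smooth_in U u -> U x -> rlap u x =
  sqn x * (\sum_i hess u i i x) - 2 * euler u x - \sum_i \sum_j x 0 i * x 0 j * hess u i j x.
Proof.
move=> su Ux; have p i j k := partial_rot i j k su Ux.
have r2 j k : j != k -> rot j k (rot j k u) x =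
    x 0 j ^+ 2 * hess u k k x + x 0 k ^+ 2 * hess u j j x - x 0 j * partial j u x
    - x 0 k * partial k u x - x 0 j * x 0 k * (hess u k j x + hess u j k x).
  move=> jk; have -> : rot j k (rot j k u) x =
    x 0 j * partial k (rot j k u) x - x 0 k * partial j (rot j k u) x by [].
  apply: (etrans (congr2 (fun a b => x 0 j * a - x 0 k * b) (p k j k) (p j j k))).
  have kj : (k == j) = false by rewrite eq_sym (negbTE jk).
  rewrite kj (negbTE jk) !eqxx /=.
  by move: (hess u) (partial j u x) (partial k u x) (x 0 j) (x 0 k) => *; ring.
apply: (etrans (congr2 +%R (congr2 +%R (r2 0 1 isT) (r2 0 2%:R isT)) (r2 1 2%:R isT))).
have key (X P : 'I_3 -> R) (M : 'I_3 -> 'I_3 -> R) :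
    X 0 ^+ 2 * M 1 1 + X 1 ^+ 2 * M 0 0 - X 0 * P 0 - X 1 * P 1 - X 0 * X 1 * (M 1 0 + M 0 1) +
    (X 0 ^+ 2 * M 2%:R 2%:R + X 2%:R ^+ 2 * M 0 0 - X 0 * P 0 - X 2%:R * P 2%:R
       - X 0 * X 2%:R * (M 2%:R 0 + M 0 2%:R)) +
    (X 1 ^+ 2 * M 2%:R 2%:R + X 2%:R ^+ 2 * M 1 1 - X 1 * P 1 - X 2%:R * P 2%:R
       - X 1 * X 2%:R * (M 2%:R 1 + M 1 2%:R)) =
    (\sum_i X i ^+ 2) * (\sum_i M i i) - 2 * (\sum_i X i * P i) - \sum_i \sum_j X i * X j * M i j.
  rewrite !sum3; move: (M 0 0) (M 0 1) (M 0 2%:R) (M 1 0) (M 1 1) (M 1 2%:R) (M 2%:R 0) (M 2%:R 1)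
    (M 2%:R 2%:R) (X 0) (X 1) (X 2%:R) (P 0) (P 1) (P 2%:R) => *; ring.
exact: (key (fun i => x 0 i) (fun i => partial i u x) (fun i j => hess u i j x)).
Qed.

Lemma div_tang U u x : smooth_in U u -> U x -> x != 0 ->
  \sum_i partial i (tang u i) x = rlap u x / sqn x.
Proof.
move=> su Ux x0; have s0 : sqn x != 0 by rewrite sqn_eq0.
rewrite (rlapE su Ux).
have -> : \sum_i partial i (tang u i) x = \sum_i (hess u i i x -
    (((i == i)%:R * euler u x + x 0 i * \sum_k ((i == k)%:R * partial k u x + x 0 k * hess u i k x)) / sqn x
     - x 0 i * euler u x * (2 * x 0 i / sqn x ^+ 2))).
  by apply: eq_bigr => i _; have [_ ->] := has_grad_tang i su Ux x0.
have key (X P : 'I_3 -> R) (M : 'I_3 -> 'I_3 -> R) (s e : R) : s != 0 ->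
    s = \sum_i X i ^+ 2 -> e = \sum_i X i * P i ->
    \sum_i (M i i - (((i == i)%:R * e + X i * \sum_k ((i == k)%:R * P k + X k * M i k)) / s
     - X i * e * (2 * X i / s ^+ 2))) =
    (s * (\sum_i M i i) - 2 * e - \sum_i \sum_j X i * X j * M i j) / s.
  rewrite !sum3 !eqxx /=; move: (M 0 0) (M 0 1) (M 0 2%:R) (M 1 0) (M 1 1) (M 1 2%:R) (M 2%:R 0)
    (M 2%:R 1) (M 2%:R 2%:R) (X 0) (X 1) (X 2%:R) (P 0) (P 1) (P 2%:R)
    => m00 m01 m02 m10 m11 m12 m20 m21 m22 a b c p q r sn0 sE ->.
  by move: sn0; rewrite sE => sn0; field.
exact: (key (fun i => x 0 i) (fun i => partial i u x) (fun i j => hess u i j x)).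
Qed.

Definition ray (r : R) x : V := (r / enorm x) *: x.

(** [x / |x|^3] is divergence free off the origin, so only the radial derivative of [K] remains. *)
Lemma div_radial (K : V -> R) x : x != 0 -> differentiable K x ->
  \sum_i partial i (fun y : V => y 0 i * (K y * (enorm y)^-1 ^+ 3)) x = euler K x / enorm x ^+ 3.
Proof.
move=> x0 dK; have e0 : enorm x != 0 by rewrite enorm_eq0.
have hr : has_grad (fun y : V => (enorm y)^-1 ^+ 3) x (fun i => (- 3 * (enorm x)^-1 ^+ 4) * (x 0 i / enorm x)).
  apply: (has_grad_radial (f := fun r : R => r^-1 ^+ 3) x0).
  have d := is_derive_inv (f := fun y : R => y) e0 (is_derive_ident (enorm x)).
  move: (is_derive_mul (is_derive_mul d d) d) => {}d.
  have -> : (fun r : R => r^-1 ^+ 3) = (fun r => r^-1 / r / r).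
    by apply/funext => y; rewrite 2!exprSr expr1.
  by apply: (is_derive_change d); field.
have h i : has_grad (fun y : V => y 0 i * (K y * (enorm y)^-1 ^+ 3)) x _ :=
  has_gradM (has_grad_coord i x) (has_gradM (has_grad_partial dK) hr).
have -> : \sum_i partial i (fun y : V => y 0 i * (K y * (enorm y)^-1 ^+ 3)) x =
   \sum_i (K x * (enorm x)^-1 ^+ 3 + x 0 i * partial i K x * (enorm x)^-1 ^+ 3
     - 3 * (K x * (enorm x)^-1 ^+ 5) * x 0 i ^+ 2).
  by apply: eq_bigr => i _; have [_ ->] := h i; rewrite eqxx /=; field.
rewrite !big_split /= -!mulr_suml sumrN -mulr_sumr -/(sqn x) -/(euler K x) -sqr_enorm sumr_const card_ord.
by rewrite -mulr_natl; field.
Qed.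

End Divergence.

(** * Functions along rays and on spheres *)

Section Rays.
Variable R : realType.
Notation V := 'rV[R]_3.
Implicit Types (u f : V -> R) (x : V) (U : set V).

Lemma enorm_ray (r : R) x : 0 <= r -> x != 0 -> enorm (ray r x) = r.
Proof.
move=> r0 x0; have e0 : 0 < enorm x by rewrite enorm_gt0.
by rewrite enormZ ger0_norm ?divr_ge0 ?(ltW e0) // divfK // gt_eqF.
Qed.

Lemma ray_row (r : R) : @ray R r = fun x => \row_j (r * ((enorm x)^-1 * x 0 j)).
Proof. by apply/funext => x; apply/rowP => j; rewrite !mxE mulrA. Qed.

Lemma smooth_ray u U (r : R) : smooth_in U u -> (forall x, x != 0 -> U (ray r x)) ->
  smooth_in (@nonzero R) (fun x => u (ray r x)).
Proof.
move=> su rU; apply: alg3_smooth_in; first exact: open_nonzero.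
rewrite ray_row; apply: (@alg3_row R _ U u (fun j x => r * ((enorm x)^-1 * x 0 j))) => //.
  by move=> x x0; have := rU x x0; rewrite ray_row.
move=> j; apply: alg3_mul; first exact: alg3_cst.
by apply: alg3_mul; [exact: alg3_invenorm|exact: alg3_coord].
Qed.

Lemma has_grad_invenorm x : x != 0 ->
  has_grad (fun y : V => (enorm y)^-1) x (fun i => - x 0 i / enorm x ^+ 3).
Proof.
move=> x0; have e0 : enorm x != 0 by rewrite enorm_eq0.
have d := is_derive_inv (f := fun y : R => y) e0 (is_derive_ident (enorm x)).
by apply: (has_grad_eq (has_grad_radial (f := fun t : R => t^-1) x0 d)) => i; field.
Qed.

Lemma has_grad_ray u (r : R) x g : x != 0 -> has_grad u (ray r x) g ->
  has_grad (fun y => u (ray r y)) x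
    (fun i => \sum_j g j * (r * (- x 0 i / enorm x ^+ 3 * x 0 j + (enorm x)^-1 * (i == j)%:R))).
Proof.
move=> x0 hu; rewrite ray_row; apply: has_grad_comp_row; first by move: hu; rewrite ray_row.
move=> j; apply: has_grad_eq.
  apply: has_gradM; first exact: has_grad_cst.
  by apply: has_gradM; [exact: has_grad_invenorm|exact: has_grad_coord].
by move=> i /=; ring.
Qed.

(** Rotation fields are tangent to spheres and invariant under dilations, so they commute with the
    radial projection onto a sphere. *)
Lemma rot_ray u U (r : R) j k x : smooth_in U u -> U (ray r x) -> x != 0 ->
  rot j k (fun y => u (ray r y)) x = rot j k u (ray r x).
Proof.
move=> su Ux x0; have e0 : enorm x != 0 by rewrite enorm_eq0.
have [_ g] := has_grad_ray x0 (smooth_in_grad su Ux).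
have -> : rot j k (fun y => u (ray r y)) x = x 0 j * partial k (fun y => u (ray r y)) x
  - x 0 k * partial j (fun y => u (ray r y)) x by [].
rewrite (g j) (g k) !big_distrr /= -sumrB.
have -> : rot j k u (ray r x) = \sum_l (partial l u (ray r x) * (r * (enorm x)^-1)
   * ((k == l)%:R * x 0 j - (j == l)%:R * x 0 k)).
  have sd (G : 'I_3 -> R) m (c : R) : \sum_l G l * ((m == l)%:R * c) = G m * c.
    rewrite (bigD1 m) //= eqxx mul1r big1 ?addr0 // => l /negbTE ml.
    by rewrite eq_sym ml mul0r mulr0.
  transitivity (\sum_l (partial l u (ray r x) * (r * (enorm x)^-1) * ((k == l)%:R * x 0 j)) -
      \sum_l (partial l u (ray r x) * (r * (enorm x)^-1) * ((j == l)%:R * x 0 k))).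
    by rewrite !sd /rot /ray !mxE; ring.
  by rewrite -sumrB; apply: eq_bigr => l _; ring.
by apply: eq_bigr => l _; field.
Qed.

Lemma rlap_ray u U (r : R) x : open U -> smooth_in U u -> (forall y, y != 0 -> U (ray r y)) -> x != 0 ->
  rlap (fun y => u (ray r y)) x = rlap u (ray r x).
Proof.
move=> oU su rU x0.
have h j k : rot j k (rot j k (fun y => u (ray r y))) x = rot j k (rot j k u) (ray r x).
  apply: (etrans _ (rot_ray j k (smooth_rot j k oU su) (rU x x0) x0)).
  have [_ gl] : has_grad (rot j k (fun y => u (ray r y))) x
     (fun i => partial i (fun y => rot j k u (ray r y)) x).
    apply: (near_eq_has_grad (u := fun y => rot j k u (ray r y))).
      near=> y; have y0 : y != 0 by near: y; exact: open_nonzero.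
      exact: (esym (rot_ray j k su (rU y y0) y0)).
    apply: (smooth_in_grad (U := @nonzero R)) => //.
    exact: (smooth_ray (smooth_rot j k oU su) rU).
  exact: (congr2 (fun a b => x 0 j * a - x 0 k * b) (gl k) (gl j)).
exact: (congr2 +%R (congr2 +%R (h 0 1) (h 0 2%:R)) (h 1 2%:R)).
Unshelve. all: by end_near. Qed.

(** The derivative in the direction [x / |x|]. *)
Definition dru u x : R := euler u x / enorm x.

Lemma is_derive_along_ray u U (r : R) x : smooth_in U u -> U (ray r x) -> 0 < r -> x != 0 ->
  is_derive r 1 (fun s => u (ray s x)) (dru u (ray r x)).
Proof.
move=> su Ux r0 x0; have e0 : enorm x != 0 by rewrite enorm_eq0.
have E s : ray s x = s *: ((enorm x)^-1 *: x) by rewrite /ray scalerA.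
have -> : (fun s => u (ray s x)) = (fun s => u (s *: ((enorm x)^-1 *: x))).
  by apply/funext => s; rewrite E.
apply: is_derive_change.
  by apply: is_derive_ray; rewrite -E; apply: smooth_in_grad su Ux.
rewrite /dru /euler enorm_ray ?(ltW r0) // mulr_suml; apply: eq_bigr => i _.
by rewrite [ray r x]E !mxE; field; rewrite gt_eqF.
Qed.

End Rays.

(** * Moments *)

Section Moments.
Variable R : realType.
Notation V := 'rV[R]_3.
Implicit Types (u f g : V -> R) (x : V) (U : set V).

Lemma annulus_bounded f (a b : R) : 0 < a ->
  (forall x, a <= enorm x <= b -> {for x, continuous f}) ->
  exists M : R, 0 <= M /\ forall x, a <= enorm x <= b -> `|f x| <= M.
Proof.
move=> a0 cf; pose S := [set x : V | a <= enorm x <= b].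
have cS : compact S.
  apply: (subclosed_compact _ (@compact_rV_box R b)).
    have -> : S = (@enorm R) @^-1` `[a, b]%classic by apply/seteqP; split => x; rewrite /S /= in_itv.
    apply: closed_comp => [x _|]; first exact: enorm_continuous.
    exact: (@interval_closed R (BLeft a) (BRight b)).
  move=> x /andP[_ xb] j /=; rewrite in_itv /= -ler_norml.
  exact: (le_trans (coord_le_enorm x j)).
have cfS : {within S, continuous f}.
  by apply: continuous_in_subspaceT => x; rewrite inE => xS; apply: cf.
have [M [_ hM]] := compact_bounded (continuous_compact cfS cS).
exists (Num.max 0 (M + 1)); split; first by rewrite le_max lexx.
move=> x xS; rewrite le_max; apply/orP; right.
by apply: (hM (M + 1)); [rewrite ltrDl|exists x].
Qed.

(** The moment of [f] on the sphere of radius [r], with [g] thought of as a weight depending on the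
    direction. *)
Definition mom f g (r : R) : R := avg (fun x => f (ray r x) * g x).

Lemma ray_neq0 (r : R) x : 0 < r -> x != 0 -> ray r x != 0.
Proof. by move=> r0 x0; rewrite -enorm_gt0 enorm_ray // ltW. Qed.

Lemma ray_continuous (r : R) x : x != 0 -> {for x, continuous (@ray R r)}.
Proof.
move=> x0; have c : {for x, continuous (fun y : V => r / enorm y)}.
  apply: ct_mul; first exact: ct_cst.
  by apply: ct_inv; [rewrite enorm_eq0|exact: enorm_continuous].
exact: (continuousZ c (@cvg_id _ (nbhs x))).
Qed.

Lemma continuous_ray f (r : R) x : x != 0 -> {for ray r x, continuous f} ->
  {for x, continuous (fun y => f (ray r y))}.
Proof. move=> x0 cf; exact: (@continuous_comp _ _ _ (@ray R r) f x (@ray_continuous r x x0) cf). Qed.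

Lemma continuous_along_ray f (r : R) x : {for ray r x, continuous f} ->
  {for r, continuous (fun s => f (ray s x))}.
Proof.
move=> cf; have c : {for r, continuous (fun s : R => s / enorm x)}.
  by apply: ct_mul; [exact: cvg_id|exact: ct_cst].
have cr : {for r, continuous (fun s => ray s x)}.
  exact: (continuousZ c (@cst_continuous _ _ x r)).
exact: (@continuous_comp _ _ _ (fun s => ray s x) f r cr cf).
Qed.

Lemma mom_integrable f g (r : R) :
  (forall x, x != 0 -> {for ray r x, continuous f}) -> (forall x, x != 0 -> {for x, continuous g}) ->
  (leb3 R).-integrable setT (EFin \o (fun p => f (ray r (vec3 p)) * g (vec3 p) * zeta (vec3 p))).
Proof.
move=> cf cg; apply: (@integrable_avg R (fun x => f (ray r x) * g x)) => x x0.
by apply: ct_mul; [apply: continuous_ray => //; exact: cf|exact: cg].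
Qed.

(** A single integrable majorant for all radii in [[a, b]], as continuity and differentiation under
    the integral sign require. *)
Lemma mom_dominated f g (a b : R) : 0 < a ->
  (forall x, a <= enorm x <= b -> {for x, continuous f}) -> (forall x, x != 0 -> {for x, continuous g}) ->
  exists2 G : R * (R * R) -> R, (forall p, 0 <= G p) /\ (leb3 R).-integrable setT (EFin \o G) &
    forall r p, a <= r <= b -> `|f (ray r (vec3 p)) * g (vec3 p) * zeta (vec3 p)| <= G p.
Proof.
move=> a0 cf cg; have [M [M0 hM]] := annulus_bounded a0 cf.
exists (fun p => M * (`|g (vec3 p)| * zeta (vec3 p))).
  split=> [p|]; first exact: (mulr_ge0 M0 (mulr_ge0 (normr_ge0 _) (zeta_ge0 _))).
  have h := @integrable_avg R (fun x => M * `|g x|).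
  have E : (EFin \o (fun p : R * (R * R) => M * (`|g (vec3 p)| * zeta (vec3 p)))) =
     (EFin \o (fun p : R * (R * R) => M * `|g (vec3 p)| * zeta (vec3 p))).
    by apply/funext => p /=; rewrite mulrA.
  rewrite E; apply: h => x x0.
  apply: ct_mul; first exact: ct_cst.
  by apply: (ct_comp (g := fun y : R => `|y|)); [exact: cg|exact: norm_continuous].
move=> r p /andP[ar rb]; have [v0|v0] := eqVneq (vec3 p : V) 0.
  have z0 : zeta (vec3 p : V) = 0 by rewrite v0 zeta0.
  by rewrite z0 !mulr0 normr0.
have r0 : 0 <= r by apply: le_trans ar; exact: ltW.
have := @zeta_ge0 R (vec3 p); move: (zeta _) => z z0; rewrite !normrM (ger0_norm z0) mulrA.
apply: (ler_wpM2r z0); apply: ler_wpM2r => //.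
by apply: hM; rewrite enorm_ray // ar.
Qed.

(** [f] is controlled up to [|x| = L] only; truncating the radius at [L] turns continuity from the
    left into two-sided continuity. *)
Lemma mom_continuous f g (L r : R) : 0 < r -> 0 < L ->
  (forall x, 0 < enorm x <= L -> {for x, continuous f}) -> (forall x, x != 0 -> {for x, continuous g}) ->
  {for r, continuous (fun s => mom f g (Num.min s L))}.
Proof.
move=> r0 L0 cf cg; pose a : R := Num.min (r / 2) L.
have a0 : 0 < a by rewrite lt_min L0 andbT divr_gt0.
have [|G [G0 iG] hG] := @mom_dominated f g a L a0 _ cg.
  by move=> x /andP[ax xL]; apply: cf; rewrite xL andbT; apply: lt_le_trans ax.
have min_gt0 (s : R) : r / 2 < s -> 0 < Num.min s L.
  by move=> rs; rewrite lt_min L0 andbT; apply: lt_trans rs; rewrite divr_gt0.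
have cfr (s : R) x : r / 2 < s -> x != 0 -> {for ray (Num.min s L) x, continuous f}.
  move=> rs x0; have m0 := min_gt0 s rs; apply: cf; rewrite (enorm_ray (ltW m0) x0) m0 /=.
  by rewrite ge_min lexx orbT.
have := @continuity_under_integral R _ _ (leb3 R)
  (fun s p => f (ray (Num.min s L) (vec3 p)) * g (vec3 p) * zeta (vec3 p)) setT measurableT
  (r / 2) (r + 1) _ _ G iG _ r.
apply.
- by move=> s /=; rewrite in_itv /= => /andP[rs _]; apply: mom_integrable => // x x0; exact: cfr.
- apply: aeW => p _ s /set_mem /=; rewrite in_itv /= => /andP[rs _].
  apply: (@ct_mul _ R (fun s => f (ray (Num.min s L) (vec3 p)) * g (vec3 p)) (fun=> zeta (vec3 p))); last exact: ct_cst.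
  have [v0|v0] := eqVneq (vec3 p : V) 0.
    have -> : (fun s => f (ray (Num.min s L) (vec3 p)) * g (vec3 p)) = (fun=> f 0 * g (vec3 p)).
      by apply/funext => t; rewrite v0 /ray scaler0.
    exact: ct_cst.
  apply: ct_mul; last exact: ct_cst.
  apply: (ct_comp (g := fun t => f (ray t (vec3 p))) (f := fun s : R => Num.min s L)).
    by apply: continuous_min; [exact: cvg_id|exact: cvg_cst].
  by apply: continuous_along_ray; exact: cfr.
- move=> s /=; rewrite in_itv /= => /andP[rs _].
  apply: (@filterE _ (almost_everywhere (leb3 R)) _ (fun p => setT p ->
    `|f (ray (Num.min s L) (vec3 p)) * g (vec3 p) * zeta (vec3 p)| <= G p)) => p _.
  by apply: hG; rewrite /a le_min !ge_min lexx orbT (ltW rs) //= !orbT.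
- by rewrite inE /= in_itv /=; apply/andP; split; lra.
Qed.

Lemma is_derive_mom u g U (L r : R) : open U -> smooth_in U u -> (forall x, 0 < enorm x < L -> U x) ->
  (forall x, U x -> x != 0) ->
  (forall x, x != 0 -> {for x, continuous g}) -> 0 < r < L -> is_derive r 1 (mom u g) (mom (dru u) g r).
Proof.
move=> oU su LU U0 cg /andP[r0 rL].
have sdru : smooth_in U (dru u).
  apply: alg3_smooth_in => //; rewrite /dru /euler; apply: alg3_mul; last exact: alg3_invenorm.
  apply: alg3_sum => i; apply: alg3_mul; first exact: alg3_coord.
  by apply: alg3_smooth; exact: smooth_in_partial.
pose a : R := r / 2; pose b : R := (r + L) / 2.
have a0 : 0 < a by rewrite divr_gt0.
have abL x : a <= enorm x <= b -> 0 < enorm x < L by rewrite /a /b => /andP[ax xb]; apply/andP; split; lra.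
have [|G [G0 iG] hG] := @mom_dominated (dru u) g a b a0 _ cg.
  by move=> x /abL /LU; exact: smooth_continuous.
have sL (s : R) x : a < s < b -> x != 0 -> U (ray s x).
  by move=> /andP[as_ sb] x0; apply: LU; rewrite enorm_ray //; [apply/andP; split; rewrite /a /b in as_ sb *; lra|lra].
pose F s (p : R * (R * R)) := u (ray s (vec3 p)) * g (vec3 p) * zeta (vec3 p).
have dF s p : a < s < b -> is_derive s 1 (F ^~ p) (dru u (ray s (vec3 p)) * g (vec3 p) * zeta (vec3 p)).
  move=> sab; have [v0|v0] := eqVneq (vec3 p : V) 0.
    have z0 : zeta (vec3 p : V) = 0 by rewrite v0 zeta0.
    have -> : F ^~ p = (fun=> 0) by apply/funext => t; rewrite /F z0 mulr0.
    by rewrite z0 mulr0; exact: is_derive_const.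
  have s0 : 0 < s by case/andP: sab => h _; lra.
  have d := is_derive_along_ray su (sL s _ sab v0) s0 v0.
  have d2 := is_derive_scale (g (vec3 p) * zeta (vec3 p)) d.
  have -> : F ^~ p = (fun y => g (vec3 p) * zeta (vec3 p) * u (ray y (vec3 p))).
    by apply/funext => t; rewrite /F; ring.
  by apply: (is_derive_change d2); ring.
have rI : `]a, b[%classic r by rewrite /= in_itv /= /a /b; apply/andP; split; lra.
have iF (s : R) : `]a, b[%classic s -> (leb3 R).-integrable setT (EFin \o F s).
  rewrite /= in_itv /= => sab; apply: mom_integrable => // x x0.
  by apply: (smooth_continuous su); exact: sL.
have dF1 s y : `]a, b[%classic s -> setT y -> derivable (F ^~ y) s 1.
  by rewrite /= in_itv /= => sab _; have [] := dF s y sab.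
have ub s y : `]a, b[%classic s -> setT y -> `|partial1of2 F s y| <= G y.
  rewrite /= in_itv /= => sab _; rewrite partial1of2E.
  have d := dF s y sab; rewrite derive_val; apply: hG.
  by case/andP: sab => h1 h2; rewrite !ltW.
split.
  exact: (@derivable_under_integral R _ _ (leb3 R) F setT measurableT r a b rI iF dF1 G G0 iG ub).
rewrite -derive1E.
have := @differentiation_under_integral R _ _ (leb3 R) F setT measurableT r a b rI iF dF1 G G0 iG ub.
rewrite /mom {1}/avg => ->; apply: eq_Rintegral => p _.
by rewrite partial1of2E; have d := dF r p rI; rewrite derive_val.
Qed.

End Moments.

(** * The radial equations satisfied by the moments *)

Section HarmonicMoments.
Variables (R : realType) (L : R) (h : R -> R) (W : set R).
Notation V := 'rV[R]_3.
Implicit Types (u g K : V -> R) (x : V) (U : set V).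
Hypotheses (L0 : 0 < L) (sh : smooth1_in W h) (LW : forall t, 0 <= t <= L -> W t).
Hypothesis hpos : forall t, 0 <= t < L -> 0 < h t.

(** The counterpart in space of [P = H^2 a']. *)
Definition radial_momentum u : V -> R := fun x => h (L - enorm x) ^+ 2 * dru u x.

Lemma smooth_dru U u : open U -> U `<=` @nonzero R -> smooth_in U u -> smooth_in U (dru u).
Proof.
move=> oU U0 su; apply: alg3_smooth_in => //; rewrite /dru /euler.
apply: alg3_mul; last exact: alg3_invenorm.
apply: alg3_sum => i; apply: alg3_mul; first exact: alg3_coord.
by apply: alg3_smooth; exact: smooth_in_partial.
Qed.

Lemma smooth_rlap U u : open U -> smooth_in U u -> smooth_in U (rlap u).
Proof.
move=> oU su; have s2 j k := smooth_rot j k oU (smooth_rot j k oU su).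
apply: alg3_smooth_in => //.
exact: (alg3_add (alg3_add (alg3_smooth (s2 0 1)) (alg3_smooth (s2 0 2%:R))) (alg3_smooth (s2 1 2%:R))).
Qed.

Lemma alg3_profile U : (forall x, U x -> 0 < enorm x <= L) -> alg3 U (fun x => h (L - enorm x)).
Proof.
move=> UL; apply: (@alg3_comp R U W h (fun x => L - enorm x)) => //.
  by move=> x /UL /andP[x0 xL]; apply: LW; rewrite subr_ge0 xL /= gerBl ltW.
apply: alg3_add; first exact: alg3_cst.
have -> : (fun x : V => - enorm x) = (fun x => (-1) * enorm x) by apply/funext => x; rewrite mulN1r.
apply: alg3_mul; first exact: alg3_cst.
by apply: alg3_enorm => x /UL /andP[]; rewrite enorm_gt0.
Qed.

Lemma smooth_radial_momentum U u : open U -> (forall x, U x -> 0 < enorm x <= L) ->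
  smooth_in U u -> smooth_in U (radial_momentum u).
Proof.
move=> oU UL su; have U0 : U `<=` @nonzero R by move=> x /UL /andP[]; rewrite enorm_gt0.
apply: alg3_smooth_in => //; rewrite /radial_momentum; apply: alg3_mul.
  by have a := alg3_profile UL; apply: (alg3_mul a a).
by apply: alg3_smooth; exact: smooth_dru.
Qed.

(** The flux is the tangential gradient plus [x H^2 d_r u / |x|^3]. This splitting separates the
    spherical Laplacian from the radial operator in the divergence. *)
Lemma has_grad_flux U u x i : open U -> U `<=` @nonzero R -> smooth_in U u -> U x ->
  differentiable (radial_momentum u) x ->
  has_grad (flux L h u i) x (fun j => partial j (tang u i) x +
    partial j (fun y : V => y 0 i * (radial_momentum u y * (enorm y)^-1 ^+ 3)) x).
Proof.
move=> oU U0 su Ux dK; have x0 := U0 _ Ux.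
apply: (near_eq_has_grad (u := fun y => tang u i y + y 0 i * (radial_momentum u y * (enorm y)^-1 ^+ 3))).
  near=> y; have y0 : y != 0 by near: y; exact: open_nonzero.
  rewrite /flux /tang /radial_momentum /dru -sqr_enorm; field; by rewrite enorm_eq0.
apply: has_gradD.
  by apply: has_grad_partial; have [] := has_grad_tang i su Ux x0.
apply: has_grad_partial.
have i1 := has_grad_invenorm x0.
exact: (has_gradM (has_grad_coord i x) (has_gradM (has_grad_partial dK) (has_gradM i1 (has_gradM i1 i1)))).1.
Unshelve. all: by end_near. Qed.

Lemma div_flux U u x : open U -> U `<=` @nonzero R -> smooth_in U u -> U x ->
  differentiable (radial_momentum u) x ->
  \sum_i partial i (flux L h u i) x =
  rlap u x / enorm x ^+ 2 + euler (radial_momentum u) x / enorm x ^+ 3.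
Proof.
move=> oU U0 su Ux dK; have x0 := U0 _ Ux.
rewrite sqr_enorm -(div_tang su Ux x0) -(div_radial x0 dK) -big_split /=.
by apply: eq_bigr => i _; have [_ ->] := has_grad_flux i oU U0 su Ux dK.
Qed.

Lemma laplace_beltramiE U u x : open U -> U `<=` @nonzero R -> smooth_in U u -> U x -> 0 < enorm x < L ->
  differentiable (radial_momentum u) x -> laplace_beltrami (revolution_metric L h) u x =
  (h (L - enorm x) / enorm x) ^- 2 * (rlap u x / enorm x ^+ 2 + euler (radial_momentum u) x / enorm x ^+ 3).
Proof.
move=> oU U0 su Ux xL dK; have x0 := U0 _ Ux.
have hx y : 0 < enorm y < L -> h (L - enorm y) != 0.
  move=> /andP[y0 yL]; rewrite gt_eqF //; apply: hpos; rewrite subr_ge0 (ltW yL) /=.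
  by rewrite gtrBl.
rewrite -(div_flux oU U0 su Ux dK) /laplace_beltrami vol_density_revolution //; congr (_ * _).
apply: eq_bigr => i _; have g := has_grad_flux i oU U0 su Ux dK.
apply: (etrans _ (esym (g.2 i))).
apply: ((near_eq_has_grad (v := fun y => vol_density (revolution_metric L h) y *
  grad (revolution_metric L h) u i y) _ g).2 i).
have nA : nbhs x [set y : V | 0 < enorm y < L].
  by apply: open_nbhs_nbhs; split; [exact: open_annulus|exact: xL].
near=> y; have yL : 0 < enorm y < L by near: y; exact: nA.
by apply: esym; apply: flux_revolution; [rewrite -enorm_gt0; case/andP: yL|exact: hx].
Unshelve. all: by end_near. Qed.

Lemma harmonic_radial_momentum U u x : open U -> U `<=` @nonzero R -> smooth_in U u -> U x -> 0 < enorm x < L ->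
  differentiable (radial_momentum u) x -> laplace_beltrami (revolution_metric L h) u x = 0 ->
  dru (radial_momentum u) x = - rlap u x.
Proof.
move=> oU U0 su Ux xL dK; have x0 := U0 _ Ux; have e0 : enorm x != 0 by rewrite enorm_eq0.
have hx : h (L - enorm x) / enorm x != 0.
  case/andP: xL => y0 yL; rewrite mulf_neq0 ?invr_eq0 // gt_eqF //; apply: hpos.
  by rewrite subr_ge0 (ltW yL) /= gtrBl.
rewrite (laplace_beltramiE oU U0 su Ux xL dK) => /eqP; rewrite mulf_eq0 invr_eq0 expf_eq0 (negbTE hx) /= => /eqP E.
have {}E : (rlap u x + euler (radial_momentum u) x / enorm x) / enorm x ^+ 2 = 0.
  by rewrite -[RHS]E; field.
have := congr1 (fun z => z * enorm x ^+ 2) E; rewrite mul0r divfK ?expf_neq0 // => /eqP.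
by rewrite addr_eq0 /dru => /eqP ->; rewrite opprK.
Qed.

(** Spherical averages commute with radial differentiation; harmonicity turns the radial derivative
    of [H^2 d_r u] into [- rlap u], and the symmetry of [rlap] moves it onto the weight. *)
Lemma moment_equation U u g : open U -> U `<=` @nonzero R -> smooth_in U u ->
  (forall x, 0 < enorm x < L -> U x) ->
  (forall x, 0 < enorm x < L -> laplace_beltrami (revolution_metric L h) u x = 0) ->
  smooth_in (@nonzero R) g -> forall r, 0 < r < L ->
  is_derive r 1 (mom u g) (h (L - r) ^+ 2 * mom (dru u) g r / h (L - r) ^+ 2) /\
  is_derive r 1 (fun r => h (L - r) ^+ 2 * mom (dru u) g r) (- mom u (rlap g) r).
Proof.
move=> oU U0 su LU LB sg r rL; have /andP[r0 rL'] := rL.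
have cg x : x != 0 -> {for x, continuous g} by move=> x0; apply: (smooth_continuous sg).
have hr : h (L - r) != 0.
  by rewrite gt_eqF //; apply: hpos; rewrite subr_ge0 (ltW rL') /= gtrBl.
split.
  apply: is_derive_change; first exact: (is_derive_mom oU su LU U0 cg rL).
  by field.
pose A := [set x : V | 0 < enorm x < L].
have oA : open A by exact: open_annulus.
have sA : smooth_in A u by apply: smooth_in_sub su.
have A0 : A `<=` @nonzero R by move=> x /andP[]; rewrite enorm_gt0.
have sK : smooth_in A (radial_momentum u).
  by apply: smooth_radial_momentum => // x /andP[-> /ltW].
have Ar s x : 0 < s < L -> x != 0 -> A (ray s x).
  by move=> /andP[s0 sL] x0; rewrite /A /= enorm_ray ?ltW // s0.
apply: (is_derive_ext (f := mom (radial_momentum u) g)).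
  near=> s; have sL : 0 < s < L.
    by apply/andP; split; near: s; [exact: lt_nbhsr|exact: lt_nbhsl].
  have cd x : x != 0 -> {for x, continuous (fun y => dru u (ray s y) * g y)}.
    move=> x0; apply: ct_mul; last exact: cg.
    apply: continuous_ray => //; apply: (@smooth_continuous _ A); last exact: Ar.
    exact: smooth_dru.
  rewrite /mom -avgZ //; apply: eq_avg => x x0.
  by rewrite /radial_momentum enorm_ray ?mulrA //; case/andP: sL => /ltW.
apply: is_derive_change; first exact: (is_derive_mom oA sK (fun x a => a) A0 cg rL).
have E x : x != 0 -> dru (radial_momentum u) (ray r x) = - rlap (fun y => u (ray r y)) x.
  move=> x0; have Ax := Ar _ _ rL x0.
  rewrite (rlap_ray oA sA) //; last by move=> y y0; exact: Ar.
  apply: (harmonic_radial_momentum oA A0 sA) => //; last exact: LB.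
  exact: (smooth_in_grad sK Ax).1.
have su_r : smooth_in (@nonzero R) (fun y => u (ray r y)).
  by apply: (smooth_ray sA) => x x0; exact: Ar.
rewrite /mom -(avg_rlapM su_r sg) -[RHS]mulN1r -avgZ.
  by apply: eq_avg => x x0; rewrite E // mulN1r mulNr.
move=> x x0; apply: ct_mul; last exact: cg.
by apply: (@smooth_continuous R (@nonzero R) _ x (smooth_rlap (@open_nonzero R) su_r)).
Unshelve. all: by end_near. Qed.

End HarmonicMoments.

(** * The weights and their spherical Laplacian *)

Section Weights.
Variables (R : realType) (e : 'rV[R]_3).
Notation V := 'rV[R]_3.
Implicit Types (f g F : V -> R) (x y : V).
Hypothesis e1 : sqn e = 1.

Definition dot x y : R := \sum_i x 0 i * y 0 i.

(* The angle between [x] and [e] has cosine [2 * wt x - 1]. *)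
Definition wt x : R := (1 + dot x e / enorm x) / 2.

Lemma sqn_unit_sub x : x != 0 -> sqn ((enorm x)^-1 *: x - e) = 4 * (1 - wt x).
Proof.
move=> x0; have u1 := sqn_unit x0; have n0 : enorm x != 0 by rewrite enorm_eq0.
have -> : sqn ((enorm x)^-1 *: x - e) = sqn ((enorm x)^-1 *: x) + sqn e - 2 * (dot x e / enorm x).
  rewrite /sqn /dot mulr_suml mulr_sumr -sumrN -!big_split /=; apply: eq_bigr => i _.
  by rewrite !mxE; field.
by rewrite u1 e1 /wt; field.
Qed.

Lemma sqn_unit_add x : x != 0 -> sqn ((enorm x)^-1 *: x + e) = 4 * wt x.
Proof.
move=> x0; have u1 := sqn_unit x0; have n0 : enorm x != 0 by rewrite enorm_eq0.
have -> : sqn ((enorm x)^-1 *: x + e) = sqn ((enorm x)^-1 *: x) + sqn e + 2 * (dot x e / enorm x).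
  rewrite /sqn /dot mulr_suml mulr_sumr -!big_split /=; apply: eq_bigr => i _.
  by rewrite !mxE; field.
by rewrite u1 e1 /wt; field.
Qed.

Lemma wt_ge0 x : x != 0 -> 0 <= wt x.
Proof. by move=> x0; have := sqn_ge0 ((enorm x)^-1 *: x + e); rewrite sqn_unit_add // pmulr_rge0. Qed.

Lemma wt_le1 x : x != 0 -> wt x <= 1.
Proof. by move=> x0; have := sqn_ge0 ((enorm x)^-1 *: x - e); rewrite sqn_unit_sub // pmulr_rge0 // subr_ge0. Qed.

Lemma alg3_wt : alg3 (@nonzero R) wt.
Proof.
rewrite /wt /dot; apply: alg3_mul; last exact: alg3_cst.
apply: alg3_add; first exact: alg3_cst.
apply: alg3_mul; last exact: alg3_invenorm.
by apply: alg3_sum => i; apply: alg3_mul; [exact: alg3_coord|exact: alg3_cst].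
Qed.

Lemma smooth_wtX n : smooth_in (@nonzero R) (fun x => wt x ^+ n).
Proof.
apply: alg3_smooth_in; first exact: open_nonzero.
elim: n => [|n IH]; first by under eq_fun do rewrite expr0; exact: alg3_cst.
by under eq_fun do rewrite exprS; apply: alg3_mul => //; exact: alg3_wt.
Qed.

Lemma rot_near f g j k x : (\near x, f x = g x) -> differentiable f x -> rot j k f x = rot j k g x.
Proof.
move=> fg df; have [_ h] := near_eq_has_grad fg (has_grad_partial df).
exact: (congr2 (fun a b => x 0 j * a - x 0 k * b) (esym (h k)) (esym (h j))).
Qed.

Lemma rot_grad f (G : 'I_3 -> R) j k x : has_grad f x G -> rot j k f x = x 0 j * G k - x 0 k * G j.
Proof. by move=> [_ h]; exact: (congr2 (fun a b => x 0 j * a - x 0 k * b) (h k) (h j)). Qed.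

Lemma has_grad_dot x : has_grad (dot^~ e) x (fun i => e 0 i).
Proof.
have -> : dot^~ e = fun y => y 0 0 * e 0 0 + y 0 1 * e 0 1 + y 0 2%:R * e 0 2%:R.
  by apply/funext => y; rewrite /dot sum3.
have h j := has_gradM (has_grad_coord j x) (has_grad_cst (e 0 j) x).
apply: (has_grad_eq (has_gradD (has_gradD (h 0) (h 1)) (h 2%:R))) => i.
by case: (ord3E i) => -> /=; rewrite !mulr0 !addr0 ?mul1r ?mul0r ?addr0 ?add0r.
Qed.

Definition wt_rot (j k : 'I_3) x : R := (x 0 j * e 0 k - x 0 k * e 0 j) / (2 * enorm x).

Lemma has_grad_wt x : x != 0 ->
  has_grad wt x (fun i => (e 0 i / enorm x - dot x e * x 0 i / enorm x ^+ 3) / 2).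
Proof.
move=> x0; have n0 : enorm x != 0 by rewrite enorm_eq0.
apply: has_grad_eq.
  apply: has_gradM; last exact: has_grad_cst.
  apply: has_gradD; first exact: has_grad_cst.
  by apply: has_gradM; [exact: has_grad_dot|exact: has_grad_invenorm].
by move=> i /=; field.
Qed.

Lemma rot_wt j k x : x != 0 -> rot j k wt x = wt_rot j k x.
Proof.
move=> x0; have n0 : enorm x != 0 by rewrite enorm_eq0.
by rewrite (rot_grad j k (has_grad_wt x0)) /wt_rot; field.
Qed.

Lemma rot_wt_rot j k x : j != k -> x != 0 ->
  rot j k (wt_rot j k) x = - (x 0 j * e 0 j + x 0 k * e 0 k) / (2 * enorm x).
Proof.
move=> jk x0; have n0 : enorm x != 0 by rewrite enorm_eq0.
have h : has_grad (wt_rot j k) x (fun i => ((i == j)%:R * e 0 k - (i == k)%:R * e 0 j) / (2 * enorm x)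
    - (x 0 j * e 0 k - x 0 k * e 0 j) * x 0 i / (2 * enorm x ^+ 3)).
  have -> : wt_rot j k = fun y => (y 0 j * e 0 k + - (y 0 k * e 0 j)) * (2^-1 * (enorm y)^-1).
    by apply/funext => y; rewrite /wt_rot invfM.
  have c l m := has_gradM (has_grad_coord l x) (has_grad_cst (e 0 m) x).
  apply: (has_grad_eq (has_gradM (has_gradD (c j k) (has_gradN (c k j)))
    (has_gradM (has_grad_cst 2^-1 x) (has_grad_invenorm x0)))).
  by move=> i /=; field.
rewrite (rot_grad j k h) !eqxx (negbTE jk) eq_sym (negbTE jk) /=; field.
exact: n0.
Qed.

Lemma rot_wtX n j k x : x != 0 -> rot j k (fun y => wt y ^+ n) x = n%:R * wt x ^+ n.-1 * wt_rot j k x.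
Proof.
move=> x0; have g := has_grad_comp (has_grad_wt x0) (is_derive_pow n (wt x)).
rewrite (rot_grad j k g) -(rot_wt j k x0) (rot_grad j k (has_grad_wt x0)); ring.
Qed.

Lemma differentiable_wt_rot j k x : x != 0 -> differentiable (wt_rot j k) x.
Proof.
move=> x0; have c l m := has_gradM (has_grad_coord l x) (has_grad_cst (e 0 m) x).
have -> : wt_rot j k = fun y => (y 0 j * e 0 k + - (y 0 k * e 0 j)) * (2^-1 * (enorm y)^-1).
  by apply/funext => y; rewrite /wt_rot invfM.
exact: (has_gradM (has_gradD (c j k) (has_gradN (c k j)))
    (has_gradM (has_grad_cst 2^-1 x) (has_grad_invenorm x0))).1.
Qed.

Lemma rot2_wtX n j k x : j != k -> x != 0 -> rot j k (rot j k (fun y => wt y ^+ n)) x =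
  n%:R * (n.-1%:R * wt x ^+ n.-2 * wt_rot j k x ^+ 2
     - wt x ^+ n.-1 * ((x 0 j * e 0 j + x 0 k * e 0 k) / (2 * enorm x))).
Proof.
move=> jk x0; pose p m := fun y => wt y ^+ m.
have dp m : differentiable (p m) x := (smooth_in_grad (smooth_wtX m) x0).1.
have dr := differentiable_wt_rot j k x0.
have -> : rot j k (rot j k (fun y => wt y ^+ n)) x =
    rot j k (fun y => n%:R * (p n.-1 y * wt_rot j k y)) x.
  apply: esym; apply: rot_near.
    near=> y; have y0 : y != 0 by near: y; exact: open_nonzero.
    by rewrite rot_wtX // mulrA.
  exact: (has_gradM (has_grad_cst _ x) (has_gradM (has_grad_partial (dp _)) (has_grad_partial dr))).1.
rewrite (rotM j k (has_grad_cst n%:R x).1 (has_gradM (has_grad_partial (dp _)) (has_grad_partial dr)).1).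
rewrite (rotM j k (dp _) dr) (rot_wtX _ _ _ x0) (rot_wt_rot jk x0).
by rewrite (rot_grad j k (has_grad_cst n%:R x)) /p expr2; ring.
Unshelve. all: by end_near. Qed.

Lemma rlap_wtX n x : x != 0 ->
  rlap (fun y => wt y ^+ n.+1) x = n.+1%:R ^+ 2 * wt x ^+ n - lam R n.+1 * wt x ^+ n.+1.
Proof.
move=> x0; have n0 : enorm x != 0 by rewrite enorm_eq0.
have h := fun j k jk => @rot2_wtX n.+1 j k x jk x0.
apply: (etrans (congr2 +%R (congr2 +%R (h 0 1 isT) (h 0 2%:R isT)) (h 1 2%:R isT))).
rewrite /=.
(* Lagrange's identity: the squares of the components of the cross product of [x] and [e] add up to
   [|x|^2 |e|^2 - (x . e)^2]. *)
have q : wt_rot 0 1 x ^+ 2 + wt_rot 0 2%:R x ^+ 2 + wt_rot 1 2%:R x ^+ 2 = wt x * (1 - wt x).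
  have := e1; have := sqr_enorm x; rewrite /wt /dot /wt_rot /sqn !sum3.
  move: (enorm x) n0 (x 0 0) (x 0 1) (x 0 2%:R) (e 0 0) (e 0 1) (e 0 2%:R).
  move=> s s0 a b c a' b' c' s2 ee.
  have E : (a * b' - b * a') ^+ 2 + (a * c' - c * a') ^+ 2 + (b * c' - c * b') ^+ 2 =
     s ^+ 2 - (a * a' + b * b' + c * c') ^+ 2.
    have -> : s ^+ 2 = (a ^+ 2 + b ^+ 2 + c ^+ 2) * (a' ^+ 2 + b' ^+ 2 + c' ^+ 2).
      by rewrite ee mulr1.
    by ring.
  have -> : ((a * b' - b * a') / (2 * s)) ^+ 2 + ((a * c' - c * a') / (2 * s)) ^+ 2 +
     ((b * c' - c * b') / (2 * s)) ^+ 2 = ((a * b' - b * a') ^+ 2 + (a * c' - c * a') ^+ 2 +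
     (b * c' - c * b') ^+ 2) / (4 * s ^+ 2) by field.
  by rewrite E; field.
have d : (x 0 0 * e 0 0 + x 0 1 * e 0 1) / (2 * enorm x) + (x 0 0 * e 0 0 + x 0 2%:R * e 0 2%:R) / (2 * enorm x)
   + (x 0 1 * e 0 1 + x 0 2%:R * e 0 2%:R) / (2 * enorm x) = 2 * wt x - 1.
  by rewrite /wt /dot sum3; field.
(* For [n = 0] the truncated exponent [n.-1] is compensated by the factor [n]. *)
have w2 : n%:R * (wt x ^+ n.-1 * (wt x * (1 - wt x))) = n%:R * (wt x ^+ n * (1 - wt x)).
  case: n {h} => [|m]; first by rewrite !mul0r.
  by rewrite /= [in RHS]exprSr -mulrA.
set A := (_ + _) / (2 * _) in d *; set A' := (_ + _) / (2 * _) in d *.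
set A'' := (_ + _) / (2 * _) in d *.
transitivity (n.+1%:R * (n%:R * (wt x ^+ n.-1 * (wt_rot 0 1 x ^+ 2 + wt_rot 0 2%:R x ^+ 2 + wt_rot 1 2%:R x ^+ 2))
   - wt x ^+ n * (A + A' + A''))).
  move: A A' A'' {d q w2} (wt_rot 0 1 x) (wt_rot 0 2%:R x) (wt_rot 1 2%:R x) => *; ring.
rewrite q d mulrBr [n%:R * _]w2 /lam [wt x ^+ n.+1]exprS -natr1.
by move: (wt x ^+ n) (wt x) n%:R => *; ring.
Qed.

End Weights.

(** * Concentration of the weights at a point of the sphere *)

Section Peaking.
Variables (R : realType) (e : 'rV[R]_3).
Notation V := 'rV[R]_3.
Implicit Types (F : V -> R) (x y : V).
Hypothesis e1 : sqn e = 1.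

Let e_neq0 : e != 0. Proof. by rewrite -sqn_eq0 e1 oner_eq0. Qed.

Let enorm_e : enorm e = 1. Proof. by rewrite /enorm -/(sqn e) e1 sqrtr1. Qed.

Lemma near_gt (f : V -> R) x (c : R) : {for x, continuous f} -> c < f x -> \forall y \near x, c < f y.
Proof. by move=> cf cx; exact: (@cvgr_gt R _ (nbhs x) (nbhs_filter x) f (f x) cf c cx). Qed.

Lemma wt_scale (s : R) x : 0 < s -> x != 0 -> wt e (s *: x) = wt e x.
Proof.
move=> s0 x0; have n0 : enorm x != 0 by rewrite enorm_eq0.
rewrite /wt enormZ (gtr0_norm s0).
have -> : dot (s *: x) e = s * dot x e.
  by rewrite /dot mulr_sumr; apply: eq_bigr => i _; rewrite mxE mulrA.
by congr (_ / _); congr (1 + _); field; rewrite n0 gt_eqF.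
Qed.

Lemma wt_self : wt e e = 1.
Proof.
have -> : wt e e = (1 + sqn e / enorm e) / 2.
  by rewrite /wt /dot /sqn; congr ((1 + _ / _) / 2); apply: eq_bigr => i _; rewrite expr2.
by rewrite e1 enorm_e divr1; field.
Qed.

Let wt_continuous x : x != 0 -> {for x, continuous (wt e)}.
Proof.
have s := smooth_wtX e 1; move=> x0; apply: (smooth_continuous (U := @nonzero R)) x0.
by move: s; under eq_fun do rewrite expr1.
Qed.

Section OneSided.
Variable F : V -> R.
Hypotheses (cF : forall x, x != 0 -> {for x, continuous F}).
Hypothesis hom : forall (s : R) x, 0 < s -> x != 0 -> F (s *: x) = F x.

Lemma near_direction (c : R) : c < F e -> exists d : R, [/\ 0 < d, d < 1 &
  forall x, x != 0 -> 1 - d < wt e x -> c < F x].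
Proof.
move=> cFe; have := near_gt (cF e_neq0) cFe.
move/nbhs_ballP => [eps /= eps0 hb].
pose d : R := Num.min (1/2) (eps ^+ 2 / 4).
exists d; split.
- by rewrite lt_min !divr_gt0 // exprn_gt0.
- by rewrite gt_min; apply/orP; left; lra.
move=> x x0 wx; have n0 : 0 < (enorm x)^-1 by rewrite invr_gt0 enorm_gt0.
rewrite -(hom n0 x0); apply: hb; apply/(ball_rV3 _ _ eps0) => i.
have s4 : sqn ((enorm x)^-1 *: x - e) < eps ^+ 2.
  rewrite (sqn_unit_sub e1 x0).
  have : 1 - wt e x < eps ^+ 2 / 4.
    by apply: (@lt_le_trans _ _ d); [lra|rewrite /d ge_min lexx orbT].
  by lra.
have := coord_le_enorm ((enorm x)^-1 *: x - e) i; rewrite !mxE distrC => /le_lt_trans; apply.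
rewrite -(ltr_pXn2r (n := 2)) ?nnegrE ?enorm_ge0 ?(ltW eps0) //.
by rewrite sqr_enorm.
Qed.

(** If [F e > 0], then [F > F e / 2] on the cap [wt > 1 - d]. A box inside the smaller cap
    [wt > 1 - d / 2] contributes at least a multiple of [(1 - d / 2)^n], while at most a multiple of
    [(1 - d)^n] is lost outside the cap, so the average would be positive for large [n]. *)
Lemma peak_le0 : (forall n, avg (fun x => F x * wt e x ^+ n) = 0) -> F e <= 0.
Proof.
move=> av; rewrite leNgt; apply/negP => Fe.
have [d [d0 d1 hd]] : exists d : R, [/\ 0 < d, d < 1 &
  forall x, x != 0 -> 1 - d < wt e x -> F e / 2 < F x] by apply: near_direction; lra.
pose c : R := F e / 2; have c0 : 0 < c by rewrite divr_gt0.
have [M [M0 hM]] : exists M : R, 0 <= M /\ forall x, x != 0 -> `|F x| <= M.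
  have [|M [M0 hM]] := @annulus_bounded R F 1 1 ltr01.
    by move=> x /andP[x1 _]; apply: cF; rewrite -enorm_gt0; apply: lt_le_trans x1.
  exists M; split => // x x0; have n0 : 0 < (enorm x)^-1 by rewrite invr_gt0 enorm_gt0.
  rewrite -(hom n0 x0); apply: hM.
  by rewrite enormZ (gtr0_norm n0) mulVf ?lexx // enorm_eq0.
(* A point in the direction [e] in the interior of the shell, where [zeta] equals
   [(35 / 16)^2 > 1]. *)
pose y := (3 / 2) *: e : V.
have y0 : y != 0 by rewrite scaler_eq0 negb_or e_neq0 andbT; lra.
have [r [r0 hr]] : exists r : R, 0 < r /\
    forall x, (forall i, `|x 0 i - y 0 i| < r) -> [/\ x != 0, 1 - d / 2 < wt e x & 1 < zeta x].
  have n1 : \forall x \near y, 1 - d / 2 < wt e x.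
    apply: near_gt; first exact: wt_continuous.
    by rewrite wt_scale // wt_self; lra.
  have n2 : \forall x \near y, 1 < zeta x.
    apply: near_gt; first exact: zeta_continuous.
    have sy : sqn y = 9 / 4.
      by rewrite -sqr_enorm enormZ enorm_e ger0_norm; lra.
    rewrite /zeta /shell sy /ppsq.
    have -> : Num.max 0 ((9 / 4 - 1) * (4 - 9 / 4)) = 35 / 16 :> R by rewrite max_r; lra.
    lra.
  have n3 : \forall x \near y, x != 0 by exact: open_nonzero.
  have : \forall x \near y, [/\ x != 0, 1 - d / 2 < wt e x & 1 < zeta x].
    by near=> x; split; near: x.
  move/nbhs_ballP => [r /= r0 hb]; exists r; split => // x hx.
  by apply: hb; apply/(ball_rV3 _ _ r0) => i; rewrite distrC.
pose D := box y r.
have key n p : c * (1 - d / 2) ^+ n * \1_D p - M * (1 - d) ^+ n * zeta (vec3 p) <=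
    F (vec3 p) * wt e (vec3 p) ^+ n * zeta (vec3 p).
  have [v0|v0] := eqVneq (vec3 p : V) 0.
    have z0 : zeta (vec3 p : V) = 0 by rewrite v0 zeta0.
    rewrite z0 !mulr0 subr0 indicE; case: (boolP (p \in D)); rewrite ?mulr0 // inE => /in_box /hr [].
    by rewrite v0 eqxx.
  have z0 := @zeta_ge0 R (vec3 p); have w0 := wt_ge0 e1 v0.
  have [wd|wd] := ltP (1 - d) (wt e (vec3 p)).
    have Fc : c < F (vec3 p) by exact: hd.
    have t0 : 0 <= M * (1 - d) ^+ n * zeta (vec3 p).
      by apply: mulr_ge0 => //; apply: mulr_ge0 => //; apply: exprn_ge0; lra.
    apply: (@le_trans _ _ (c * (1 - d / 2) ^+ n * \1_D p)); first by rewrite gerBl.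
    rewrite indicE; case: (boolP (p \in D)); rewrite ?mulr0 ?mulr1.
      rewrite inE => /in_box /hr [_ wx zx].
      apply: (@le_trans _ _ (F (vec3 p) * wt e (vec3 p) ^+ n)).
        apply: ler_pM => //; [exact: ltW|by apply: exprn_ge0; lra|exact: ltW|].
        by apply: lerXn2r; rewrite ?nnegrE ?(ltW wx) //; lra.
      by rewrite ler_peMr ?(ltW zx) //; apply: mulr_ge0; [lra|exact: exprn_ge0].
    by move=> _; apply: mulr_ge0 => //; apply: mulr_ge0; [lra|exact: exprn_ge0].
  have -> : (\1_D p : R) = 0.
    rewrite indicE; case: (boolP (p \in D)) => //; rewrite inE => /in_box /hr [_ wx _]; lra.
  rewrite mulr0 sub0r -mulNr; apply: ler_wpM2r => //.
  have : `|F (vec3 p) * wt e (vec3 p) ^+ n| <= M * (1 - d) ^+ n.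
    rewrite normrM (ger0_norm (exprn_ge0 _ w0)); apply: ler_pM => //; [exact: exprn_ge0|exact: hM|].
    by apply: lerXn2r; rewrite ?nnegrE //; lra.
  by rewrite ler_norml => /andP[].
have iD : (leb3 R).-integrable setT (EFin \o (\1_D : R * (R * R) -> R)).
  have [B [B0 hB]] : exists B : R, 0 < B /\ forall p, D p -> box 0 B p.
    exists (2 + r); split; first lra.
    move=> p /in_box pD; apply/in_box0 => i; have := pD i.
    have yi : `|y 0 i| <= 3 / 2.
      by apply: (le_trans (coord_le_enorm y i)); rewrite enormZ enorm_e ger0_norm; lra.
    move=> pi; have := ler_normD (vec3 p 0 i - y 0 i) (y 0 i); rewrite subrK; lra.
  apply: (integrable_box (B := B) (M := 1)) => //.
  - by apply: measurable_indic; exact: measurable_box.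
  - by move=> p; rewrite indicE; case: (p \in D); rewrite ?normr1 ?normr0.
  - by move=> p np; rewrite indicE memNset // => /hB.
have iz : (leb3 R).-integrable setT (EFin \o (fun p => zeta (vec3 p))).
  have i1 : (leb3 R).-integrable setT (EFin \o (fun p => 1 * zeta (vec3 p))).
    by apply: (@integrable_avg R (fun=> 1)) => x _; exact: ct_cst.
  have -> : (fun p => zeta (vec3 p)) = (fun p => 1 * zeta (vec3 p)) :> (R * (R * R) -> R).
    by apply/funext => p; rewrite mul1r.
  exact: i1.
pose Z := \int[leb3 R]_p zeta (vec3 p).
have main n : c * (1 - d / 2) ^+ n * (2 * r) ^+ 3 <= M * (1 - d) ^+ n * Z.
  have iF : (leb3 R).-integrable setT (EFin \o (fun p => F (vec3 p) * wt e (vec3 p) ^+ n * zeta (vec3 p))).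
    apply: (@integrable_avg R (fun x => F x * wt e x ^+ n)) => x x0.
    by apply: ct_mul; [exact: cF|apply: ct_exp; exact: wt_continuous].
  have iL1 := integrableZl measurableT (c * (1 - d / 2) ^+ n) iD.
  have iL2 := integrableZl measurableT (M * (1 - d) ^+ n) iz.
  have iL := integrableB measurableT iL1 iL2.
  have := @le_Rintegral _ _ _ (leb3 R) setT
    (fun p => c * (1 - d / 2) ^+ n * \1_D p - M * (1 - d) ^+ n * zeta (vec3 p)) _ measurableT iL iF.
  move=> /(_ (fun p _ => key n p)); rewrite [X in _ <= X -> _](av n).
  rewrite RintegralB // !RintegralZl // -/Z subr_le0.
  have -> : \int[leb3 R]_p (\1_D p : R) = (2 * r) ^+ 3.
    rewrite /Rintegral integral_indic ?setIT //; last exact: measurable_box.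
    by rewrite [X in fine X](@mu3_box R y r r0).
  by [].
have Z0 : 0 <= Z by apply: Rintegral_ge0 => p _; exact: zeta_ge0.
pose q : R := (1 - d) / (1 - d / 2).
have q0 : 0 < q by rewrite divr_gt0; lra.
have q1 : q < 1 by rewrite /q ltr_pdivrMr; lra.
pose K : R := c * (2 * r) ^+ 3.
have K0 : 0 < K by rewrite mulr_gt0 // exprn_gt0 // mulr_gt0.
have hK n : K <= M * Z * q ^+ n.
  have a0 : 0 < (1 - d / 2) ^+ n by apply: exprn_gt0; lra.
  rewrite /q expr_div_n mulrA ler_pdivlMr //; have := main n; rewrite /K; lra.
have : (fun n => M * Z * q ^+ n) @ \oo --> (M * Z * 0).
  apply: cvgMr; apply: cvg_expr; by rewrite gtr0_norm.
rewrite mulr0 => /cvgrPdist_lt /(_ K K0) [N _ /(_ N (leqnn N))] /=.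
have := hK N; rewrite sub0r normrN ger0_norm; first lra.
by rewrite !mulr_ge0 // exprn_ge0 // ltW.
Unshelve. all: by end_near. Qed.

End OneSided.

(* The weights [wt e ^+ n] concentrate at [e]. *)
Lemma peak F : (forall x, x != 0 -> {for x, continuous F}) ->
  (forall (s : R) x, 0 < s -> x != 0 -> F (s *: x) = F x) ->
  (forall n, avg (fun x => F x * wt e x ^+ n) = 0) -> F e = 0.
Proof.
move=> cF hom av; apply/le_anti/andP; split; first exact: peak_le0 cF hom av.
rewrite -oppr_le0; apply: (@peak_le0 (fun x => - F x)).
- by move=> x x0; apply: ct_opp; exact: cF.
- by move=> s x s0 x0; rewrite hom.
move=> n; rewrite -[RHS](mulr0 (-1)) -(av n) -avgZ.
  by apply: eq_avg => x x0; rewrite mulN1r mulNr.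
by move=> x x0; apply: ct_mul; [exact: cF|apply: ct_exp; exact: wt_continuous].
Qed.

End Peaking.

(** * An inequality in place of polar coordinates *)

Section PolarBound.
Variable R : realType.
Notation V := 'rV[R]_3.
Notation T3 := (R * (R * R))%type.
Notation mu := (@lebesgue_measure R).
Notation mu3 := (leb3 R).

Lemma measurable_inv : measurable_fun [set: R] (fun t : R => t^-1).
Proof.
have -> : [set: R] = [set t : R | t != 0] `|` [set 0].
  by apply/seteqP; split => t // _ /=; have [->|] := eqVneq t 0; [right|left].
have oN : open [set t : R | t != 0].
  by rewrite (_ : mkset _ = ~` [set 0]); [apply: closed_openC; exact: closed_eq|apply/seteqP; split => t /= /eqP].
apply/measurable_funU => //; first exact: open_measurable.
split; last exact: measurable_fun_set1.
apply: open_continuous_measurable_fun => // t /set_mem /= t0.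
by apply: (@ct_inv _ _ (fun t : R => t)) => //; exact: cvg_id.
Qed.

Lemma measurable_scale3_joint : measurable_fun setT (fun q : R * T3 => scale3 q.1 q.2).
Proof.
have m1 : measurable_fun setT (fun q : R * T3 => q.1) by exact: measurable_fst.
have m2 : measurable_fun setT (fun q : R * T3 => q.2.1).
  exact: (measurableT_comp measurable_fst measurable_snd).
have m3 : measurable_fun setT (fun q : R * T3 => q.2.2.1).
  exact: (measurableT_comp measurable_fst (measurableT_comp measurable_snd measurable_snd)).
have m4 : measurable_fun setT (fun q : R * T3 => q.2.2.2).
  exact: (measurableT_comp measurable_snd (measurableT_comp measurable_snd measurable_snd)).
apply/measurable_fun_pairP; split; first exact: (measurable_funM m1 m2).
by apply/measurable_fun_pairP; split; [exact: (measurable_funM m1 m3)|exact: (measurable_funM m1 m4)].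
Qed.

Let N (p : T3) : R := enorm (vec3 p).
Let z (p : T3) : R := zeta (vec3 p).
Let pos (s : R) : R := \1_(`]0%R, +oo[%classic) s.

Let mN : measurable_fun setT N.
Proof. by apply: (@measurable_vec3_continuous R (@enorm R)); exact: enorm_continuous. Qed.

Let mz : measurable_fun setT z.
Proof. by apply: (@measurable_vec3_continuous R (@zeta R)); exact: zeta_continuous. Qed.

Let mpos : measurable_fun setT pos. Proof. exact: measurable_indic. Qed.

Let N0 p : 0 <= N p. Proof. exact: enorm_ge0. Qed.
Let z0 p : 0 <= z p. Proof. exact: zeta_ge0. Qed.
Let pos0 s : 0 <= pos s. Proof. by rewrite /pos indicE. Qed.
Let posE s : 0 < s -> pos s = 1.
Proof. by move=> s0; rewrite /pos indicE mem_set //= in_itv /= s0. Qed.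
Let posN s : ~~ (0 < s) -> pos s = 0.
Proof. by move=> s0; rewrite /pos indicE memNset //= in_itv /= andbT; apply/negP. Qed.

Let z_eq0 p : N p = 0 -> z p = 0.
Proof.
by move=> p0; apply: zeta_eq0; rewrite -sqr_enorm -/(N p) p0 expr0n /= ltr10.
Qed.

Variable Q : T3 -> R.
Hypotheses (mQ : measurable_fun setT Q) (Q0 : forall p, 0 <= Q p).

(** [A], [B] and [D] are the integrands before, between and after the substitutions [r = |p| s] and
    [y = s p]; [pos] restricts the radius to positive values. *)
Let A (q : R * T3) : \bar R := (pos q.1 * Q (scale3 (q.1 / N q.2) q.2) * z q.2)%:E.
Let B (q : R * T3) : \bar R := (N q.2 * pos q.1 * Q (scale3 q.1 q.2) * z q.2)%:E.
Let D (q : R * T3) : \bar R := (pos q.1 * q.1^-1 ^+ 4 * N q.2 * Q q.2 * z (scale3 q.1^-1 q.2))%:E.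

Let mfst (f : R -> R) : measurable_fun setT f -> measurable_fun setT (fun q : R * T3 => f q.1).
Proof. by move=> mf; exact: (measurableT_comp mf measurable_fst). Qed.

Let msnd (f : T3 -> R) : measurable_fun setT f -> measurable_fun setT (fun q : R * T3 => f q.2).
Proof. by move=> mf; exact: (measurableT_comp mf measurable_snd). Qed.

Let mscale (f : T3 -> R) (k : R * T3 -> R) : measurable_fun setT f -> measurable_fun setT k ->
  measurable_fun setT (fun q => f (scale3 (k q) q.2)).
Proof.
move=> mf mk; apply: (measurableT_comp mf).
have mp : measurable_fun setT (fun q : R * T3 => (k q, q.2)).
  by apply/measurable_fun_pairP; split => //; exact: measurable_snd.
exact: (measurableT_comp measurable_scale3_joint mp).
Qed.

Let mA : measurable_fun setT A.
Proof.
apply/measurable_EFinP; apply: measurable_funM; last exact: msnd.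
apply: measurable_funM; first exact: (mfst mpos).
apply: (mscale mQ); apply: measurable_funM; first exact: measurable_fst.
by apply: (msnd (f := fun p => (N p)^-1)); exact: (measurableT_comp measurable_inv mN).
Qed.

Let mB : measurable_fun setT B.
Proof.
apply/measurable_EFinP; apply: measurable_funM; last exact: msnd.
apply: measurable_funM; last by apply: (mscale mQ); exact: measurable_fst.
by apply: measurable_funM; [exact: msnd|exact: (mfst mpos)].
Qed.

Let mD : measurable_fun setT D.
Proof.
apply/measurable_EFinP; apply: measurable_funM; last first.
  by apply: (mscale mz); apply: (mfst (f := fun t => t^-1)); exact: measurable_inv.
apply: measurable_funM; last exact: msnd.
apply: measurable_funM; last exact: msnd.
apply: measurable_funM; first exact: (mfst mpos).
by apply: (mfst (f := fun t => t^-1 ^+ 4)); apply: measurable_funX; exact: measurable_inv.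
Qed.

Local Lemma polar_radial_ge0 q : (0 <= A q)%E.
Proof. by rewrite lee_fin; exact: (mulr_ge0 (mulr_ge0 (pos0 _) (Q0 _)) (z0 _)). Qed.
Local Lemma polar_scaled_ge0 q : (0 <= B q)%E.
Proof. by rewrite lee_fin; exact: (mulr_ge0 (mulr_ge0 (mulr_ge0 (N0 _) (pos0 _)) (Q0 _)) (z0 _)). Qed.
Local Lemma polar_kernel_ge0 q : (0 <= D q)%E.
Proof.
rewrite lee_fin; have [s0|s0] := boolP (0 < q.1); last by rewrite (posN s0) !mul0r.
have i0 : 0 <= q.1^-1 ^+ 4 by rewrite exprn_ge0 // invr_ge0 ltW.
exact: (mulr_ge0 (mulr_ge0 (mulr_ge0 (mulr_ge0 (pos0 _) i0) (N0 _)) (Q0 _)) (z0 _)).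
Qed.

Local Lemma polar_radial_scaled : (\int[mu]_s \int[mu3]_p A (s, p) = \int[mu]_s \int[mu3]_p B (s, p))%E.
Proof.
rewrite (@fubini_tonelli _ _ _ _ R mu mu3 A mA polar_radial_ge0) (@fubini_tonelli _ _ _ _ R mu mu3 B mB polar_scaled_ge0).
apply: eq_integral => p _; have [Np|Np] := eqVneq (N p) 0.
  transitivity (\int[mu]_s (0 : \bar R))%E; last apply: esym; rewrite ?integral0;
    by apply: integral0_eq => s _; rewrite /A /B /= (z_eq0 Np) mulr0.
have Np0 : 0 < N p by rewrite lt_def Np; exact: N0.
have h := @ge0_integral_scale R (N p) (fun s => A (s, p)) Np0 (measurableT_comp mA (measurable_pair2 p)) (fun s => polar_radial_ge0 _).
transitivity ((N p)%:E * \int[mu]_s A (N p * s, p)%R)%E.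
  by rewrite h muleA -EFinM divff // mul1e.
have mAs : measurable_fun setT (fun s => A (N p * s, p)).
  apply: (measurableT_comp mA); apply/measurable_fun_pairP; split; last exact: measurable_cst.
  have m : measurable_fun [set: R] (fun x : R => N p * x) by exact: measurable_funM.
  exact: m.
have E := @ge0_integralZl_EFin _ _ _ mu setT measurableT _ (fun s _ => polar_radial_ge0 (N p * s, p)) mAs _ (N0 p).
apply: (etrans (esym E)).
apply: eq_integral => s _; rewrite /A /B /= -EFinM; congr EFin.
have -> : pos (N p * s) = pos s.
  have [s0|s0] := boolP (0 < s); first by rewrite !posE // mulr_gt0.
  by rewrite !posN // pmulr_rgt0.
have -> : N p * s / N p = s by field.
by rewrite !mulrA.
Qed.

Local Lemma polar_scaled_kernel : (\int[mu]_s \int[mu3]_p B (s, p) = \int[mu]_s \int[mu3]_p D (s, p))%E.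
Proof.
apply: eq_integral => s _; have [s0|s0] := boolP (0 < s); last first.
  by rewrite !integral0_eq // => p _; rewrite /B /D /= (posN s0) !(mul0r, mulr0).
have is0 : 0 < s^-1 by rewrite invr_gt0.
have h := @ge0_integral_scale3 R s (fun p => (s^+3)%:E * D (s, p))%E s0.
transitivity (\int[mu3]_p ((s ^+ 3)%:E * D (s, scale3 s p)))%E.
  apply: eq_integral => p _; rewrite /B /D /= posE // -EFinM; congr EFin.
  have -> : scale3 s^-1 (scale3 s p) = p.
    by case: p => a [b c]; rewrite /scale3 /= !mulrA mulVf ?gt_eqF // !mul1r.
  by rewrite {2}/N vec3_scale enormZ (gtr0_norm s0) -/(N p); field; rewrite gt_eqF.
have mDs : measurable_fun setT (fun p => D (s, p)).
  by apply: (measurableT_comp mD); exact: measurable_pair1.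
rewrite h.
- have s30 : 0 <= s ^+ 3 by rewrite exprn_ge0 // ltW.
  have E := @ge0_integralZl_EFin _ _ _ mu3 setT measurableT (fun p => D (s, p)) (fun p _ => polar_kernel_ge0 _) mDs _ s30.
  apply: (etrans (congr1 (fun y => (s^-1 ^+ 3)%:E * y)%E E)).
  by rewrite muleA -EFinM -exprMn mulVf ?gt_eqF // expr1n mul1e.
- by apply: emeasurable_funM => //; exact: measurable_cst.
- move=> p; apply: mule_ge0; last exact: polar_kernel_ge0.
  by rewrite lee_fin exprn_ge0 // ltW.
Qed.

Local Lemma polar_weight_ge0 (c : R) n p : 0 <= c -> 0 <= c * (N p)^-1 ^+ n * Q p.
Proof.
move=> c0; have i0 : 0 <= (N p)^-1 ^+ n by apply: exprn_ge0; rewrite invr_ge0; exact: N0.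
exact: (mulr_ge0 (mulr_ge0 c0 i0) (Q0 p)).
Qed.

Local Lemma polar_kernel_le p : (\int[mu]_s D (s, p) <= (48 * (N p)^-1 ^+ 2 * Q p)%:E)%E.
Proof.
have [Np|Np] := eqVneq (N p) 0.
  rewrite integral0_eq; first by rewrite lee_fin polar_weight_ge0.
  by move=> s _; rewrite /D /= Np mulr0 !mul0r.
have Np0 : 0 < N p by rewrite lt_def Np; exact: N0.
(* On the support [s] lies between [N p / 2] and [N p], so [s^-4] is at most [2^4 (N p)^-4], and
   [zeta <= 6]: hence [96 = 2^4 * 6]. The interval has length [N p / 2], which leaves 48. *)
pose K : R := 96 * (N p)^-1 ^+ 3 * Q p.
have K0 : 0 <= K by exact: polar_weight_ge0.
pose I := `]N p / 2, N p[%classic.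
apply: (@le_trans _ _ (\int[mu]_s (K * \1_I s)%:E)%E).
  apply: ge0_le_integral => //.
  - by move=> s _; exact: polar_kernel_ge0.
  - by apply: (measurableT_comp mD); exact: measurable_pair2.
  - apply/measurable_EFinP; apply: measurable_funM; first exact: measurable_cst.
    by apply: measurable_indic; exact: measurable_itv.
  move=> s _; rewrite /D lee_fin /=; have [s0|s0] := boolP (0 < s); last first.
    by rewrite (posN s0) !mul0r mulr_ge0 // indicE.
  have is0 : 0 < s^-1 by rewrite invr_gt0.
  rewrite posE // mul1r.
  have sq : sqn (vec3 (scale3 s^-1 p) : V) = (N p / s) ^+ 2.
    by rewrite vec3_scale -sqr_enorm enormZ gtr0_norm ?invr_gt0 // mulrC.
  have [ni|ni] := boolP (1 < (N p / s) ^+ 2 < 4); last first.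
    have -> : z (scale3 s^-1 p) = 0 by apply: zeta_eq0; rewrite sq.
    by rewrite mulr0 mulr_ge0 // indicE.
  have q0 : 0 < N p / s by rewrite divr_gt0.
  have {ni} /andP[h1 h2] : (1 < N p / s) && (N p / s < 2).
    by case/andP: ni => a b; apply/andP; split; nra.
  have sN : s < N p by move: h1; rewrite ltr_pdivlMr // mul1r.
  have Ns : N p / 2 < s by move: h2; rewrite ltr_pdivrMr // ltr_pdivrMr // mulrC.
  rewrite indicE mem_set ?mulr1; last by rewrite /I /= in_itv /= Ns sN.
  have zl : z (scale3 s^-1 p) <= 6 by exact: zeta_le.
  have i1 : s^-1 <= 2 * (N p)^-1.
    by rewrite -[X in X * _]invrK -invfM lef_pV2 ?posrE ?mulr_gt0 ?invr_gt0 // mulrC ltW.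
  have i4 : s^-1 ^+ 4 <= (2 * (N p)^-1) ^+ 4.
    have j0 : 0 <= 2 / N p by rewrite divr_ge0 // N0.
    by apply: lerXn2r; rewrite ?nnegrE // (ltW is0).
  apply: (@le_trans _ _ ((2 * (N p)^-1) ^+ 4 * N p * Q p * 6)).
    have s40 : 0 <= s^-1 ^+ 4 by rewrite exprn_ge0 // invr_ge0 ltW.
    apply: ler_pM => //; first exact: (mulr_ge0 (mulr_ge0 s40 (N0 p)) (Q0 p)).
    by apply: ler_wpM2r => //; apply: ler_wpM2r.
  by rewrite le_eqVlt; apply/orP; left; apply/eqP; rewrite /K; field.
rewrite (_ : (fun s => _) = (fun s => K%:E * (\1_I s)%:E)%E); last by apply/funext => s; rewrite EFinM.
rewrite ge0_integralZl_EFin //; last first.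
  by apply/measurable_EFinP; apply: measurable_indic; exact: measurable_itv.
rewrite integral_indic //; last exact: measurable_itv.
have IE : mu (I `&` setT) = (N p - N p / 2)%:E.
  by rewrite setIT /I lebesgue_measure_itv /= lte_fin ifT ?EFinB //; lra.
apply: (le_trans (y := (K%:E * (N p - N p / 2)%:E)%E)).
  exact: (eq_ind _ (fun y => (K%:E * y <= _)%E) (lexx _) _ (esym IE)).
rewrite -EFinM lee_fin le_eqVlt; apply/orP; left; apply/eqP; rewrite /K; field.
exact: Np.
Qed.

(* Polar coordinates with the shell [1 < |x| < 2] in place of the sphere: after the
   substitutions [r = |p| s] and [y = s p] only the factor [\int s^-4 zeta(y/s) |y|^3 ds <= 48]
   is left. *)
Lemma polar_bound :
  (\int[mu]_s \int[mu3]_p (pos s * Q (scale3 (s / N p) p) * z p)%:E <=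
   \int[mu3]_p (48 * (N p)^-1 ^+ 2 * Q p)%:E)%E.
Proof.
rewrite [leLHS]polar_radial_scaled polar_scaled_kernel (@fubini_tonelli _ _ _ _ R mu mu3 D mD polar_kernel_ge0).
apply: ge0_le_integral => //.
- by move=> p _; apply: integral_ge0 => s _; exact: polar_kernel_ge0.
- exact: (@measurable_fun_fubini_tonelli_G _ _ _ _ R mu D mD polar_kernel_ge0).
- apply/measurable_EFinP; apply: measurable_funM => //; apply: measurable_funM; first exact: measurable_cst.
  by apply: measurable_funX; exact: (measurableT_comp measurable_inv mN).
- by move=> p _; exact: polar_kernel_le.
Qed.

Lemma measurable_polar : measurable_fun setT
  (fun q : R * T3 => (pos q.1 * Q (scale3 (q.1 / N q.2) q.2) * z q.2)%:E).
Proof. exact: mA. Qed.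

End PolarBound.

(** * The energy of the moments of a function *)

Section Energy.
Variables (R : realType) (L : R) (h : R -> R) (W : set R).
Notation V := 'rV[R]_3.
Notation T3 := (R * (R * R))%type.
Notation mu := (@lebesgue_measure R).
Implicit Types (u f g : V -> R) (x : V) (U : set V).
Hypotheses (L0 : 0 < L) (sh : smooth1_in W h) (LW : forall t, 0 <= t <= L -> W t).
Hypothesis hpos : forall t, 0 <= t < L -> 0 < h t.

Lemma profile_gt0 r : 0 < r -> r <= L -> 0 < h (L - r).
Proof. by move=> r0 rL; apply: hpos; rewrite subr_ge0 rL /= gtrBl. Qed.

Lemma le_avg f g : (forall x, x != 0 -> {for x, continuous f}) ->
  (forall x, x != 0 -> {for x, continuous g}) -> (forall x, x != 0 -> f x <= g x) -> avg f <= avg g.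
Proof.
move=> cf cg fg; have If := integrable_avg cf; have Ig := integrable_avg cg.
apply: (@le_Rintegral _ _ _ (leb3 R) setT _ _ measurableT If Ig) => p _.
have [v0|v0] := eqVneq (vec3 p : V) 0.
  have z0 : zeta (vec3 p : V) = 0 by rewrite v0 zeta0.
  by rewrite z0 !mulr0.
by apply: ler_wpM2r; [exact: zeta_ge0|exact: fg].
Qed.

(** Cauchy-Schwarz, obtained from [(f g - t)^2 >= 0] at [t = m / (Z + 1)]. The 1 added to the total
    mass [Z] keeps the divisor positive. *)
Lemma avg_sqr_le f g : (forall x, x != 0 -> {for x, continuous f}) ->
  (forall x, x != 0 -> {for x, continuous g}) -> (forall x, x != 0 -> `|g x| <= 1) ->
  avg (fun x => f x * g x) ^+ 2 <= (avg (fun=> 1 : R) + 1) * avg (fun x => f x ^+ 2).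
Proof.
move=> cf cg g1; set Z := avg (fun=> 1 : R); set m := avg (fun x => f x * g x); set q := avg (fun x => f x ^+ 2).
have c1 (x : V) : x != 0 -> {for x, continuous (fun=> 1 : R)} by move=> _; exact: ct_cst.
have cfg x : x != 0 -> {for x, continuous (fun x => f x * g x)} by move=> x0; apply: ct_mul; [exact: cf|exact: cg].
have Z0 : 0 <= Z.
  by apply: Rintegral_ge0 => p _; rewrite mul1r; exact: zeta_ge0.
have key (t : R) : 2 * t * m - t ^+ 2 * Z <= q.
  have -> : 2 * t * m - t ^+ 2 * Z = avg (fun x => 2 * t * (f x * g x) + - t ^+ 2 * 1).
    rewrite (@avgD R (fun x => 2 * t * (f x * g x)) (fun x => - t ^+ 2 * 1)).
    - by rewrite (@avgZ R (2 * t)) // (@avgZ R (- t ^+ 2) (fun=> 1)) // mulNr.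
    - by move=> x x0; apply: ct_mul; [exact: ct_cst|exact: cfg].
    - by move=> x x0; exact: ct_cst.
  apply: le_avg => [x x0|x x0|x x0].
  - by apply: ct_add; [apply: ct_mul; [exact: ct_cst|exact: cfg]|exact: ct_cst].
  - by apply: ct_exp; exact: cf.
  have gg : g x ^+ 2 <= 1 by rewrite -real_normK ?num_real // expr_le1 // g1.
  have : 0 <= (f x * g x - t) ^+ 2 by exact: sqr_ge0.
  have : f x ^+ 2 * g x ^+ 2 <= f x ^+ 2 by rewrite ler_piMr // sqr_ge0.
  by nra.
have Zp : 0 < Z + 1 by lra.
have {}key := key (m / (Z + 1)); rewrite mulrC -ler_pdivrMr //.
apply: le_trans key; rewrite -subr_ge0.
have -> : 2 * (m / (Z + 1)) * m - (m / (Z + 1)) ^+ 2 * Z - m ^+ 2 / (Z + 1) = (m / (Z + 1)) ^+ 2.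
  by field; rewrite gt_eqF.
exact: sqr_ge0.
Qed.

(** What is dropped is the tangential energy, a sum of squares. *)
Lemma flux_dot_ge u x : x != 0 -> h (L - enorm x) ^+ 2 * dru u x ^+ 2 / enorm x ^+ 2 <=
  \sum_i flux L h u i x * partial i u x.
Proof.
move=> x0; have n0 : enorm x != 0 by rewrite enorm_eq0.
have s0 : sqn x != 0 by rewrite sqn_eq0.
have -> : \sum_i flux L h u i x * partial i u x =
    \sum_i (tang u i x ^+ 2 + (x 0 i * partial i u x) * ((1 + (h (L - enorm x) / enorm x) ^+ 2) * euler u x / sqn x)
     - x 0 i ^+ 2 * (euler u x / sqn x) ^+ 2).
  by apply: eq_bigr => i _; rewrite /flux /tang; field; rewrite n0 s0.
rewrite sumrB big_split /= -!mulr_suml -/(euler u x) -/(sqn x).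
have -> : euler u x * ((1 + (h (L - enorm x) / enorm x) ^+ 2) * euler u x / sqn x)
    = h (L - enorm x) ^+ 2 * dru u x ^+ 2 / enorm x ^+ 2 + sqn x * (euler u x / sqn x) ^+ 2.
  by rewrite /dru -sqr_enorm; field.
rewrite addrA addrK lerDr; apply: sumr_ge0 => i _; exact: sqr_ge0.
Qed.

(** On each sphere, Cauchy-Schwarz bounds the squared moment by a multiple of the mean square of the
    radial derivative; [polar_bound] turns the integral of these over the radius into one over the
    ball, where the energy density dominates its radial part. The conclusion is phrased with [phi]
    to match the [energy] hypothesis on radial solutions. *)
Lemma energy_bound U u g : open U -> U `<=` @nonzero R -> smooth_in U u ->
  (forall x, 0 < enorm x < L -> U x) ->
  (@lebesgue3 R).-integrable (punctured_ball L) (integrand L h (grad_dot (revolution_metric L h) u u)) ->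
  (forall x, x != 0 -> {for x, continuous g}) -> (forall x, x != 0 -> `|g x| <= 1) ->
  exists D : R, forall (r s : R) (phi dphi : R -> R), 0 < r -> r < s -> s < L ->
    (forall t, r <= t <= s -> is_derive t 1 phi (dphi t)) ->
    (forall t, r <= t <= s -> dphi t <= h (L - t) ^+ 2 * mom (dru u) g t ^+ 2) ->
    phi s - phi r <= D.
Proof.
move=> oU U0 su LU ie cg g1.
pose A := [set x : V | 0 < enorm x < L].
have oA : open A by exact: open_annulus.
have sA : smooth_in A u by apply: smooth_in_sub su.
have A0 : A `<=` @nonzero R by move=> x /andP[]; rewrite enorm_gt0.
have AL x : A x -> 0 < enorm x <= L by move=> /andP[-> /ltW].
pose q x := h (L - enorm x) ^+ 2 * dru u x ^+ 2.
have cdru x : A x -> {for x, continuous (dru u)}.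
  by apply: smooth_continuous; exact: smooth_dru.
have cq x : A x -> {for x, continuous q}.
  move=> Ax; apply: ct_mul; apply: ct_exp; last exact: cdru.
  by apply: (smooth_continuous (U := A)) => //; apply: alg3_smooth_in => //; exact: (alg3_profile (W := W)).
have q0 x : 0 <= q x by rewrite mulr_ge0 // sqr_ge0.
have Ar (s : R) x : 0 < s < L -> x != 0 -> A (ray s x).
  by move=> /andP[s0 sL] x0; rewrite /A /= enorm_ray ?ltW // s0.
pose Zp := avg (fun=> 1 : R) + 1.
have Zp0 : 0 <= Zp.
  by apply: addr_ge0 => //; apply: Rintegral_ge0 => p _; rewrite mul1r; exact: zeta_ge0.
have m1q t : 0 < t < L -> h (L - t) ^+ 2 * mom (dru u) g t ^+ 2 <= Zp * mom q (fun=> 1) t.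
  move=> tL; have cr x : x != 0 -> {for x, continuous (fun y => dru u (ray t y))}.
    by move=> x0; apply: continuous_ray => //; apply: cdru; exact: Ar.
  have := avg_sqr_le cr cg g1; rewrite -/Zp -/(mom (dru u) g t) => H1.
  have -> : mom q (fun=> 1) t = h (L - t) ^+ 2 * avg (fun x => dru u (ray t x) ^+ 2).
    rewrite -avgZ; last by move=> x x0; apply: ct_exp; exact: cr.
    apply: eq_avg => x x0; rewrite mulr1 /q enorm_ray //; by case/andP: tL => /ltW.
  by rewrite [leRHS]mulrCA; apply: ler_wpM2l => //; exact: sqr_ge0.
pose E0 := fine (\int[leb3 R]_(p in punctured_ball L) integrand L h (grad_dot (revolution_metric L h) u u) p)%E.
exists (Zp * (48 * E0)) => r s phi dphi r0 rs sL dp dle.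
(* Clamping the radius to [[r, s]] makes [Psi] continuous on the whole line, so that it has a
   primitive to compare with [phi]. *)
pose cl (t : R) : R := Num.min (Num.max r t) s.
have clE t : r <= t <= s -> cl t = t by move=> /andP[rt ts]; rewrite /cl max_r // min_l.
have cl_in t : 0 < cl t < L.
  by rewrite /cl lt_min gt_min lt_max r0 sL orbT (lt_trans r0 rs).
pose Psi t := mom q (fun=> 1) (cl t).
have cPsi : continuous Psi.
  apply: ctP => t; apply: (ct_comp (g := fun y : R => mom q (fun=> 1) (Num.min y s)) (f := fun y : R => Num.max r y)).
    by apply: continuous_max; [exact: cst_continuous|exact: cvg_id].
  apply: mom_continuous; [by rewrite lt_max r0|exact: lt_trans rs| |].
    by move=> x /andP[x0 xs]; apply: cq; rewrite /A /= x0 (le_lt_trans xs).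
  by move=> x x0; exact: ct_cst.
have step1 : phi s - phi r <= Zp * (prim Psi s - prim Psi r).
  have : Zp * prim Psi r - phi r <= Zp * prim Psi s - phi s.
    apply: (@le_of_derive_cc _ (fun t => Zp * prim Psi t + - phi t) (fun t => Zp * Psi t + - dphi t)) => //; first exact: ltW.
      move=> t /[dup] trs /andP[rt ts]; apply: is_derive_add.
        by apply: is_derive_scale; apply: is_derive_prim => //; lra.
      by apply: is_derive_opp; exact: dp.
    move=> t trs; rewrite subr_ge0; apply: (le_trans (dle t trs)); rewrite /Psi clE //.
    by apply: m1q; rewrite -(clE t trs).
  lra.
apply: (le_trans step1); apply: ler_wpM2l => //.
pose S : set T3 := [set p | r <= enorm (vec3 p) <= s].
have mS : measurable S.
  have me : measurable_fun setT (fun p : T3 => enorm (vec3 p)).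
    by apply: (@measurable_vec3_continuous R (@enorm R)); exact: enorm_continuous.
  have -> : S = setT `&` (fun p : T3 => enorm (vec3 p)) @^-1` `[r, s]%classic.
    by rewrite setTI; apply/seteqP; split => p; rewrite /S /= in_itv.
  by apply: me => //; exact: measurable_itv.
(* [polar_bound] takes a nonnegative measurable function on all of space, so the radial energy is
   cut to the closed shell [S], which lies inside the punctured ball. *)
pose Q : T3 -> R := (fun p => q (vec3 p)) \_ S.
have QS p : S p -> Q p = q (vec3 p) by move=> Sp; rewrite /Q patchE mem_set.
have QnS p : ~ S p -> Q p = 0 by move=> Sp; rewrite /Q patchE memNset.
have Q0 p : 0 <= Q p by rewrite /Q patchE; case: ifP.
have mQ : measurable_fun setT Q.
  apply/measurable_restrict => //; rewrite setTI.
  apply: (measurable_funS (measurable_vec3_open oA)); last exact: measurable_fun_vec3.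
  by move=> p /andP[rp ps]; rewrite /A /=; apply/andP; split; [exact: lt_le_trans rp|exact: le_lt_trans sL].
have pb := polar_bound mQ Q0.
have dPsi : (prim Psi s - prim Psi r)%:E = (\int[mu]_(t in `]r, s]) (Psi t)%:E)%E.
  have iPsi (a b : R) : mu.-integrable `[a, b] (EFin \o Psi).
    by apply: continuous_compact_integrable; [exact: segment_compact|exact: continuous_subspaceT].
  rewrite /prim opprB addrA subrK (@Rintegral_itvB _ _ (BLeft (-1)) (BRight s)) //; [|by rewrite bnd_simp; lra|by rewrite bnd_simp ltW].
  rewrite /Rintegral fineK //; apply: integrable_fin_num => //.
  by apply: (integrableS _ _ _ (iPsi r s)) => //; apply: subset_itvr; rewrite bnd_simp.
rewrite -lee_fin dPsi.
have step2 : (\int[mu]_(t in `]r, s]) (Psi t)%:E <=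
    \int[mu]_t \int[leb3 R]_p (\1_(`]0%R, +oo[%classic) t * Q (scale3 (t / enorm (vec3 p)) p) * zeta (vec3 p))%:E)%E.
  pose G (t : R) : \bar R := (\int[leb3 R]_p (\1_(`]0%R, +oo[%classic) t *
    Q (scale3 (t / enorm (vec3 p)) p) * zeta (vec3 p))%:E)%E.
  have mG : measurable_fun setT G.
    have G0 (v : R * T3) : (0 <= (\1_(`]0%R, +oo[%classic) v.1 *
      Q (scale3 (v.1 / enorm (vec3 v.2)) v.2) * zeta (vec3 v.2))%:E :> \bar R)%E.
      rewrite lee_fin; apply: mulr_ge0; last exact: zeta_ge0.
      by apply: mulr_ge0; rewrite ?indicE.
    exact: (@measurable_fun_fubini_tonelli_F _ _ _ _ R (leb3 R) _ (measurable_polar mQ) G0).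
  have G0 t : (0 <= G t)%E.
    apply: integral_ge0 => p _; rewrite lee_fin; apply: mulr_ge0; last exact: zeta_ge0.
    by apply: mulr_ge0; rewrite ?indicE.
  apply: (@le_trans _ _ (\int[mu]_(t in `]r, s]) G t)%E); last first.
    have sub := @ge0_subset_integral _ _ _ mu _ _ (measurable_itv `]r, s]) measurableT G mG (fun y _ => G0 y) (@subsetT _ _).
    exact: sub.
  rewrite le_eqVlt; apply/orP; left; apply/eqP; apply: eq_integral => t.
  rewrite inE /= in_itv /= => /andP[rt ts]; have t0 : 0 < t by exact: lt_trans rt.
  have tS : r <= t <= s by rewrite (ltW rt).
  have tL : 0 < t < L by rewrite t0 (le_lt_trans ts).
  have cqr x : x != 0 -> {for ray t x, continuous q} by move=> x0; apply: cq; exact: Ar.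
  have I1 := mom_integrable cqr (fun x _ => @ct_cst R V 1 x).
  rewrite /Psi (clE t tS) /mom /avg /Rintegral fineK; last exact: integrable_fin_num.
  apply: eq_integral => p _; rewrite mulr1; congr EFin.
  rewrite indicE mem_set ?mul1r; last by rewrite /= in_itv /= t0.
  have [v0|v0] := eqVneq (vec3 p : V) 0.
    have z0 : zeta (vec3 p : V) = 0 by rewrite v0 zeta0.
    by rewrite z0 !mulr0.
  congr (_ * _); rewrite QS ?vec3_scale //.
  by rewrite /S /= vec3_scale -/(ray t (vec3 p)) enorm_ray // ltW.
apply: (le_trans step2); apply: (le_trans pb).
have mball : measurable (@punctured_ball R L) := measurable_vec3_open oA.
have fE : (E0%:E = \int[leb3 R]_(p in punctured_ball L) integrand L h (grad_dot (revolution_metric L h) u u) p)%E.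
  by rewrite /E0 fineK //; exact: integrable_fin_num.
have gd p : punctured_ball L p -> ((q (vec3 p) / enorm (vec3 p) ^+ 2)%:E <=
    integrand L h (grad_dot (revolution_metric L h) u u) p)%E.
  move=> pL; have x0 : (vec3 p : V) != 0 by exact: A0.
  rewrite /integrand lee_fin grad_dot_revolution //; first exact: flux_dot_ge.
  by rewrite gt_eqF //; apply: profile_gt0; case/andP: pL => // _ /ltW.
have gd0 p : punctured_ball L p -> (0 <= integrand L h (grad_dot (revolution_metric L h) u u) p)%E.
  by move=> pL; apply: (le_trans _ (gd p pL)); rewrite lee_fin divr_ge0 // exprn_ge0 // enorm_ge0.
rewrite EFinM fE [X in (_ <= _ * X)%E]integral_mkcond -ge0_integralZl_EFin //.
- apply: ge0_le_integral => //.
  + move=> p _; rewrite lee_fin mulr_ge0 // mulr_ge0 // exprn_ge0 // invr_ge0; exact: enorm_ge0.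
  + apply/measurable_EFinP; apply: measurable_funM => //; apply: measurable_funM; first exact: measurable_cst.
    apply: measurable_funX; apply: (measurableT_comp (@measurable_inv R)).
    by apply: (@measurable_vec3_continuous R (@enorm R)); exact: enorm_continuous.
  + apply: emeasurable_funM; first exact: measurable_cst.
    by apply/(measurable_restrictT _ mball); exact: (measurable_int _ ie).
  + move=> p _; have [Sp|Sp] := pselect (S p); last first.
      rewrite (QnS _ Sp) mulr0; apply: mule_ge0; first by rewrite lee_fin.
      by rewrite patchE; case: ifPn => //; rewrite inE; exact: gd0.
    have pL : punctured_ball L p.
      by case/andP: Sp => rp ps; apply/andP; split; [exact: lt_le_trans rp|exact: le_lt_trans sL].
    rewrite patchE mem_set // (QS _ Sp); apply: (@le_trans _ _ (48%:E * (q (vec3 p) / enorm (vec3 p) ^+ 2)%:E)%E).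
      rewrite -EFinM lee_fin -mulrA; apply: ler_wpM2l => //.
      by rewrite exprVn mulrC.
    by apply: lee_wpmul2l; [rewrite lee_fin|exact: gd].
- by move=> p _; rewrite patchE; case: ifPn => //; rewrite inE; exact: gd0.
- by apply/(measurable_restrictT _ mball); exact: (measurable_int _ ie).
Qed.


End Energy.

(** * The sphere spectrum *)

Section SphereSpectrumUpper.
Variable R : realType.
Notation V := 'rV[R]_3.
Implicit Types (u f F : V -> R) (x e : V).

Lemma mom_wt_rlap F e n : sqn e = 1 -> smooth_in (@nonzero R) F ->
  avg (fun x => F x * rlap (fun y => wt e y ^+ n) x) =
  n%:R ^+ 2 * avg (fun x => F x * wt e x ^+ n.-1) - lam R n * avg (fun x => F x * wt e x ^+ n).
Proof.
move=> e1 sF; have cF x : x != 0 -> {for x, continuous F} by move=> x0; exact: (smooth_continuous sF).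
have cw m x : x != 0 -> {for x, continuous (fun x => F x * wt e x ^+ m)}.
  by move=> x0; apply: ct_mul; [exact: cF|exact: (smooth_continuous (smooth_wtX e m))].
rewrite -(@avgZ R (n%:R ^+ 2)); last exact: cw.
rewrite -mulNr -(@avgZ R (- lam R n)); last exact: cw.
rewrite -avgD; last 2 first.
- by move=> x x0; apply: ct_mul; [exact: ct_cst|exact: cw].
- by move=> x x0; apply: ct_mul; [exact: ct_cst|exact: cw].
apply: eq_avg => x x0; case: n => [|n]; last by rewrite rlap_wtX //=; ring.
have -> : rlap (fun y => wt e y ^+ 0) x = 0.
  have r0 j k : rot j k (fun y => wt e y ^+ 0) = fun=> 0.
    apply/funext => y; have -> : (fun y => wt e y ^+ 0) = fun=> 1 by apply/funext => t; rewrite expr0.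
    by rewrite (rot_grad j k (has_grad_cst 1 y)) !mulr0 subrr.
  have r1 j k : rot j k (rot j k (fun y => wt e y ^+ 0)) x = 0.
    by rewrite r0 (rot_grad j k (has_grad_cst 0 x)) !mulr0 subrr.
  apply: (etrans (congr2 +%R (congr2 +%R (r1 0 1) (r1 0 2%:R)) (r1 1 2%:R))).
  by rewrite !addr0.
by rewrite /lam /= expr0n /= !mul0r oppr0 !mul0r mulr0 addr0.
Qed.

Lemma ray1 x : ray 1 x = (enorm x)^-1 *: x.
Proof. by rewrite /ray mul1r. Qed.

Lemma ray_ext_ray f x : x != 0 -> ray_ext f (ray 1 x) = ray_ext f x.
Proof. by move=> x0; rewrite /ray_ext (enorm_ray ler01 x0) invr1 scale1r ray1. Qed.

Lemma ray_ext_scale f (s : R) x : 0 < s -> x != 0 -> ray_ext f (s *: x) = ray_ext f x.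
Proof.
move=> s0 x0; have n0 : enorm x != 0 by rewrite enorm_eq0.
by rewrite /ray_ext enormZ (gtr0_norm s0) scalerA; congr (f (_ *: _)); field; rewrite n0 gt_eqF.
Qed.

Lemma euler_ray_ext f x : smooth_in (@nonzero R) (ray_ext f) -> x != 0 -> euler (ray_ext f) x = 0.
Proof.
move=> sf x0; have hg := smooth_in_grad sf x0.
have d : is_derive (1 : R) 1 (fun s : R => ray_ext f (s *: x)) (euler (ray_ext f) x).
  by apply: is_derive_ray; rewrite scale1r.
have d0 : is_derive (1 : R) 1 (fun s : R => ray_ext f (s *: x)) 0.
  apply: (is_derive_ext _ (is_derive_const (ray_ext f x) 1)).
  near=> s; rewrite ray_ext_scale //; near: s; exact: lt_nbhsr.
by rewrite -(@derive_val _ _ _ _ _ _ _ d) (@derive_val _ _ _ _ _ _ _ d0).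
Unshelve. all: by end_near. Qed.

(** On a function of degree 0 the first and second radial derivatives vanish, so [rlapE] reduces to
    [|x|^2] times the Euclidean Laplacian. *)
Lemma rlap_ray_ext f x : smooth_in (@nonzero R) (ray_ext f) -> x != 0 ->
  rlap (ray_ext f) x = sqn x * sphere_laplacian f x.
Proof.
move=> sf x0; have oN := @open_nonzero R.
have E0 : euler (ray_ext f) x = 0 by exact: euler_ray_ext.
have E2 : \sum_i \sum_j x 0 i * x 0 j * hess (ray_ext f) i j x = 0.
  have [_ g] := has_grad_euler sf x0.
  have g0 i : partial i (euler (ray_ext f)) x = 0.
    have [|_ ->//] := near_eq_has_grad (v := euler (ray_ext f)) _ (has_grad_cst 0 x).
    near=> y; apply: esym; apply: euler_ray_ext => //; near: y; exact: open_nonzero.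
  have : \sum_i x 0 i * partial i (euler (ray_ext f)) x = 0 by apply: big1 => i _; rewrite g0 mulr0.
  rewrite (eq_bigr (fun i => x 0 i * partial i (ray_ext f) x + \sum_j x 0 i * x 0 j * hess (ray_ext f) i j x)).
    by rewrite big_split /= -/(euler (ray_ext f) x) E0 add0r.
  move=> i _; rewrite g big_split /= (bigD1 i) //= eqxx mul1r big1 ?addr0; last first.
    by move=> j ji; rewrite eq_sym (negbTE ji) mul0r.
  by rewrite mulrDr; congr (_ + _); rewrite mulr_sumr; apply: eq_bigr => j _; rewrite mulrA.
by rewrite (rlapE sf x0) E0 E2 mulr0 !subr0.
Unshelve. all: by end_near. Qed.

Lemma eq_rlap u F y : smooth_in (@nonzero R) u -> (forall x, x != 0 -> u x = F x) ->
  y != 0 -> rlap u y = rlap F y.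
Proof.
move=> su uF y0; have oN := @open_nonzero R.
have nr j k : rot j k (rot j k u) y = rot j k (rot j k F) y.
  apply: rot_near; last exact: (smooth_in_grad (smooth_rot j k oN su) y0).1.
  near=> t; have t0 : t != 0 by near: t; exact: open_nonzero.
  apply: rot_near; last exact: (smooth_in_grad su t0).1.
  by near=> s; apply: uF; near: s; exact: open_nonzero.
exact: (congr2 +%R (congr2 +%R (nr 0 1) (nr 0 2%:R)) (nr 1 2%:R)).
Unshelve. all: by end_near. Qed.

Lemma sphere_spectrum_lam (la : R) : @sphere_spectrum R la -> exists n, la = lam R n.
Proof.
move=> [f [[U [oU NU sU]] [x x1 fx] ef]]; apply: contrapT => nla.
have {}nla n : la != lam R n by apply/eqP => E; apply: nla; exists n.
have sf : smooth_in (@nonzero R) (ray_ext f) by move=> y y0; apply: sU; exact: NU.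
have eF y : y != 0 -> rlap (ray_ext f) y = - la * ray_ext f y.
  move=> y0; have oN := @open_nonzero R.
  have r1 : rlap (ray_ext f) y = rlap (ray_ext f) (ray 1 y).
    apply: (etrans (eq_rlap sf (fun t t0 => esym (ray_ext_ray f t0)) y0)).
    by apply: (rlap_ray oN sf) => // t t0; exact: ray_neq0.
  have y1 : enorm (ray 1 y) = 1 by exact: enorm_ray.
  have r2 := rlap_ray_ext sf (ray_neq0 (@ltr01 R) y0).
  apply: (etrans r1); apply: (etrans r2); move: (ef _ y1); rewrite -sqr_enorm y1 expr1n mul1r => E.
  by rewrite mulNr -[LHS]opprK E ray1.
have M0 e n : sqn e = 1 -> avg (fun x => ray_ext f x * wt e x ^+ n) = 0.
  move=> e1; have := fun n => mom_wt_rlap n e1 sf.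
  have cw m y : y != 0 -> {for y, continuous (fun x => ray_ext f x * wt e x ^+ m)}.
    by move=> y0; apply: ct_mul; [exact: (smooth_continuous sf)|exact: (smooth_continuous (smooth_wtX e m))].
  (* Symmetry of [rlap] makes [rlap_wtX] a recurrence. Its leading coefficient never vanishes, as
     [la] is none of the [lam R m], and its right-hand side is 0 at [m = 0]. *)
  have step m : (lam R m - la) * avg (fun x => ray_ext f x * wt e x ^+ m) =
      m%:R ^+ 2 * avg (fun x => ray_ext f x * wt e x ^+ m.-1).
    have := mom_wt_rlap m e1 sf; rewrite -(avg_rlapM sf (smooth_wtX e m)).
    have -> : avg (fun x => rlap (ray_ext f) x * wt e x ^+ m) = - la * avg (fun x => ray_ext f x * wt e x ^+ m).
      by rewrite -avgZ; [apply: eq_avg => y y0; rewrite eF // mulrA|exact: cw].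
    by move=> E; rewrite mulrBl -mulNr E; ring.
  move=> _; elim: n => [|n IH].
    have := step 0%N; rewrite expr0n mul0r => /eqP; rewrite mulf_eq0 subr_eq0 eq_sym (negbTE (nla _)) /=.
    by move/eqP.
  have := step n.+1; rewrite /= IH mulr0 => /eqP; rewrite mulf_eq0 subr_eq0 eq_sym (negbTE (nla _)) /=.
  by move/eqP.
have s1 : sqn x = 1 by rewrite -sqr_enorm x1 expr1n.
have : ray_ext f x = 0.
  apply: (peak s1) => [y y0|s y s0 y0|n]; [exact: (smooth_continuous sf)|exact: ray_ext_scale|exact: M0].
by rewrite /ray_ext x1 invr1 scale1r => /eqP; rewrite (negbTE fx).
Unshelve. all: by end_near. Qed.

End SphereSpectrumUpper.

(** * The Steklov spectrum *)

Section SteklovSpectrumUpper.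
Variables (R : realType) (L : R) (h : R -> R) (W : set R).
Notation V := 'rV[R]_3.
Implicit Types (u f g : V -> R) (x e : V) (U : set V).
Hypotheses (L0 : 0 < L) (sh : smooth1_in W h) (LW : forall t, 0 <= t <= L -> W t).
Hypothesis hpos : forall t, 0 <= t < L -> 0 < h t.

Let H (r : R) := h (L - r).

Lemma norm_wtX_le1 e n x : sqn e = 1 -> x != 0 -> `|wt e x ^+ n| <= 1.
Proof.
move=> e1 x0; have w0 := wt_ge0 e1 x0; rewrite ger0_norm ?exprn_ge0 //.
by apply: exprn_ile1 => //; exact: wt_le1.
Qed.

Lemma profile_continuous : {for L, continuous H}.
Proof.
apply: (ct_comp (g := h) (f := fun r : R => L - r)).
  by apply: ct_add; [exact: ct_cst|apply: ct_opp; exact: cvg_id].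
have WL : W 0 by apply: LW; rewrite lexx ltW.
rewrite subrr; exact: is_derive_continuous (smooth1_in_is_derive sh WL).
Qed.

Variables (B kap kap0 : R) (a P : nat -> R -> R).
Hypotheses (LB : L < B) (kap00 : 0 < kap0).
Hypothesis Hpos : forall r, 0 < r < B -> 0 < H r.
Hypothesis Hkap : forall r, 0 < r < L -> kap0 <= r ^+ 2 / H r ^+ 2 <= kap.
Hypothesis sol : forall n, radial_solution H B (lam R n) (a n) (P n).
Hypothesis reg : forall n, regular_at0 (a n) (P n).

Definition steklov_ev n : R := P n L / a n L / h 0 ^+ 2.

Let LinB : 0 < L < B. Proof. by rewrite L0. Qed.
Let inB r : 0 < r < L -> 0 < r < B.
Proof. by move=> /andP[-> rL]; rewrite (lt_trans rL). Qed.
Let HposL r : 0 < r < L -> 0 < H r. Proof. by move=> /inB; exact: Hpos. Qed.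
Let aL n : 0 < a n L. Proof. exact: (regular_solution_gt0 (lam_ge0 R n) (sol n) (reg n) LinB). Qed.

Lemma near_left_small (f : R -> R) (r e : R) : {for L, continuous f} -> f L = 0 -> r < L -> 0 < e ->
  \forall s \near L, r < s /\ `|f s| <= e.
Proof.
move=> cf fL rL e0; have c0 : f s @[s --> L] --> (0 : R) by rewrite -fL; exact: cf.
have ne : \forall s \near L, `|f s| <= e by move/cvgr0_norm_le: c0 => /(_ _ e0).
near=> s; split; near: s; [exact: lt_nbhsr|exact: ne].
Unshelve. all: by end_near. Qed.

Lemma left_point (Pr : R -> Prop) : (\forall s \near L, Pr s) -> exists2 s, s < L & Pr s.
Proof.
move/nbhs_ballP => [d /= d0 hd]; exists (L - d / 2); first by lra.
by apply: hd; rewrite /ball /= opprB addrC subrK ger0_norm; lra.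
Qed.

Lemma left_limit_eq0 (f : R -> R) : {for L, continuous f} -> (forall s, 0 < s < L -> f s = 0) -> f L = 0.
Proof.
move=> cf f0; apply/eqP; rewrite -normr_le0; apply/ler_addgt0Pl => eps eps0; rewrite addr0.
pose g s := f L - f s.
have cg : {for L, continuous g} by apply: ct_add; [exact: ct_cst|exact: ct_opp].
have [|s sL [s0 gs]] := left_point (near_left_small (r := 0) cg _ L0 eps0); first by rewrite /g subrr.
have fs : f s = 0 by apply: f0; rewrite s0.
by move: gs; rewrite /g fs subr0.
Qed.

(** The multiple [al] of the regular solution is chosen to agree with the moment at [L]. Their
    difference solves the same equation, has finite energy and vanishes at [L], so it is 0. The
    Steklov condition then reads [al (sigma - steklov_ev n) = 0] up to a nonzero factor, which
    forces [al = 0]. *)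
Lemma steklov_mode U u g n (sigma : R) : open U -> (forall x, 0 < enorm x <= L -> U x) -> smooth_in U u ->
  (forall x, 0 < enorm x < L -> laplace_beltrami (revolution_metric L h) u x = 0) ->
  (@lebesgue3 R).-integrable (punctured_ball L) (integrand L h (grad_dot (revolution_metric L h) u u)) ->
  (forall x, enorm x = L -> 'D_(L^-1 *: x) u x = sigma * u x) ->
  smooth_in (@nonzero R) g -> (forall x, x != 0 -> `|g x| <= 1) ->
  (forall r, 0 < r < L -> mom u (rlap g) r = - lam R n * mom u g r) ->
  sigma != steklov_ev n -> forall r, 0 < r < L -> mom u g r = 0.
Proof.
move=> oU0 LU0 su0 lb ie bc sg g1 mg ns.
pose U1 := U `&` @nonzero R.
have oU : open U1 by apply: openI => //; exact: open_nonzero.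
have U10 : U1 `<=` @nonzero R by move=> x [].
have LU x : 0 < enorm x <= L -> U1 x.
  by move=> xL; split; [exact: LU0|rewrite /nonzero /= -enorm_gt0; case/andP: xL].
have LU' x : 0 < enorm x < L -> U1 x by move=> /andP[x0 /ltW xL]; apply: LU; rewrite x0.
have su : smooth_in U1 u by apply: smooth_in_sub su0 => x [].
have cg x : x != 0 -> {for x, continuous g} by exact: (smooth_continuous sg).
have cu x : 0 < enorm x <= L -> {for x, continuous u} by move=> /LU; exact: smooth_continuous.
have cdu x : 0 < enorm x <= L -> {for x, continuous (dru u)}.
  by move=> /LU; apply: smooth_continuous; exact: smooth_dru.
have ME := moment_equation sh LW hpos oU U10 su LU' lb sg.
pose m := mom u g; pose Pm r := H r ^+ 2 * mom (dru u) g r.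
have solm : radial_solution H L (lam R n) m Pm.
  move=> r rL; have [d1 d2] := ME r rL; split => //.
  by apply: (is_derive_change d2); rewrite mg // mulNr opprK.
have [D hD] := energy_bound sh LW hpos oU U10 su LU' ie cg g1.
pose al : R := m L / a n L.
have am : al * a n L = m L by rewrite /al divfK // gt_eqF.
pose d r := m r - al * a n r; pose Pd r := Pm r - al * P n r.
have sold : radial_solution H L (lam R n) d Pd.
  move=> r rL; have [d1 d2] := solm r rL; have [e1 e2] := sol n (inB rL); split.
    apply: (is_derive_change (is_derive_add d1 (is_derive_opp (is_derive_scale al e1)))).
    by rewrite /Pd; ring.
  apply: (is_derive_change (is_derive_add d2 (is_derive_opp (is_derive_scale al e2)))).
  by rewrite /d; ring.
(* The derivative of [P a] dominates the energy density [P^2 / H^2] of the regular solution, so its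
   increments bound that energy without an integral. *)
pose PA r := P n r * a n r; pose dPA r := lam R n * a n r * a n r + P n r * (P n r / H r ^+ 2).
have dPAE r : 0 < r < B -> is_derive r 1 PA (dPA r).
  by move=> rB; have [e1 e2] := sol n rB; exact: is_derive_mul.
have dPA0 r : 0 <= dPA r.
  by rewrite /dPA -mulrA -expr2 mulrA -expr2; apply: addr_ge0; [rewrite mulr_ge0 ?lam_ge0 ?sqr_ge0|rewrite divr_ge0 ?sqr_ge0].
have PAge r : 0 < r < B -> 0 <= PA r.
  move=> rB; apply: mulr_ge0; first exact: (regular_momentum_ge0 (lam_ge0 R n) (sol n) (reg n) rB).
  exact: ltW (regular_solution_gt0 (lam_ge0 R n) (sol n) (reg n) rB).
have PAle r s : 0 < r -> r <= s -> s < L -> PA s - PA r <= PA L.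
  move=> r0 rs sL; have rB : 0 < r < B by rewrite r0 (le_lt_trans rs (lt_trans sL LB)).
  have h1 : PA s <= PA L.
    apply: (@le_of_derive_cc _ PA dPA) => [|x /andP[sx xL]|//]; first exact: ltW.
    by apply: dPAE; rewrite (lt_le_trans (lt_le_trans r0 rs) sx) (le_lt_trans xL LB).
  by have := PAge _ rB; lra.
(* [fm] and [fP] are [d] and [Pd] with the radius of the moment truncated at [L], which makes them
   continuous at [L] from both sides. *)
pose fm s := mom u g (Num.min s L) - al * a n s.
pose fP s := H s ^+ 2 * mom (dru u) g (Num.min s L) - al * P n s.
have [e1 e2] := sol n LinB.
have cfm : {for L, continuous fm}.
  apply: ct_add; first exact: mom_continuous.
  by apply: ct_opp; apply: ct_mul; [exact: ct_cst|exact: is_derive_continuous e1].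
have cfP : {for L, continuous fP}.
  apply: ct_add.
    by apply: ct_mul; [apply: ct_exp; exact: profile_continuous|exact: mom_continuous].
  by apply: ct_opp; apply: ct_mul; [exact: ct_cst|exact: is_derive_continuous e2].
have fmE s : s < L -> fm s = d s by move=> sL; rewrite /fm min_l ?ltW.
have fPE s : s < L -> fP s = Pd s by move=> sL; rewrite /fP min_l ?ltW.
have fmL : fm L = 0 by rewrite /fm min_l // -/m am subrr.
have d0 r : 0 < r < L -> d r = 0.
  apply: (finite_energy_eq0 (D := 2 * D + 2 * al ^+ 2 * PA L) (lam_ge0 R n) kap00 sold HposL Hkap).
    move=> r' s phi dphi r0 rs sL dp dle.
    (* The energy of a difference is at most twice the sum of the energies; [phi2] turns a test
       function for the difference into one for the moment alone. *)
    pose phi2 t := (phi t - 2 * al ^+ 2 * PA t) / 2.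
    have inL t : r' <= t <= s -> 0 < t < L.
      by move=> /andP[rt ts]; rewrite (lt_le_trans r0 rt) (le_lt_trans ts sL).
    have := hD r' s phi2 (fun t => (dphi t - 2 * al ^+ 2 * dPA t) / 2) r0 rs sL _ _.
    have K1 t : r' <= t <= s -> is_derive t 1 phi2 ((dphi t - 2 * al ^+ 2 * dPA t) / 2).
      move=> tr; have q1 := dp t tr; have q2 := dPAE t (inB (inL _ tr)).
      have q := is_derive_mul (is_derive_add q1 (is_derive_opp (is_derive_scale (2 * al ^+ 2) q2))) (is_derive_const 2^-1 t).
      by apply: (is_derive_change q); rewrite mulr0 addr0.
    have K2 t : r' <= t <= s -> (dphi t - 2 * al ^+ 2 * dPA t) / 2 <= h (L - t) ^+ 2 * mom (dru u) g t ^+ 2.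
      move=> tr; have tL := inL _ tr; have Ht : H t != 0 by rewrite gt_eqF // HposL.
      have := dle t tr; rewrite /Pd /Pm /dPA -/(H t).
      have l0 : 0 <= lam R n * a n t * a n t by rewrite -mulrA -expr2 mulr_ge0 ?lam_ge0 ?sqr_ge0.
      have -> : (H t ^+ 2 * mom (dru u) g t - al * P n t) ^+ 2 / H t ^+ 2 =
        2 * (H t ^+ 2 * mom (dru u) g t ^+ 2) + 2 * al ^+ 2 * (P n t * (P n t / H t ^+ 2))
        - (H t * mom (dru u) g t + al * P n t / H t) ^+ 2 by field.
      have := sqr_ge0 (H t * mom (dru u) g t + al * P n t / H t).
      have : 0 <= 2 * al ^+ 2 * (lam R n * a n t * a n t) by rewrite mulr_ge0 // mulr_ge0 // sqr_ge0.
      move: (_ * (_ / _)) (lam R n * a n t * a n t) l0 (al ^+ 2) => X Y Y0 Z.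
      lra.
    move=> /(_ K1 K2); rewrite /phi2 => hphi.
    have h1 := PAle r' s r0 (ltW rs) sL.
    have h2 : 2 * al ^+ 2 * (PA s - PA r') <= 2 * al ^+ 2 * PA L by rewrite ler_wpM2l // mulr_ge0 // sqr_ge0.
    lra.
  move=> r' eps /andP[r0 rL] eps0.
  have cp : {for L, continuous (fun s => fP s * fm s)} by exact: ct_mul.
  have pL : fP L * fm L = 0 by rewrite fmL mulr0.
  have n1 := near_left_small cfm fmL rL eps0; have n2 := near_left_small cp pL rL eps0.
  have [s sL [[rs s1] [_ s2]]] := left_point (filterI n1 n2).
  by exists s; split; [exact: rs|exact: sL|rewrite -(fmE _ sL) -(fPE _ sL)|rewrite -(fmE _ sL)].
have Pd0 r : 0 < r < L -> Pd r = 0.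
  move=> rL; have [dd _] := sold r rL; have Hr : H r != 0 by rewrite gt_eqF // HposL.
  have dz : is_derive r 1 d 0.
    apply: (is_derive_ext _ (is_derive_const 0 r)); case/andP: rL => r0 rL.
    by near=> s; rewrite d0 //; apply/andP; split; near: s; [exact: lt_nbhsr|exact: lt_nbhsl].
  have : Pd r / H r ^+ 2 = 0 by rewrite -(@derive_val _ _ _ _ _ _ _ dd) (@derive_val _ _ _ _ _ _ _ dz).
  by move/eqP; rewrite mulf_eq0 invr_eq0 expf_eq0 /= (negbTE Hr) orbF => /eqP.
have fPL : fP L = 0.
  apply: left_limit_eq0 => // s /[dup] /Pd0 E /andP[_ sL]; by rewrite fPE.
have mdru : mom (dru u) g L = sigma * m L.
  rewrite /m /mom -avgZ; last first.
    move=> x x0; apply: ct_mul; last exact: cg.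
    by apply: continuous_ray => //; apply: cu; rewrite enorm_ray ?lexx ?L0 // ltW.
  apply: eq_avg => x x0; rewrite mulrA; congr (_ * _).
  have xL : enorm (ray L x) = L by rewrite enorm_ray // ltW.
  rewrite -(bc _ xL); have Ux : U1 (ray L x) by apply: LU; rewrite xL L0 /=.
  rewrite (has_grad_derive _ (smooth_in_grad su Ux)) /dru /euler xL mulr_suml.
  by apply: eq_bigr => i _; rewrite !mxE; ring.
have al0 : al = 0.
  apply/eqP; move: fPL; rewrite /fP min_l // mdru -am /H subrr => E.
  have h0 : h 0 != 0 by rewrite gt_eqF // hpos // lexx.
  have E2 : al * (sigma - steklov_ev n) * (a n L * h 0 ^+ 2) = 0.
    by rewrite -[RHS]E /steklov_ev; field; rewrite h0 gt_eqF.
  have nz : (sigma - steklov_ev n) * (a n L * h 0 ^+ 2) != 0.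
    by rewrite mulf_neq0 ?subr_eq0 // mulf_neq0 ?expf_neq0 // gt_eqF.
  by move/eqP: E2; rewrite -mulrA mulf_eq0 (negbTE nz) orbF.
by move=> r rL; have := d0 r rL; rewrite /d al0 mul0r subr0.
Unshelve. all: by end_near. Qed.

Lemma steklov_spectrum_sub (sigma : R) : steklov_spectrum L h sigma -> exists n, sigma = steklov_ev n.
Proof.
move=> [u [[U [oU LU su]] [x /andP[x0 xL] ux] lb [[_ ie] _] bc]]; apply: contrapT => ns.
have {}ns n : sigma != steklov_ev n by apply/eqP => E; apply: ns; exists n.
have cu y : 0 < enorm y <= L -> {for y, continuous u} by move=> /LU; exact: smooth_continuous.
have M0 e n : sqn e = 1 -> forall r, 0 < r < L -> mom u (fun y => wt e y ^+ n) r = 0.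
  move=> e1; elim: n => [|n IH].
    apply: (steklov_mode oU LU su lb ie bc (smooth_wtX e 0) _ _ (ns 0%N)).
      by move=> y; exact: norm_wtX_le1.
    move=> r rL; have su_r : smooth_in (@nonzero R) (fun y => u (ray r y)).
      by apply: (smooth_ray su) => y y0; apply: LU; case/andP: rL => r0 rL; rewrite /= enorm_ray ?r0 ?ltW.
    by rewrite /mom (mom_wt_rlap 0 e1 su_r) expr0n mul0r sub0r mulNr.
  apply: (steklov_mode oU LU su lb ie bc (smooth_wtX e n.+1) _ _ (ns n.+1)).
    by move=> y; exact: norm_wtX_le1.
  move=> r rL; have su_r : smooth_in (@nonzero R) (fun y => u (ray r y)).
    by apply: (smooth_ray su) => y y0; apply: LU; case/andP: rL => r0 rL'; rewrite /= enorm_ray ?r0 ?ltW.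
  have := IH r rL; rewrite /mom => E.
  by rewrite (mom_wt_rlap n.+1 e1 su_r) /= E mulr0 sub0r mulNr.
pose e := (enorm x)^-1 *: x; have xx0 : x != 0 by rewrite -enorm_gt0.
have e1 : sqn e = 1 by exact: sqn_unit.
have ne1 : enorm e = 1 by rewrite /enorm -/(sqn e) e1 sqrtr1.
have e0 : e != 0 by rewrite -enorm_gt0 ne1 ltr01.
have u0 r : 0 < r < L -> u (r *: e) = 0.
  move=> /[dup] rL /andP[r0 rL'].
  have re : ray r e = r *: e by rewrite /ray ne1 divr1.
  rewrite -re; apply: (@peak R e e1 (fun y => u (ray r y))) => [y y0|s y s0 y0|n].
  - by apply: continuous_ray => //; apply: cu; rewrite /= enorm_ray ?r0 ?ltW.
  - congr (u _); rewrite /ray enormZ (gtr0_norm s0) scalerA; congr (_ *: _).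
    have ny : enorm y != 0 by rewrite enorm_eq0.
    by field; rewrite ny gt_eqF.
  - exact: M0.
have xe : x = enorm x *: e by rewrite /e scalerA divff ?scale1r // enorm_eq0.
move/eqP: ux; apply; rewrite xe; case: (ltP (enorm x) L) => xL'; first by apply: u0; rewrite x0.
have -> : enorm x = L by apply/le_anti/andP.
(* A boundary point is reached from the interior along its ray. *)
apply: (left_limit_eq0 (f := fun r => u (r *: e))) => //.
have -> : (fun r => u (r *: e)) = (fun r => u (ray r e)).
  by apply/funext => r; rewrite /ray ne1 divr1.
by apply: continuous_along_ray; apply: cu; rewrite enorm_ray ?L0 ?lexx // ltW.
Qed.

End SteklovSpectrumUpper.

(** * Listing a discrete spectrum in increasing order *)

Section Enumeration.
Variable R : realType.

Lemma inf_min (S : set R) m : S m -> (forall x, S x -> m <= x) -> inf S = m.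
Proof.
move=> Sm lb; apply/le_anti/andP; split.
  by apply: ge_inf => //; exists m => x; exact: lb.
by apply: lb_le_inf; [exists m|move=> x; exact: lb].
Qed.

Lemma nth_least_range (S : set R) (s : nat -> R) : (forall n, s n < s n.+1) ->
  (forall x, S x <-> exists n, x = s n) -> forall j, nth_least S j = s j.
Proof.
move=> inc hS; have mono : {mono s : m n / (m <= n)%O >-> m <= n}.
  exact/increasing_seqP.
elim=> [|j IH] /=.
  by apply: inf_min => [|x /hS [n ->]]; [apply/hS; exists 0%N|rewrite mono].
rewrite IH; apply: inf_min => [|x [/hS [n ->]]]; first by split; [apply/hS; exists j.+1|exact: inc].
by rewrite ltNge !mono -ltnNge.
Qed.

End Enumeration.

(** * From an admissible profile to its radial modes *)

Section Modes.
Variable R : realType.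
Implicit Types (h : R -> R) (r L : R).

(** Everything built from a profile, for all degrees at once. The interval reaches beyond [L], so
    that values and derivatives at [L] are taken at an interior point; [mal] is the factor in
    [a = r^n mal], which tends to 1 at the center. *)
Record modes L h : Type := Modes {
  mdom : set R; mB : R; ma : nat -> R -> R; mP : nat -> R -> R;
  mal : nat -> R -> R; mdal : nat -> R -> R; mC : nat -> R; mkap : R; mkap0 : R;
  mdom_smooth : smooth1_in mdom h;
  mdom_sub : forall t, 0 <= t <= L -> mdom t;
  mpos : forall t, 0 <= t < L -> 0 < h t;
  mL0 : 0 < L;
  mLB : L < mB;
  mBdom : forall r, 0 < r < mB -> mdom (L - r) /\ 0 < h (L - r);
  mkap0_gt0 : 0 < mkap0;
  mkapP : forall r, 0 < r < mB -> mkap0 <= r ^+ 2 / h (L - r) ^+ 2 <= mkap;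
  mC_ge0 : forall n, 0 <= mC n;
  msol : forall n, radial_solution (fun r => h (L - r)) mB (lam R n) (ma n) (mP n);
  mreg : forall n, regular_at0 (ma n) (mP n);
  mfactor : forall n r, 0 < r < mB -> [/\ ma n r = r ^+ n * mal n r, is_derive r 1 (mal n) (mdal n r),
    `|r * mdal n r| <= mC n, `|mal n r - 1| <= mC n * r & `|mP n r| <= mC n * r ^+ n.+1]
}.

Lemma regular_at0_factor (B C : R) n (a P al : R -> R) : 0 < B -> 0 <= C ->
  (forall r, 0 < r < B -> [/\ a r = r ^+ n * al r, `|al r - 1| <= C * r & `|P r| <= C * r ^+ n.+1]) ->
  regular_at0 a P.
Proof.
(* [C r <= 1 / 2] keeps [al] between [1 / 2] and [3 / 2], and [r <= 1] keeps [r^n] at most 1; as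
   [2 al >= 1], the bound on [P] relative to [a] holds with [2 C]. *)
move=> B0 C0 hf; pose d : R := Num.min B (Num.min 1 ((2 * C + 1)^-1)).
have c0 : 0 < 2 * C + 1 by lra.
exists d, (2 * C); split.
- by rewrite !lt_min B0 ltr01 invr_gt0.
- by rewrite mulr_ge0.
move=> r /andP[r0]; rewrite !lt_min => /and3P[rB r1 rC].
have [->] := hf r (introT andP (conj r0 rB)) => hal hP.
have rC2 : C * r <= 1 / 2.
  by move: rC; rewrite -[X in _ < X]div1r ltr_pdivlMr // => rC; nra.
move: hal; rewrite ler_norml => /andP[al1 al2].
have al3 : 1 / 2 <= al r by lra.
have al4 : al r <= 3 / 2 by lra.
have rn0 : 0 < r ^+ n by exact: exprn_gt0.
have rn1 : r ^+ n <= 1 by apply: exprn_ile1; exact: ltW.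
have P2 : `|P r| <= 2 * C * r * (r ^+ n * al r).
  apply: (le_trans hP); rewrite exprS.
  have -> : 2 * C * r * (r ^+ n * al r) = C * (r * r ^+ n) * (2 * al r) by ring.
  by rewrite ler_peMr //; [rewrite mulr_ge0 // mulr_ge0 ?ltW|lra].
split => //; first by rewrite mulr_gt0 //; lra.
  by have := ler_pM (ltW rn0) _ rn1 al4; lra.
apply: (le_trans hP); rewrite exprS.
have : r * r ^+ n <= r * 1 by rewrite ler_pM2l.
by have : 0 <= C * r by [rewrite mulr_ge0 // ltW]; nra.
Qed.

Section Profile.
Variables (L : R) (h : R -> R) (W : set R).
Hypotheses (L0 : 0 < L) (oW : open W) (sh : smooth1_in W h) (LW : forall t, 0 <= t <= L -> W t).
Hypotheses (hpos : forall t, 0 <= t < L -> 0 < h t) (hL : h L = 0) (dhL : derive1 h L = -1).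
Let H r := h (L - r).

Lemma is_derive_reflect (f : R -> R) (r d : R) : is_derive (L - r) 1 f d -> is_derive r 1 (fun r => f (L - r)) (- d).
Proof.
move=> df.
have d1 : is_derive r 1 (fun r : R => L - r) (-1).
  by apply: (is_derive_change (is_derive_add (is_derive_const L r) (is_derive_opp (is_derive_ident r)))); rewrite add0r.
have q := @is_derive1_comp R f (fun r => L - r) r d (-1) df d1.
by apply: (is_derive_change q); rewrite mulrN1.
Qed.

(** [h] is smooth on an open set around [[0, L]] and positive at 0, so [t = L - r] may become
    slightly negative. *)
Lemma extended_domain : exists2 B : R, L < B & forall r, 0 <= r <= B -> W (L - r) /\ (0 < r -> 0 < h (L - r)).
Proof.
have W0 : W 0 by apply: LW; rewrite lexx ltW.
have h0 : 0 < h 0 by apply: hpos; rewrite lexx.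
have ch : {for (0 : R), continuous h} := is_derive_continuous (smooth1_in_is_derive sh W0).
have n1 : \forall t \near (0 : R), 0 < h t by exact: (@cvgr_gt R _ (nbhs (0 : R)) _ h (h 0) ch 0 h0).
have n2 : \forall t \near (0 : R), W t by apply: open_nbhs_nbhs.
have : \forall t \near (0 : R), 0 < h t /\ W t by exact: filterI n1 n2.
move/nbhs_ballP => [d /= d0 hd].
exists (L + d / 2) => [|r /andP[r0 rB]]; first by rewrite ltrDl divr_gt0.
case: (leP r L) => rL.
  split=> [|r1]; first by apply: LW; rewrite subr_ge0 rL gerBl.
  by apply: hpos; rewrite subr_ge0 rL gtrBl.
have [|h1 W1] := hd (L - r) _; last by split.
by rewrite /ball /= sub0r normrN ler0_norm; lra.
Qed.

(** Taylor's formula of order two at the center, with [h(L) = 0], [h'(L) = -1] and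
    [c = - h''(L) / 2]. It lets [(r - H r) / r^2] extend continuously to 0, which is the source of
    the continuity of [eta]. *)
Lemma profile_expansion : exists c : R, forall e : R, 0 < e ->
  exists2 d : R, 0 < d & forall r, 0 < r < d -> `|r - H r - c * r ^+ 2| <= e * r ^+ 2.
Proof.
have WL : W L by apply: LW; rewrite lexx ltW.
have sh1 := smooth1_in_derive1 sh.
have dH r : W (L - r) -> is_derive r 1 H (- derive1 h (L - r)).
  by move=> Wr; apply: is_derive_reflect; exact: smooth1_in_is_derive Wr.
pose c : R := - derive1 (derive1 h) L / 2.
exists c => e e0.
have d2 : is_derive (0 : R) 1 (fun r => 1 + derive1 h (L - r)) (2 * c).
  have q : is_derive (0 : R) 1 (fun r => derive1 h (L - r)) (- derive1 (derive1 h) L).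
    by apply: is_derive_reflect; rewrite subr0; exact: smooth1_in_is_derive WL.
  by apply: (is_derive_change (is_derive_add (is_derive_const 1 0) q)); rewrite /c; field.
pose N1 r := 1 + derive1 h (L - r) - 2 * c * r.
have [d d0 hd] : exists2 d : R, 0 < d & forall r, 0 <= r < d -> W (L - r) /\ `|N1 r| <= 2 * e * r.
  have n1 : \forall r \near (0 : R), W (L - r).
    have cc : {for (0 : R), continuous (fun r : R => L - r)}.
      by apply: ct_add; [exact: ct_cst|apply: ct_opp; exact: cvg_id].
    by apply: cc; rewrite subr0; exact: open_nbhs_nbhs.
  have n2 : \forall r \near (0 : R)^', `|r^-1 *: (1 + derive1 h (L - r)) - 2 * c| <= 2 * e.
    have [dd dv] := d2.
    have : r^-1 *: ((1 + derive1 h (L - (r *: 1 + 0))) - (1 + derive1 h (L - 0))) @[r --> 0^'] --> 2 * c.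
      by rewrite -dv; exact: dd.
    move/cvgrPdist_le => /(_ (2 * e)); rewrite mulr_gt0 // => /(_ isT).
    apply: filterS => r /=; rewrite subr0 dhL subrr subr0 addr0 [r *: 1]mulr1 distrC.
    exact.
  have [d1 /= d10 hd1] : exists2 d : R, 0 < d & forall r, `|r| < d -> r != 0 ->
      W (L - r) /\ `|r^-1 *: (1 + derive1 h (L - r)) - 2 * c| <= 2 * e.
    move/nbhs_ballP: n1 => [x /= x0 hx]; move/nbhs_ballP: n2 => [y /= y0 hy].
    exists (Num.min x y); first by rewrite lt_min x0.
    move=> r; rewrite lt_min => /andP[rx ry] rn0; split.
      by apply: hx; rewrite /ball /= sub0r normrN.
    by apply: hy => //; rewrite /ball /= sub0r normrN.
  exists d1 => // r /andP[r0 rd]; have [->|rn0] := eqVneq r 0.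
    by rewrite subr0 /N1 subr0 dhL subrr !mulr0 subr0 normr0.
  have [|W1 N] := hd1 r _ rn0; first by rewrite ger0_norm.
  split=> //.
  have -> : N1 r = r * (r^-1 *: (1 + derive1 h (L - r)) - 2 * c).
    have -> : r^-1 *: (1 + derive1 h (L - r)) = r^-1 * (1 + derive1 h (L - r)) by [].
    by rewrite /N1; field.
  by rewrite normrM (ger0_norm r0) mulrC ler_wpM2r.
exists d => // r /andP[r0 rd].
pose N (t : R) := t - H t - c * t ^+ 2.
have dN t : 0 <= t <= r -> is_derive t 1 N (N1 t).
  move=> /andP[t0 tr]; have [Wt _] := hd t (introT andP (conj t0 (le_lt_trans tr rd))).
  apply: (is_derive_change (is_derive_add (is_derive_add (is_derive_ident t) (is_derive_opp (dH t Wt)))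
    (is_derive_opp (is_derive_scale c (is_derive_pow 2 t))))).
  by rewrite /N1 /= expr1; ring.
have de (t : R) : is_derive t 1 (fun t : R => e * t ^+ 2) (2 * e * t).
  by apply: (is_derive_change (is_derive_scale e (is_derive_pow 2 t))); rewrite /= expr1; ring.
have N0 : N 0 = 0 by rewrite /N /H subr0 hL expr0n /= mulr0 !subr0.
have N1b t : 0 <= t <= r -> - (2 * e * t) <= N1 t <= 2 * e * t.
  by move=> /andP[t0 tr]; have [_] := hd t (introT andP (conj t0 (le_lt_trans tr rd))); rewrite ler_norml.
rewrite -/(N r) ler_norml; apply/andP; split.
  have K := @le_of_derive_cc _ (fun t => N t + e * t ^+ 2) (fun t => N1 t + 2 * e * t) 0 r (ltW r0)
    (fun t tr => is_derive_add (dN t tr) (de t)).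
  have : N 0 + e * 0 ^+ 2 <= N r + e * r ^+ 2 by apply: K => t /N1b /andP[]; lra.
  by rewrite N0 expr0n /= mulr0; lra.
have K := @le_of_derive_cc _ (fun t => e * t ^+ 2 + - N t) (fun t => 2 * e * t + - N1 t) 0 r (ltW r0)
  (fun t tr => is_derive_add (de t) (is_derive_opp (dN t tr))).
have : e * 0 ^+ 2 + - N 0 <= e * r ^+ 2 + - N r by apply: K => t /N1b /andP[]; lra.
by rewrite N0 expr0n /= mulr0; lra.
Qed.

End Profile.
End Modes.

Section AdmissibleModes.
Variable R : realType.
Implicit Types (h : R -> R) (L : R).

Lemma segment_bounded (f : R -> R) (a b : R) :
  (forall t, a <= t <= b -> {for t, continuous f}) ->
  exists M : R, 0 <= M /\ forall t, a <= t <= b -> `|f t| <= M.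
Proof.
move=> cf; have cfS : {within `[a, b]%classic, continuous f}.
  by apply: continuous_in_subspaceT => t; rewrite inE /= in_itv /= => /cf.
have [M [_ hM]] := compact_bounded (continuous_compact cfS (@segment_compact _ a b)).
exists (Num.max 0 (M + 1)); split; first by rewrite le_max lexx.
move=> t tS; rewrite le_max; apply/orP; right.
by apply: (hM (M + 1)); [rewrite ltrDl|exists t => //=; rewrite in_itv].
Qed.

Lemma admissible_modes L h : 0 < L -> admissible L h -> inhabited (modes L h).
Proof.
move=> L0 [[W [oW LW' sh0]] hpos hL dhL].
have sh : smooth1_in W h by move=> n t Wt; exact: sh0.
have LW t : 0 <= t <= L -> W t by move=> tL; apply: LW'; rewrite /= in_itv.
have [B0 LB0 hB0] := extended_domain L0 oW sh LW hpos.
have [c hc] := profile_expansion L0 oW sh LW hL dhL.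
pose H r := h (L - r); pose B : R := (L + B0) / 2.
have LB : L < B by rewrite /B; lra.
have BB0 : B < B0 by rewrite /B; lra.
have B_gt0 : 0 < B by lra.
(* [H = r x] with [x = 1 - r y], hence [r^2 / H^2 - 1 = r y (1 + x) / x^2]. The quotient by [r] is
   [e1] below, continuous up to 0 because [y] is. *)
pose y r := if 0 < r then (r - H r) / r ^+ 2 else c.
have cy t : t <= B -> {for t, continuous y}.
  move=> tB; have [t0|t0|t0] := ltgtP 0 t.
  - have cH : {for t, continuous H}.
      have [Wt _] : W (L - t) /\ (0 < t -> 0 < h (L - t)) by apply: hB0; rewrite (ltW t0) (le_trans tB (ltW BB0)).
      apply: (ct_comp (g := h) (f := fun r : R => L - r)).
        by apply: ct_add; [exact: ct_cst|apply: ct_opp; exact: cvg_id].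
      exact: is_derive_continuous (smooth1_in_is_derive sh Wt).
    have cz : {for t, continuous (fun r => (r - H r) * (r ^+ 2)^-1)}.
      apply: ct_mul; first by apply: ct_add; [exact: cvg_id|exact: ct_opp].
      by apply: ct_inv; [rewrite expf_neq0 // gt_eqF|apply: ct_exp; exact: cvg_id].
    have E : \forall r \near t, (r - H r) * (r ^+ 2)^-1 = y r.
      by near=> r; rewrite /y ifT //; near: r; exact: lt_nbhsr.
    have yt : y t = (t - H t) * (t ^+ 2)^-1 by rewrite /y t0.
    have cz' : (r - H r) * (r ^+ 2)^-1 @[r --> t] --> y t by rewrite yt; exact: cz.
    have : y r @[r --> t] --> y t by apply: cvg_trans cz'; exact: near_eq_cvg.
    exact.
  - have yc : \forall r \near t, y r = c.
      near=> r; rewrite /y ifF //; apply/negbTE; rewrite -leNgt.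
      by apply: ltW; near: r; exact: lt_nbhsl.
    exact: ct_near_cst yc.
  rewrite -t0; have y0 : y 0 = c by rewrite /y ltxx.
  have : y r @[r --> (0 : R)] --> y 0; last exact.
  rewrite y0; apply/cvgrPdist_le => e e0; have [d d0 hd] := hc e e0.
  near=> r; rewrite /y; case: ifPn => [r0|_]; last by rewrite subrr normr0 ltW.
  have rd : r < d by near: r; exact: lt_nbhsl.
  have r20 : 0 < r ^+ 2 by exact: exprn_gt0.
  have := hd r (introT andP (conj r0 rd)); rewrite -/(H r) => hr.
  have -> : c - (r - H r) / r ^+ 2 = - (r - H r - c * r ^+ 2) / r ^+ 2 by field; rewrite gt_eqF.
  by rewrite normrM normrN normfV (gtr0_norm r20) ler_pdivrMr.
pose x t := 1 - t * y t.
have cx t : t <= B -> {for t, continuous x}.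
  by move=> tB; apply: ct_add; [exact: ct_cst|apply: ct_opp; apply: ct_mul; [exact: cvg_id|exact: cy]].
have xE t : 0 < t -> x t = H t / t by move=> t0; rewrite /x /y t0; field; rewrite gt_eqF.
have HB t : 0 < t -> t <= B -> 0 < H t.
  by move=> t0 tB; have [_] := hB0 t (introT andP (conj (ltW t0) (le_trans tB (ltW BB0)))); apply.
have x_gt0 t : 0 <= t <= B -> 0 < x t.
  move=> /andP[]; rewrite le_eqVlt => /predU1P[<-|t0 tB]; first by rewrite /x mul0r subr0.
  by rewrite xE // divr_gt0 // HB.
pose e1 t := y t * (1 + x t) * (x t ^+ 2)^-1.
have ce1 t : 0 <= t <= B -> {for t, continuous e1}.
  move=> tB; have tB' : t <= B by case/andP: tB.
  apply: ct_mul; first by apply: ct_mul; [exact: cy|apply: ct_add; [exact: ct_cst|exact: cx]].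
  by apply: ct_inv; [rewrite expf_neq0 // gt_eqF // x_gt0|apply: ct_exp; exact: cx].
have [E [E0 hE]] := segment_bounded ce1.
have [K [K0 hK]] : exists M : R, 0 <= M /\ forall t, 0 <= t <= B -> `|(x t ^+ 2)^-1| <= M.
  apply: segment_bounded => t tB; have tB' : t <= B by case/andP: tB.
  by apply: ct_inv; [rewrite expf_neq0 // gt_eqF // x_gt0|apply: ct_exp; exact: cx].
have [K1 [K10 hK1]] : exists M : R, 0 <= M /\ forall t, 0 <= t <= B -> `|x t ^+ 2| <= M.
  by apply: segment_bounded => t /andP[_ tB]; apply: ct_exp; exact: cx.
pose cl (r : R) : R := Num.max 0 (Num.min r B).
have clB r : 0 <= cl r <= B by rewrite /cl le_max lexx /= ge_max (ltW B_gt0) ge_min lexx orbT.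
have cle r : 0 < r < B -> cl r = r by move=> /andP[r0 rB]; rewrite /cl min_l ?max_r ?ltW.
have ccl : continuous cl.
  apply: ctP => r; apply: (ct_comp (g := fun z : R => Num.max 0 z)); last exact: max0_continuous.
  by apply: continuous_min; [exact: cvg_id|exact: cst_continuous].
pose eta r := e1 (cl r).
have ceta : continuous eta by apply: ctP => r; apply: ct_comp; [exact: ccl|exact: ce1].
have etaE r : `|eta r| <= E by exact: hE.
have Hpos r : 0 < r < B -> 0 < H r by move=> /andP[r0 /ltW rB]; exact: HB.
have qE r : 0 < r < B -> r ^+ 2 / H r ^+ 2 = (x r ^+ 2)^-1.
  move=> rB; have /andP[r0 _] := rB; rewrite xE //; have := Hpos r rB => Hr.
  by field; rewrite !gt_eqF.
have Heta r : 0 < r < B -> r ^+ 2 / H r ^+ 2 = 1 + r * eta r.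
  move=> rB; rewrite qE // /eta cle // /e1; have /andP[r0 r1] := rB.
  have xr : x r != 0 by rewrite gt_eqF // x_gt0 // !ltW.
  have ry : r * y r = 1 - x r by rewrite /x opprB addrCA subrr addr0.
  by rewrite !mulrA ry; field.
have hn n := regular_solution n B_gt0 ceta etaE Hpos Heta.
have hn' n : exists q : (R -> R) * (R -> R) * (R -> R) * (R -> R) * R, 0 <= q.2 /\ forall r : R, 0 < r < B ->
    [/\ is_derive r 1 q.1.1.1.1 (q.1.1.1.2 r / H r ^+ 2), is_derive r 1 q.1.1.1.2 (lam R n * q.1.1.1.1 r),
        q.1.1.1.1 r = r ^+ n * q.1.1.2 r, is_derive r 1 q.1.1.2 (q.1.2 r)
      & [/\ `|r * q.1.2 r| <= q.2, `|q.1.1.2 r - 1| <= q.2 * r & `|q.1.1.1.2 r| <= q.2 * r ^+ n.+1]].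
  by have [a [P [al [dal [C hC]]]]] := hn n; exists (a, P, al, dal, C).
have [q hq] := choice hn'.
have kapP r : 0 < r < B -> (K1 + 1)^-1 <= r ^+ 2 / h (L - r) ^+ 2 <= K.
  move=> rB; have /andP[r0 r1] := rB; have rB' : 0 <= r <= B by rewrite !ltW.
  rewrite -/(H r) qE //; have x2 : 0 < x r ^+ 2 by rewrite exprn_gt0 // x_gt0.
  apply/andP; split; last by apply: le_trans (hK r rB'); exact: ler_norm.
  rewrite lef_pV2 ?posrE //; last lra.
  by have := hK1 r rB'; rewrite gtr0_norm //; lra.
have sol n : radial_solution H B (lam R n) (q n).1.1.1.1 (q n).1.1.1.2.
  by move=> r rB; have [_ /(_ r rB) [d1 d2 _ _ _]] := hq n.
have reg n : regular_at0 (q n).1.1.1.1 (q n).1.1.1.2.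
  have [C0 hC] := hq n.
  apply: (regular_at0_factor (al := (q n).1.1.2) (n := n) B_gt0 C0) => r rB.
  by have [_ _ e _ [_ g1 g2]] := hC r rB.
apply: (inhabits (@Modes R L h W B (fun n => (q n).1.1.1.1) (fun n => (q n).1.1.1.2) (fun n => (q n).1.1.2)
  (fun n => (q n).1.2) (fun n => (q n).2) K (K1 + 1)^-1 sh LW hpos L0 LB _ _ kapP _ sol reg _)).
- by move=> r /andP[r0 /ltW rB]; split; [have [] := hB0 r (introT andP (conj (ltW r0) (le_trans rB (ltW BB0))))|exact: HB].
- by rewrite invr_gt0; lra.
- by move=> n; have [] := hq n.
- by move=> n r rB; have [_ /(_ r rB) [_ _ e3 e4 [e5 e6 e7]]] := hq n.
Unshelve. all: by end_near. Qed.

End AdmissibleModes.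

(** * One spherical harmonic of each degree *)

Section HarmonicPolynomials.
Variable R : realType.
Notation V := 'rV[R]_3.
Implicit Types (u f : V -> R) (x : V) (U : set V).

(* Real and imaginary parts of [(x_0 + i x_1)^k]. *)
Fixpoint harm (k : nat) (x : V) : R * R :=
  if k is k'.+1 then
    (x 0 0 * (harm k' x).1 - x 0 1 * (harm k' x).2, x 0 0 * (harm k' x).2 + x 0 1 * (harm k' x).1)
  else (1, 0).

Definition harm_re k x := (harm k x).1.
Definition harm_im k x := (harm k x).2.

Let sel (a b : R) (i : 'I_3) : R := if i == 0 then a else if i == 1 then b else 0.

(** With [z = x_0 + i x_1], the power [z^k] has derivative [k z^(k-1)] in [x_0] and [i] times that
    in [x_1]. *)
Lemma has_grad_harm k x :
  has_grad (harm_re k) x (sel (k%:R * harm_re k.-1 x) (- (k%:R * harm_im k.-1 x))) /\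
  has_grad (harm_im k) x (sel (k%:R * harm_im k.-1 x) (k%:R * harm_re k.-1 x)).
Proof.
elim: k => [|k [g1 g2]].
  split; [apply: (has_grad_eq (has_grad_cst (1 : R) x))|apply: (has_grad_eq (has_grad_cst (0 : R) x))];
    by move=> i; rewrite /sel !mul0r ?oppr0; case: (i == 0); case: (i == 1).
have c0 := has_grad_coord 0 x; have c1 := has_grad_coord 1 x.
have e k' : (harm_re k'.+1 = fun y => y 0 0 * harm_re k' y + - (y 0 1 * harm_im k' y)) /\
   (harm_im k'.+1 = fun y => y 0 0 * harm_im k' y + y 0 1 * harm_re k' y) by [].
have [er ei] := e k; split.
  rewrite er; apply: (has_grad_eq (has_gradD (has_gradM c0 g1) (has_gradN (has_gradM c1 g2)))).
  move=> i; case: (ord3E i) => -> /=; rewrite /sel /=.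
  - by case: k {g1 g2 er ei} => [|k] /=; [rewrite /harm_re /harm_im /=; ring|rewrite -[in RHS]natr1; have [-> ->] := e k; ring].
  - by case: k {g1 g2 er ei} => [|k] /=; [rewrite /harm_re /harm_im /=; ring|rewrite -[in RHS]natr1; have [-> ->] := e k; ring].
  - by rewrite !mul0r !mulr0 addr0 oppr0 addr0.
rewrite ei; apply: (has_grad_eq (has_gradD (has_gradM c0 g2) (has_gradM c1 g1))).
move=> i; case: (ord3E i) => -> /=; rewrite /sel /=.
- by case: k {g1 g2 er ei} => [|k] /=; [rewrite /harm_re /harm_im /=; ring|rewrite -[in RHS]natr1; have [-> ->] := e k; ring].
- by case: k {g1 g2 er ei} => [|k] /=; [rewrite /harm_re /harm_im /=; ring|rewrite -[in RHS]natr1; have [-> ->] := e k; ring].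
- by rewrite !mul0r !mulr0 !addr0.
Qed.

Lemma alg3_harm U k : alg3 U (harm_re k) /\ alg3 U (harm_im k).
Proof.
elim: k => [|k [g1 g2]]; first by split; exact: alg3_cst.
have m1 := alg3_mul (alg3_cst U (-1)) (alg3_mul (alg3_coord U 1) g2).
split; last exact: (alg3_add (alg3_mul (alg3_coord U 0) g2) (alg3_mul (alg3_coord U 1) g1)).
have := alg3_add (alg3_mul (alg3_coord U 0) g1) m1.
congr (alg3 U _); apply/funext => x; rewrite /harm_re /harm_im /=; ring.
Qed.

Lemma smooth_harm U k : open U -> smooth_in U (harm_re k).
Proof. by move=> oU; apply: alg3_smooth_in => //; case: (alg3_harm U k). Qed.

Lemma euler_harm k x : euler (harm_re k) x = k%:R * harm_re k x.
Proof.
have [[_ g] _] := has_grad_harm k x; rewrite /euler sum3 !g /sel /= mulr0 addr0.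
by case: k {g} => [|k]; rewrite ?mul0r ?oppr0 ?mulr0 ?addr0 //= /harm_re /harm_im /=; ring.
Qed.

Lemma partial_harm k i : partial i (harm_re k) =
  fun x => sel (k%:R * harm_re k.-1 x) (- (k%:R * harm_im k.-1 x)) i.
Proof. by apply/funext => x; have [[_ ->] _] := has_grad_harm k x. Qed.

Lemma laplace_harm k x : \sum_i hess (harm_re k) i i x = 0.
Proof.
have [[_ g1] [_ g2]] := (has_grad_harm k.-1 x).
have d (g : V -> R) (c : R) i : differentiable g x -> partial i (fun y => c * g y) x = c * partial i g x.
  by move=> dg; have [_ ->] := has_gradM (has_grad_cst c x) (has_grad_partial dg); rewrite mul0r add0r.
have [[dr _] [di _]] := has_grad_harm k.-1 x.
rewrite sum3 /hess !partial_harm.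
have -> : (fun y => sel (k%:R * harm_re k.-1 y) (- (k%:R * harm_im k.-1 y)) 0) = fun y => k%:R * harm_re k.-1 y by [].
have -> : (fun y => sel (k%:R * harm_re k.-1 y) (- (k%:R * harm_im k.-1 y)) 1) = fun y => (- k%:R) * harm_im k.-1 y.
  by apply/funext => y; rewrite mulNr.
have -> : (fun y => sel (k%:R * harm_re k.-1 y) (- (k%:R * harm_im k.-1 y)) 2%:R) = fun=> 0 by [].
rewrite !d // (has_grad_cst 0 x).2 g1 g2 /sel /=; ring.
Qed.

(** On functions of degree [k] the radial part of [|x|^2] times the Laplacian acts as
    [k (k + 1)]. *)
Lemma rlap_homogeneous U u (k : R) x : open U -> smooth_in U u -> U x ->
  (forall y, U y -> euler u y = k * u y) ->
  rlap u x = sqn x * (\sum_i hess u i i x) - k * (k + 1) * u x.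
Proof.
move=> oU su Ux eu; have hg := smooth_in_grad su Ux.
have ee : \sum_i x 0 i * partial i (euler u) x = k * (k * u x).
  have gk : has_grad (euler u) x (fun i => k * partial i u x).
    apply: (near_eq_has_grad (u := fun y => k * u y)).
      have nU : nbhs x U by exact: open_nbhs_nbhs.
      by near=> y; rewrite eu //; near: y; exact: nU.
    apply: (has_grad_eq (has_gradM (has_grad_cst k x) hg)) => i.
    by rewrite mul0r add0r.
  rewrite -(eu x Ux) /euler mulr_sumr; apply: eq_bigr => i _; rewrite gk.2; ring.
have [_ g] := has_grad_euler su Ux.
have E2 : \sum_i x 0 i * partial i (euler u) x = euler u x + \sum_i \sum_j x 0 i * x 0 j * hess u i j x.
  rewrite /euler -big_split /=; apply: eq_bigr => i _; rewrite g big_split /= (bigD1 i) //= eqxx mul1r big1 ?addr0; last first.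
    by move=> j ji; rewrite eq_sym (negbTE ji) mul0r.
  by rewrite mulrDr; congr (_ + _); rewrite mulr_sumr; apply: eq_bigr => j _; rewrite mulrA.
rewrite (rlapE su Ux) eu //; move: E2; rewrite ee eu // => E2.
have -> : \sum_i \sum_j x 0 i * x 0 j * hess u i j x = k * (k * u x) - k * u x.
  by rewrite E2 addrAC subrr add0r.
ring.
Unshelve. all: by end_near. Qed.

Lemma rlap_harm k x : x != 0 -> rlap (harm_re k) x = - lam R k * harm_re k x.
Proof.
move=> x0; have oN := @open_nonzero R.
rewrite (rlap_homogeneous oN (smooth_harm k oN) x0 (fun y _ => euler_harm k y)) laplace_harm.
by rewrite /lam mulr0 sub0r mulNr.
Qed.

Let ray1_neq0 x : x != 0 -> @nonzero R (ray 1 x). Proof. exact: ray_neq0. Qed.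

(** The sectoral harmonic of degree [k], extended with degree 0. *)
Definition sph k : V -> R := ray_ext (harm_re k).

Lemma smooth_sph k : smooth_in (@nonzero R) (sph k).
Proof.
have := smooth_ray (r := 1) (smooth_harm k (@open_nonzero R)) ray1_neq0.
by congr (smooth_in _ _); apply/funext => x; rewrite /sph /ray_ext ray1.
Qed.

Lemma rlap_sph k x : x != 0 -> rlap (sph k) x = - lam R k * sph k x.
Proof.
move=> x0; have oN := @open_nonzero R.
have e : sph k = fun x => harm_re k (ray 1 x) by apply/funext => y; rewrite /sph /ray_ext ray1.
rewrite e; apply: (etrans (rlap_ray oN (smooth_harm k oN) ray1_neq0 x0)).
exact: (rlap_harm k (ray_neq0 ltr01 x0)).
Qed.

Definition pole : V := \row_j (j == 0)%:R.

Lemma sqn_pole : sqn pole = 1.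
Proof. by rewrite /sqn sum3 !mxE /= expr1n !expr0n /= !addr0. Qed.

Lemma enorm_pole : enorm pole = 1.
Proof. by rewrite /enorm -/(sqn pole) sqn_pole sqrtr1. Qed.

Lemma pole_neq0 : pole != 0.
Proof. by rewrite -enorm_gt0 enorm_pole ltr01. Qed.

Lemma harm_pole k : harm_re k pole = 1.
Proof.
suff [] : harm_re k pole = 1 /\ harm_im k pole = 0 by [].
elim: k => [|k [h1 h2]] //; rewrite /harm_re /harm_im /= in h1 h2 *.
by rewrite h1 h2 !mxE /= !mulr1 !mulr0 ?mul0r ?subr0 ?addr0.
Qed.

Lemma sph_pole k : sph k pole = 1.
Proof. by rewrite /sph /ray_ext enorm_pole invr1 scale1r harm_pole. Qed.

Lemma lam_sphere_spectrum k : @sphere_spectrum R (lam R k).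
Proof.
exists (harm_re k); split.
- by exists (@nonzero R); split => //; [exact: open_nonzero|exact: smooth_sph].
- by exists pole; [exact: enorm_pole|rewrite harm_pole oner_eq0].
move=> x x1; have x0 : x != 0 by rewrite -enorm_gt0 x1.
have := rlap_ray_ext (smooth_sph k) x0; rewrite -/(sph k) => E.
have := etrans (esym (rlap_sph k x0)) E; rewrite -sqr_enorm x1 expr1n mul1r => <-.
by rewrite mulNr opprK /sph /ray_ext x1 invr1 scale1r.
Qed.

End HarmonicPolynomials.

(** * Existence of eigenfunctions *)

Lemma near_eq_continuous (R : realType) (T : topologicalType) (f g : T -> R) x :
  (\forall y \near x, f y = g y) -> {for x, continuous f} -> {for x, continuous g}.
Proof.
move=> fg cf; have cf' : f y @[y --> x] --> g x by rewrite -(nbhs_singleton fg); exact: cf.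
have : g y @[y --> x] --> g x by apply: cvg_trans cf'; exact: near_eq_cvg.
exact.
Qed.

(** * Removability of the center for bounded divergence-free fields *)

Section RemovableCenter.
Variable R : realType.
Notation V := 'rV[R]_3.
Notation T3 := (R * (R * R))%type.
Implicit Types (u f : V -> R) (x : V).

(** A C^1 transition from 0 to 1 across [[1, 2]]. *)
Definition step01 (s : R) : R := ppsq (1 - ppsq (2 - s)).
Definition dstep01 (s : R) : R := 4 * Num.max 0 (1 - ppsq (2 - s)) * Num.max 0 (2 - s).

Lemma is_derive_step01 (s : R) : is_derive s 1 step01 (dstep01 s).
Proof.
have d1 : is_derive s 1 (fun s : R => 2 - s) (-1).
  by apply: (is_derive_change (is_derive_add (is_derive_const 2 s) (is_derive_opp (is_derive_ident s)))); rewrite add0r.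
have d2 := @is_derive1_comp R (@ppsq R) (fun s => 2 - s) s _ _ (is_derive_ppsq _) d1.
have d3 := is_derive_add (is_derive_const 1 s) (is_derive_opp d2).
have d4 := @is_derive1_comp R (@ppsq R) _ s _ _ (is_derive_ppsq _) d3.
by apply: (is_derive_change d4); rewrite /dstep01 /=; ring.
Qed.

Lemma step01_le1 (s : R) : s <= 1 -> step01 s = 0 /\ dstep01 s = 0.
Proof.
move=> s1; have m : Num.max 0 (2 - s) = 2 - s by rewrite max_r; lra.
have p : 1 - ppsq (2 - s) <= 0 by rewrite /ppsq m; nra.
by rewrite /step01 /dstep01 (ppsq_le0 p) (max_l p) mulr0 mul0r.
Qed.

Lemma step01_ge2 (s : R) : 2 <= s -> step01 s = 1 /\ dstep01 s = 0.
Proof.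
move=> s2; have p : 2 - s <= 0 by lra.
rewrite /step01 /dstep01 (ppsq_le0 p) (max_l p) mulr0 subr0 /ppsq max_r //.
by rewrite expr1n.
Qed.

Lemma step01_bound (s : R) : 0 <= step01 s <= 1 /\ (0 <= s -> 0 <= dstep01 s <= 8).
Proof.
have q0 := ppsq_ge0 (2 - s).
have m0 : 0 <= Num.max 0 (1 - ppsq (2 - s)) by rewrite le_max lexx.
have m1 : Num.max 0 (1 - ppsq (2 - s)) <= 1 by rewrite ge_max ler01 /=; lra.
split; first by rewrite /step01 {1 3}/ppsq sqr_ge0 /= expr_le1.
move=> s0; have n0 : 0 <= Num.max 0 (2 - s) by rewrite le_max lexx.
have n1 : Num.max 0 (2 - s) <= 2 by rewrite ge_max; apply/andP; split; lra.
by rewrite /dstep01; apply/andP; split; nra.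
Qed.

Definition cutoff (e : R) x : R := step01 (sqn x / e ^+ 2).

Lemma has_grad_cutoff e x : has_grad (cutoff e) x (fun i => dstep01 (sqn x / e ^+ 2) * (2 * x 0 i / e ^+ 2)).
Proof.
have g := has_gradM (has_grad_sqn x) (has_grad_cst (e ^+ 2)^-1 x).
by apply: (has_grad_eq (has_grad_comp g (is_derive_step01 _))) => i; rewrite mulr0 addr0.
Qed.

Lemma dstep01_continuous : continuous dstep01.
Proof.
have c2 (s : R) : {for s, continuous (fun s : R => 2 - s)}.
  by apply: ct_add; [exact: ct_cst|apply: ct_opp; exact: cvg_id].
apply: ctP => s; apply: ct_mul; last by apply: (ct_comp (g := fun y : R => Num.max 0 y)); [exact: c2|exact: max0_continuous].
apply: ct_mul; first exact: ct_cst.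
apply: (ct_comp (g := fun y : R => Num.max 0 y)); last exact: max0_continuous.
apply: ct_add; first exact: ct_cst.
apply: ct_opp; apply: (ct_comp (g := @ppsq R)); first exact: c2.
exact: is_derive_continuous (is_derive_ppsq _).
Qed.

Lemma cutoff_grad_continuous e i : continuous (fun x => dstep01 (sqn x / e ^+ 2) * (2 * x 0 i / e ^+ 2)).
Proof.
have cx x : {for x, continuous (fun y : V => y 0 i)} by exact: differentiable_continuous (has_grad_coord i x).1.
apply: ctP => x; apply: ct_mul.
  apply: (ct_comp (g := dstep01)); last exact: dstep01_continuous.
  by apply: ct_mul; [exact: sqn_continuous|exact: ct_cst].
by apply: ct_mul; [apply: ct_mul; [exact: ct_cst|exact: cx]|exact: ct_cst].
Qed.

Variables (L : R) (X : 'I_3 -> V -> R) (M : R).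
Hypothesis L0 : 0 < L.
Let A := [set x : V | 0 < enorm x < L].
Hypothesis sX : forall i, smooth_in A (X i).
Hypothesis bX : forall i x, A x -> `|X i x| <= M.
Hypothesis dX : forall x, A x -> \sum_i partial i (X i) x = 0.

Let oA : open A. Proof. exact: open_annulus. Qed.

Section Test.
Variables (phi : V -> R) (r0 : R).
Hypotheses (r0L : r0 < L) (sphi : smooth_in setT phi) (phi0 : forall x, r0 <= enorm x -> phi x = 0).

Let G e i x := cutoff e x * (phi x * X i x).

Let G_near0 e i x : 0 < e -> ~ A x -> \near x, (0 : R) = G e i x.
Proof.
move=> e0 nA; have [n0|n0] := eqVneq (enorm x) 0.
  have : \forall y \near x, sqn y < e ^+ 2.
    have c : {for x, continuous (fun y : V => - sqn y)} by apply: ct_opp; exact: sqn_continuous.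
    have := @cvgr_gt R _ (nbhs x) (nbhs_filter x) (fun y => - sqn y) (- sqn x) c (- e ^+ 2).
    rewrite ltrN2 -sqr_enorm n0 expr0n /= exprn_gt0 // => /(_ isT).
    by apply: filterS => y; rewrite ltrN2.
  apply: filterS => y ye; rewrite /G /cutoff (step01_le1 _).1 ?mul0r //.
  by rewrite ler_pdivrMr ?exprn_gt0 // mul1r ltW.
have Lx : L <= enorm x.
  by rewrite leNgt; apply/negP => xL; apply: nA; rewrite /A /= lt_def n0 enorm_ge0.
have : \forall y \near x, r0 < enorm y.
  exact: (@cvgr_gt R _ (nbhs x) (nbhs_filter x) (@enorm R) (enorm x) (enorm_continuous (x:=x)) r0 (lt_le_trans r0L Lx)).
by apply: filterS => y ry; rewrite /G phi0 ?mul0r ?mulr0 // ltW.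
Qed.

Let dG e i x : R := dstep01 (sqn x / e ^+ 2) * (2 * x 0 i / e ^+ 2) * (phi x * X i x)
  + cutoff e x * (partial i phi x * X i x + phi x * partial i (X i) x).

Let G_grad e i x : A x -> partial i (G e i) x = dG e i x /\ differentiable (G e i) x.
Proof.
move=> Ax; have [d g] := has_gradM (has_grad_cutoff e x)
  (has_gradM (smooth_in_grad sphi (I : setT x)) (smooth_in_grad (@sX i) Ax)).
by split => //; rewrite g.
Qed.

Let G_grad0 e i x : 0 < e -> ~ A x -> partial i (G e i) x = 0 /\ differentiable (G e i) x.
Proof.
by move=> e0 nA; have [d g] := near_eq_has_grad (G_near0 i e0 nA) (has_grad_cst 0 x); split.
Qed.

Let cphi x : {for x, continuous phi}.
Proof. exact: (smooth_continuous sphi). Qed.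

Let cdphi i x : {for x, continuous (partial i phi)}.
Proof. by apply: (smooth_continuous (U := setT)) => //; exact: smooth_in_partial. Qed.

Let G_continuous e i : 0 < e -> continuous (partial i (G e i)).
Proof.
move=> e0; apply: ctP => x; have [Ax|nA] := pselect (A x); last first.
  have : nbhs x [set y | 0 = G e i y] := G_near0 i e0 nA.
  move/nbhs_ballP => [d /= d0 hd].
  apply: (ct_near_cst (c := 0)); apply/nbhs_ballP; exists (d / 2) => /=; first by rewrite divr_gt0.
  move=> y yd; have : \near y, (0 : R) = G e i y.
    apply/nbhs_ballP; exists (d / 2) => /=; first by rewrite divr_gt0.
    by move=> z zd; apply: hd; rewrite /= (splitr d); exact: ball_triangle yd zd.
  by move=> ny; have [_ ->] := near_eq_has_grad ny (has_grad_cst 0 y).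
have cX : {for x, continuous (X i)} := smooth_continuous (@sX i) Ax.
have cdX : {for x, continuous (partial i (X i))} := smooth_continuous (smooth_in_partial i (@sX i)) Ax.
have cG : {for x, continuous (dG e i)}.
  apply: ct_add.
    by apply: ct_mul; [exact: cutoff_grad_continuous|exact: ct_mul].
  apply: ct_mul; first exact: differentiable_continuous (has_grad_cutoff e x).1.
  by apply: ct_add; apply: ct_mul.
have E : \forall y \near x, dG e i y = partial i (G e i) y.
  have nA : nbhs x A by exact: open_nbhs_nbhs.
  by near=> y; rewrite (G_grad e i _).1 //; near: y; exact: nA.
exact: (near_eq_continuous E cG).
Unshelve. all: by end_near. Qed.

Let F p : R := ((fun p => \sum_i X i (vec3 p) * partial i phi (vec3 p)) \_ (@punctured_ball R L)) p.

Let M0 : 0 <= M.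
Proof.
pose x := \row_j ((L / 2) * (j == 0)%:R) : V.
have sx : sqn x = (L / 2) ^+ 2 by rewrite /sqn sum3 !mxE /= mulr1 !mulr0 expr0n /= !addr0.
have ex : enorm x = L / 2 by rewrite /enorm -/(sqn x) sx sqrtr_sqr ger0_norm // divr_ge0 // ltW.
apply: (le_trans (normr_ge0 (X 0 x))); apply: bX; rewrite /A /= ex.
by rewrite divr_gt0 // ltr_pdivrMr // ltr_pMr // ltr1n.
Qed.

Let mF : measurable_fun setT F.
Proof.
have mball : measurable (@punctured_ball R L) := measurable_vec3_open oA.
apply/(measurable_restrictT _ mball).
apply: (@measurable_fun_vec3 R A (fun x => \sum_i X i x * partial i phi x)) => // x Ax.
by apply: ct_sum => i; apply: ct_mul; [exact: (smooth_continuous (@sX i))|exact: cdphi].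
Qed.

Lemma phi_support x : (exists j, L < `|x 0 j|) -> phi x = 0.
Proof.
by move=> [j xj]; apply: phi0; apply: le_trans (coord_le_enorm x j); rewrite ltW // (lt_trans r0L).
Qed.

(* The center is removable: cutting off at scale [e] costs [O(1/e)] on a set of measure [O(e^3)]. *)
Lemma divergence_free_weak : (\int[@lebesgue3 R]_(p in @punctured_ball R L)
  (\sum_i X i (vec3 p) * partial i phi (vec3 p))%:E = 0)%E.
Proof.
have [C0 hC0] := bounded_compact_support L0 (ctP (@cphi)) phi_support.
have dsup i x : (exists j, L < `|x 0 j|) -> partial i phi x = 0.
  apply: (partial_support (G := phi)) => y [j yj]; apply: phi0.
  by apply: le_trans (coord_le_enorm y j); apply: le_trans yj; exact: ltW.
have [C1 hC1] : exists C, forall i x, `|partial i phi x| <= C.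
  have h i := bounded_compact_support L0 (ctP (@cdphi i)) (dsup i).
  have [a ha] := h 0; have [b hb] := h 1; have [c hc] := h 2%:R.
  exists (Num.max a (Num.max b c)) => i x; rewrite !le_max.
  by apply/or3P; case: (ord3E i) => ->; [apply: Or31; exact: ha|apply: Or32; exact: hb|apply: Or33; exact: hc].
have C00 : 0 <= C0 by apply: le_trans (hC0 0); exact: normr_ge0.
have C10 : 0 <= C1 by apply: le_trans (hC1 0 0); exact: normr_ge0.
pose B : R := L + 1; have LL : 0 < L := L0; have rL : r0 < L := r0L; have B0 : 0 < B by rewrite /B; lra.
have GB e i x : (exists j, B <= `|x 0 j|) -> G e i x = 0.
  move=> [j xj]; rewrite /G phi0 ?mul0r ?mulr0 //.
  by apply: le_trans (coord_le_enorm x j); apply: le_trans xj; rewrite /B; lra.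
have dGi e i x : 0 < e -> differentiable (G e i) x.
  by move=> e0; have [/(G_grad e i)[]|/(G_grad0 i e0)[]] := pselect (A x).
have IG e : 0 < e -> (\int[leb3 R]_p (\sum_i partial i (G e i) (vec3 p))%:E = 0)%E /\
    (leb3 R).-integrable setT (EFin \o (fun p => \sum_i partial i (G e i) (vec3 p))).
  move=> e0; have I0 i := @integral_partial R (G e i) i B B0 (fun x => dGi e i x e0) (G_continuous e0) (GB e i).
  have ii i : (leb3 R).-integrable setT (EFin \o (fun p => partial i (G e i) (vec3 p))).
    have [D hD] := bounded_compact_support (B := B) B0 (G_continuous (i := i) e0) (partial_support i (GB e i)).
    apply: (integrable_box (B := B + 1) (M := D)) => //; first by lra.
      by apply: (@measurable_vec3_continuous R (partial i (G e i))); exact: G_continuous.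
    move=> p np; apply: (partial_support i (GB e i)).
    apply: contrapT => nj; apply: np; apply/in_box0 => j; rewrite ltNge; apply/negP => pj.
    by apply: nj; exists j; apply: lt_le_trans pj; rewrite ltrDl.
  have E : (fun p : T3 => (\sum_i partial i (G e i) (vec3 p))%:E) =
     (fun p => \sum_i (partial i (G e i) (vec3 p))%:E)%E by apply/funext => p; rewrite sumEFin.
  have i3 : (leb3 R).-integrable setT (fun p => \sum_i (partial i (G e i) (vec3 p))%:E)%E.
    by apply: integrable_sum => // i _; exact: ii.
  split; last by rewrite /comp E.
  rewrite E integral_sum //; apply: big1 => i _; exact: I0.
(* The error comes from [1 - cutoff], at most 1, and from the gradient of the cutoff, at most
   [8 * 2 * (2 e) / e^2 = 32 / e] per coordinate; three coordinates give 96. Both live in the box of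
   half-width [2 e]. *)
have key e p : 0 < e -> 2 * e < L ->
    `|F p - \sum_i partial i (G e i) (vec3 p)| <= (3 * M * C1 + 96 * C0 * M / e) * \1_(box 0 (2 * e)) p.
  move=> e0 eL; have Ma := mulr_ge0 M0 C10; have Mb : 0 <= C0 * M / e by rewrite !mulr_ge0 // invr_ge0 ltW.
  have RHS0 : 0 <= (3 * M * C1 + 96 * C0 * M / e) * \1_(box 0 (2 * e)) p.
    by rewrite mulr_ge0 ?indicE //; lra.
  have [Ap|nA] := pselect (A (vec3 p)); last first.
    rewrite /F patchE memNset // big1 ?subrr ?normr0 // => i _; exact: (G_grad0 i e0 nA).1.
  rewrite /F patchE mem_set //.
  have -> : \sum_i X i (vec3 p) * partial i phi (vec3 p) - \sum_i partial i (G e i) (vec3 p) =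
     \sum_i ((1 - cutoff e (vec3 p)) * (X i (vec3 p) * partial i phi (vec3 p))
       - dstep01 (sqn (vec3 p) / e ^+ 2) * (2 * (vec3 p : V) 0 i / e ^+ 2) * (phi (vec3 p) * X i (vec3 p)))
     - cutoff e (vec3 p) * phi (vec3 p) * \sum_i partial i (X i) (vec3 p).
    rewrite mulr_sumr -!sumrB; apply: eq_bigr => i _; rewrite (G_grad e i Ap).1 /dG; ring.
  rewrite dX // mulr0 subr0.
  have e20 : 0 < e ^+ 2 by exact: exprn_gt0.
  have [s2|s2] := leP 2 (sqn (vec3 p) / e ^+ 2).
    have [c1 d1] := step01_ge2 s2.
    by rewrite big1 ?normr0 // => i _; rewrite /cutoff c1 d1 subrr !mul0r subrr.
  have n2 : enorm (vec3 p) < 2 * e.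
    have e2 : 0 <= 2 * e by rewrite mulr_ge0 // ltW.
    rewrite -(ltr_pXn2r (n := 2)) ?nnegrE ?enorm_ge0 // sqr_enorm.
    by move: s2; rewrite ltr_pdivrMr // exprMn => s2; apply: lt_trans s2 _; lra.
  have inb : box 0 (2 * e) p by apply/in_box0 => j; exact: le_lt_trans (coord_le_enorm _ _) n2.
  rewrite indicE mem_set // mulr1; apply: (le_trans (ler_norm_sum _ _ _)).
  have -> : 3 * M * C1 + 96 * C0 * M / e = \sum_(i < 3) (M * C1 + 32 * C0 * M / e).
    by rewrite sumr_const card_ord -mulr_natl; ring.
  apply: ler_sum => i _; apply: (le_trans (ler_normB _ _)); apply: lerD.
    have [/andP[t0 t1] _] := step01_bound (sqn (vec3 p) / e ^+ 2).
    rewrite !normrM -[leRHS]mul1r; apply: ler_pM; rewrite ?mulr_ge0 //.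
      by rewrite ger0_norm /cutoff; lra.
    by apply: ler_pM => //; exact: bX.
  have s0 : 0 <= sqn (vec3 p : V) / e ^+ 2 by rewrite divr_ge0 ?sqn_ge0 // ltW.
  have [_ /(_ s0) /andP[t0 t1]] := step01_bound (sqn (vec3 p) / e ^+ 2).
  have -> : 32 * C0 * M / e = 8 * (2 * (2 * e) / e ^+ 2) * (C0 * M) by field; rewrite gt_eqF.
  rewrite [X in X <= _]normrM [`|phi _ * _|]normrM; apply: ler_pM; rewrite ?mulr_ge0 //.
    rewrite normrM (ger0_norm t0); apply: ler_pM => //.
    rewrite normrM (ger0_norm (x := (e ^+ 2)^-1)) ?invr_ge0 ?(ltW e20) //.
    apply: ler_wpM2r; first by rewrite invr_ge0 ltW.
    rewrite normrM ger0_norm //; apply: ler_wpM2l => //.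
    exact: ltW (le_lt_trans (coord_le_enorm _ _) n2).
  by apply: ler_pM => //; exact: bX.
have iF : (leb3 R).-integrable setT (EFin \o F).
  apply: (integrable_box (B := B) (M := 3 * M * C1)) => // p.
    rewrite /F patchE; case: ifPn => [|_]; last by rewrite normr0 !mulr_ge0 // M0.
    rewrite inE => Ap; apply: (le_trans (ler_norm_sum _ _ _)).
    have -> : 3 * M * C1 = \sum_(i < 3) (M * C1) by rewrite sumr_const card_ord; ring.
    by apply: ler_sum => i _; rewrite normrM; apply: ler_pM => //; exact: bX.
  move=> np; rewrite /F patchE memNset // => /andP[_ pL]; apply: np; apply/in_box0 => j.
  by apply: (le_lt_trans (coord_le_enorm _ _)); apply: (lt_trans pL); rewrite /B ltrDl.
(* The box has measure [(4 e)^3 = 64 e^3], and one factor [e] absorbs the [1 / e]. *)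
have est e : 0 < e -> 2 * e < L -> `|\int[leb3 R]_p F p| <= (3 * M * C1 * e + 96 * C0 * M) * 64 * e ^+ 2.
  move=> e0 eL; have [I0 ie] := IG e e0.
  have iD := integrableB measurableT iF ie.
  pose K : R := 3 * M * C1 + 96 * C0 * M / e.
  have K0 : 0 <= K by rewrite addr_ge0 // ?mulr_ge0 ?M0 // invr_ge0 ltW.
  have ib : (leb3 R).-integrable setT (EFin \o (fun p => K * \1_(box (0 : V) (2 * e)) p)).
    apply: (integrable_box (B := 2 * e) (M := K)); first by rewrite mulr_gt0.
    - by apply: measurable_funM; [exact: measurable_cst|apply: measurable_indic; exact: measurable_box].
    - by move=> p; rewrite normrM (ger0_norm K0) indicE; case: (p \in _); rewrite ?normr1 ?normr0 ?mulr1 ?mulr0.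
    - by move=> p np; rewrite indicE memNset // mulr0.
  have -> : \int[leb3 R]_p F p = \int[leb3 R]_p (F p - \sum_i partial i (G e i) (vec3 p)).
    by rewrite RintegralB // [X in _ - X]/Rintegral I0 /= subr0.
  have iDn : (leb3 R).-integrable setT (EFin \o (fun p => F p - \sum_i partial i (G e i) (vec3 p))) by exact: iD.
  apply: (le_trans (le_normr_Rintegral measurableT iDn)).
  have ian := integrable_norm iDn.
  apply: (@le_trans _ _ (\int[leb3 R]_p (K * \1_(box (0 : V) (2 * e)) p))).
    by apply: (@le_Rintegral _ _ _ (leb3 R) setT _ _ measurableT ian ib) => p _; exact: key.
  have iD1 : (leb3 R).-integrable setT (EFin \o (\1_(box (0 : V) (2 * e)) : T3 -> R)).
    apply: (integrable_box (B := 2 * e) (M := 1)); first by rewrite mulr_gt0.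
    - by apply: measurable_indic; exact: measurable_box.
    - by move=> p; rewrite indicE; case: (p \in _); rewrite ?normr1 ?normr0.
    - by move=> p np; rewrite indicE memNset.
  rewrite RintegralZl // le_eqVlt; apply/orP; left; apply/eqP.
  have -> : \int[leb3 R]_p (\1_(box (0 : V) (2 * e)) p : R) = (2 * (2 * e)) ^+ 3.
    rewrite /Rintegral integral_indic ?setIT //; last exact: measurable_box.
    by rewrite [X in fine X](@mu3_box R 0 (2 * e) _) // mulr_gt0.
  by rewrite /K; field; rewrite gt_eqF.
have F0 : \int[leb3 R]_p F p = 0.
  apply/eqP; rewrite -normr_le0; apply/ler_addgt0Pl => eps eps0; rewrite addr0.
  pose K : R := (3 * M * C1 * L + 96 * C0 * M) * 64.
  have K0 : 0 <= K by rewrite mulr_ge0 // addr_ge0 // !mulr_ge0 // ?M0 // ltW.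
  pose e : R := Num.min (L / 4) (Num.min 1 (eps / (K + 1))).
  have e0 : 0 < e by rewrite !lt_min !divr_gt0 ?ltr01 //; lra.
  have eL : e <= L / 4 by rewrite /e ge_min lexx.
  have e1 : e <= 1 by rewrite /e !ge_min lexx orbT.
  have eK : e <= eps / (K + 1) by rewrite /e !ge_min lexx !orbT.
  apply: (le_trans (est e e0 _)); first lra.
  apply: (@le_trans _ _ (K * e)).
    rewrite /K -[e ^+ 2]/(e * e) mulrA; apply: ler_wpM2r; first exact: ltW.
    have MC : 0 <= 3 * M * C1 by rewrite !mulr_ge0 // M0.
    have MC0 : 0 <= 96 * C0 * M by rewrite !mulr_ge0 // M0.
    have h1 : 3 * M * C1 * e <= 3 * M * C1 * L by apply: ler_wpM2l => //; lra.
    have h0 : 0 <= 3 * M * C1 * e by rewrite mulr_ge0 // ltW.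
    by nra.
  move: eK; rewrite ler_pdivlMr; last lra.
  by nra.
have fF : (\int[leb3 R]_p (F p)%:E \is a fin_num)%E by exact: integrable_fin_num.
have IF : (\int[leb3 R]_p (F p)%:E = 0)%E.
  by have := fineK fF; rewrite -[fine _]/(\int[leb3 R]_p F p) F0 => <-.
apply: (etrans (@integral_mkcond _ _ _ (leb3 R) (@punctured_ball R L) _)); apply: etrans IF.
apply: eq_integral => p _; rewrite /F !patchE; by case: ifP.
Qed.

End Test.
End RemovableCenter.

Arguments mdom_smooth {R L h} m.
Arguments mdom_sub {R L h} m [t] _.
Arguments mpos {R L h} m [t] _.
Arguments mL0 {R L h} m.
Arguments mLB {R L h} m.
Arguments mBdom {R L h} m [r] _.
Arguments mkap0_gt0 {R L h} m.
Arguments mkapP {R L h} m [r] _.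
Arguments mC_ge0 {R L h} m n.
Arguments msol {R L h} m n.
Arguments mreg {R L h} m n.
Arguments mfactor {R L h} m n [r] _.

Lemma sph_scale (R : realType) k (s : R) (x : 'rV[R]_3) : 0 < s -> x != 0 -> sph k (s *: x) = sph k x.
Proof. exact: ray_ext_scale. Qed.

(** * The separated modes as Steklov eigenfunctions *)

Section SteklovSpectrumLower.
Variables (R : realType) (L : R) (h : R -> R) (Mo : modes L h) (k : nat).
Notation V := 'rV[R]_3.
Implicit Types (u f : V -> R) (x : V).

Let B := mB Mo.
Let a := ma Mo k.
Let P := mP Mo k.
Let Y := @sph R k.
Let H (r : R) := h (L - r).
Let L0 : 0 < L := mL0 Mo.
Let LB : L < B := mLB Mo.
Let A := [set x : V | 0 < enorm x < B].
Let AL := [set x : V | 0 < enorm x < L].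

Let oA : open A. Proof. exact: open_annulus. Qed.
Let oAL : open AL. Proof. exact: open_annulus. Qed.
Let A0 : A `<=` @nonzero R. Proof. by move=> x /andP[]; rewrite enorm_gt0. Qed.
Let ALA x : AL x -> A x.
Proof. by move=> /andP[x0 xL]; rewrite /A /= x0 (lt_trans xL). Qed.
Let AL0 : AL `<=` @nonzero R. Proof. by move=> x /ALA; exact: A0. Qed.
Let Hpos r : 0 < r < B -> 0 < H r. Proof. by move=> /(mBdom Mo)[]. Qed.
Let LinB : 0 < L < B. Proof. by rewrite L0. Qed.
Let sol := msol Mo k.

Lemma integrable_ball f (M : R) : (forall x, AL x -> {for x, continuous f}) ->
  (forall x, AL x -> `|f x| <= M) ->
  (@lebesgue3 R).-integrable (@punctured_ball R L) (fun p => (f (vec3 p))%:E).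
Proof.
move=> cf bf; have mball : measurable (@punctured_ball R L) := measurable_vec3_open oAL.
apply: (proj2 (@integrable_mkcond _ _ _ (leb3 R) _ (fun p => (f (vec3 p))%:E) mball)).
have -> : ((fun p => (f (vec3 p))%:E) \_ (@punctured_ball R L)) =
  EFin \o ((fun p => f (vec3 p)) \_ (@punctured_ball R L)).
  by apply/funext => p; rewrite /= !patchE; case: ifP.
have LL : 0 < L := L0.
apply: (@integrable_box R _ (L + 1) (Num.max 0 M)); first by lra.
- apply/(measurable_restrictT _ mball); exact: (@measurable_fun_vec3 R AL f).
- move=> p; rewrite patchE le_max; case: ifPn => [|_]; last by rewrite normr0 lexx.
  by rewrite inE => pA; rewrite bf ?orbT.
move=> p np; rewrite patchE memNset // => /andP[_ pL]; apply: np; apply/in_box0 => j.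
by apply: (le_lt_trans (coord_le_enorm _ _)); apply: (lt_trans pL); rewrite ltrDl.
Qed.

(** The equation expresses the derivatives of [a] and [P] through [a], [P] and [1 / H^2], so
    together with the derivatives of [h] they generate a class closed under differentiation. *)
Lemma smooth_mode : smooth1_in `]0, B[%classic a.
Proof.
pose base (f : R -> R) := [\/ f = a, f = P | exists n, f = fun r => derive1n n h (L - r)].
have oI : open `]0, B[%classic by exact: interval_open.
apply: (@alg1_smooth_in R base) => //; last by apply: alg1_base; exact: Or31.
have aH : alg1 base `]0, B[%classic H by apply: alg1_base; apply: Or33; exists 0%N.
have inI (r : R) : `]0, B[%classic r -> 0 < r < B by rewrite /= in_itv.
move=> f [->|->|[n ->]].
- exists (fun r => P r * (H r * H r)^-1); last by move=> r /inI /sol[].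
  apply: alg1_mul; first by apply: alg1_base; exact: Or32.
  apply: alg1_inv; last exact: alg1_mul.
  by move=> r /inI /Hpos Hr; rewrite mulf_neq0 // gt_eqF.
- exists (fun r => lam R k * a r); last by move=> r /inI /sol[].
  by apply: alg1_mul; [exact: alg1_cst|apply: alg1_base; exact: Or31].
exists (fun r => -1 * derive1n n.+1 h (L - r)).
  by apply: alg1_mul; [exact: alg1_cst|apply: alg1_base; apply: Or33; exists n.+1].
move=> r /inI rB; rewrite mulN1r; apply: is_derive_reflect.
have [Wr _] := mBdom Mo rB; have d := mdom_smooth Mo n (L - r) Wr.
by rewrite derive1nS derive1E; exact: derivableP.
Qed.

Definition mode x : R := a (enorm x) * Y x.

Lemma smooth_mode3 : smooth_in A mode.
Proof.
apply: alg3_smooth_in => //; apply: alg3_mul.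
  apply: (alg3_comp smooth_mode); last exact: alg3_enorm.
  by move=> x; rewrite /A /= in_itv.
by apply: alg3_smooth; apply: smooth_in_sub A0 (@smooth_sph R k).
Qed.

Let gY x : A x -> has_grad Y x (fun i => partial i Y x).
Proof. by move=> /A0 x0; exact: (smooth_in_grad (@smooth_sph R k)). Qed.

Let has_grad_radialY (f : R -> R) x d : A x -> is_derive (enorm x) 1 f d ->
  has_grad (fun y => f (enorm y) * Y y) x (fun i => d * (x 0 i / enorm x) * Y x + f (enorm x) * partial i Y x).
Proof. by move=> Ax df; apply: has_gradM; [apply: has_grad_radial => //; exact: A0|exact: gY]. Qed.

Let euler_radialY (f : V -> R) (F : R -> R) x d : A x -> is_derive (enorm x) 1 F d ->
  (\near x, F (enorm x) * Y x = f x) -> euler f x = enorm x * d * Y x.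
Proof.
move=> Ax dF Ff; have [_ g] := near_eq_has_grad Ff (has_grad_radialY Ax dF).
have n0 : enorm x != 0 by rewrite enorm_eq0; exact: A0.
have eY : euler Y x = 0 := euler_ray_ext (@smooth_sph R k) (A0 Ax).
have -> : euler f x = d * Y x / enorm x * sqn x + F (enorm x) * euler Y x.
  rewrite /euler /sqn !mulr_sumr -big_split /=; apply: eq_bigr => i _; rewrite g; field.
  exact: n0.
by rewrite eY mulr0 addr0 -sqr_enorm; field.
Qed.

Lemma euler_mode x : A x -> euler mode x = enorm x * (P (enorm x) / H (enorm x) ^+ 2) * Y x.
Proof.
by move=> Ax; have [d _] := sol Ax; apply: (euler_radialY Ax d); near=> y.
Unshelve. all: by end_near. Qed.

Lemma euler_momentum x : A x ->
  euler (radial_momentum L h mode) x = enorm x * (lam R k * a (enorm x)) * Y x.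
Proof.
move=> Ax; have [_ d] := sol Ax; apply: (euler_radialY Ax d).
have nA : nbhs x A by exact: open_nbhs_nbhs.
near=> y; have Ay : A y by near: y; exact: nA.
have n0 : enorm y != 0 by rewrite enorm_eq0; exact: A0.
have Hy : H (enorm y) != 0 by rewrite gt_eqF // Hpos.
rewrite /H in Hy; rewrite /radial_momentum /dru euler_mode // /P /H; field.
by rewrite n0 Hy.
Unshelve. all: by end_near. Qed.

Lemma rlapZ (c : R) f x : smooth_in (@nonzero R) f -> x != 0 -> rlap (fun y => c * f y) x = c * rlap f x.
Proof.
move=> sf x0; have oN := @open_nonzero R.
have r1 (g : V -> R) j i y : differentiable g y -> rot j i (fun z => c * g z) y = c * rot j i g y.
  move=> dg; rewrite (rotM j i (has_grad_cst c y).1 dg) (rot_grad j i (has_grad_cst c y)).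
  by rewrite !mulr0 subrr mul0r add0r.
have r2 j i : rot j i (rot j i (fun y => c * f y)) x = c * rot j i (rot j i f) x.
  rewrite -(r1 _ _ _ _ (smooth_in_grad (smooth_rot j i oN sf) x0).1); apply: esym; apply: rot_near.
    near=> y; apply: esym; apply: r1; have y0 : y != 0 by near: y; exact: open_nonzero.
    exact: (smooth_in_grad sf y0).1.
  exact: (has_gradM (has_grad_cst c x) (smooth_in_grad (smooth_rot j i oN sf) x0)).1.
apply: (etrans (congr2 +%R (congr2 +%R (r2 0 1) (r2 0 2%:R)) (r2 1 2%:R))).
rewrite -!mulrDr; congr (_ * _).
Unshelve. all: by end_near. Qed.

(** On each sphere [mode] is a constant multiple of [Y], and [rlap] differentiates along spheres
    only. *)
Lemma rlap_mode x : A x -> rlap mode x = - lam R k * mode x.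
Proof.
move=> Ax; have x0 := A0 Ax; have n0 : enorm x != 0 by rewrite enorm_eq0.
have rA y : y != 0 -> A (ray (enorm x) y) by move=> y0; rewrite /A /= enorm_ray ?enorm_ge0.
have rx : ray (enorm x) x = x by rewrite /ray divff // scale1r.
have E := rlap_ray oA smooth_mode3 rA x0; rewrite rx in E; rewrite -E.
have eq y : y != 0 -> mode (ray (enorm x) y) = a (enorm x) * Y y.
  move=> y0; have er := enorm_ray (enorm_ge0 x) y0; rewrite /mode er.
  apply: (congr1 (fun z => a (enorm x) * z)).
  have px : 0 < enorm x by rewrite enorm_gt0; exact: x0.
  have py : 0 < enorm y by rewrite enorm_gt0; exact: y0.
  have s0 := divr_gt0 px py.
  exact: (ray_ext_scale (@harm_re R k) s0 y0).
have sm : smooth_in (@nonzero R) (fun y => mode (ray (enorm x) y)) by exact: smooth_ray smooth_mode3 rA.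
apply: (etrans (eq_rlap sm eq x0)); apply: (etrans (rlapZ _ (@smooth_sph R k) x0)).
by apply: (etrans (congr1 (fun z => a (enorm x) * z) (rlap_sph k x0))); rewrite /mode mulrCA.
Qed.

Lemma div_mode x : A x -> rlap mode x / enorm x ^+ 2 + euler (radial_momentum L h mode) x / enorm x ^+ 3 = 0.
Proof.
move=> Ax; have n0 : enorm x != 0 by rewrite enorm_eq0; exact: A0.
by rewrite (rlap_mode Ax) (euler_momentum Ax) /mode; field.
Qed.

Let sAL : smooth_in AL mode. Proof. by move=> x /ALA; exact: smooth_mode3. Qed.

Let dK x : AL x -> differentiable (radial_momentum L h mode) x.
Proof.
move=> Ax; apply: (smooth_in_grad _ Ax).1.
by apply: (smooth_radial_momentum (mdom_smooth Mo) (mdom_sub Mo)) => // y /andP[-> /ltW].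
Qed.

(** [Y] has degree 0 and its partial derivatives degree [-1], so bounds on the unit sphere extend
    everywhere. *)
Lemma sph_bounded : exists2 M : R, 0 <= M & forall x, x != 0 -> `|Y x| <= M /\
  forall i, `|partial i Y x| <= M / enorm x.
Proof.
have sY := @smooth_sph R k; have c1 x : 1 <= enorm x <= 1 -> x != 0.
  by move=> /andP[x1 _]; rewrite -enorm_gt0 (lt_le_trans ltr01).
have [|M [M0 hM]] := @annulus_bounded R Y 1 1 ltr01; first by move=> x /c1; exact: (smooth_continuous sY).
have bi i := @annulus_bounded R (partial i Y) 1 1 ltr01
  (fun x hx => smooth_continuous (smooth_in_partial i sY) (c1 x hx)).
have [N0 [N00 hN0]] := bi 0; have [N1 [N10 hN1]] := bi 1; have [N2 [N20 hN2]] := bi 2%:R.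
have M2 : 0 <= M + N0 + N1 + N2 by rewrite !addr_ge0.
exists (M + N0 + N1 + N2) => // x x0; have n0 : enorm x != 0 by rewrite enorm_eq0.
have x1 : enorm (ray 1 x) = 1 by exact: enorm_ray.
have r1 : 1 <= enorm (ray 1 x) <= 1 by rewrite x1 lexx.
split.
  have -> : Y x = Y (ray 1 x) by rewrite /Y /sph ray_ext_ray.
  apply: (le_trans (hM _ r1)); lra.
move=> i; have rn0 := ray_neq0 (@ltr01 R) x0.
have gr := has_grad_ray x0 (smooth_in_grad sY rn0).
have e : partial i Y x = partial i Y (ray 1 x) / enorm x.
  have ne : \near x, Y (ray 1 x) = Y x.
    by near=> y; apply: ray_ext_ray; near: y; exact: open_nonzero.
  rewrite (near_eq_has_grad ne gr).2.
  have -> : \sum_j partial j Y (ray 1 x) * (1 * (- x 0 i / enorm x ^+ 3 * x 0 j + (enorm x)^-1 * (i == j)%:R))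
     = - (x 0 i / enorm x ^+ 2) * euler Y (ray 1 x) + \sum_j partial j Y (ray 1 x) * (enorm x)^-1 * (i == j)%:R.
    rewrite /euler mulr_sumr -big_split /=; apply: eq_bigr => j _; rewrite ray1 !mxE; field.
    exact: n0.
  rewrite (euler_ray_ext sY rn0) mulr0 add0r (bigD1 i) //= eqxx mulr1 big1 ?addr0 //.
  by move=> j ji; rewrite eq_sym (negbTE ji) mulr0.
rewrite e normrM normfV (ger0_norm (enorm_ge0 x)); apply: ler_wpM2r; first by rewrite invr_ge0 enorm_ge0.
have : `|partial i Y (ray 1 x)| <= N0 + N1 + N2.
  case: (ord3E i) => ->; [apply: (le_trans (hN0 _ r1))|apply: (le_trans (hN1 _ r1))|apply: (le_trans (hN2 _ r1))]; lra.
move=> h1; apply: (le_trans h1); lra.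
Unshelve. all: by end_near. Qed.

Let B_gt0 : 0 < B. Proof. exact: lt_trans LB. Qed.

(** For [k > 0] this follows from [P = O(r^(k+1))]. For [k = 0] that is one power short, but then
    [P' = 0] and [P] vanishes identically. *)
Lemma momentum_bound : exists2 C : R, 0 <= C & forall r, 0 < r < B -> `|P r| <= C * r ^+ 2.
Proof.
have C0 := mC_ge0 Mo k; have f r rB := mfactor Mo k (r := r) rB.
have P0 : k = 0%N -> forall r, 0 < r < B -> P r = 0.
  move=> k0; have sm : small_at0 P.
    exists B, (mC Mo k); split => // r rB; have [_ _ _ _] := f r rB; by rewrite {3}k0 expr1.
  have dP r : 0 < r < B -> is_derive r 1 P 0.
    by move=> rB; have [_ d] := sol rB; apply: (is_derive_change d); rewrite k0 /lam !mul0r.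
  move=> r rB; apply/le_anti/andP; split; last exact: (grow_from0 sm dP).
  rewrite -oppr_ge0; apply: (grow_from0 (small_at0N sm) (df := fun=> 0) _ _ rB) => // s sB.
  by apply: (is_derive_change (is_derive_opp (dP s sB))); rewrite oppr0.
have [k0|k0] := eqVneq k 0%N.
  by exists 0 => // r rB; rewrite P0 // normr0 mul0r.
exists (mC Mo k * B ^+ k.-1); first by rewrite mulr_ge0 // exprn_ge0 // ltW.
move=> r rB; have [_ _ _ _ hP] := f r rB; have /andP[r0 rB'] := rB.
apply: (le_trans hP); rewrite -mulrA; apply: ler_wpM2l => //.
have -> : r ^+ k.+1 = r ^+ k.-1 * r ^+ 2.
  by rewrite -exprD; congr (_ ^+ _); case: (k) k0 => // n _; rewrite addn2.
apply: ler_wpM2r; first by rewrite exprn_ge0 // ltW.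
by apply: lerXn2r; rewrite ?nnegrE ?ltW.
Qed.

Lemma slope_bound : exists2 C : R, 0 <= C & forall r, 0 < r < B -> `|P r / H r ^+ 2| <= C.
Proof.
have [C C0 hC] := momentum_bound.
have kp r : 0 < r < B -> 0 < r ^+ 2 / H r ^+ 2 by move=> rB; rewrite divr_gt0 ?exprn_gt0 ?Hpos //; case/andP: rB.
have K0 : 0 <= mkap Mo.
  have [_ k2] := andP (mkapP Mo LinB); apply: le_trans k2; exact/ltW/kp.
exists (C * mkap Mo); first exact: mulr_ge0.
move=> r rB; have /andP[r0 _] := rB; have [_ k2] := andP (mkapP Mo rB).
have Hr := Hpos rB.
have -> : P r / H r ^+ 2 = (P r / r ^+ 2) * (r ^+ 2 / H r ^+ 2) by field; rewrite !gt_eqF.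
rewrite normrM (gtr0_norm (kp _ rB)); apply: ler_pM => //; first exact/ltW/kp.
by rewrite normrM normfV (gtr0_norm (exprn_gt0 2 r0)) ler_pdivrMr ?exprn_gt0 // hC.
Qed.

Lemma mode_bounds : exists2 C : R, 0 <= C & forall x, A x ->
  [/\ `|mode x| <= C, `|P (enorm x) / H (enorm x) ^+ 2 * Y x| <= C & forall i, `|partial i mode x| <= C].
Proof.
have [M M0 hM] := sph_bounded; have [S S0 hS] := slope_bound.
have C0 := mC_ge0 Mo k; pose Q : R := 1 + mC Mo k * B.
have Q0 : 0 <= Q by rewrite addr_ge0 // mulr_ge0 // ltW.
have ha r : 0 < r < B -> `|a r| <= r ^+ k * Q.
  move=> /[dup] rB /andP[r0 rB']; have [e1 _ _ hal _] := mfactor Mo k rB; rewrite /a e1.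
  rewrite normrM ger0_norm ?exprn_ge0 ?(ltW r0) //; apply: ler_wpM2l; first by rewrite exprn_ge0 // ltW.
  have : mC Mo k * r <= mC Mo k * B by apply: ler_wpM2l => //; exact: ltW.
  have := ler_normD (mal Mo k r - 1) 1; rewrite subrK normr1 /Q; lra.
have gr x i : A x -> partial i mode x = P (enorm x) / H (enorm x) ^+ 2 * (x 0 i / enorm x) * Y x + a (enorm x) * partial i Y x.
  by move=> Ax; have [d _] := sol Ax; have [_ ->] := has_grad_radialY Ax d.
have SY x : A x -> `|P (enorm x) / H (enorm x) ^+ 2 * Y x| <= S * M.
  by move=> Ax; rewrite normrM; apply: ler_pM => //; [exact: hS|exact: (hM x (A0 Ax)).1].
(* The factor [1 / |x|] in the derivatives of [Y] is absorbed by [a = O(r^k)] when [k > 0]; for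
   [k = 0] the function [Y] is constant. *)
have aY : exists2 T : R, 0 <= T & forall x i, A x -> `|a (enorm x) * partial i Y x| <= T.
  have [k0|k0] := eqVneq k 0%N.
    exists 0 => // x i Ax; have -> : partial i Y x = 0.
      have -> : Y = fun=> 1 by apply/funext => y; rewrite /Y k0.
      by rewrite (has_grad_cst 1 x).2.
    by rewrite mulr0 normr0.
  exists (B ^+ k.-1 * Q * M); first by rewrite !mulr_ge0 // exprn_ge0 // ltW.
  move=> x i Ax; have /andP[x0 xB] := Ax; rewrite normrM.
  have h1 : `|a (enorm x)| <= enorm x * (B ^+ k.-1 * Q).
    apply: (le_trans (ha _ Ax)); rewrite mulrA; apply: ler_wpM2r => //.
    have -> : enorm x ^+ k = enorm x * enorm x ^+ k.-1 by rewrite -exprS prednK // lt0n.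
    apply: ler_wpM2l; first exact: ltW.
    by apply: lerXn2r; rewrite ?nnegrE ?ltW.
  apply: (@le_trans _ _ (enorm x * (B ^+ k.-1 * Q) * (M / enorm x))).
    by apply: ler_pM => //; exact: (hM x (A0 Ax)).2.
  by rewrite le_eqVlt; apply/orP; left; apply/eqP; field; rewrite gt_eqF.
have [T T0 hT] := aY.
have BQ : 0 <= B ^+ k * Q * M by rewrite !mulr_ge0 // exprn_ge0 // ltW.
have SM := mulr_ge0 S0 M0.
exists (B ^+ k * Q * M + S * M + T); first by rewrite !addr_ge0.
move=> x Ax; have /andP[x0 xB] := Ax; split.
- have : `|mode x| <= B ^+ k * Q * M; last by lra.
  rewrite normrM; apply: ler_pM => //; last exact: (hM x (A0 Ax)).1.
  apply: (le_trans (ha _ Ax)); apply: ler_wpM2r => //.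
  by apply: lerXn2r; rewrite ?nnegrE ?ltW.
- by have := SY x Ax; lra.
move=> i; rewrite (gr x i Ax); apply: (le_trans (ler_normD _ _)).
have : `|P (enorm x) / H (enorm x) ^+ 2 * (x 0 i / enorm x) * Y x| <= S * M.
  rewrite mulrAC normrM -[leRHS]mulr1; apply: ler_pM => //; first exact: SY.
  rewrite normrM normfV (gtr0_norm x0) ler_pdivrMr // mul1r; exact: coord_le_enorm.
by have := hT x i Ax; lra.
Qed.

(** The volume density of the metric off the center. *)
Let conf x : R := (h (L - enorm x) / enorm x) ^+ 2.

Lemma conf_bound x : A x -> 0 <= conf x <= (mkap0 Mo)^-1.
Proof.
move=> Ax; have /andP[x0 xB] := Ax; have [k1 _] := andP (mkapP Mo Ax); have Hx := Hpos Ax.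
rewrite sqr_ge0 /=; have -> : conf x = (enorm x ^+ 2 / H (enorm x) ^+ 2)^-1.
  by rewrite /conf -/(H (enorm x)); field; rewrite !gt_eqF.
rewrite lef_pV2 ?posrE ?mkap0_gt0 //.
by rewrite divr_gt0 // exprn_gt0.
Qed.

Lemma alg3_conf : alg3 AL conf.
Proof.
have c1 : alg3 AL (fun x => h (L - enorm x) * (enorm x)^-1).
  apply: alg3_mul; last exact: alg3_invenorm.
  by apply: (alg3_profile (mdom_smooth Mo) (mdom_sub Mo)) => y /andP[-> /ltW].
exact: (alg3_mul c1 c1).
Qed.

Lemma smooth_flux_mode i : smooth_in AL (flux L h mode i).
Proof.
apply: alg3_smooth_in => //.
have aE : alg3 AL (fun x => euler mode x / sqn x).
  apply: alg3_mul.
    apply: alg3_sum => j; apply: alg3_mul; first exact: alg3_coord.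
    by apply: alg3_smooth; exact: smooth_in_partial.
  apply: (alg3_comp (@smooth1_inv R)); last exact: alg3_sqn.
  by move=> x /AL0 x0; rewrite /= lt_def sqn_eq0 x0 sqn_ge0.
have ap : alg3 AL (partial i mode) by apply: alg3_smooth; exact: smooth_in_partial.
have := alg3_add (alg3_add ap (alg3_mul (alg3_cst AL (-1)) (alg3_mul (alg3_coord AL i) aE)))
  (alg3_mul (alg3_coord AL i) (alg3_mul alg3_conf aE)).
by congr (alg3 AL _); apply/funext => x; rewrite /flux /conf mulN1r mulrA.
Qed.

(** Boundedness of the flux up to the center is the condition under which the center is removable
    for the weak equation. *)
Lemma flux_mode_bound : exists2 M : R, 0 <= M & forall i x, A x -> `|flux L h mode i x| <= M.
Proof.
have [C C0 hC] := mode_bounds; have k0 : 0 <= (mkap0 Mo)^-1 by rewrite invr_ge0 ltW // mkap0_gt0.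
exists (C + C + (mkap0 Mo)^-1 * C); first by rewrite !addr_ge0 // mulr_ge0.
move=> i x Ax; have [_ h1 /(_ i) h2] := hC x Ax; have /andP[x0 xB] := Ax.
have n0 : enorm x != 0 by rewrite gt_eqF.
have E : x 0 i * (euler mode x / sqn x) = (x 0 i / enorm x) * (P (enorm x) / H (enorm x) ^+ 2 * Y x).
  have Hx : H (enorm x) != 0 by rewrite gt_eqF // Hpos.
  by rewrite (euler_mode Ax) -sqr_enorm; field; rewrite n0 Hx.
have hE : `|x 0 i * (euler mode x / sqn x)| <= C.
  rewrite E normrM -[leRHS]mul1r; apply: ler_pM => //.
  by rewrite normrM normfV (gtr0_norm x0) ler_pdivrMr // mul1r coord_le_enorm.
have -> : flux L h mode i x = partial i mode x - x 0 i * (euler mode x / sqn x)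
   + conf x * (x 0 i * (euler mode x / sqn x)) by rewrite /flux /conf; ring.
apply: (le_trans (ler_normD _ _)); apply: lerD.
  by apply: (le_trans (ler_normB _ _)); apply: lerD.
have /andP[c0 c1] := conf_bound Ax.
by rewrite normrM (ger0_norm c0); apply: ler_pM.
Qed.

Lemma finite_energy_mode : finite_energy L h mode.
Proof.
have [C C0 hC] := mode_bounds; have [M M0 hM] := flux_mode_bound.
have mball : measurable (@punctured_ball R L) := measurable_vec3_open oAL.
have hx x : AL x -> h (L - enorm x) != 0 by move=> /ALA /Hpos Hx; rewrite gt_eqF.
split.
  apply: (@eq_integrable _ _ _ (leb3 R) (@punctured_ball R L) mball (fun p => (mode (vec3 p) ^+ 2 * conf (vec3 p))%:E)).
    move=> p; rewrite inE => Ap; rewrite /integrand vol_density_revolution //; exact: AL0.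
  apply: (@integrable_ball (fun x => mode x ^+ 2 * conf x) (C ^+ 2 * (mkap0 Mo)^-1)) => x Ax.
    apply: ct_mul; first by apply: ct_exp; exact: (smooth_continuous sAL).
    apply: (smooth_continuous (U := AL)) => //; apply: alg3_smooth_in => //; exact: alg3_conf.
  have [h1 _ _] := hC x (ALA Ax); have /andP[c0 c1] := conf_bound (ALA Ax).
  rewrite normrM (ger0_norm c0); apply: ler_pM => //.
  by rewrite normrX; apply: lerXn2r; rewrite ?nnegrE.
apply: (@eq_integrable _ _ _ (leb3 R) (@punctured_ball R L) mball (fun p => (\sum_i flux L h mode i (vec3 p) * partial i mode (vec3 p))%:E)).
  move=> p; rewrite inE => Ap; rewrite /integrand grad_dot_revolution //; [exact: AL0|exact: hx].
apply: (@integrable_ball (fun x => \sum_i flux L h mode i x * partial i mode x) (\sum_(i < 3) M * C)) => x Ax.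
  apply: ct_sum => i; apply: ct_mul; first exact: (smooth_continuous (smooth_flux_mode i)).
  exact: (smooth_continuous (smooth_in_partial i sAL)).
apply: (le_trans (ler_norm_sum _ _ _)); apply: ler_sum => i _; rewrite normrM.
by have [_ _ h3] := hC x (ALA Ax); apply: ler_pM => //; exact: hM (ALA Ax).
Qed.

Lemma enorm_scaled_pole : enorm (L *: @pole R) = L.
Proof. by rewrite enormZ enorm_pole mulr1 gtr0_norm. Qed.

Lemma mode_scaled_pole : mode (L *: @pole R) = a L.
Proof.
have yp := etrans (sph_scale k L0 (@pole_neq0 R)) (sph_pole R k).
exact: (etrans (congr2 (fun r y => a r * y) enorm_scaled_pole yp) (mulr1 _)).
Qed.

Lemma steklov_eigenfunction_mode : steklov_eigenfunction L h (steklov_ev L h (ma Mo) (mP Mo) k) mode.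
Proof.
have aL : 0 < a L := regular_solution_gt0 (lam_ge0 R k) sol (mreg Mo k) LinB.
have hx x : AL x -> h (L - enorm x) != 0 by move=> /ALA /Hpos Hx; rewrite gt_eqF.
have [M M0 hM] := flux_mode_bound.
split.
- exists A; split => //; last exact: smooth_mode3.
  by move=> x /andP[x0 xL]; rewrite /A /= x0 (le_lt_trans xL).
- exists (L *: @pole R); first by rewrite enorm_scaled_pole L0 lexx.
  by rewrite mode_scaled_pole gt_eqF.
- move=> x xL; rewrite (laplace_beltramiE (mpos Mo) oAL AL0 sAL xL xL (dK xL)).
  by rewrite (div_mode (ALA xL)) mulr0.
- split; first exact: finite_energy_mode.
  move=> phi [[U [_ UT sphi]] [r r0 phi0]].
  have sphi' : smooth_in setT phi by move=> x _; apply: sphi; exact: UT.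
  have dv x : AL x -> \sum_i partial i (flux L h mode i) x = 0.
    move=> Ax; rewrite (div_flux oAL AL0 sAL Ax (dK Ax)); exact: (div_mode (ALA Ax)).
  have K := divergence_free_weak (L0) smooth_flux_mode (fun i x Ax => hM i x (ALA Ax)) dv r0 sphi' phi0.
  have E p : p \in @punctured_ball R L -> integrand L h (grad_dot (revolution_metric L h) mode phi) p =
      (\sum_i flux L h mode i (vec3 p) * partial i phi (vec3 p))%:E.
    rewrite inE => Ap; apply: (congr1 EFin).
    exact: (grad_dot_revolution mode phi (AL0 Ap) (hx _ Ap)).
  exact: (etrans (@eq_integral _ _ _ (leb3 R) (@punctured_ball R L) _ _ E) K).
move=> x xL; have Ax : A x by rewrite /A /= xL L0.
rewrite (has_grad_derive _ (smooth_in_grad smooth_mode3 Ax)).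
have -> : \sum_i (L^-1 *: x) 0 i * partial i mode x = L^-1 * euler mode x.
  by rewrite /euler mulr_sumr; apply: eq_bigr => i _; rewrite mxE mulrA.
have h0 : h 0 != 0.
  by have := Hpos LinB; rewrite /H subrr => ?; rewrite gt_eqF.
rewrite (euler_mode Ax) /mode xL /H subrr /steklov_ev -/a -/P; field.
by rewrite h0 !gt_eqF.
Qed.

End SteklovSpectrumLower.

(** * Gaps and optimality *)

Section Eigenvalues.
Variable R : realType.

Lemma sphere_eigenvalueE j : sphere_eigenvalue R j = lam R j.
Proof.
apply: nth_least_range => [n|x]; first exact: lam_lt.
by split=> [/sphere_spectrum_lam|[n ->]] //; exact: lam_sphere_spectrum.
Qed.

Variables (L : R) (h : R -> R) (Mo : modes L h).

Let ev := steklov_ev L h (ma Mo) (mP Mo).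
Let Hpos r : 0 < r < mB Mo -> 0 < h (L - r). Proof. by move=> /(mBdom Mo)[]. Qed.
Let LinB : 0 < L < mB Mo. Proof. by rewrite (mL0 Mo) (mLB Mo). Qed.
Let h00 : 0 < h 0. Proof. by apply: (mpos Mo); rewrite lexx (mL0 Mo). Qed.

Lemma steklov_ev_gap j : ev j.+1 - ev j =
  (mP Mo j.+1 L / ma Mo j.+1 L - mP Mo j L / ma Mo j L) / h 0 ^+ 2.
Proof. by rewrite mulrBl. Qed.

Lemma steklovE j : steklov L h j = ev j.
Proof.
have LL := mL0 Mo.
apply: nth_least_range => [n|x].
  rewrite -subr_gt0 steklov_ev_gap divr_gt0 ?exprn_gt0 //.
  exact: (gap_gt0 (lam_ge0 R n) (lam_lt R (ltnSn n)) (msol Mo n) (mreg Mo n) (msol Mo n.+1) (mreg Mo n.+1) LinB).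
split=> [|[n ->]]; last by exists (mode Mo n); exact: steklov_eigenfunction_mode.
apply: (steklov_spectrum_sub LL (mdom_smooth Mo) (mdom_sub Mo) (mpos Mo) (mLB Mo) (mkap0_gt0 Mo) Hpos _ (msol Mo) (mreg Mo)).
by move=> r /andP[r0 rL]; apply: (mkapP Mo); rewrite r0 (lt_trans rL (mLB Mo)).
Qed.

Lemma steklov_gap_lt j : steklov L h j.+1 - steklov L h j < L * (lam R j.+1 - lam R j) / h 0 ^+ 2.
Proof.
rewrite !steklovE steklov_ev_gap ltr_pM2r ?invr_gt0 ?exprn_gt0 // [ltRHS]mulrC.
exact: (gap_lt (lam_ge0 R j) (lam_lt R (ltnSn j)) (msol Mo j) (mreg Mo j) (msol Mo j.+1) (mreg Mo j.+1) Hpos LinB).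
Qed.

(* If [h (L - r) >= r (c + M min(r, L - r))] then [\int_0^L r^2 / h(L - r)^2 dr] is [O(1 / M)]. *)
Lemma steklov_gap_ge j (c M : R) : 0 < c -> 0 < M ->
  (forall r, 0 < r < L -> r * (c + M * Num.min r (L - r)) <= h (L - r)) ->
  (L * (lam R j.+1 - lam R j) - 2 * lam R j.+1 ^+ 2 / (M * c)) / h 0 ^+ 2 <=
  steklov L h j.+1 - steklov L h j.
Proof.
move=> c0 M0 hh; have LL := mL0 Mo; rewrite !steklovE steklov_ev_gap ler_pM2r ?invr_gt0 ?exprn_gt0 //.
pose l1 := lam R j; pose l2 := lam R j.+1; have l20 : 0 <= l2 := lam_ge0 R _.
pose kap : R := 2 * l2 ^+ 2 / (M * c).
pose w r := mP Mo j.+1 r / ma Mo j.+1 r - mP Mo j r / ma Mo j r.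
pose q1 r : R := c + M * r; pose q2 r : R := c + M * (L - r).
have q10 r : 0 <= r -> 0 < q1 r by move=> r0; rewrite /q1 ltr_pwDl // mulr_ge0 // ltW.
have q20 r : r <= L -> 0 < q2 r by move=> rL; rewrite /q2 ltr_pwDl // mulr_ge0 ?subr_ge0 // ltW.
(* [1 / (c + M min(r, L - r))^2] is at most the sum of the two squares obtained from [r] and from
   [L - r]. [G] is the primitive of [l2^2] times this sum that vanishes at 0, and each half of it
   adds at most [l2^2 / (M c)], whence the 2 in [kap]. *)
pose G r : R := l2 ^+ 2 / M * (c^-1 - (q1 r)^-1 + ((q2 r)^-1 - (q2 0)^-1)).
pose dG r : R := l2 ^+ 2 * ((q1 r)^-1 ^+ 2 + (q2 r)^-1 ^+ 2).
have dGE r : 0 < r < L -> is_derive r 1 G (dG r).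
  move=> /andP[r0 rL]; have n1 : q1 r != 0 by rewrite gt_eqF // q10 // ltW.
  have n2 : q2 r != 0 by rewrite gt_eqF // q20 // ltW.
  have d1 : is_derive r 1 q1 M.
    by apply: (is_derive_change (is_derive_add (is_derive_const c r) (is_derive_scale M (is_derive_ident r)))); rewrite mulr1 add0r.
  have d2 : is_derive r 1 q2 (- M).
    apply: (is_derive_change (is_derive_add (is_derive_const c r) (is_derive_scale M
      (is_derive_add (is_derive_const L r) (is_derive_opp (is_derive_ident r)))))).
    by rewrite !add0r mulrN1.
  have d := is_derive_scale (l2 ^+ 2 / M) (is_derive_add
    (is_derive_add (is_derive_const c^-1 r) (is_derive_opp (is_derive_inv n1 d1)))
    (is_derive_add (is_derive_inv n2 d2) (is_derive_const (- (q2 0)^-1) r))).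
  by apply: (is_derive_change d); rewrite /dG; field; rewrite n1 n2 gt_eqF.
have Gsmall : small_at0 G.
  exists L, (l2 ^+ 2 * (2 / c ^+ 2)); split => //; first by rewrite mulr_ge0 ?sqr_ge0 // divr_ge0 // sqr_ge0.
  move=> r /andP[r0 rL]; have p1 := q10 r (ltW r0); have p2 := q20 r (ltW rL); have p3 := q20 0 (ltW LL).
  have -> : G r = l2 ^+ 2 * ((c * q1 r)^-1 + (q2 r * q2 0)^-1) * r.
    have k1 : q1 r - c = M * r by rewrite /q1; ring.
    have k2 : q2 0 - q2 r = M * r by rewrite /q2; ring.
    have -> : G r = l2 ^+ 2 / M * ((q1 r - c) * (c * q1 r)^-1 + (q2 0 - q2 r) * (q2 r * q2 0)^-1).
      rewrite /G; move: (q1 r) (q2 r) (q2 0) p1 p2 p3 => x1 x2 x3 p1 p2 p3; field.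
      by rewrite !gt_eqF.
    rewrite k1 k2; move: (c * q1 r)^-1 (q2 r * q2 0)^-1 => z1 z2; field.
    by rewrite gt_eqF.
  have c1 : c <= q1 r by rewrite lerDl mulr_ge0 // ltW.
  have c2 : c <= q2 r by rewrite lerDl mulr_ge0 ?subr_ge0 // ltW.
  have c3 : c <= q2 0 by rewrite lerDl mulr_ge0 ?subr0 // ltW.
  have i1 : (c * q1 r)^-1 <= (c ^+ 2)^-1.
    by rewrite lef_pV2 ?posrE ?mulr_gt0 ?exprn_gt0 // expr2 ler_pM2l.
  have i2 : (q2 r * q2 0)^-1 <= (c ^+ 2)^-1.
    by rewrite lef_pV2 ?posrE ?mulr_gt0 ?exprn_gt0 // expr2; apply: ler_pM => //; exact: ltW.
  have i0 : 0 <= (c * q1 r)^-1 + (q2 r * q2 0)^-1 by rewrite addr_ge0 // invr_ge0 ltW // mulr_gt0.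
  rewrite ger0_norm; last by rewrite mulr_ge0 ?(ltW r0) // mulr_ge0 ?sqr_ge0.
  apply: ler_wpM2r; first exact: ltW.
  by apply: ler_wpM2l; [exact: sqr_ge0|lra].
have Gle r : 0 < r < L -> G r <= kap.
  move=> /andP[r0 rL]; have p1 := q10 r (ltW r0); have p2 := q20 r (ltW rL); have p3 := q20 0 (ltW LL).
  have c2 : c <= q2 r by rewrite lerDl mulr_ge0 ?subr_ge0 // ltW.
  have -> : kap = l2 ^+ 2 / M * (2 * c^-1) by rewrite /kap; field; rewrite !gt_eqF.
  apply: ler_wpM2l; first by rewrite divr_ge0 ?sqr_ge0 // ltW.
  have i1 : 0 <= (q1 r)^-1 by rewrite invr_ge0 ltW.
  have i3 : 0 <= (q2 0)^-1 by rewrite invr_ge0 ltW.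
  have i2 : (q2 r)^-1 <= c^-1 by rewrite lef_pV2 ?posrE.
  lra.
have rB r : 0 < r < L -> 0 < r < mB Mo by move=> /andP[-> rL]; rewrite (lt_trans rL (mLB Mo)).
have GH s : 0 < s < L -> l2 ^+ 2 * (s ^+ 2 / h (L - s) ^+ 2) <= dG s.
  move=> sL; have /andP[s0 s1] := sL; apply: ler_wpM2l; first exact: sqr_ge0.
  have p1 := q10 s (ltW s0); have p2 := q20 s (ltW s1); have Hs := Hpos (rB s sL).
  have mn : 0 < c + M * Num.min s (L - s) by rewrite ltr_pwDl // mulr_ge0 ?ltW // lt_min s0 subr_gt0.
  have h1 : s ^+ 2 / h (L - s) ^+ 2 <= (c + M * Num.min s (L - s))^-1 ^+ 2.
    have sh0 : 0 <= s / h (L - s) by rewrite divr_ge0 // ltW.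
    have mi0 : 0 <= (c + M * Num.min s (L - s))^-1 by rewrite invr_ge0 ltW.
    rewrite -expr_div_n; apply: lerXn2r; rewrite ?nnegrE //.
    by rewrite ler_pdivrMr // ler_pdivlMl // mulrC hh.
  apply: (le_trans h1); rewrite /Num.min; case: ifP => _; rewrite -/(q1 s) -/(q2 s).
    by rewrite lerDl sqr_ge0.
  by rewrite lerDr sqr_ge0.
have wlow r : 0 < r < L -> (l2 - l1) * r - kap <= w r.
  move=> rL; have res (n : nat) : radial_solution (fun r => h (L - r)) L (lam R n) (ma Mo n) (mP Mo n).
    by move=> s sL; exact: msol (rB s sL).
  have HposL s : 0 < s < L -> 0 < h (L - s) by move=> sL; exact: Hpos (rB s sL).
  have := @gap_lower R (fun r => h (L - r)) L l1 l2 _ _ _ _ (lam_ge0 R j) (lam_lt R (ltnSn j))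
    (res j) (mreg Mo j) (res j.+1) (mreg Mo j.+1) HposL G dG r Gsmall dGE GH rL.
  by apply: le_trans; rewrite lerD2l lerN2; exact: Gle.
have aL n : 0 < ma Mo n L := regular_solution_gt0 (lam_ge0 R n) (msol Mo n) (mreg Mo n) LinB.
have cw n : {for L, continuous (fun r => mP Mo n r / ma Mo n r)}.
  have [d1 d2] := msol Mo n _ LinB.
  apply: ct_mul; first exact: is_derive_continuous d2.
  by apply: ct_inv; [rewrite gt_eqF|exact: is_derive_continuous d1].
(* The lower bound holds for [r < L]; continuity carries it to [L]. *)
pose f r := (l2 - l1) * r - kap - w r.
have cf : {for L, continuous f}.
  apply: ct_add; last by apply: ct_opp; apply: ct_add; [exact: cw|apply: ct_opp; exact: cw].
  by apply: ct_add; [apply: ct_mul; [exact: ct_cst|exact: cvg_id]|exact: ct_cst].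
have fL : f L <= 0.
  rewrite leNgt; apply/negP => fL0.
  have n1 : \forall s \near L, 0 < f s by exact: (@cvgr_gt R _ (nbhs L) (nbhs_filter L) f (f L) cf 0 fL0).
  have n2 : \forall s \near L, 0 < s by exact: lt_nbhsr.
  have n3 : \forall s \near L, 0 < s /\ 0 < f s by exact: filterI n2 n1.
  have [s sL [s0 fs]] := left_point n3.
  by move: fs; rewrite /f subr_gt0 ltNge wlow // s0.
by move: fL; rewrite /f /w /kap -/l1 -/l2 subr_le0 mulrC.
Qed.

End Eigenvalues.

(** * Profiles that nearly attain the bound *)

Section Optimality.
Variable R : realType.

(** With [r = L - t] the profile is [r p(r)]. The affine part of [p] interpolates between 1 at
    [r = 0], which gives [h'(L) = -1], and [h0 / L] at [r = L], which gives [h(0) = h0]. The bump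
    [(2 M / L) r (L - r)] vanishes at both ends and is at least [M min(r, L - r)], as the larger of
    [r] and [L - r] is at least [L / 2]. *)
Lemma admissible_peaked (L h0 M : R) : 0 < L -> 0 < h0 -> 0 < M -> exists h : R -> R,
  [/\ admissible L h, h 0 = h0 & forall r, 0 < r < L ->
      r * (Num.min 1 (h0 / L) + M * Num.min r (L - r)) <= h (L - r)].
Proof.
move=> L0 h00 M0; pose p (r : R) := 1 + (h0 / L - 1) / L * r + 2 * M / L * (r * (L - r)).
pose h (t : R) := (L - t) * p (L - t).
have nL : L != 0 by rewrite gt_eqF.
have hL0 : 0 < h0 / L by rewrite divr_gt0.
have hp r : 0 <= r <= L -> Num.min 1 (h0 / L) + M * Num.min r (L - r) <= p r.
  move=> /andP[r0 rL]; rewrite /p; apply: lerD.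
    have -> : 1 + (h0 / L - 1) / L * r = 1 * ((L - r) / L) + (h0 / L) * (r / L) by field.
    have k1 : 0 <= (L - r) / L by rewrite divr_ge0 ?subr_ge0 // ltW.
    have k2 : 0 <= r / L by rewrite divr_ge0 // ltW.
    have k3 : (L - r) / L + r / L = 1 by field.
    rewrite -[leLHS]mulr1 -k3 mulrDr; apply: lerD; apply: ler_wpM2r => //.
      by rewrite ge_min lexx.
    by rewrite ge_min lexx orbT.
  have -> : 2 * M / L * (r * (L - r)) = M * (2 * r * (L - r) / L) by field.
  apply: ler_wpM2l; first exact: ltW.
  rewrite ler_pdivlMr //; have [rr|rr] := leP r (L - r).
    have : r * L <= r * (2 * (L - r)) by apply: ler_wpM2l => //; lra.
    lra.
  have : (L - r) * L <= (L - r) * (2 * r) by apply: ler_wpM2l; lra.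
  lra.
have pc r : 0 <= r <= L -> 0 < p r.
  move=> rL; apply: lt_le_trans (hp r rL); rewrite ltr_pwDl ?lt_min ?ltr01 //.
  by case/andP: rL => r0 rL; rewrite mulr_ge0 ?le_min ?r0 ?subr_ge0 // ltW.
have sh : smooth1_in [set: R] h.
  have oT : open [set: R] by exact: openT.
  have nob (f : R -> R) : (fun _ : R -> R => False) f -> exists2 g, alg1 (fun _ => False) [set: R] g &
    forall x, [set: R] x -> is_derive x 1 f (g x) by [].
  apply: (alg1_smooth_in oT nob).
  have ai : alg1 (fun _ : R -> R => False) [set: R] (fun t => L - t).
    have E : (fun t : R => L - t) = (fun t => L + (-1) * t) by apply/funext => t; rewrite mulN1r.
    rewrite E; apply: alg1_add; first exact: alg1_cst.
    by apply: alg1_mul; [exact: alg1_cst|apply: alg1_smooth; exact: smooth1_id].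
  apply: (alg1_mul ai); rewrite /p; apply: alg1_add.
    by apply: alg1_add; [exact: alg1_cst|apply: alg1_mul => //; exact: alg1_cst].
  apply: alg1_mul; first exact: alg1_cst.
  apply: alg1_mul => //.
  have E : (fun t : R => L - (L - t)) = id by apply/funext => t; rewrite subKr.
  by rewrite E; apply: alg1_smooth; exact: smooth1_id.
exists h; split; last first.
- move=> r /andP[r0 rL]; rewrite /h subKr; apply: ler_wpM2l; first exact: ltW.
  by apply: hp; rewrite !ltW.
- by rewrite /h /p subr0 subrr mulr0 mulr0 addr0; field.
split.
- by exists [set: R]; split => //; exact: openT.
- move=> t /andP[t0 tL]; rewrite mulr_gt0 ?subr_gt0 //; apply: pc.
  by rewrite subr_ge0 (ltW tL) /= gerBl.
- by rewrite /h subrr mul0r.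
rewrite derive1E; apply: derive_val.
have d1 : is_derive L 1 (fun t : R => L - t) (-1).
  by apply: (is_derive_change (is_derive_add (is_derive_const L L) (is_derive_opp (is_derive_ident L)))); rewrite add0r.
have dp (y : R) : is_derive y 1 p ((h0 / L - 1) / L + 2 * M / L * (L - y - y)).
  apply: (is_derive_change (is_derive_add (is_derive_add (is_derive_const 1 y)
    (is_derive_scale ((h0 / L - 1) / L) (is_derive_ident y))) (is_derive_scale (2 * M / L)
    (is_derive_mul (is_derive_ident y) (is_derive_add (is_derive_const L y) (is_derive_opp (is_derive_ident y))))))).
  by ring.
have d2 := @is_derive1_comp R p (fun t => L - t) L _ _ (dp (L - L)) d1.
apply: (is_derive_change (is_derive_mul d1 d2)).
by rewrite /p /= subrr; ring.
Qed.

End Optimality.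

Theorem theorem1p4 (R : realType) (L : R) (L_gt0 : 0 < L) :
  (forall h : R -> R, admissible L h -> forall j : nat,
     steklov L h j.+1 - steklov L h j <
       L * (sphere_eigenvalue R j.+1 - sphere_eigenvalue R j) / h 0 ^+ 2) /\
  (forall h0 : R, 0 < h0 -> forall j : nat,
     ereal_sup [set (steklov L h j.+1 - steklov L h j)%:E |
                 h in [set h : R -> R | admissible L h /\ h 0 = h0]] =
       (L * (sphere_eigenvalue R j.+1 - sphere_eigenvalue R j) / h0 ^+ 2)%:E).
Proof.
have upper h : admissible L h -> forall j, steklov L h j.+1 - steklov L h j <
    L * (lam R j.+1 - lam R j) / h 0 ^+ 2.
  by move=> ha j; have [Mo] := admissible_modes L_gt0 ha; exact: steklov_gap_lt.
split=> [h ha j|h0 h00 j]; first by rewrite !sphere_eigenvalueE; exact: upper.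
rewrite !sphere_eigenvalueE; apply/le_anti/andP; split.
  by apply: ub_ereal_sup => _ [h [ha <-] <-]; rewrite lee_fin ltW // upper.
apply/lee_addgt0Pr => e e0.
pose c : R := Num.min 1 (h0 / L); have c0 : 0 < c by rewrite lt_min ltr01 divr_gt0.
pose K : R := 2 * lam R j.+1 ^+ 2 / c / h0 ^+ 2.
have h2 : 0 < h0 ^+ 2 by rewrite exprn_gt0.
have K0 : 0 <= K by rewrite !divr_ge0 ?mulr_ge0 ?sqr_ge0 // ltW.
(* [K / M] is the deficit of the lower bound for a bump of size [M]; this choice makes it at most
   [e]. *)
pose M : R := K / e + 1; have M0 : 0 < M by rewrite ltr_wpDl // divr_ge0 // ltW.
have [h [ha hh0 hh]] := admissible_peaked L_gt0 h00 M0.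
have [Mo] := admissible_modes L_gt0 ha.
have := steklov_gap_ge Mo j c0 M0 hh; rewrite hh0 => lower.
have Ke : K / M <= e.
  by rewrite ler_pdivrMr // /M mulrDr mulr1 mulrCA divff ?gt_eqF // mulr1 lerDl ltW.
apply: (@le_trans _ _ ((steklov L h j.+1 - steklov L h j)%:E + e%:E)%E).
  rewrite -EFinD lee_fin; apply: le_trans (lerD lower Ke).
  rewrite le_eqVlt; apply/orP; left; apply/eqP; rewrite /K; field.
  by rewrite !gt_eqF.
by apply: leeD => //; apply: ereal_sup_ubound; exists h.
Qed.
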